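(* Let $M$ be a complete connected Riemannian manifold. Let $U\subsetneq M$ be a compact connected subset such that $S=\partial U$ is a $C^1$-smooth codimension one submanifold of $M$ and the central set $C_U$ is compact. Let $p\in U$ be a standard point in $U$. Then the set $C_{U,p}$ is compact, non-empty and homotopy equivalent to a point.
   Context: $d$ is the intrinsic metric on $M$ and $B_p(r)=\{x\in M: d(p,x)\le r\}$ is the closed geodesic ball ($B_p(0)=\{p\}$). For a closed set $U\subsetneq M$, a closed geodesic ball $B_x(r)\subset U$ is maximal in $U$ if it is not a proper subset of any other closed geodesic ball $B_y(R)\subset U$ such that $d(x,y)+r\le R$. The central set $C_U$ is the set of centers of all maximal balls in $U$, and $\mathbf{r}_U\colon C_U\to[0,\infty)$ is the function such that $B_x(\mathbf{r}_U(x))$ is the maximal ball in $U$ centered at $x$. For $p\in U$, the central set of $U$ relative to $p$ is $C_{U,p}=\{x\in C_U: p\in B_x(\mathbf{r}_U(x))\}$. A point $p\in U$ is a standard point in $U$ if for every point $q\in U$ that can be connected with $p$ by two distinct geodesic segments of lengths $l_1$ and $l_2$ respectively, the closed ball $B_q(\max\{l_1,l_2\})$ is not contained in $U$. *)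

(* Defs.v *)
From HB Require Import structures.
From mathcomp Require Import all_boot all_order all_algebra.
From mathcomp Require Import all_classical all_reals all_analysis.

Set Implicit Arguments.
Unset Strict Implicit.
Unset Printing Implicit Defensive.

Import Order.TTheory GRing.Theory Num.Theory.
Import numFieldNormedType.Exports.

Local Open Scope ring_scope.
Local Open Scope classical_set_scope.

(* Meant for an open set D of a finite-dimensional V, where the existence and
   continuity of all iterated directional derivatives of order at most k is the
   usual C^k condition; for k > 0 the continuity of f itself then follows. *)
Fixpoint Ck {R : realType} {V W : normedModType R}
    (k : nat) (D : set V) (f : V -> W) : Prop :=
  if k is k'.+1 then
    forall v, (forall x, D x -> derivable f x v) /\ Ck k' D ('D_v f)
  else forall x, D x -> {for x, continuous f}.

(* The values of chart_fun outside chart_dom, and of chart_inv outside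
   chart_codom, are irrelevant. *)
Record chart (R : realType) (n : nat) (M : topologicalType) := Chart {
  chart_dom : set M ;
  chart_codom : set 'rV[R]_n ;
  chart_fun :> M -> 'rV[R]_n ;
  chart_inv : 'rV[R]_n -> M ;
  chart_dom_open : open chart_dom ;
  chart_codom_open : open chart_codom ;
  chart_fun_codom : forall x, chart_dom x -> chart_codom (chart_fun x) ;
  chart_inv_dom : forall u, chart_codom u -> chart_dom (chart_inv u) ;
  chart_funK : forall x, chart_dom x -> chart_inv (chart_fun x) = x ;
  chart_invK : forall u, chart_codom u -> chart_fun (chart_inv u) = u ;
  chart_fun_continuous :
    forall x, chart_dom x -> {for x, continuous chart_fun} ;
  chart_inv_continuous :
    forall u, chart_codom u -> {for u, continuous chart_inv} }.

Section Transition.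
Context {R : realType} {n : nat} {M : topologicalType}.
Implicit Types phi psi : chart R n M.

Definition transition phi psi : 'rV[R]_n -> 'rV[R]_n := psi \o chart_inv phi.

Definition transition_dom phi psi : set 'rV[R]_n :=
  chart_codom phi `&` chart_inv phi @^-1` chart_dom psi.

Definition Ck_transition (k : nat) phi psi : Prop :=
  Ck k (transition_dom phi psi) (transition phi psi).

Definition mx_inner (G : 'M[R]_n) (u v : 'rV[R]_n) : R := (u *m G *m v^T) 0 0.

End Transition.

(* The metric tensor is given by its matrices metric i, as functions of the
   coordinates in chart i, which transform as a covariant 2-tensor. *)
Record riemannianManifold (R : realType) (n : nat) := RiemannianManifold {
  rm_space :> topologicalType ;
  rm_hausdorff : hausdorff_space rm_space ;
  rm_second_countable : @second_countable rm_space ;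
  rm_index : Type ;
  atlas : rm_index -> chart R n rm_space ;
  chart_at : rm_space -> rm_index ;
  chart_at_dom : forall x, chart_dom (atlas (chart_at x)) x ;
  atlas_smooth : forall i j k, Ck_transition k (atlas i) (atlas j) ;
  metric : rm_index -> 'rV[R]_n -> 'M[R]_n ;
  metric_smooth : forall i k, Ck k (chart_codom (atlas i)) (metric i) ;
  metric_symmetric : forall i x, chart_codom (atlas i) x ->
    (metric i x)^T = metric i x ;
  metric_posdef : forall i x u, chart_codom (atlas i) x -> u != 0 ->
    0 < mx_inner (metric i x) u u ;
  metric_compat : forall i j x u v,
    transition_dom (atlas i) (atlas j) x ->
    let t := transition (atlas i) (atlas j) in
    mx_inner (metric i x) u v =
    mx_inner (metric j (t x)) ('D_u t x) ('D_v t x) }.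

Section Riemannian.
Context {R : realType} {n : nat} (M : riemannianManifold R n).
Implicit Types (gamma : R -> M) (A : set R) (x y z p q : M) (r l : R).

Definition coord_curve (i : rm_index M) gamma : R -> 'rV[R]_n :=
  atlas i \o gamma.

Definition speed gamma (t : R) : R :=
  let i := chart_at (gamma t) in
  let v := (coord_curve i gamma)^`() t in
  Num.sqrt (mx_inner (metric i (coord_curve i gamma t)) v v).

Definition C1_curve_on A gamma : Prop :=
  forall t, A t -> {for t, continuous gamma} /\
  forall i, chart_dom (atlas i) (gamma t) ->
    derivable (coord_curve i gamma) t 1 /\
    {for t, continuous (coord_curve i gamma)^`()}.

(* Smoothness on a closed interval means smoothness on an open
   interval containing it, here and in geodesic_segment. *)
Definition C1_arc x y l : Prop :=
  exists gamma (e : R), [/\ 0 < e, C1_curve_on `]- e, 1 + e[ gamma,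
    gamma 0 = x, gamma 1 = y &
    l = Rintegral (@lebesgue_measure R) `[0, 1] (speed gamma)].

Inductive piecewise_C1_arc : M -> M -> R -> Prop :=
| piecewise_nil x : piecewise_C1_arc x x 0
| piecewise_cons x y z l l' :
    C1_arc x y l -> piecewise_C1_arc y z l' -> piecewise_C1_arc x z (l + l').

Definition rdist x y : R := inf [set l | piecewise_C1_arc x y l].

Definition metrically_complete : Prop :=
  forall u : nat -> M,
    (forall e : R, 0 < e -> exists N : nat, forall i j : nat,
       (N <= i)%N -> (N <= j)%N -> rdist (u i) (u j) < e) ->
    exists x, (fun i => rdist (u i) x) @ \oo --> (0 : R).

(* Gamma^k_ab in chart i, at the point of coordinates x *)
Definition christoffel (i : rm_index M) (x : 'rV[R]_n) (k a b : 'I_n) : R :=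
  let g (c d : 'I_n) := fun y : 'rV[R]_n => metric i y c d in
  let e (c : 'I_n) : 'rV[R]_n := delta_mx 0 c in
  2^-1 * \sum_(l < n) invmx (metric i x) k l *
    ('D_(e a) (g b l) x + 'D_(e b) (g a l) x - 'D_(e l) (g a b) x).

Definition geodesic_on A gamma : Prop :=
  forall t, A t -> {for t, continuous gamma} /\
  forall i, chart_dom (atlas i) (gamma t) ->
    let c := coord_curve i gamma in
    let dc := c^`() in
    [/\ derivable c t 1, derivable dc t 1 &
      forall k : 'I_n,
        derive1 dc t 0 k + \sum_(a < n) \sum_(b < n)
          christoffel i (c t) k a b * dc t 0 a * dc t 0 b = 0].

(* A geodesic segment of length l, parametrized by arc length on [0, l];
   the values of gamma away from [0, l] are irrelevant. *)
Definition geodesic_segment p q l gamma : Prop :=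
  [/\ 0 <= l, gamma 0 = p, gamma l = q &
    exists2 e : R, 0 < e &
      geodesic_on `]- e, l + e[ gamma /\
      forall t, `]- e, l + e[ t -> speed gamma t = 1].

Definition distinct_segments l1 gamma1 l2 gamma2 : Prop :=
  l1 <> l2 \/ exists2 t, `[0, l1] t & gamma1 t <> gamma2 t.

Definition geodesic_ball p r : set M := [set x | rdist p x <= r].

Definition maximal_ball (U : set M) x r : Prop :=
  [/\ 0 <= r, geodesic_ball x r `<=` U &
    ~ exists y (r' : R), [/\ 0 <= r', geodesic_ball y r' `<=` U,
        rdist x y + r <= r' & geodesic_ball x r `<` geodesic_ball y r']].

Definition central_set (U : set M) : set M :=
  [set x | exists r, maximal_ball U x r].

Definition central_radius (U : set M) x : R := get [set r | maximal_ball U x r].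

Definition relative_central_set (U : set M) p : set M :=
  central_set U `&` [set x | geodesic_ball x (central_radius U x) p].

Definition standard_point (U : set M) p : Prop :=
  U p /\ forall q l1 l2 gamma1 gamma2, U q ->
    geodesic_segment p q l1 gamma1 -> geodesic_segment p q l2 gamma2 ->
    distinct_segments l1 gamma1 l2 gamma2 ->
    ~ geodesic_ball q (Num.max l1 l2) `<=` U.

Definition C1_hypersurface (S : set M) : Prop :=
  forall x, S x -> exists (psi : chart R n M) (c : 'I_n),
    [/\ chart_dom psi x,
        forall i, Ck_transition 1 (atlas i) psi /\ Ck_transition 1 psi (atlas i)
      & S `&` chart_dom psi = chart_dom psi `&` [set y | psi y 0 c = 0]].

End Riemannian.

Definition boundary {T : topologicalType} (A : set T) : set T :=
  closure A `\` interior A.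

Definition homotopic (R : realType) {X Y : topologicalType} (f g : X -> Y) :=
  exists H : R * X -> Y,
    [/\ {within `[0, 1] `*` [set: X], continuous H},
        forall x, H (0, x) = f x & forall x, H (1, x) = g x].

Definition homotopy_equivalent (R : realType) (X Y : topologicalType) : Prop :=
  exists (f : X -> Y) (g : Y -> X), [/\ continuous f, continuous g,
    homotopic R (g \o f) idfun & homotopic R (f \o g) idfun].

(* Main.v *)
Require Import Defs.
From mathcomp Require Import all_boot all_order all_algebra.
From mathcomp Require Import all_classical all_reals all_analysis.
From mathcomp Require Import ring lra.

(* Let depth(x) be the distance from x to the complement of U.  Every x in U lies in
   a maximal ball B_y(depth y) with d(x, y) + depth x <= depth y, found by maximizing
   the depth over such y.  It is unique: if s realizes the distance from x to the
   boundary, then the minimal paths from s to two candidates y, y' both start along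
   the inner unit normal of the boundary at s, hence one contains the other, so that
   one of the balls contains the other; two different maximal balls of this kind
   would have equal point sets, which is excluded by a nonbranching argument.
   So x |-> y is a well defined map, continuous because its graph is closed and the
   central set is compact.  As p is standard, every x with d(p, x) <= depth x is
   joined to p by a unique minimal path, along which this inequality persists;
   moving x along this path and applying the map contracts C_{U,p} to a point.

   The Riemannian facts needed are about minimal paths: they are C^2 solutions of the
   geodesic equation, extend beyond their end points and do not branch.  Comparing
   distances with straight segments and with functions whose gradient is almost
   constant shows that the second differences of a minimal path are O(h^2), so that
   it is C^{1,1}; the first variation of the length then yields the geodesic equation.
   Conversely a short solution is minimal, since a minimal path with the same ends is a
   solution of the same boundary value problem, whose solution is unique. *)

(** The distance is an infimum over piecewise C^1 arcs, so a minimal path is at first only an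
    isometric image of an interval, and everything differentiable about it has to be recovered from
    distance estimates of second order. Two comparisons in a chart supply them. A straight
    coordinate segment bounds a distance from above with cubic error, because the first order
    variation of the metric is odd about the midpoint. A linear function with a quadratic correction
    by Christoffel symbols bounds it from below. The parallelogram law combines the two. The
    boundary is only C^1, so no tubular neighbourhood is available. Its inner normal is
    characterized by balls touching from inside: it is the unit vector that maximizes a linear form
    on the unit ball, hence unique by strict convexity. Maximality of a ball is about proper
    inclusion of point sets. Two balls with different centres and radii but equal point sets would
    therefore not contradict each other's maximality, which is why this case is excluded separately.
    Minimal paths exist because the balls in which they run lie in a compact set, mostly [U]
    itself. *)

Set Implicit Arguments.
Unset Strict Implicit.
Unset Printing Implicit Defensive.

Import Order.TTheory GRing.Theory Num.Theory.
Import numFieldNormedType.Exports.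

Local Open Scope ring_scope.
Local Open Scope classical_set_scope.

(* lra parses every hypothesis, which is slow in the presence of long quantified ones. *)
Ltac short_lra := solve [repeat match goal with H : ?T |- _ =>
  lazymatch type of T with Prop =>
    lazymatch T with is_true _ => fail | _ = _ => fail | _ => clear H end
  end end; lra] || lra.

(** * Differential calculus in coordinates *)

Section Calculus.
Context {R : realType}.

Lemma coord_le_norm (n : nat) (v : 'rV[R]_n) (k : 'I_n) : `|v 0 k| <= `|v|.
Proof.
rewrite {2}/Num.norm /= mx_normrE.
exact: (le_bigmax_cond 0 (fun x : 'I_1 * 'I_n => `|v x.1 x.2|) (j := (0, k))).
Qed.

Lemma rvDE (n : nat) (u v : 'rV[R]_n) k : (u + v) 0 k = u 0 k + v 0 k.
Proof. by rewrite mxE. Qed.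

Lemma rvNE (n : nat) (u : 'rV[R]_n) k : (- u) 0 k = - u 0 k.
Proof. by rewrite mxE. Qed.

Lemma rvBE (n : nat) (u v : 'rV[R]_n) k : (u - v) 0 k = u 0 k - v 0 k.
Proof. by rewrite !mxE. Qed.

Lemma rvZE (n : nat) c (u : 'rV[R]_n) k : (c *: u) 0 k = c * u 0 k.
Proof. by rewrite mxE. Qed.

Lemma norm_le_coord (n : nat) (v : 'rV[R]_n) (c : R) :
  0 <= c -> (forall k, `|v 0 k| <= c) -> `|v| <= c.
Proof.
move=> c0 vc; rewrite /Num.norm /= mx_normrE.
by apply/bigmax_leP; split => // -[i k] _ /=; rewrite ord1.
Qed.

(** Stated without the quotient and including [h = 0], so that derivatives are established and used
    by plain norm estimates. *)
Lemma is_derive_eps (V W : normedModType R) (f : V -> W) (x v : V) (d : W) :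
  is_derive x v f d <->
  forall e : R, 0 < e -> exists2 del : R, 0 < del &
    forall h, `|h| < del -> `|f (h *: v + x) - f x - h *: d| <= e * `|h|.
Proof.
split.
- move=> fd e e0.
  have [df Df] : derivable f x v /\ 'D_v f x = d by split; case: fd.
  have : (fun h => h^-1 *: ((f \o shift x) (h *: v) - f x)) @ 0^' --> d.
    by rewrite -Df; exact: df.
  move=> /cvgrPdist_le /(_ e e0); rewrite near_withinE => /nbhs_ballP [del del0 H].
  exists del => // h hd.
  have [->|h0] := eqVneq h 0.
    by rewrite !scale0r add0r subrr subr0 normr0 normr0 mulr0.
  have := H h; rewrite /ball /= sub0r normrN => /(_ hd h0).
  rewrite -(ler_pM2r (_ : 0 < `|h|)) ?normr_gt0 //.
  rewrite [X in X <= _ -> _]mulrC -normrZ scalerBr scalerA mulfV// scale1r.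
  by rewrite distrC.
- move=> H.
  have C : (fun h => h^-1 *: ((f \o shift x) (h *: v) - f x)) @ 0^' --> d.
    apply/cvgrPdist_le => e e0; have [del del0 {}H] := H e e0.
    rewrite near_withinE; apply/nbhs_ballP; exists del => //= h.
    rewrite /ball /= sub0r normrN => hd h0.
    rewrite -(ler_pM2r (_ : 0 < `|h|)) ?normr_gt0 //.
    rewrite [X in X <= _]mulrC -normrZ scalerBr scalerA mulfV// scale1r.
    by rewrite distrC; exact: H.
  split; first by apply/cvg_ex; exists d.
  exact: (cvg_lim _ C).
Qed.

Lemma continuous_eps (V W : normedModType R) (f : V -> W) (x : V) :
  {for x, continuous f} <->
  forall e : R, 0 < e -> exists2 del : R, 0 < del &
    forall y, `|y - x| < del -> `|f y - f x| <= e.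
Proof.
split.
- move=> /cvgrPdist_le H e e0; have /nbhs_ballP [del del0 {}H] := H e e0.
  exists del => // y yx; rewrite distrC; apply: H.
  by rewrite -ball_normE /= distrC.
- move=> H; apply/cvgrPdist_le => e e0; have [del del0 {}H] := H e e0.
  apply/nbhs_ballP; exists del => //= y; rewrite -ball_normE /= distrC => yx.
  by rewrite distrC; exact: H.
Qed.

Lemma open_eps (V : normedModType R) (D : set V) (x : V) :
  open D -> D x -> exists2 r : R, 0 < r & forall y, `|y - x| <= r -> D y.
Proof.
move=> oD Dx; have /nbhs_ballP [r r0 H] := open_nbhs_nbhs (conj oD Dx).
exists (r / 2) => [|y yx]; first by rewrite divr_gt0.
apply: H; rewrite -ball_normE /= distrC; apply: le_lt_trans yx _.
by rewrite ltr_pdivrMr// mulr_natr mulr2n ltrDl.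
Qed.

Lemma is_derive_continuous (f : R -> R) (x d : R) :
  is_derive x 1 f d -> {for x, continuous f}.
Proof.
move=> fd; apply: differentiable_continuous; apply/derivable1_diffP.
by case: fd.
Qed.

Lemma within_continuousP (f : R -> R) (a b : R) :
  (forall x, a <= x <= b -> {for x, continuous f}) ->
  {within `[a, b], continuous f}.
Proof.
move=> H; apply: continuous_in_subspaceT => x; rewrite inE /= in_itv /=.
exact: H.
Qed.

Lemma mvt_bound (f df : R -> R) (a b K : R) :
  (forall x, Num.min a b <= x <= Num.max a b -> is_derive x 1 f (df x)) ->
  (forall x, Num.min a b <= x <= Num.max a b -> `|df x| <= K) ->
  `|f b - f a| <= K * `|b - a|.
Proof.
wlog ab : a b / a <= b.
  move=> H; have /orP[ab|ba] := le_total a b; first exact: (H _ _ ab).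
  rewrite minC maxC => d1 d2; rewrite distrC (distrC b).
  exact: (H _ _ ba).
rewrite (min_idPl ab) (max_idPr ab) => fd dfK.
have d1 x : x \in `]a, b[%R -> is_derive x 1 f (df x).
  by rewrite in_itv /= => /andP[ax xb]; apply: fd; rewrite !ltW.
have d2 : {within `[a, b], continuous f}.
  by apply: within_continuousP => x xab; exact: is_derive_continuous (fd _ xab).
have [c cab ->] := MVT_segment ab d1 d2.
by rewrite normrM ler_wpM2r// dfK.

Qed.

Definition evec {n : nat} (k : 'I_n) : 'rV[R]_n := delta_mx 0 k.

Lemma evecE (n : nat) (k j : 'I_n) : @evec n k 0 j = (j == k)%:R.
Proof. by rewrite mxE eqxx. Qed.

Lemma norm_evec (n : nat) (k : 'I_n) : `|@evec n k| <= 1.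
Proof.
by apply: norm_le_coord => // j; rewrite evecE; case: (_ == _); rewrite ?normr1 ?normr0.
Qed.

Lemma evec_sum (n : nat) (v : 'rV[R]_n) : v = \sum_k v 0 k *: evec k.
Proof. exact: row_sum_delta. Qed.

(* The intermediate points have coordinates taken from [m] or [m + h], hence
   stay in the ball, which is a box for the sup norm. *)
Lemma partials_estimate (n : nat) (f : 'rV[R]_n -> R) (u0 m h : 'rV[R]_n)
    (r e : R) (a : 'I_n -> R) :
  (forall x k, `|x - u0| <= r -> derivable f x (evec k)) ->
  `|m - u0| <= r -> `|m + h - u0| <= r ->
  (forall x k, `|x - u0| <= r -> `|x - m| <= `|h| ->
     `|'D_(evec k) f x - a k| <= e) ->
  `|f (m + h) - f m - \sum_k h 0 k * a k| <= n%:R * (e * `|h|).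
Proof.
move=> fd m1 m2 He.
(* [tr j] keeps the first [j] coordinates of [h]: consecutive points differ in one coordinate, and
   the increment telescopes into one-variable increments. *)
pose tr (j : nat) : 'rV[R]_n := \row_k (if (k < j)%N then h 0 k else 0).
have tr0 : tr 0%N = 0 by apply/rowP => k; rewrite !mxE.
have trn : tr n = h by apply/rowP => k; rewrite !mxE ltn_ord.
have -> : f (m + h) - f m = \sum_(j < n) (f (m + tr j.+1) - f (m + tr j)).
  rewrite -(big_mkord xpredT (fun j => f (m + tr j.+1) - f (m + tr j))).
  by rewrite telescope_sumr// trn tr0 addr0.
rewrite -sumrB; apply: le_trans (ler_norm_sum _ _ _) _.
have -> : n%:R * (e * `|h|) = \sum_(j < n) e * `|h|.
  by rewrite sumr_const card_ord mulr_natl.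
apply: ler_sum => j _.
have r0 : 0 <= r by apply: le_trans m1.
pose p (s : R) := m + tr j + s *: evec j.
have pE s k : p s 0 k = m 0 k + (if (k < j)%N then h 0 k else if k == j then s else 0).
  rewrite /p !mxE eqxx /=; case: ltngtP => [kj|kj|/val_inj ->].
  - have /negPf -> : k != j by apply/eqP => kj'; rewrite kj' ltnn in kj.
    by rewrite /= mulr0 addr0.
  - have /negPf -> : k != j by apply/eqP => kj'; rewrite kj' ltnn in kj.
    by rewrite /= mulr0 !addr0.
  - by rewrite eqxx mulr1 addr0.
have p0 : m + tr j = p 0 by rewrite /p scale0r addr0.
have p1 : m + tr j.+1 = p (h 0 j).
  apply/rowP => k; rewrite pE !mxE ltnS leq_eqVlt.
  case: ltngtP => [kj|kj|/val_inj ->] //=; last by rewrite eqxx.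
  have /negPf -> // : k != j by apply/eqP => kj'; rewrite kj' ltnn in kj.
have pin s : Num.min 0 (h 0 j) <= s <= Num.max 0 (h 0 j) ->
    `|p s - u0| <= r /\ `|p s - m| <= `|h|.
  move=> /andP[s1 s2]; split; apply: norm_le_coord => // k.
  - have := le_trans (coord_le_norm _ k) m1; have := le_trans (coord_le_norm _ k) m2.
    rewrite (rvBE (p s)) pE !(rvBE, rvDE).
    case: ifP => [//|_]; case: eqP => [->|_]; last by rewrite addr0.
    rewrite !ler_norml => /andP[a1 a2] /andP[a3 a4].
    case: (leP 0 (h 0 j)) s1 s2 => h0 s1 s2; apply/andP; split; lra.
  - rewrite (rvBE (p s)) pE addrAC subrr add0r.
    case: ifP => _; first exact: coord_le_norm.
    case: eqP => _; last by rewrite normr0.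
    apply: le_trans (coord_le_norm _ j).
    by case: (leP 0 (h 0 j)) s1 s2 => h0 s1 s2; rewrite ler_norml;
      [rewrite ger0_norm//|rewrite ltr0_norm//]; apply/andP; split; lra.
rewrite p0 p1.
(* Subtracting the linear function [s * a j] turns closeness of the partial derivative to [a j] into
   a bound on a derivative. *)
have D s : Num.min 0 (h 0 j) <= s <= Num.max 0 (h 0 j) ->
    is_derive s 1 (fun s => f (p s) - s * a j) ('D_(evec j) f (p s) - a j).
  move=> /pin [ps _].
  have := derivableP (fd _ j ps) => /is_derive_eps H.
  apply/is_derive_eps => ep ep0; have [del del0 {}H] := H ep ep0.
  exists del => // t td; apply: le_trans (H t td).
  rewrite (_ : p (t *: 1 + s) = t *: evec j + p s); last first.
    by rewrite /p scalerDl -scalerA scale1r addrCA.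
  rewrite le_eqVlt; apply/orP; left; apply/eqP; congr (`|_|).
  by rewrite /GRing.scale /= mulr1; ring.
have := mvt_bound D (fun s hs => He _ _ (pin s hs).1 (pin s hs).2).
rewrite mul0r !subr0 => H.
have -> : f (p (h 0 j)) - f (p 0) - h 0 j * a j =
  f (p (h 0 j)) - h 0 j * a j - f (p 0) by ring.
apply: le_trans H _; apply: ler_wpM2l; last exact: coord_le_norm.
apply: le_trans (He m j m1 _) => //.
by rewrite subrr normr0.
Qed.

Lemma Ck_ext (V W : normedModType R) k (D : set V) (f g : V -> W) :
  open D -> (forall x, D x -> f x = g x) -> Ck k D f -> Ck k D g.
Proof.
move=> oD; elim: k f g => [|k IH] f g fg /=.
  move=> H x Dx; apply/continuous_eps => e e0.
  have /continuous_eps /(_ e e0) [del del0 {}H] := H x Dx.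
  have [r r0 rD] := open_eps oD Dx.
  exists (Num.min del r) => [|y]; first by rewrite lt_min del0.
  rewrite lt_min => /andP[y1 y2].
  by rewrite -!fg//; [exact: H|exact/rD/ltW].
move=> H v; have [H1 H2] := H v.
have E x : D x -> {near x, f =1 g}.
  by move=> Dx; apply: filterS (open_nbhs_nbhs (conj oD Dx)) => y; exact: fg.
(* [near_eq_derivable] is applied to a non-zero direction; in the direction 0 both derivatives are
   0. *)
have [v0|v0] := eqVneq v 0.
  subst v; split; first by move=> x _; exact: derivable0.
  by apply: IH H2 => x Dx; rewrite !derive0.
split; first by move=> x Dx; apply: near_eq_derivable (H1 x Dx) => //; exact: E.
by apply: IH H2 => x Dx; apply: near_eq_derive => //; exact: E.
Qed.

Lemma Ck_entry (V : normedModType R) k (D : set V) p q (f : V -> 'M[R]_(p, q)) i j :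
  open D -> Ck k D f -> Ck k D (fun x => f x i j).
Proof.
move=> oD; elim: k f => [|k IH] f /=.
  move=> H x Dx; apply: (@continuous_comp _ _ _ f (fun M : 'M[R]_(p, q) => M i j)).
    exact: H.
  exact: coord_continuous.
move=> H v; have [H1 H2] := H v; split.
  by move=> x Dx; have /derivable_mxP := H1 x Dx; apply.
apply: Ck_ext (IH _ H2) => // x Dx.
by rewrite derive_mx ?mxE//; exact: H1.
Qed.

Lemma finite_eps (I : finType) (P : I -> R -> Prop) :
  (forall i d d', d' <= d -> P i d -> P i d') ->
  (forall i, exists2 d : R, 0 < d & P i d) ->
  exists2 d : R, 0 < d & forall i, P i d.
Proof.
move=> Pm H.
have /choice [d H1] : forall i, exists d : R, 0 < d /\ P i d.
  by move=> i; have [d d0 dP] := H i; exists d.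
exists (\big[Num.min/1]_i d i).
  by apply/bigmin_gtP; split => // i _; case: (H1 i).
by move=> i; apply: (Pm i (d i)); [exact: bigmin_le_cond|case: (H1 i)].
Qed.

Section C1.
Context (n : nat) (D : set 'rV[R]_n) (f : 'rV[R]_n -> R).
Hypothesis oD : open D.
Hypothesis fC1 : Ck 1 D f.

Lemma C1_derivable x v : D x -> derivable f x v.
Proof. by move=> Dx; have [H _] := fC1 v; exact: H. Qed.

Lemma C1_partial_continuous x v : D x -> {for x, continuous ('D_v f)}.
Proof. by move=> Dx; have [_ H] := fC1 v; exact: H. Qed.

Lemma C1_expand x e : D x -> 0 < e -> exists2 del : R, 0 < del &
  forall h, `|h| < del ->
    `|f (x + h) - f x - \sum_k h 0 k * 'D_(evec k) f x| <= e * `|h|.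
Proof.
move=> Dx e0.
have e'0 : 0 < e / n.+1%:R by rewrite divr_gt0.
have [d d0 dP] : exists2 d : R, 0 < d & forall k y, `|y - x| < d ->
    `|'D_(evec k) f y - 'D_(evec k) f x| <= e / n.+1%:R.
  apply: finite_eps; first by move=> i d d' dd H y yd; apply/H/(lt_le_trans yd).
  move=> k; have /continuous_eps /(_ _ e'0) [d d0 H] := C1_partial_continuous (v := evec k) Dx.
  by exists d.
have [r r0 rD] := open_eps oD Dx.
exists (Num.min r d) => [|h]; first by rewrite lt_min r0.
rewrite lt_min => /andP[hr hd].
apply: le_trans (partials_estimate (u0 := x) (r := Num.max 0 `|h|) _ _ _ _) _.
- move=> y k; rewrite le_max => yh; apply: C1_derivable; apply: rD.
  case/orP: yh => yh; last by apply: le_trans yh (ltW hr).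
  by apply: le_trans yh (ltW r0).
- by rewrite subrr normr0 le_max lexx.
- by rewrite addrAC subrr add0r le_max lexx orbT.
- by move=> y k _ yh; apply: dP; apply: le_lt_trans hd.
- rewrite mulrA ler_wpM2r// mulrCA ler_piMr ?(ltW e0)//.
  by rewrite ler_pdivrMr// mul1r ler_nat.
Qed.

Lemma C1_chain (c : R -> 'rV[R]_n) t v : D (c t) -> is_derive t 1 c v ->
  is_derive t 1 (fun s => f (c s)) (\sum_k v 0 k * 'D_(evec k) f (c t)).
Proof.
move=> Dc /is_derive_eps cd; apply/is_derive_eps => e e0.
set S := \sum_k `|'D_(evec k) f (c t)|.
have S0 : 0 <= S by apply: sumr_ge0.
(* The error is split in halves. [e1] controls the error of [c] after the differential of [f], whose
   size is at most [S]; [e2] controls the error of [f]. The bound [e1 <= 1] makes the increment of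
   [c] at most [(|v| + 1) |h|]. *)
set e1 : R := Num.min 1 (e / 2 / (S + 1)).
have e10 : 0 < e1 by rewrite lt_min ltr01 divr_gt0 ?divr_gt0// ltr_wpDl.
set e2 := e / 2 / (`|v| + 1).
have e20 : 0 < e2 by rewrite divr_gt0 ?divr_gt0// ltr_wpDl.
have [d1 d10 H1] := cd e1 e10.
have [d2 d20 H2] := C1_expand Dc e20.
exists (Num.min d1 (d2 / (`|v| + 1))) => [|h].
  by rewrite lt_min d10 divr_gt0// ltr_wpDl.
rewrite lt_min ltr_pdivlMr ?ltr_wpDl// => /andP[hd1 hd2].
have {}H1 := H1 h hd1; set k := c (h *: 1 + t) - c t.
have ck : c (h *: 1 + t) = c t + k by rewrite /k addrCA subrr addr0.
have kb : `|k| <= (`|v| + 1) * `|h|.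
  have -> : k = (k - h *: v) + h *: v by rewrite subrK.
  apply: le_trans (ler_normD _ _) _; rewrite mulrDl mul1r normrZ addrC [`|h| * _]mulrC.
  rewrite lerD2l; apply: le_trans H1 _.
  by rewrite ler_piMl// ge_min lexx.
have := H2 k; rewrite -ck => /(_ (le_lt_trans kb _)).
rewrite [X in X < _]mulrC => /(_ hd2) {}H2.
set A := \sum_k v 0 k * _; set B := \sum__ _ in H2.
have BA : `|B - h * A| <= e1 * `|h| * S.
  rewrite mulr_sumr -sumrB mulr_sumr; apply: le_trans (ler_norm_sum _ _ _) _.
  apply: ler_sum => j _; rewrite mulrA -mulrBl normrM ler_wpM2r//.
  apply: le_trans H1; rewrite -rvZE -rvBE; exact: coord_le_norm.
have -> : f (c (h *: 1 + t)) - f (c t) - h *: A =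
   (f (c (h *: 1 + t)) - f (c t) - B) + (B - h * A) by rewrite addrA subrK.
apply: le_trans (ler_normD _ _) _.
have -> : e * `|h| = e2 * ((`|v| + 1) * `|h|) + e / 2 * `|h|.
  rewrite mulrA [e2 * _]divfK ?gt_eqF ?ltr_wpDl// -mulrDl; congr (_ * _); by field.
apply: lerD; first by apply: le_trans H2 _; rewrite ler_wpM2l// ltW.
apply: le_trans BA _; rewrite mulrAC ler_wpM2r//.
apply: (@le_trans _ _ (e / 2 / (S + 1) * S)).
  by rewrite ler_wpM2r// ge_min lexx orbT.
rewrite mulrAC ler_pdivrMr ?ltr_wpDl// ler_wpM2l ?lerDl//.
by rewrite divr_ge0// ltW.
Qed.

Lemma C1_derive x v : D x -> 'D_v f x = \sum_k v 0 k * 'D_(evec k) f x.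
Proof.
move=> Dx.
have H : is_derive (0 : R) 1 (fun s : R => x + s *: v) v.
  apply/is_derive_eps => e e0; exists 1 => // h _.
  rewrite scale0r !addr0 [x + _]addrC addrK /GRing.scale /= mulr1 subrr normr0.
  by rewrite mulr_ge0// ltW.
have := C1_chain (c := fun s => x + s *: v) (t := 0); rewrite scale0r addr0.
move=> /(_ v Dx H) {H} H; apply/esym.
have /is_derive_eps H' := H.
have /is_derive_eps H2 : is_derive x v f (\sum_k v 0 k * 'D_(evec k) f x).
  apply/is_derive_eps => e e0; have [d d0 {}H'] := H' e e0; exists d => // h hd.
  by have := H' h hd; rewrite scale0r !addr0 [x + _]addrC /GRing.scale /= mulr1.
by move: H2 => /is_derive_eps H2; rewrite derive_val.
Qed.

Lemma C1_lipschitz u0 r C : (forall x, `|x - u0| <= r -> D x) ->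
  (forall x k, `|x - u0| <= r -> `|'D_(evec k) f x| <= C) ->
  forall x y, `|x - u0| <= r -> `|y - u0| <= r ->
  `|f x - f y| <= n%:R * (C * `|x - y|).
Proof.
move=> rD HC x y xr yr.
have := @partials_estimate n f u0 y (x - y) r C (fun=> 0).
rewrite subrKC; under eq_bigr do rewrite mulr0.
rewrite sumr_const mul0rn subr0; apply => //.
- by move=> z k zr; apply: C1_derivable; exact: rD.
- by move=> z k zr _; rewrite subr0; exact: HC.
Qed.

Lemma C1_taylor u0 r C : 0 <= C -> (forall x, `|x - u0| <= r -> D x) ->
  (forall x y k, `|x - u0| <= r -> `|y - u0| <= r ->
      `|'D_(evec k) f x - 'D_(evec k) f y| <= C * `|x - y|) ->
  forall x h, `|x - u0| <= r -> `|x + h - u0| <= r ->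
  `|f (x + h) - f x - \sum_k h 0 k * 'D_(evec k) f x| <= n%:R * (C * `|h| * `|h|).
Proof.
move=> C0 rD HC x h xr hr; apply: (partials_estimate _ xr hr).
- by move=> z k zr; apply: C1_derivable; exact: rD.
- by move=> z k zr zx; apply: le_trans (HC _ _ _ zr xr) _; rewrite ler_wpM2l.
Qed.

End C1.

End Calculus.

(** * Metric tensors near a point *)

Section Inner.
Context {R : realType} {n : nat}.
Implicit Types (G H : 'M[R]_n) (u v w : 'rV[R]_n).

Lemma mx_innerE G u v : mx_inner G u v = \sum_a \sum_b u 0 a * G a b * v 0 b.
Proof.
rewrite /mx_inner mxE exchange_big /=; apply: eq_bigr => b _.
by rewrite mxE mulr_suml; apply: eq_bigr => a _; rewrite mxE.
Qed.

Lemma mx_innerDl G u u' v : mx_inner G (u + u') v = mx_inner G u v + mx_inner G u' v.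
Proof. by rewrite /mx_inner !mulmxDl mxE. Qed.

Lemma mx_innerDr G u v v' : mx_inner G u (v + v') = mx_inner G u v + mx_inner G u v'.
Proof. by rewrite /mx_inner linearD /= mulmxDr mxE. Qed.

Lemma mx_innerZl G c u v : mx_inner G (c *: u) v = c * mx_inner G u v.
Proof. by rewrite /mx_inner -!scalemxAl mxE. Qed.

Lemma mx_innerZr G c u v : mx_inner G u (c *: v) = c * mx_inner G u v.
Proof. by rewrite /mx_inner linearZ /= -scalemxAr mxE. Qed.

Lemma mx_innerNl G u v : mx_inner G (- u) v = - mx_inner G u v.
Proof. by rewrite -scaleN1r mx_innerZl mulN1r. Qed.

Lemma mx_innerNr G u v : mx_inner G u (- v) = - mx_inner G u v.
Proof. by rewrite -scaleN1r mx_innerZr mulN1r. Qed.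

Lemma mx_innerBl G u u' v : mx_inner G (u - u') v = mx_inner G u v - mx_inner G u' v.
Proof. by rewrite mx_innerDl mx_innerNl. Qed.

Lemma mx_innerBr G u v v' : mx_inner G u (v - v') = mx_inner G u v - mx_inner G u v'.
Proof. by rewrite mx_innerDr mx_innerNr. Qed.

Lemma mx_inner0l G v : mx_inner G 0 v = 0.
Proof. by rewrite -(scale0r 0) mx_innerZl mul0r. Qed.

Lemma mx_inner0r G v : mx_inner G v 0 = 0.
Proof. by rewrite -(scale0r 0) mx_innerZr mul0r. Qed.

Lemma mx_innerDm G H u v : mx_inner (G + H) u v = mx_inner G u v + mx_inner H u v.
Proof. by rewrite /mx_inner mulmxDr mulmxDl mxE. Qed.

Lemma mx_innerZm c G u v : mx_inner (c *: G) u v = c * mx_inner G u v.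
Proof. by rewrite /mx_inner -scalemxAr -scalemxAl mxE. Qed.

Lemma mx_innerBm G H u v : mx_inner (G - H) u v = mx_inner G u v - mx_inner H u v.
Proof. by rewrite mx_innerDm -scaleN1r mx_innerZm mulN1r. Qed.

Lemma mx_inner_summ (I : finType) (F : I -> 'M[R]_n) u v :
  mx_inner (\sum_i F i) u v = \sum_i mx_inner (F i) u v.
Proof.
apply: (big_morph (fun G => mx_inner G u v)) => [G H|]; first exact: mx_innerDm.
by rewrite -(scale0r 0) mx_innerZm mul0r.
Qed.

Lemma mx_innerC G u v : G^T = G -> mx_inner G u v = mx_inner G v u.
Proof.
move=> GT; rewrite /mx_inner.
have -> : (v *m G *m u^T) = (u *m G *m v^T)^T.
  by rewrite !trmx_mul GT trmxK mulmxA.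
by rewrite [RHS]mxE.
Qed.

Lemma mx_inner_bound G (c : R) u v : 0 <= c -> (forall a b, `|G a b| <= c) ->
  `|mx_inner G u v| <= n%:R ^+ 2 * c * `|u| * `|v|.
Proof.
move=> c0 Gc; rewrite mx_innerE; apply: le_trans (ler_norm_sum _ _ _) _.
have -> : n%:R ^+ 2 * c * `|u| * `|v| = \sum_(a < n) \sum_(b < n) `|u| * c * `|v|.
  by rewrite !sumr_const !card_ord -[in LHS]mulr_natl !mulr_natl -!mulrnAr; ring.
apply: ler_sum => a _; apply: le_trans (ler_norm_sum _ _ _) _.
apply: ler_sum => b _; rewrite !normrM.
by rewrite !ler_pM ?mulr_ge0 ?coord_le_norm.
Qed.

(** The polynomial [t |-> G(u + t v, u + t v)] is non-negative. If [G(v, v) > 0], its minimum gives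
    the claim; if [G(v, v) = 0], it is affine, and a non-zero slope would let it take the value
    -1. *)
Lemma mx_inner_cauchy G u v : G^T = G -> (forall w, 0 <= mx_inner G w w) ->
  mx_inner G u v ^+ 2 <= mx_inner G u u * mx_inner G v v.
Proof.
move=> GT Gp.
have H (t : R) : 0 <= mx_inner G u u + 2 * t * mx_inner G u v + t ^+ 2 * mx_inner G v v.
  have := Gp (u + t *: v); rewrite !(mx_innerDl, mx_innerDr, mx_innerZl, mx_innerZr).
  rewrite (mx_innerC v u GT); set A := mx_inner G u u; set B := mx_inner G u v.
  by set C := mx_inner G v v; congr (_ <= _); ring.
set A := mx_inner G u u in H *; set B := mx_inner G u v in H *.
set C := mx_inner G v v in H *.
have C0 : 0 <= C by exact: Gp.
move: C0; rewrite le_eqVlt => /predU1P[C0|C0].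
- have [->|B0] := eqVneq B 0; first by rewrite expr0n /= -C0 mulr0.
  have := H (- (A + 1) / (2 * B)); rewrite -C0 mulr0 addr0.
  have -> : A + 2 * (- (A + 1) / (2 * B)) * B = -1 by field.
  by rewrite oppr_ge0 ler10.
- have := H (- B / C); rewrite -(ler_pM2r C0) mul0r.
  have -> : (A + 2 * (- B / C) * B + (- B / C) ^+ 2 * C) * C = A * C - B ^+ 2.
    by field; rewrite gt_eqF.
  by rewrite subr_ge0.
Qed.

Lemma is_derive_inner (G : R -> 'M[R]_n) (u v : R -> 'rV[R]_n) (t : R) (dG : 'M[R]_n) du dv :
  (forall a b, is_derive t 1 (fun s => G s a b) (dG a b)) ->
  is_derive t 1 u du -> is_derive t 1 v dv ->
  is_derive t 1 (fun s => mx_inner (G s) (u s) (v s))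
    (mx_inner dG (u t) (v t) + mx_inner (G t) du (v t) + mx_inner (G t) (u t) dv).
Proof.
move=> HG Hu Hv.
have coord (w : R -> 'rV[R]_n) dw k : is_derive t 1 w dw ->
    is_derive t 1 (fun s => w s 0 k) (dw 0 k).
  move=> /is_derive_eps H; apply/is_derive_eps => e e0.
  have [d d0 {}H] := H e e0; exists d => // h hd; apply: le_trans (H h hd).
  by rewrite -[h *: dw 0 k]rvZE -!rvBE; exact: coord_le_norm.
rewrite (_ : (fun s => mx_inner (G s) (u s) (v s)) =
  \sum_a \sum_b ((fun s => u s 0 a) * (fun s => G s a b) * (fun s => v s 0 b))); last first.
  apply/funext => s; rewrite mx_innerE fct_sumE; apply: eq_bigr => a _.
  by rewrite fct_sumE; apply: eq_bigr => b _.
rewrite !mx_innerE -!big_split /=.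
under [X in is_derive _ _ _ X]eq_bigr do rewrite -!big_split /=.
apply: is_derive_sum => a; apply: is_derive_sum => b.
have Hu' := coord _ _ a Hu; have Hv' := coord _ _ b Hv; have HG' := HG a b.
apply: is_derive_eq; rewrite /GRing.scale /= ?fctE; ring.
Qed.

End Inner.

Section LocalMetric.
Context {R : realType} {n : nat}.
Variables (g : 'rV[R]_n -> 'M[R]_n).
Implicit Types (x y u v w h : 'rV[R]_n).

(* The directional derivative of [g], in a form that is linear in [w] by definition. *)
Definition dmetric x w : 'M[R]_n := \sum_k w 0 k *: 'D_(evec k) g x.

(** The metric enters the local estimates through these bounds on a closed coordinate ball for the
    sup norm: an ellipticity constant [lam], and one constant [C] for sizes, Lipschitz moduli and
    the second order Taylor remainder. They concern bilinear forms rather than entries, so that the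
    dimension is absorbed in [C]. *)
Record metric_ball (D : set 'rV[R]_n) (u0 : 'rV[R]_n) (r lam C : R) : Prop :=
  MetricBall {
  mb_r : 0 < r ;
  mb_lam : 0 < lam ;
  mb_C : 1 <= C ;
  mb_dom : forall x, `|x - u0| <= r -> D x ;
  mb_sym : forall x, `|x - u0| <= r -> (g x)^T = g x ;
  mb_dsym : forall x w, `|x - u0| <= r -> (dmetric x w)^T = dmetric x w ;
  mb_pos : forall x v, `|x - u0| <= r -> lam * `|v| ^+ 2 <= mx_inner (g x) v v ;
  mb_bound : forall x u v, `|x - u0| <= r ->
    `|mx_inner (g x) u v| <= C * `|u| * `|v| ;
  mb_dbound : forall x w u v, `|x - u0| <= r ->
    `|mx_inner (dmetric x w) u v| <= C * `|w| * `|u| * `|v| ;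
  mb_lip : forall x y u v, `|x - u0| <= r -> `|y - u0| <= r ->
    `|mx_inner (g x) u v - mx_inner (g y) u v| <= C * `|x - y| * `|u| * `|v| ;
  mb_dlip : forall x y w u v, `|x - u0| <= r -> `|y - u0| <= r ->
    `|mx_inner (dmetric x w) u v - mx_inner (dmetric y w) u v| <=
      C * `|x - y| * `|w| * `|u| * `|v| ;
  mb_taylor : forall x h u v, `|x - u0| <= r -> `|x + h - u0| <= r ->
    `|mx_inner (g (x + h)) u v - mx_inner (g x) u v - mx_inner (dmetric x h) u v|
      <= C * `|h| ^+ 2 * `|u| * `|v| ;
  mb_derive : forall (c : R -> 'rV[R]_n) (t : R) v a b, `|c t - u0| <= r ->
    is_derive t 1 c v ->
    is_derive t 1 (fun s => g (c s) a b) (dmetric (c t) v a b) }.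

Lemma dmetricD x w w' : dmetric x (w + w') = dmetric x w + dmetric x w'.
Proof.
by rewrite /dmetric -big_split; apply: eq_bigr => k _; rewrite rvDE scalerDl.
Qed.

Lemma dmetricZ x c w : dmetric x (c *: w) = c *: dmetric x w.
Proof.
by rewrite /dmetric scaler_sumr; apply: eq_bigr => k _; rewrite rvZE scalerA.
Qed.

Lemma metric_ball_sub D u0 r lam C u1 r1 : metric_ball D u0 r lam C ->
  0 < r1 -> `|u1 - u0| + r1 <= r -> metric_ball D u1 r1 lam C.
Proof.
move=> mb r10 r1r.
have sub x : `|x - u1| <= r1 -> `|x - u0| <= r.
  move=> xr; rewrite -(subrK u1 x) -addrA.
  apply: le_trans (ler_normD _ _) _; apply: le_trans r1r.
  by rewrite [leRHS]addrC lerD2r.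
case: mb => r0 lam0 C1 h1 h2 h2' h3 h4 h5 h6 h7 h8 h9; split => //.
- by move=> x /sub; exact: h1.
- by move=> x /sub; exact: h2.
- by move=> x w /sub; exact: h2'.
- by move=> x v /sub; exact: h3.
- by move=> x u v /sub; exact: h4.
- by move=> x w u v /sub; exact: h5.
- by move=> x y u v /sub xr /sub; exact: h6.
- by move=> x y w u v /sub xr /sub; exact: h7.
- by move=> x h u v /sub xr /sub; exact: h8.
- by move=> c t v a b /sub; exact: h9.
Qed.

Lemma local_bound (I : finType) (F : I -> 'rV[R]_n -> R) (u0 : 'rV[R]_n) :
  (forall i, {for u0, continuous (F i)}) ->
  exists d C : R, [/\ 0 < d, 0 <= C & forall i x, `|x - u0| <= d -> `|F i x| <= C].
Proof.
move=> Fc.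
have [d d0 H] : exists2 d : R, 0 < d & forall i x, `|x - u0| < d ->
    `|F i x - F i u0| <= 1.
  apply: finite_eps; first by move=> i d d' dd H x xd; apply/H/(lt_le_trans xd).
  by move=> i; have /continuous_eps /(_ 1 ltr01) [d d0 H] := Fc i; exists d.
exists (d / 2), (1 + \sum_i `|F i u0|); split => [||i x xd].
- by rewrite divr_gt0.
- by rewrite addr_ge0// sumr_ge0.
- have {}H : `|F i x - F i u0| <= 1 by apply: H; lra.
  rewrite -(subrK (F i u0) (F i x)); apply: le_trans (ler_normD _ _) _.
  apply: lerD => //; rewrite (bigD1 i) //= lerDl; exact: sumr_ge0.
Qed.

(** [lam] is the minimum of the quadratic form on the unit sphere of the sup norm, which is
    compact. *)
Lemma posdef_lower_bound (G : 'M[R]_n) :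
  (forall v, v != 0 -> 0 < mx_inner G v v) ->
  exists2 lam : R, 0 < lam & forall v, lam * `|v| ^+ 2 <= mx_inner G v v.
Proof.
move=> Gp; pose S := [set v : 'rV[R]_n | `|v| = 1].
have Sc : compact S.
  apply: bounded_closed_compact.
    by exists 1; split => // M M1 v /= ->; exact: ltW.
  rewrite (_ : S = (fun v : 'rV[R]_n => `|v|) @^-1` [set 1])//.
  by apply: preimage_closed; [move=> v _; exact: norm_continuous|exact: closed_eq].
have Gc : continuous (fun v => mx_inner G v v).
  move=> v; apply/continuous_eps => e e0.
  have [d [C [d0 C0 H]]] := @local_bound unit (fun _ v => `|v|) v (fun=> @norm_continuous _ _ v).
  set K := n%:R ^+ 2 * (\sum_a \sum_b `|G a b|).
  have K0 : 0 <= K by rewrite mulr_ge0 ?exprn_ge0// sumr_ge0// => a _; rewrite sumr_ge0.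
  have GK a b : `|G a b| <= \sum_a \sum_b `|G a b|.
    rewrite (bigD1 a)//= (bigD1 b)//= -addrA lerDl addr_ge0 ?sumr_ge0// => i _.
    by rewrite sumr_ge0.
  have KC : 0 < K * (2 * C) + 1 by rewrite ltr_wpDl// mulr_ge0// mulr_ge0.
  exists (Num.min d (e / (K * (2 * C) + 1))) => [|w].
    by rewrite lt_min d0 divr_gt0.
  rewrite lt_min ltr_pdivlMr// => /andP[w1 w2].
  have -> : mx_inner G w w - mx_inner G v v = mx_inner G (w - v) w + mx_inner G v (w - v).
    by rewrite mx_innerBl mx_innerBr addrA subrK.
  apply: le_trans (ler_normD _ _) _.
  have S0 : 0 <= \sum_a \sum_b `|G a b| by rewrite sumr_ge0// => a _; rewrite sumr_ge0.
  have H1 := mx_inner_bound (w - v) w S0 GK; have H2 := mx_inner_bound v (w - v) S0 GK.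
  rewrite -/K in H1 H2.
  have vC : `|v| <= C by rewrite -[`|v|]normr_id; apply: (H tt); rewrite subrr normr0 ltW.
  have wC : `|w| <= C by rewrite -[`|w|]normr_id; apply: (H tt); rewrite ltW.
  apply: le_trans (lerD H1 H2) _; apply: ltW; apply: le_lt_trans w2.
  rewrite mulrDr mulr1; apply: (@le_trans _ _ (`|w - v| * (K * (2 * C)))); last by rewrite lerDl.
  have -> : `|w - v| * (K * (2 * C)) = K * `|w - v| * C + K * C * `|w - v| by ring.
  by apply: lerD; [rewrite ler_wpM2l// mulr_ge0|rewrite ler_wpM2r// ler_wpM2l].
(* An empty sphere means that 0 is the only vector; any [lam] works then. *)
have [[v0 Sv0]|S0] := pselect (S !=set0); last first.
  exists 1 => // v; have [->|v0] := eqVneq v 0.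
    by rewrite normr0 expr0n mulr0 mx_inner0l.
  exfalso; apply: S0; exists (`|v|^-1 *: v).
  by rewrite /S /= normrZ normfV normr_id mulVf// normr_eq0.
have [v Sv vmin] := @EVT_min_rV R n (fun v => mx_inner G v v) S
  (ex_intro _ v0 Sv0) Sc (continuous_subspaceT Gc).
have vn : `|v| = 1 by move: Sv; rewrite inE.
exists (mx_inner G v v).
  by apply: Gp; rewrite -normr_gt0 vn.
move=> w; have [->|w0] := eqVneq w 0.
  by rewrite normr0 expr0n mulr0 mx_inner0l.
have wn : 0 < `|w| by rewrite normr_gt0.
have : `|w|^-1 *: w \in S.
  by rewrite inE /S /= normrZ normfV normr_id mulVf// gt_eqF.
move=> /vmin; rewrite mx_innerZl mx_innerZr mulrA -expr2 exprVn.
by rewrite -ler_pdivrMl ?invr_gt0 ?exprn_gt0// invrK mulrC.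
Qed.

End LocalMetric.

Section MetricBallExists.
Context {R : realType} {n : nat} (M : riemannianManifold R n).
Variable i : rm_index M.
Let g := metric i.
Let D := chart_codom (atlas i).

Lemma metric_entry_Ck k a b : Ck k D (fun x => g x a b).
Proof. by apply: Ck_entry; [exact: chart_codom_open|exact: metric_smooth]. Qed.

Lemma metric_ball_exists u0 : D u0 -> exists r lam C, metric_ball g D u0 r lam C.
Proof.
move=> Du0.
have oD : open D by exact: chart_codom_open.
pose E (ab : 'I_n * 'I_n) (x : 'rV[R]_n) : R := g x ab.1 ab.2.
pose E1 (q : 'I_n * 'I_n * 'I_n) := 'D_(evec q.2) (E q.1).
pose E2 (q : 'I_n * 'I_n * 'I_n * 'I_n) := 'D_(evec q.2) (E1 q.1).
have EC k ab : Ck k D (E ab) by exact: metric_entry_Ck.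
have E1C k q : Ck k D (E1 q) by have [_] := EC k.+1 q.1 (evec q.2).
have E2C k q : Ck k D (E2 q) by have [_] := E1C k.+1 q.1 (evec q.2).
have [|d0 [C0 [d00 C00 B0]]] := @local_bound _ _ _ E u0.
  by move=> q; apply: EC 0%N q _ Du0.
have [|d1 [C1 [d10 C10 B1]]] := @local_bound _ _ _ E1 u0.
  by move=> q; apply: E1C 0%N q _ Du0.
have [|d2 [C2 [d20 C20 B2]]] := @local_bound _ _ _ E2 u0.
  by move=> q; apply: E2C 0%N q _ Du0.
have [d3 d30 rD] := open_eps oD Du0.
have [lam lam0 Hlam] : exists2 lam : R, 0 < lam & forall v, lam * `|v| ^+ 2 <= mx_inner (g u0) v v.
  by apply: posdef_lower_bound => v v0; exact: metric_posdef.
pose N : R := n%:R + 1.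
have N1 : 1 <= N by rewrite lerDr.
have N0 : 0 <= N by apply: le_trans N1.
have nN : n%:R <= N by rewrite lerDl.
pose C' := 1 + C0 + C1 + C2.
(* An estimate involves at most four sums over indices, each costing a factor [n <= N]: two for the
   bilinear form, one for contraction with a direction, one for the mean value inequality. *)
pose C := N ^+ 4 * C'.
have C'1 : 1 <= C' by rewrite /C'; lra.
have C'0 : 0 <= C' by apply: le_trans C'1.
have powN (a b : nat) : (a <= b)%N -> n%:R ^+ a <= N ^+ b :> R.
  move=> ab; apply: (@le_trans _ _ (N ^+ a)); first by rewrite lerXn2r ?nnegrE.
  exact: ler_weXn2l.
have C1' : 1 <= C.
  by apply: le_trans (C'1) _; rewrite ler_peMl// exprn_ege1.
pose r0 : R := Num.min (Num.min d0 d1) (Num.min d2 d3).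
have r00 : 0 < r0 by rewrite !lt_min d00 d10 d20.
have r0D x : `|x - u0| <= r0 -> [/\ `|x - u0| <= d0, `|x - u0| <= d1, `|x - u0| <= d2 & D x].
  rewrite !le_min => /andP[/andP[-> ->] /andP[-> /rD]] //.
(* Within this radius the quadratic form drifts by at most [lam / 2] from its value at [u0], which
   leaves the ellipticity [lam / 2]. *)
pose r : R := Num.min r0 (lam / 2 / C).
have r_gt0 : 0 < r by rewrite lt_min r00 divr_gt0// ?divr_gt0// (lt_le_trans ltr01).
have rr0 x : `|x - u0| <= r -> `|x - u0| <= r0 by move=> xr; apply: le_trans xr _; rewrite ge_min lexx.
have b0 x a b : `|x - u0| <= r0 -> `|g x a b| <= C'.
  by move=> /r0D[x0 _ _ _]; apply: le_trans (B0 (a, b) x x0) _; rewrite /C'; lra.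
have b1 x a b k : `|x - u0| <= r0 -> `|E1 (a, b, k) x| <= C'.
  by move=> /r0D[_ x0 _ _]; apply: le_trans (B1 (a, b, k) x x0) _; rewrite /C'; lra.
have b2 x a b k l : `|x - u0| <= r0 -> `|E2 (a, b, k, l) x| <= C'.
  by move=> /r0D[_ _ x0 _]; apply: le_trans (B2 (a, b, k, l) x x0) _; rewrite /C'; lra.
have derE x k a b : D x -> ('D_(evec k) g x) a b = E1 (a, b, k) x.
  by move=> Dx; rewrite derive_mx ?mxE//; have [H _] := metric_smooth i 1 (evec k); exact: H.
have dmE x w a b : D x -> dmetric g x w a b = \sum_k w 0 k * E1 (a, b, k) x.
  move=> Dx; rewrite /dmetric summxE; apply: eq_bigr => k _.
  by rewrite mxE derE.
have sumb (c : R) (F : 'I_n -> R) (w : 'rV[R]_n) : (forall k, `|F k| <= c) -> 0 <= c ->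
    `|\sum_k w 0 k * F k| <= n%:R * c * `|w|.
  move=> Fc c0; apply: le_trans (ler_norm_sum _ _ _) _.
  have -> : n%:R * c * `|w| = \sum_(k < n) `|w| * c.
    by rewrite sumr_const card_ord -mulr_natl; ring.
  by apply: ler_sum => k _; rewrite normrM ler_pM// coord_le_norm.
have lip0 x y a b : `|x - u0| <= r0 -> `|y - u0| <= r0 ->
    `|(g x - g y) a b| <= n%:R * (C' * `|x - y|).
  move=> xr yr; rewrite [_ a b]mxE [X in _ + X]mxE.
  have H := @C1_lipschitz _ _ _ _ (EC 1%N (a, b)) u0 r0 C' _ _ x y xr yr.
  apply: H; first by move=> z /r0D [].
  by move=> z k /(b1 _ a b k).
have lip1 x y a b k : `|x - u0| <= r0 -> `|y - u0| <= r0 ->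
    `|E1 (a, b, k) x - E1 (a, b, k) y| <= n%:R * (C' * `|x - y|).
  move=> xr yr; apply: (@C1_lipschitz _ _ _ _ (E1C 1%N (a, b, k)) u0 r0 C' _ _ x y xr yr).
  - by move=> z /r0D [].
  - by move=> z l /(b2 _ a b k l).
have fin (p q : nat) (X : R) : (p <= 4)%N -> 0 <= X -> n%:R ^+ p * (C' * X) <= C * X.
  by move=> p4 X0; rewrite mulrA ler_wpM2r// /C ler_wpM2r// powN.
have lipg x y u v : `|x - u0| <= r0 -> `|y - u0| <= r0 ->
    `|mx_inner (g x) u v - mx_inner (g y) u v| <= C * `|x - y| * `|u| * `|v|.
  move=> xr yr; rewrite -mx_innerBm.
  apply: le_trans (mx_inner_bound u v _ (fun a b => lip0 x y a b xr yr)) _.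
    by rewrite !mulr_ge0.
  have := @fin 3 0%N (`|x - y| * `|u| * `|v|) isT; rewrite !mulr_ge0// => /(_ isT) H.
  apply: le_trans (le_trans _ H) _; last by rewrite !mulrA.
  by rewrite le_eqVlt; apply/orP; left; apply/eqP; ring.
have u0r : `|u0 - u0| <= r0 by rewrite subrr normr0 ltW.
have mono (p : nat) (X Y Z : R) : (p <= 4)%N -> 0 <= X -> Y <= n%:R ^+ p * (C' * X) ->
    C * X = Z -> Y <= Z.
  by move=> p4 X0 YX <-; apply: le_trans YX _; exact: (fin p 0%N).
exists r, (lam / 2), C; split => //.
- by rewrite divr_gt0.
- by move=> x /rr0 /r0D [].
- by move=> x /rr0 /r0D [_ _ _ Dx]; exact: metric_symmetric.
- move=> x w /rr0 /r0D [_ _ _ Dx]; apply/matrixP => a b; rewrite mxE !dmE//.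
  apply: eq_bigr => k _; congr (_ * _); rewrite /E1 /=.
  apply: near_eq_derive; apply: filterS (open_nbhs_nbhs (conj oD Dx)) => y Dy /=.
  by have /matrixP /(_ a b) := metric_symmetric (i := i) Dy; rewrite mxE /E.
- move=> x v xr; have := lipg x u0 v v (rr0 _ xr) u0r.
  have xrC : C * `|x - u0| <= lam / 2.
    rewrite mulrC -ler_pdivlMr ?(lt_le_trans ltr01)//.
    by apply: le_trans xr _; rewrite ge_min lexx orbT.
  rewrite ler_norml => /andP[H _].
  have := Hlam v.
  have : C * `|x - u0| * `|v| * `|v| <= lam / 2 * `|v| * `|v|.
    by rewrite !ler_wpM2r.
  rewrite expr2; set a := `|v|; set b := C * `|x - u0| in H *.
  set y := mx_inner _ _ _ in H *; set z := mx_inner _ _ _ in H *; move=> h1 h2.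
  have : lam * (a * a) = 2 * (lam / 2 * a * a) by field.
  move: H; rewrite -/a mulrA; set c := lam / 2 * a * a; set d := b * a * a in h1 *.
  move=> h3 h4; rewrite mulrA in h2; rewrite mulrA in h4; lra.
- move=> x u v /rr0 xr; apply: le_trans (mx_inner_bound u v C'0 (fun a b => b0 x a b xr)) _.
  by apply: (@mono 2 (`|u| * `|v|)) => //; rewrite ?mulr_ge0//; [rewrite le_eqVlt; apply/orP; left; apply/eqP; ring|ring].
- move=> x w u v /rr0 xr.
  have [_ _ _ Dx] := r0D x xr.
  have H a b : `|dmetric g x w a b| <= n%:R * C' * `|w|.
    by rewrite dmE//; apply: sumb => // k; exact: b1.
  apply: le_trans (mx_inner_bound u v _ H) _; first by rewrite !mulr_ge0.
  by apply: (@mono 3 (`|w| * `|u| * `|v|)) => //; rewrite ?mulr_ge0//; [rewrite le_eqVlt; apply/orP; left; apply/eqP; ring|ring].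
- by move=> x y u v /rr0 xr /rr0 yr; exact: lipg.
- move=> x y w u v /rr0 xr /rr0 yr.
  have [_ _ _ Dx] := r0D x xr; have [_ _ _ Dy] := r0D y yr.
  rewrite -mx_innerBm.
  have H a b : `|(dmetric g x w - dmetric g y w) a b| <= n%:R * (n%:R * (C' * `|x - y|)) * `|w|.
    rewrite mxE [X in _ + X]mxE [X in X - _]dmE// [X in _ - X]dmE// -sumrB (eq_bigr _ (fun k _ => esym (mulrBr _ _ _))).
    by apply: sumb => [k|]; [exact: lip1|rewrite !mulr_ge0].
  apply: le_trans (mx_inner_bound u v _ H) _; first by rewrite !mulr_ge0.
  by apply: (@mono 4 (`|x - y| * `|w| * `|u| * `|v|)) => //; rewrite ?mulr_ge0//; [rewrite le_eqVlt; apply/orP; left; apply/eqP; ring|ring].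
- move=> x h u v /rr0 xr /rr0 hr.
  have [_ _ _ Dx] := r0D x xr.
  rewrite -!mx_innerBm.
  have H a b : `|(g (x + h) - g x - dmetric g x h) a b| <= n%:R * (n%:R * C' * `|h| * `|h|).
    rewrite mxE [X in _ + X]mxE dmE// [(g (x + h) - g x) a b]mxE [X in _ + X - _]mxE.
    apply: (@C1_taylor _ _ _ _ (EC 1%N (a, b)) u0 r0 (n%:R * C') _ _ _ x h xr hr) => //.
    - by rewrite mulr_ge0.
    - by move=> z /r0D [].
    - by move=> y z k yr zr; rewrite -mulrA; exact: (lip1 y z a b k).
  apply: le_trans (mx_inner_bound u v _ H) _; first by rewrite !mulr_ge0.
  by apply: (@mono 4 (`|h| ^+ 2 * `|u| * `|v|)) => //; rewrite ?mulr_ge0// ?exprn_ge0//; [rewrite le_eqVlt; apply/orP; left; apply/eqP; ring|ring].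
- move=> c t v a b /rr0 /r0D [_ _ _ Dc] cd; rewrite dmE//.
  exact: (C1_chain oD (EC 1%N (a, b)) Dc cd).
Qed.

End MetricBallExists.

(** * Curves on the line *)

Section Curves.
Context {R : realType}.

Lemma is_derive_rV (n : nat) (c : R -> 'rV[R]_n) (t : R) (v : 'rV[R]_n) :
  is_derive t 1 c v <-> forall k, is_derive t 1 (fun s => c s 0 k) (v 0 k).
Proof.
split=> [/is_derive_eps H k|H]; apply/is_derive_eps => e e0.
- have [d d0 {}H] := H e e0; exists d => // h hd; apply: le_trans (H h hd).
  by rewrite -[h *: v 0 k]rvZE -!rvBE; exact: coord_le_norm.
- have [d d0 {}H] : exists2 d : R, 0 < d & forall k (h : R), `|h| < d ->
      `|c (h *: 1 + t) 0 k - c t 0 k - h *: v 0 k| <= e * `|h|.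
    apply: finite_eps => [k d d' dd Hd h hd|k].
      exact/Hd/(lt_le_trans hd).
    by have /is_derive_eps /(_ e e0) [d d0 Hd] := H k; exists d.
  exists d => // h hd; apply: norm_le_coord => [|k]; first by rewrite mulr_ge0// ltW.
  by rewrite !rvBE rvZE; exact: H.
Qed.

Lemma is_derive_rV_continuous (n : nat) (c : R -> 'rV[R]_n) (t : R) (v : 'rV[R]_n) :
  is_derive t 1 c v -> {for t, continuous c}.
Proof.
move=> cd; apply: differentiable_continuous; apply/derivable1_diffP.
by case: cd.
Qed.

Lemma continuous_rV (T : topologicalType) (n : nat) (c : T -> 'rV[R]_n) (t : T) :
  (forall k, {for t, continuous (fun s => c s 0 k)}) <-> {for t, continuous c}.
Proof.
split=> [H|H k]; last first.
  apply: (@continuous_comp _ _ _ c (fun M : 'rV[R]_n => M 0 k)) => //.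
  exact: coord_continuous.
apply/cvgrPdist_le => e e0.
have F : \forall s \near t, forall k, `|c t 0 k - c s 0 k| <= e.
  apply: filter_forall => k; have /cvgrPdist_le := H k; exact.
apply: filterS F => s Hs; apply: norm_le_coord => [|k]; first exact: ltW.
by rewrite rvBE; exact: Hs.
Qed.

Lemma continuous_sum_fun (T : topologicalType) (I : finType) (F : I -> T -> R) (t : T) :
  (forall i, {for t, continuous (F i)}) ->
  {for t, continuous (fun s => \sum_i F i s)}.
Proof.
move=> H; rewrite (_ : (fun s => _) = \sum_i F i); last first.
  by apply/funext => s; rewrite fct_sumE.
apply: (big_ind (fun f : T -> R => {for t, continuous f})) => //.
- by move=> e; exact: cvg_cst.
- by move=> f g; exact: continuousD.
Qed.

Lemma continuous_inner (T : topologicalType) (n : nat) (G : T -> 'M[R]_n)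
    (u v : T -> 'rV[R]_n) (t : T) :
  (forall a b, {for t, continuous (fun s => G s a b)}) ->
  {for t, continuous u} -> {for t, continuous v} ->
  {for t, continuous (fun s => mx_inner (G s) (u s) (v s))}.
Proof.
move=> HG /continuous_rV Hu /continuous_rV Hv.
rewrite (_ : (fun s => _) = fun s => \sum_a \sum_b u s 0 a * G s a b * v s 0 b); last first.
  by apply/funext => s; rewrite mx_innerE.
apply: continuous_sum_fun => a; apply: continuous_sum_fun => b.
by apply: continuousM; [apply: continuousM|].
Qed.

Lemma near_eq_continuous (T U : topologicalType) (f g : T -> U) (t : T) :
  {near t, f =1 g} -> {for t, continuous f} -> {for t, continuous g}.
Proof.
move=> fg fc; have E : f t = g t := nbhs_singleton fg.
rewrite /prop_for /continuous_at -E.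
by apply: cvg_trans fc; apply: near_eq_cvg; apply: filterS fg => x ->.
Qed.

Lemma itv_oo_near (a b t : R) : a < t < b -> \forall s \near t, a < s < b.
Proof.
move=> tab; have oab : open `]a, b[%classic by exact: interval_open.
have : nbhs t `]a, b[%classic by apply: open_nbhs_nbhs; split => //=; rewrite in_itv.
by apply: filterS => s /=; rewrite in_itv.
Qed.

Lemma antiderivative (f : R -> R) (a b : R) : a < b ->
  (forall t, a <= t <= b -> {for t, continuous f}) ->
  exists L, forall t, a < t < b -> is_derive t 1 L (f t).
Proof.
move=> ab fc.
have fi : lebesgue_measure.-integrable `[a, b] (EFin \o f).
  apply: continuous_compact_integrable; first exact: segment_compact.
  exact: within_continuousP.
have [F H] : exists F : R -> R, forall t, a < t < b -> {for t, continuous f} ->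
    derivable F t 1 /\ F^`() t = f t.
  by eexists => t /andP[at_ tb]; exact: (continuous_FTC1_closed tb fi at_).
exists F => t tab; have [|H1 H2] := H t tab.
  by apply: fc; case/andP: tab => *; rewrite !ltW.
by split => //; rewrite -H2 derive1E.
Qed.

(** Regularity is asked on a larger open interval, which avoids one-sided derivatives at the
    ends. *)
Lemma FTC2 (f F : R -> R) (a b e : R) : a < b -> 0 < e ->
  (forall t, a - e < t < b + e -> is_derive t 1 F (f t)) ->
  (forall t, a - e < t < b + e -> {for t, continuous f}) ->
  (\int[lebesgue_measure]_(t in `[a, b]) f t)%R = F b - F a.
Proof.
move=> ab e0 Fd fc.
have inn t : a <= t <= b -> a - e < t < b + e by move=> /andP[? ?]; lra.
rewrite /Rintegral (@continuous_FTC2 _ f F a b ab) //.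
- by apply: within_continuousP => t tab; exact/fc/inn.
- split.
  + move=> t; rewrite in_itv /= => /andP[t1 t2].
    have [] : is_derive t 1 F (f t) by apply/Fd/inn; rewrite !ltW.
    by [].
  + apply: cvg_at_right_filter.
    by apply: is_derive_continuous (Fd a _); apply: inn; rewrite lexx ltW.
  + apply: cvg_at_left_filter.
    by apply: is_derive_continuous (Fd b _); apply: inn; rewrite lexx ltW.
- move=> t; rewrite in_itv /= => /andP[t1 t2].
  have [_ <-] : is_derive t 1 F (f t) by apply/Fd/inn; rewrite !ltW.
  by rewrite derive1E.
Qed.

Lemma mvt_dom (f df g dg : R -> R) (a b : R) : a <= b ->
  (forall t, a <= t <= b -> is_derive t 1 f (df t)) ->
  (forall t, a <= t <= b -> is_derive t 1 g (dg t)) ->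
  (forall t, a <= t <= b -> df t <= dg t) ->
  f b - f a <= g b - g a.
Proof.
move=> ab fd gd fg.
have hd t : a <= t <= b -> is_derive t 1 (g \- f) (dg t - df t).
  by move=> tab; have := fd t tab; have := gd t tab => *; apply: is_deriveB.
have d1 x : x \in `]a, b[%R -> is_derive x 1 (g \- f) (dg x - df x).
  by rewrite in_itv /= => /andP[ax xb]; apply: hd; rewrite !ltW.
have d2 : {within `[a, b], continuous (g \- f)}.
  by apply: within_continuousP => x xab; exact: is_derive_continuous (hd _ xab).
have [c cab H] := MVT_segment ab d1 d2.
have : 0 <= (g \- f) b - (g \- f) a.
  by rewrite H mulr_ge0 ?subr_ge0// fg.
rewrite /=; lra.
Qed.

(** The supremum of the times up to which [P] holds throughout satisfies [P] by the first closure
    condition and cannot lie below [b] by the second. It serves for all continuation arguments along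
    paths. *)
Lemma real_induction (P : R -> Prop) (a b : R) : a <= b -> P a ->
  (forall t, a < t <= b -> (forall s, a <= s < t -> P s) -> P t) ->
  (forall t, a <= t < b -> (forall s, a <= s <= t -> P s) ->
     exists2 d : R, 0 < d & forall s, t <= s <= t + d -> s <= b -> P s) ->
  forall t, a <= t <= b -> P t.
Proof.
move=> ab Pa Pl Pr.
pose S := [set t | a <= t <= b /\ forall s, a <= s <= t -> P s].
have Sa : S a by split=> [|s]; [rewrite lexx ab|rewrite -eq_le => /eqP <-].
have Sb : ubound S b by move=> t [/andP[]].
have hS : has_sup S by split; [exists a|exists b].
pose m := sup S.
have am : a <= m by apply: ub_le_sup => //; exists b.
have mb : m <= b by apply: ge_sup => //; exists a.
have below s : a <= s < m -> P s.
  move=> /andP[as_ sm]; have [t St st] := sup_gt (ex_intro _ a Sa) sm.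
  by case: St => _; apply; rewrite as_ ltW.
have Pm : P m.
  move: am; rewrite le_eqVlt => /predU1P[<-//|am]; apply: Pl => //.
  by rewrite am mb.
have Sm s : a <= s <= m -> P s.
  move=> /andP[as_]; rewrite le_eqVlt => /predU1P[->//|sm].
  by apply: below; rewrite as_.
suff -> : b = m by [].
apply/eqP; rewrite eq_le mb andbT leNgt; apply/negP => mb'.
have [|d d0 Hd] := Pr m _ Sm; first by rewrite am.
pose m' : R := Num.min b (m + d).
have mm' : m < m' by rewrite lt_min mb' ltrDl.
have : S m'.
  split; first by rewrite (le_trans am (ltW mm')) ge_min lexx.
  move=> s /andP[as_ sm']; have [sm|sm] := leP s m; first by apply: Sm; rewrite as_.
  move: sm'; rewrite le_min => /andP[sb sd].
  by apply: Hd => //; rewrite (ltW sm).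
move=> /(ub_le_sup (ex_intro _ b Sb)); rewrite -/m leNgt mm' //.
Qed.

End Curves.

(** * Curves in charts *)

Section ManifoldCurves.
Context {R : realType} {n : nat} (M : riemannianManifold R n).
Implicit Types (gamma : R -> M) (i j : rm_index M) (t l : R).

Definition cinner i (x u v : 'rV[R]_n) : R := mx_inner (metric i x) u v.

Lemma itv_oo_open (a b : R) : open (`]a, b[%classic : set R).
Proof. exact: interval_open. Qed.

Lemma transition_dom_open (phi psi : chart R n M) : open (transition_dom phi psi).
Proof.
rewrite openE => u [Cu Du]; rewrite /interior.
have Hc : nbhs u (chart_codom phi).
  by apply: open_nbhs_nbhs; split=> //; exact: chart_codom_open.
have Hi : nbhs u (chart_inv phi @^-1` chart_dom psi).
  apply: (chart_inv_continuous (c := phi)) => //.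
  by apply: open_nbhs_nbhs; split=> //; exact: chart_dom_open.
exact: filterI Hc Hi.
Qed.

Lemma transition_dom_chart (phi psi : chart R n M) (x : M) :
  chart_dom phi x -> chart_dom psi x -> transition_dom phi psi (phi x).
Proof.
by move=> px qx; split; [exact: chart_fun_codom|rewrite /= chart_funK].
Qed.

Lemma C1_derive_coord (D : set 'rV[R]_n) (f : 'rV[R]_n -> 'rV[R]_n) (x v : 'rV[R]_n) k :
  open D -> Ck 1 D f -> D x -> ('D_v f x) 0 k = 'D_v (fun y => f y 0 k) x.
Proof.
by move=> oD fC Dx; have [H _] := fC v; rewrite derive_mx ?mxE//; exact: H.
Qed.

Lemma C1_chain_rV (D : set 'rV[R]_n) (f : 'rV[R]_n -> 'rV[R]_n) (c : R -> 'rV[R]_n) t v :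
  open D -> Ck 1 D f -> D (c t) -> is_derive t 1 c v ->
  is_derive t 1 (f \o c) ('D_v f (c t)).
Proof.
move=> oD fC Dc cd; apply/is_derive_rV => k.
rewrite (C1_derive_coord _ _ oD)// (C1_derive oD)//; last exact: Ck_entry.
by apply: (C1_chain oD) => //; exact: Ck_entry.
Qed.

Lemma C1_derive_continuous (D : set 'rV[R]_n) (f : 'rV[R]_n -> 'rV[R]_n)
    (c v : R -> 'rV[R]_n) t :
  open D -> Ck 1 D f -> D (c t) -> {for t, continuous c} -> {for t, continuous v} ->
  {for t, continuous (fun s => 'D_(v s) f (c s))}.
Proof.
move=> oD fC Dc cc vc; apply/continuous_rV => k.
have fk : Ck 1 D (fun y => f y 0 k) by exact: Ck_entry.
have nD : \forall s \near t, D (c s).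
  by apply: cc; apply: open_nbhs_nbhs.
apply: (@near_eq_continuous _ _ (fun s => \sum_l v s 0 l * 'D_(evec l) (fun y => f y 0 k) (c s))).
  by apply: filterS nD => s Ds; rewrite (C1_derive_coord _ _ oD)// (C1_derive oD).
apply: continuous_sum_fun => l; apply: continuousM.
  by move/continuous_rV: vc; apply.
apply: (continuous_comp (f := c) (g := 'D_(evec l) (fun y => f y 0 k))) => //.
exact: C1_partial_continuous.
Qed.

Lemma transition_chain i j (c : R -> 'rV[R]_n) t v :
  transition_dom (atlas i) (atlas j) (c t) -> is_derive t 1 c v ->
  is_derive t 1 (transition (atlas i) (atlas j) \o c)
    ('D_v (transition (atlas i) (atlas j)) (c t)).
Proof.
exact: (C1_chain_rV (@transition_dom_open (atlas i) (atlas j))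
  (@atlas_smooth _ _ M i j 1)).
Qed.

Lemma coord_curve_transition i j gamma t : {for t, continuous gamma} ->
  chart_dom (atlas i) (gamma t) ->
  {near t, transition (atlas i) (atlas j) \o coord_curve i gamma =1 coord_curve j gamma}.
Proof.
move=> gc Di; have N : \forall s \near t, chart_dom (atlas i) (gamma s).
  by apply: gc; apply: open_nbhs_nbhs; split=> //; exact: chart_dom_open.
by apply: filterS N => s Ds; rewrite /transition /coord_curve /= chart_funK.
Qed.

Lemma coord_curve_derive i j gamma t v : {for t, continuous gamma} ->
  chart_dom (atlas i) (gamma t) -> chart_dom (atlas j) (gamma t) ->
  is_derive t 1 (coord_curve i gamma) v ->
  is_derive t 1 (coord_curve j gamma)
    ('D_v (transition (atlas i) (atlas j)) (coord_curve i gamma t)).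
Proof.
move=> gc Di Dj cd.
apply: (near_eq_is_derive (f := transition (atlas i) (atlas j) \o coord_curve i gamma)).
- exact: coord_curve_transition.
- by apply: transition_chain cd; exact: transition_dom_chart.
Qed.

Lemma derivable_is_derive (V : normedModType R) (c : R -> V) t :
  derivable c t 1 -> is_derive t 1 c (derive1 c t).
Proof. by move=> cd; rewrite derive1E; exact/derivableP. Qed.

Lemma derive1_val (V : normedModType R) (c : R -> V) t v :
  is_derive t 1 c v -> derive1 c t = v.
Proof. by move=> cd; rewrite derive1E derive_val. Qed.

(** [speed] is computed in the chart selected by [chart_at], which may jump along the curve.
    Compatibility of the metric matrices under transitions allows evaluation in one fixed chart. *)
Lemma speed_chart i gamma t v : {for t, continuous gamma} ->
  chart_dom (atlas i) (gamma t) -> is_derive t 1 (coord_curve i gamma) v ->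
  speed gamma t = Num.sqrt (cinner i (coord_curve i gamma t) v v).
Proof.
move=> gc Di cd; rewrite /speed /cinner; set j := chart_at (gamma t).
have Dj : chart_dom (atlas j) (gamma t) by exact: chart_at_dom.
have cjd := coord_curve_derive gc Di Dj cd.
have -> : (coord_curve j gamma)^`() t =
    'D_v (transition (atlas i) (atlas j)) (coord_curve i gamma t).
  exact: derive1_val cjd.
congr Num.sqrt; rewrite [RHS](metric_compat (j := j)); last exact: transition_dom_chart.
congr (mx_inner (metric j _) _ _).
by rewrite /coord_curve /transition /= chart_funK.
Qed.

Lemma metric_entry_continuous i (x : 'rV[R]_n) a b : chart_codom (atlas i) x ->
  {for x, continuous (fun y => metric i y a b)}.
Proof. by move=> Cx; apply: (metric_entry_Ck i 0%N a b). Qed.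

Lemma speed_continuous (A : set R) gamma t : open A -> C1_curve_on A gamma -> A t ->
  {for t, continuous (speed gamma)}.
Proof.
move=> oA gC At; set i := chart_at (gamma t).
have [gc Hi] := gC t At.
have Di : chart_dom (atlas i) (gamma t) by exact: chart_at_dom.
have [cd dc] := Hi i Di.
have N : \forall s \near t, A s /\ chart_dom (atlas i) (gamma s).
  apply: filterI; first exact: open_nbhs_nbhs.
  by apply: gc; apply: open_nbhs_nbhs; split=> //; exact: chart_dom_open.
pose G s := mx_inner (metric i (coord_curve i gamma s))
  (derive1 (coord_curve i gamma) s) (derive1 (coord_curve i gamma) s).
have Gc : {for t, continuous G}.
  apply: continuous_inner => // a b.
  apply: (continuous_comp (f := coord_curve i gamma) (g := fun x => metric i x a b)).
    exact: is_derive_rV_continuous (derivableP cd).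
  by apply: metric_entry_continuous; exact: chart_fun_codom.
have sGc : {for t, continuous (Num.sqrt \o G)}.
  by apply: continuous_comp => //; exact: sqrt_continuous.
apply: near_eq_continuous sGc.
apply: filterS N => s [As Ds]; have [gcs Hs] := gC s As; have [cds _] := Hs i Ds.
exact: esym (speed_chart gcs Ds (derivable_is_derive cds)).
Qed.

Lemma speed_ge0 gamma t : 0 <= speed gamma t.
Proof. exact: sqrtr_ge0. Qed.

Lemma chart_curve_C1 i (A : set R) (c : R -> 'rV[R]_n) : open A ->
  (forall t, A t -> [/\ chart_codom (atlas i) (c t), derivable c t 1 &
     {for t, continuous c^`()}]) ->
  C1_curve_on A (chart_inv (atlas i) \o c).
Proof.
move=> oA H t At; have [Ct cd dc] := H t At.
have cc : {for t, continuous c} := is_derive_rV_continuous (derivableP cd).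
split; first by apply: continuous_comp => //; exact: chart_inv_continuous.
move=> j /= Dj.
have cTd s : A s -> transition_dom (atlas i) (atlas j) (c s) ->
    is_derive s 1 (coord_curve j (chart_inv (atlas i) \o c))
      ('D_(derive1 c s) (transition (atlas i) (atlas j)) (c s)).
  move=> As Ts; have [Cs csd _] := H s As.
  exact: transition_chain Ts (derivable_is_derive csd).
have Tt : transition_dom (atlas i) (atlas j) (c t) by [].
split; first by have [] := cTd t At Tt.
have N : \forall s \near t, A s /\ transition_dom (atlas i) (atlas j) (c s).
  apply: filterI; first exact: open_nbhs_nbhs.
  by apply: cc; apply: open_nbhs_nbhs; split=> //; exact: transition_dom_open.
have Hc := C1_derive_continuous (@transition_dom_open (atlas i) (atlas j))
    (@atlas_smooth _ _ M i j 1) Tt cc dc.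
apply: near_eq_continuous Hc.
by apply: filterS N => s [As Ts]; rewrite (derive1_val (cTd s As Ts)).
Qed.

Lemma affine_derive (V : normedModType R) (c : R -> V) (a k t : R) v :
  is_derive (a + t * k) 1 c v -> is_derive t 1 (fun s => c (a + s * k)) (k *: v).
Proof.
move=> /is_derive_eps H; apply/is_derive_eps => e e0.
have k0 : 0 < `|k| + 1 by rewrite ltr_wpDl.
have [d d0 {}H] := H (e / (`|k| + 1)) (divr_gt0 e0 k0).
exists (d / (`|k| + 1)) => [|h]; first by rewrite divr_gt0.
rewrite ltr_pdivlMr// => hd.
have hk : `|h * k| < d.
  by rewrite normrM; apply: le_lt_trans hd; rewrite ler_wpM2l// lerDl.
have := H _ hk; rewrite scalerA /GRing.scale /= !mulr1.
have -> : a + (h + t) * k = h * k + (a + t * k) by ring.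
move=> /le_trans; apply; rewrite normrM.
have -> : e / (`|k| + 1) * (`|h| * `|k|) = e * `|h| * (`|k| / (`|k| + 1)) by ring.
rewrite ler_piMr ?mulr_ge0// ?(ltW e0)// ler_pdivrMr// mul1r lerDl//.
Qed.

Lemma affine_continuous (a k s : R) : {for s, continuous (fun u : R => a + u * k)}.
Proof.
apply: (is_derive_continuous (d := k)); apply/is_derive_eps => e e0.
exists 1 => // h _; rewrite /GRing.scale /= mulr1.
have -> : a + (h + s) * k - (a + s * k) - h * k = 0 by ring.
by rewrite normr0 mulr_ge0// ltW.
Qed.

Lemma comp_affine_continuous (T : topologicalType) (f : R -> T) (a k s : R) :
  {for a + s * k, continuous f} -> {for s, continuous (fun u : R => f (a + u * k))}.
Proof.
move=> fc; exact: (@continuous_comp _ _ _ (fun u : R => a + u * k) f s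
  (@affine_continuous a k s) fc).
Qed.

Lemma reparam_coord gamma i (a k u : R) :
  derivable (coord_curve i gamma) (a + u * k) 1 ->
  is_derive u 1 (coord_curve i (fun s => gamma (a + s * k)))
      (k *: derive1 (coord_curve i gamma) (a + u * k)).
Proof.
by move=> ud; exact: (affine_derive (c := coord_curve i gamma) (derivable_is_derive ud)).
Qed.

Lemma reparam_C1 gamma (a k : R) (A B : set R) : open A ->
  (forall s, B s -> A (a + s * k)) -> C1_curve_on A gamma ->
  C1_curve_on B (fun s => gamma (a + s * k)).
Proof.
move=> oA BA gC s Bs; have [gc Hi] := gC _ (BA s Bs).
have ac := @affine_continuous a k s.
split; first exact: comp_affine_continuous.
move=> i Di; have [cd dc] := Hi i Di.
split; first by have [] := reparam_coord cd.
have N : \forall u \near s, A (a + u * k) /\ chart_dom (atlas i) (gamma (a + u * k)).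
  apply: filterI; first by apply: ac; apply: open_nbhs_nbhs; split=> //; exact: BA.
  have gc' := comp_affine_continuous gc.
  by apply: gc'; apply: open_nbhs_nbhs; split=> //; exact: chart_dom_open.
have Hc : {for s, continuous (fun u : R => k *: derive1 (coord_curve i gamma) (a + u * k))}.
  apply/continuous_rV => j.
  rewrite (_ : (fun _ => _) = (fun u : R => k * derive1 (coord_curve i gamma) (a + u * k) 0 j)); last first.
    by apply/funext => u; rewrite rvZE.
  apply: continuousM; first exact: cvg_cst.
  have /continuous_rV := comp_affine_continuous dc; exact.
apply: near_eq_continuous Hc; apply: filterS N => u [Au Du].
have [_ Hu] := gC _ Au.
exact: esym (derive1_val (reparam_coord (proj1 (Hu i Du)))).
Qed.

Lemma reparam_speed gamma (a k s : R) (A : set R) :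
  C1_curve_on A gamma -> A (a + s * k) ->
  speed (fun s => gamma (a + s * k)) s = `|k| * speed gamma (a + s * k).
Proof.
move=> gC As; have [gc Hi] := gC _ As.
set i := chart_at (gamma (a + s * k)).
have Di : chart_dom (atlas i) (gamma (a + s * k)) by exact: chart_at_dom.
have [cd _] := Hi i Di.
rewrite (speed_chart gc Di (derivable_is_derive cd)).
have gc' := comp_affine_continuous gc.
rewrite (speed_chart gc' Di (reparam_coord cd)).
rewrite /cinner mx_innerZl mx_innerZr mulrA -expr2 sqrtrM ?sqr_ge0// sqrtr_sqr.
by rewrite /coord_curve.
Qed.

(** Affine reparametrization to [[0, 1]]. The length is expressed by a primitive [L] of the speed,
    so that later estimates compare primitives instead of integrals. *)
Lemma C1_arc_of gamma (a b e : R) (L : R -> R) : a < b -> 0 < e ->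
  C1_curve_on `]a - e, b + e[ gamma ->
  (forall t, a - e < t < b + e -> is_derive t 1 L (speed gamma t)) ->
  C1_arc (gamma a) (gamma b) (L b - L a).
Proof.
move=> ab e0 gC Ld; have k0 : 0 < b - a by rewrite subr_gt0.
pose e' := e / (b - a); have e'0 : 0 < e' by rewrite divr_gt0.
have e'k : e' * (b - a) = e by rewrite divfK// gt_eqF.
pose A : set R := `]a - e, b + e[%classic.
have oA : open A by exact: interval_open.
have BA s : - e' < s < 1 + e' -> A (a + s * (b - a)).
  move=> /andP[s1 s2]; rewrite /A /= in_itv /=.
  have s1' : - e' * (b - a) < s * (b - a) by rewrite ltr_pM2r.
  have s2' : s * (b - a) < (1 + e') * (b - a) by rewrite ltr_pM2r.
  rewrite mulNr e'k in s1'; rewrite mulrDl e'k mul1r in s2'.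
  by apply/andP; split; lra.
exists (fun s => gamma (a + s * (b - a))), e'; split => //.
- apply: (reparam_C1 oA) => // s /=; rewrite in_itv /=; exact: BA.
- by rewrite mul0r addr0.
- by rewrite mul1r addrC subrK.
- have spE s : - e' < s < 1 + e' ->
      speed (fun s => gamma (a + s * (b - a))) s = (b - a) * speed gamma (a + s * (b - a)).
    by move=> /BA As; rewrite (reparam_speed gC As) gtr0_norm.
  have H1 t : 0 - e' < t < 1 + e' -> is_derive t 1 (fun s => L (a + s * (b - a)))
      (speed (fun s => gamma (a + s * (b - a))) t).
    rewrite sub0r => te; rewrite spE//.
    apply: (affine_derive (c := L)); apply: Ld.
    by have := BA t te; rewrite /A /= in_itv.
  have H2 t : 0 - e' < t < 1 + e' ->
      {for t, continuous (speed (fun s => gamma (a + s * (b - a))))}.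
    rewrite sub0r => te.
    apply: (@speed_continuous `]- e', 1 + e'[%classic); first exact: interval_open.
      by apply: (reparam_C1 oA) => // s /=; rewrite in_itv /=; exact: BA.
    by rewrite /= ?in_itv.
  by rewrite (FTC2 ltr01 e'0 H1 H2) mul1r mul0r addr0 [a + _]addrC subrK.
Qed.

Lemma C1_arcP (x y : M) l : C1_arc x y l -> exists gamma (e : R) (L : R -> R),
  [/\ 0 < e, C1_curve_on `]- e, 1 + e[ gamma, gamma 0 = x /\ gamma 1 = y,
    l = L 1 - L 0 & forall t : R, - e < t < 1 + e -> is_derive t 1 L (speed gamma t)].
Proof.
move=> [gamma [e [e0 gC g0 g1 ->]]].
have e2 : 0 < e / 2 by rewrite divr_gt0.
have gsc t : - e < t < 1 + e -> {for t, continuous (speed gamma)}.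
  move=> te; have At : (`]- e, 1 + e[%classic : set R) t by rewrite /= in_itv.
  exact: (speed_continuous (@itv_oo_open _ _) gC At).
have [||L Ld] := @antiderivative _ (speed gamma) (- (e / 2)) (1 + e / 2).
- lra.
- by move=> t /andP[t1 t2]; apply: gsc; apply/andP; split; lra.
exists gamma, (e / 2), L; split => //.
- move=> t /=; rewrite in_itv /= => /andP[t1 t2]; apply: gC.
  by rewrite /= in_itv /=; apply/andP; split; lra.
- have H1 t : 0 - e / 2 < t < 1 + e / 2 -> is_derive t 1 L (speed gamma t).
    by rewrite sub0r; exact: Ld.
  have H2 t : 0 - e / 2 < t < 1 + e / 2 -> {for t, continuous (speed gamma)}.
    by rewrite sub0r => /andP[t1 t2]; apply: gsc; apply/andP; split; lra.
  exact: (FTC2 ltr01 e2 H1 H2).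
Qed.

Lemma C1_arc_sub gamma (e : R) (L : R -> R) : 0 < e ->
  C1_curve_on `]- e, 1 + e[ gamma ->
  (forall t : R, - e < t < 1 + e -> is_derive t 1 L (speed gamma t)) ->
  forall s t, 0 <= s <= t -> t <= 1 ->
    piecewise_C1_arc (gamma s) (gamma t) (L t - L s).
Proof.
move=> e0 gC Ld s t /andP[s0]; rewrite le_eqVlt => /predU1P[->|st] t1.
  by rewrite subrr; exact: piecewise_nil.
rewrite -[L t - L s]addr0; apply: piecewise_cons (piecewise_nil _).
apply: (C1_arc_of st e0) => [u|u /andP[u1 u2]].
  rewrite /= !in_itv /= => /andP[u1 u2]; apply: gC; rewrite /= in_itv /=.
  by apply/andP; split; lra.
by apply: Ld; apply/andP; split; lra.
Qed.

Lemma C1_arc_rev (x y : M) l : C1_arc x y l -> C1_arc y x l.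
Proof.
move=> /C1_arcP [gamma [e [L [e0 gC [<- <-] -> Ld]]]].
pose A : set R := `]- e, 1 + e[%classic.
have oA : open A by exact: interval_open.
have BA s : 0 - e < s < 1 + e -> A (1 + s * (- 1)).
  by move=> /andP[s1 s2]; rewrite /A /= in_itv /=; apply/andP; split; lra.
have := @C1_arc_of (fun s => gamma (1 + s * (- 1))) 0 1 e (fun s => - L (1 + s * (- 1))) ltr01 e0.
rewrite mul1r mul0r addr0 subrr opprK [- L 0 + _]addrC; apply.
  by apply: (reparam_C1 oA) => // s /=; rewrite in_itv; exact: BA.
move=> t te; have At := BA t te.
rewrite (reparam_speed gC At) normrN normr1 mul1r.
have H : is_derive t 1 (fun s => L (1 + s * (- 1))) (- 1 *: speed gamma (1 + t * -1)).
  by apply: (affine_derive (c := L)); apply: Ld; move: At; rewrite /A /= in_itv.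
have := is_deriveN H; rewrite scaleN1r opprK; exact.
Qed.

End ManifoldCurves.

(** * Lengths and distances *)

Lemma ge0_derive_le (R : realType) (f df : R -> R) (a b : R) : a <= b ->
  (forall t, a <= t <= b -> is_derive t 1 f (df t)) ->
  (forall t, a <= t <= b -> 0 <= df t) -> f a <= f b.
Proof.
move=> ab fd f0.
have H0 t : a <= t <= b -> is_derive t (1 : R) (fun=> 0 : R) (0 : R).
  by move=> _; exact: is_derive_cst.
by have := mvt_dom ab H0 fd f0; rewrite subrr subr_ge0.
Qed.

Lemma line_derive (R : realType) (n : nat) (a w : 'rV[R]_n) (s : R) :
  is_derive s 1 (fun s : R => a + s *: w) w.
Proof.
apply/is_derive_eps => ep ep0; exists 1 => // h _.
have -> : h *: 1 + s = h + s by rewrite /GRing.scale /= mulr1.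
have E (k : R) : a + (k + s) *: w - (a + s *: w) - k *: w = 0.
  by apply/rowP => j; rewrite !(rvDE, rvNE, rvZE) [RHS]mxE; ring.
rewrite (E h).
by rewrite normr0 mulr_ge0// ltW.
Qed.

Section Distance.
Context {R : realType} {n : nat} (M : riemannianManifold R n).
Implicit Types (gamma : R -> M) (i j : rm_index M) (t l : R).
Local Notation pw := (@piecewise_C1_arc R n M).

Lemma C1_arc_ge0 (x y : M) l : C1_arc x y l -> 0 <= l.
Proof.
move=> /C1_arcP [gamma [e [L [e0 _ _ -> Ld]]]].
have H (t : R) : 0 <= t <= 1 -> - e < t < 1 + e.
  by move=> /andP[t0 t1]; apply/andP; split; short_lra.
rewrite subr_ge0; apply: (ge0_derive_le ler01 (fun t ht => Ld t (H t ht))) => t _.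
exact: speed_ge0.
Qed.

Lemma pw_ge0 (x y : M) l : pw x y l -> 0 <= l.
Proof.
by elim=> // {}x {}y z {}l l' /C1_arc_ge0 l0 _; exact: addr_ge0.
Qed.

Lemma pw_cat (x y z : M) l l' : pw x y l -> pw y z l' -> pw x z (l + l').
Proof.
move=> H; elim: H l' => [x0 l'|x0 y0 z0 l0 l1 H _ IH l' H']; first by rewrite add0r.
by rewrite -addrA; apply: piecewise_cons H (IH _ H').
Qed.

Lemma pw_rev (x y : M) l : pw x y l -> pw y x l.
Proof.
elim=> [x0|x0 y0 z0 l0 l1 H _ IH]; first exact: piecewise_nil.
rewrite addrC; apply: pw_cat IH _; rewrite -[l0]addr0.
by apply: piecewise_cons (C1_arc_rev H) _; exact: piecewise_nil.
Qed.

Lemma C1_arc_pw (x y : M) l : C1_arc x y l -> pw x y l.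
Proof. by move=> H; rewrite -[l]addr0; apply: piecewise_cons H _; exact: piecewise_nil. Qed.

Lemma rdist_has_lbound (x y : M) : has_lbound [set l | pw x y l].
Proof. by exists 0 => l /=; exact: pw_ge0. Qed.

Lemma rdist_le (x y : M) l : pw x y l -> rdist x y <= l.
Proof. by move=> H; apply: ge_inf => //; exact: rdist_has_lbound. Qed.

Lemma rdist_ge0 (x y : M) : 0 <= rdist x y.
Proof.
have [ne|/set0P/negP/negPn/eqP E] := pselect ([set l | pw x y l] !=set0).
  by apply: lb_le_inf => // l /=; exact: pw_ge0.
by rewrite /rdist E inf0.
Qed.

Lemma rdistxx (x : M) : rdist x x = 0.
Proof.
apply/eqP; rewrite eq_le rdist_ge0 andbT; apply: rdist_le; exact: piecewise_nil.
Qed.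

Lemma rdistC (x y : M) : rdist x y = rdist y x.
Proof.
rewrite /rdist; congr inf; apply/seteqP; split => l /=; exact: pw_rev.
Qed.

(* The length is relaxed from [l] to [l'] so that the parametrization is
   strictly monotone. *)
Lemma C1_arc_select (x y : M) l l' : C1_arc x y l -> l < l' -> exists sigma : R -> M,
  [/\ sigma 0 = x, sigma l' = y & forall s t, 0 <= s <= t -> t <= l' ->
    exists2 m : R, m <= t - s & pw (sigma s) (sigma t) m].
Proof.
move=> /C1_arcP [gamma [e [L [e0 gC [<- <-] -> Ld]]]] ll'.
pose k := l' - (L 1 - L 0); have k0 : 0 < k by rewrite subr_gt0.
pose H t := L t - L 0 + k * t.
have Hd t : - e < t < 1 + e -> is_derive t 1 H (speed gamma t + k).
  move=> te; have Lt := Ld t te; apply: is_derive_eq.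
  by rewrite oppr0 addr0 /GRing.scale /= !mulr1 ?mulr0 ?addr0.
have H0 : H 0 = 0 by rewrite /H subrr mulr0 addr0.
have H1 : H 1 = l' by rewrite /H /k mulr1 addrC subrK.
have in01 (t : R) : 0 <= t <= 1 -> - e < t < 1 + e.
  by move=> /andP[t0 t1]; apply/andP; split; short_lra.
have Hc : {within `[0, 1], continuous H}.
  by apply: within_continuousP => t t01; exact: is_derive_continuous (Hd t (in01 t t01)).
have Hmono (s t : R) : 0 <= s -> s <= t -> t <= 1 ->
    L t - L s + k * (t - s) = H t - H s by move=> *; rewrite /H; ring.
have Lmono (s t : R) : 0 <= s -> s <= t -> t <= 1 -> 0 <= L t - L s.
  move=> s0 st t1; rewrite subr_ge0.
  have Hs u : s <= u <= t -> is_derive u 1 L (speed gamma u).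
    by move=> /andP[u0 u1]; apply: Ld; apply: in01; rewrite (le_trans s0 u0) (le_trans u1 t1).
  by apply: (ge0_derive_le st Hs) => u _; exact: speed_ge0.
have L01 := Lmono 0 1 (lexx _) ler01 (lexx _).
have l'0 : 0 < l' by rewrite /k in k0; short_lra.
have /choice [tau tauP] : forall s, exists t, 0 <= s <= l' -> 0 <= t <= 1 /\ H t = s.
  move=> s; have [sl|ns] := boolP (0 <= s <= l'); last by exists 0.
  have [|t] := @IVT _ H 0 1 s ler01 Hc.
    by rewrite H0 H1 (min_idPl (ltW l'0)) (max_idPr (ltW l'0)).
  by rewrite in_itv /= => t01 Ht; exists t.
have tmono (s t : R) : 0 <= s <= t -> t <= l' -> tau s <= tau t.
  move=> /andP[s0 st] tl.
  have [/andP[a0 a1] Ha] := tauP s (introT andP (conj s0 (le_trans st tl))).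
  have [/andP[b0 b1] Hb] := tauP t (introT andP (conj (le_trans s0 st) tl)).
  rewrite leNgt; apply/negP => ba.
  have := Hmono _ _ b0 (ltW ba) a1; have := Lmono _ _ b0 (ltW ba) a1.
  have : 0 < k * (tau s - tau t) by rewrite mulr_gt0// subr_gt0.
  rewrite Ha Hb; short_lra.
have t0 : tau 0 = 0.
  have [/andP[a0 a1] Ha] := tauP 0 (introT andP (conj (lexx _) (ltW l'0))).
  have := Hmono _ _ (lexx _) a0 a1; have := Lmono _ _ (lexx _) a0 a1.
  have : 0 <= k * (tau 0 - 0) by rewrite mulr_ge0 ?subr_ge0// ltW.
  rewrite Ha H0 subr0 => h1 h2 h3.
  have /eqP : k * tau 0 = 0 by short_lra.
  by rewrite mulf_eq0 gt_eqF//= => /eqP.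
have t1 : tau l' = 1.
  have [/andP[a0 a1] Ha] := tauP l' (introT andP (conj (ltW l'0) (lexx _))).
  have := Hmono _ _ a0 a1 (lexx _); have := Lmono _ _ a0 a1 (lexx _).
  have : 0 <= k * (1 - tau l') by rewrite mulr_ge0 ?subr_ge0// ltW.
  rewrite Ha H1 subrr => h1 h2 h3.
  have /eqP : k * (1 - tau l') = 0 by short_lra.
  by rewrite mulf_eq0 gt_eqF//= subr_eq0 => /eqP.
exists (gamma \o tau); rewrite /= t0 t1; split => // s t st tl.
have /andP[s0 st'] := st; have tm := tmono s t st tl.
have [/andP[a0 a1] Ha] := tauP s (introT andP (conj s0 (le_trans st' tl))).
have [/andP[b0 b1] Hb] := tauP t (introT andP (conj (le_trans s0 st') tl)).
exists (L (tau t) - L (tau s)); last first.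
  by apply: (C1_arc_sub e0 gC Ld); rewrite ?a0.
have := Hmono _ _ a0 tm b1; rewrite Ha Hb => <-.
by rewrite lerDl mulr_ge0 ?subr_ge0// ltW.
Qed.

Lemma pw_select (x y : M) l l' : pw x y l -> l < l' -> exists sigma : R -> M,
  [/\ sigma 0 = x, sigma l' = y & forall s t, 0 <= s <= t -> t <= l' ->
    exists2 m : R, m <= t - s & pw (sigma s) (sigma t) m].
Proof.
move=> H; elim: H l' => {x y l} [x l' l0|x y z l1 l2 H H2 IH l' ll].
  exists (fun=> x); split => // s t /andP[_ st] _.
  by exists 0; [rewrite subr_ge0|exact: piecewise_nil].
pose k := (l' - (l1 + l2)) / 2; have k0 : 0 < k by rewrite divr_gt0// subr_gt0.
have lk : l1 < l1 + k by rewrite ltrDl.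
have [s1 [s10 s1l H1]] := C1_arc_select H lk.
have [|s2 [s20 s2l {}H2']] := IH (l2 + k); first by rewrite ltrDl.
have l10 := C1_arc_ge0 H; have l20 := pw_ge0 H2.
pose m := l1 + k; have m0 : 0 < m by rewrite /m; short_lra.
have E : l' = m + (l2 + k) by rewrite /m /k; field.
exists (fun t => if t <= m then s1 t else s2 (t - m)); split => [||s t /andP[s0 st] tl].
- by rewrite ltW.
- rewrite E ifF; last by apply/negbTE; rewrite -ltNge; short_lra.
  by rewrite addrC addKr.
case: (leP t m) => tm; case: (leP s m) => sm.
- by apply: H1 => //; rewrite s0.
- by exfalso; short_lra.
- have [|a a1 A] := H1 s m _ (lexx _); first by rewrite s0.
  have [||b b1 B] := H2' 0 (t - m); [by rewrite lexx /=; short_lra|by short_lra|].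
  exists (a + b); first by short_lra.
  by apply: pw_cat A _; rewrite s1l -s20.
- by have [||b b1 B] := H2' (s - m) (t - m); [by apply/andP; split; short_lra|by short_lra|exists b => //; short_lra].
Qed.

(** [mvt_dom] compares a primitive of the speed with a primitive of any pointwise bound [f]. This is
    the source of all upper bounds on distances. *)
Lemma chart_curve_length i (c : R -> 'rV[R]_n) (a b e : R) (F f : R -> R) : a < b -> 0 < e ->
  (forall t, a - e < t < b + e -> [/\ chart_codom (atlas i) (c t), derivable c t 1 &
     {for t, continuous c^`()}]) ->
  (forall t, a <= t <= b -> is_derive t 1 F (f t)) ->
  (forall t, a <= t <= b ->
    Num.sqrt (cinner i (c t) (derive1 c t) (derive1 c t)) <= f t) ->
  exists2 l : R, l <= F b - F a & pw (chart_inv (atlas i) (c a)) (chart_inv (atlas i) (c b)) l.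
Proof.
move=> ab e0 Hc Fd cf.
pose gamma := chart_inv (atlas i) \o c.
have gC : C1_curve_on `]a - e, b + e[ gamma.
  apply: chart_curve_C1; first exact: itv_oo_open.
  by move=> t /=; rewrite in_itv /=; exact: Hc.
have spE t : a - e < t < b + e ->
    speed gamma t = Num.sqrt (cinner i (c t) (derive1 c t) (derive1 c t)).
  move=> te; have [Ct cd dc] := Hc t te.
  have [|gc _] := gC t; first by rewrite /= in_itv.
  have N : \forall s \near t, a - e < s < b + e by exact: itv_oo_near.
  have E : {near t, c =1 coord_curve i gamma}.
    apply: filterS N => s se; have [Cs _ _] := Hc s se.
    by rewrite /coord_curve /gamma /= chart_invK.
  have D : is_derive t 1 (coord_curve i gamma) (derive1 c t).
    exact: near_eq_is_derive (derivable_is_derive cd).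
  rewrite (speed_chart gc _ D); last exact: chart_inv_dom.
  by rewrite /coord_curve /gamma /= chart_invK.
have [||L Ld] := @antiderivative _ (speed gamma) (a - e / 2) (b + e / 2).
- short_lra.
- move=> t /andP[t1 t2]; have At : (`]a - e, b + e[%classic : set R) t.
    by rewrite /= in_itv /=; apply/andP; split; short_lra.
  exact: (speed_continuous (@itv_oo_open _ _ _) gC At).
exists (L b - L a).
- have H1 t : a <= t <= b -> is_derive t 1 L (speed gamma t).
    by move=> /andP[t1 t2]; apply: Ld; apply/andP; split; short_lra.
  have H2 t : a <= t <= b -> speed gamma t <= f t.
    move=> tab; rewrite spE; first exact: cf.
    by case/andP: tab => *; apply/andP; split; short_lra.
  exact: (mvt_dom (ltW ab) H1 Fd H2).
- have e2 : 0 < e / 2 by rewrite divr_gt0.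
  have gC' : C1_curve_on `]a - e / 2, b + e / 2[ gamma.
    move=> t; rewrite /= in_itv /= => /andP[t1 t2]; apply: gC.
    by rewrite /= in_itv /=; apply/andP; split; short_lra.
  exact: C1_arc_pw (C1_arc_of ab e2 gC' Ld).
Qed.

(** * Calibration and confinement inside a coordinate ball *)

Section Calibration.
Variables (i : rm_index M) (u0 : 'rV[R]_n) (r lam C : R).
Hypothesis mb : metric_ball (metric i) (chart_codom (atlas i)) u0 r lam C.
Local Notation mu := (Num.sqrt lam).
Local Notation phi := (atlas i).

Let lam0 : 0 < lam := mb_lam mb.
Let mu0 : 0 < mu. Proof. by rewrite sqrtr_gt0. Qed.

Lemma mu_norm_le (x v : 'rV[R]_n) : `|x - u0| <= r ->
  mu * `|v| <= Num.sqrt (cinner i x v v).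
Proof.
move=> xr; have H := mb_pos mb v xr.
have -> : mu * `|v| = Num.sqrt (lam * `|v| ^+ 2).
  by rewrite sqrtrM ?(ltW lam0)// sqrtr_sqr normr_id.
by rewrite ler_sqrt// (le_trans _ H)// mulr_ge0 ?exprn_ge0// ltW.
Qed.

Lemma chart_ball_compact (rho : R) : rho <= r ->
  compact [set x : M | chart_dom phi x /\ `|phi x - u0| <= rho].
Proof.
move=> rr; pose K := [set u : 'rV[R]_n | `|u - u0| <= rho].
have Kc : compact K.
  apply: bounded_closed_compact.
    exists (`|u0| + rho); split; first by rewrite num_real.
    move=> m mm u /= Ku; apply: le_trans (ltW mm).
    rewrite -(subrK u0 u) addrC; apply: le_trans (ler_normD _ _) _.
    by rewrite lerD2l.
  have -> : K = closed_ball_ (@Num.norm _ _) u0 rho.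
    by apply/seteqP; split => u; rewrite /K /closed_ball_ /= distrC.
  exact: closed_closed_ball_.
have KD u : K u -> chart_codom phi u by move=> Ku; apply: (mb_dom mb); exact: le_trans Ku rr.
have -> : [set x : M | chart_dom phi x /\ `|phi x - u0| <= rho] = chart_inv phi @` K.
  apply/seteqP; split => [x [Dx xr]|x [u Ku <-]].
    by exists (phi x) => //; rewrite chart_funK.
  split; first by apply: chart_inv_dom; exact: KD.
  by rewrite chart_invK//; exact: KD.
apply: continuous_compact => //.
apply: continuous_in_subspaceT => u; rewrite inE => /KD.
exact: chart_inv_continuous.
Qed.

(** Closed in the whole manifold and not only in the chart domain; this prevents an arc from
    escaping the chart at a limit time. *)
Lemma chart_ball_closed (rho : R) : rho <= r ->
  closed [set x : M | chart_dom phi x /\ `|phi x - u0| <= rho].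
Proof.
move=> rr; apply: compact_closed; first exact: rm_hausdorff.
exact: chart_ball_compact.
Qed.

(** Where the differential of [F] has norm at most [K], [F] changes by at most [K] times the length.
    Coordinates have differentials of norm at most [1 / mu], so under the assumption on [l / mu] an
    arc of length [l] from [x] cannot reach the edge of the coordinate ball. This confinement and
    the estimate support each other in a real induction. *)
Lemma calibration_arc (F : 'rV[R]_n -> R) (dF : 'rV[R]_n -> 'rV[R]_n -> R) (K : R)
    (x y : M) l :
  (forall (c : R -> 'rV[R]_n) t v, `|c t - u0| <= r -> is_derive t 1 c v ->
     is_derive t 1 (F \o c) (dF (c t) v)) ->
  (forall z v, `|z - u0| <= r -> `|dF z v| <= K * Num.sqrt (cinner i z v v)) ->
  chart_dom phi x -> `|phi x - u0| + l / mu < r -> C1_arc x y l ->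
  [/\ chart_dom phi y, `|phi y - phi x| <= l / mu & `|F (phi y) - F (phi x)| <= K * l].
Proof.
move=> Fd FK Dx xr /C1_arcP [gamma [e [L [e0 gC [g0 g1] lE Ld]]]].
have in01 (t : R) : 0 <= t <= 1 -> - e < t < 1 + e.
  by move=> /andP[t0 t1]; apply/andP; split; short_lra.
have gCt (t : R) : 0 <= t <= 1 -> {for t, continuous gamma} /\
    forall i, chart_dom (atlas i) (gamma t) ->
    derivable (coord_curve i gamma) t 1 /\
    {for t, continuous (coord_curve i gamma)^`()}.
  by move=> /in01 te; apply: gC; rewrite /= in_itv.
have Lmono (s t : R) : 0 <= s -> s <= t -> t <= 1 -> L s <= L t.
  move=> s0 st t1.
  have Hs u : s <= u <= t -> is_derive u 1 L (speed gamma u).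
    by move=> /andP[u0' u1]; apply: Ld; apply: in01; rewrite (le_trans s0 u0') (le_trans u1 t1).
  by apply: (ge0_derive_le st Hs) => u _; exact: speed_ge0.
pose rho := `|phi x - u0| + l / mu.
pose P t := chart_dom phi (gamma t) /\ `|phi (gamma t) - u0| <= rho.
have est (t : R) : 0 <= t <= 1 -> (forall s : R, 0 <= s <= t -> chart_dom phi (gamma s) /\
      `|phi (gamma s) - u0| <= r) ->
    `|phi (gamma t) - phi x| <= (L t - L 0) / mu /\
    `|F (phi (gamma t)) - F (phi x)| <= K * (L t - L 0).
  move=> /andP[t0 t1] Ht.
  pose c := coord_curve i gamma.
  have cd (s : R) : 0 <= s <= t -> is_derive s 1 c (derive1 c s).
    move=> st; have [Ds _] := Ht s st; have [|_ H] := gCt s.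
      by case/andP: st => -> st; rewrite (le_trans st t1).
    exact: (derivable_is_derive (proj1 (H i Ds))).
  have sp (s : R) : 0 <= s <= t -> speed gamma s = Num.sqrt (cinner i (c s) (derive1 c s) (derive1 c s)).
    move=> st; have [Ds _] := Ht s st.
    have [|gc _] := gCt s; first by case/andP: st => -> st; rewrite (le_trans st t1).
    exact: speed_chart gc Ds (cd s st).
  have Ls (s : R) : 0 <= s <= t -> is_derive s 1 L (speed gamma s).
    by move=> /andP[s0 st]; apply: Ld; apply: in01; rewrite s0 (le_trans st t1).
  have key (k : R) (f df : R -> R) : (forall s : R, 0 <= s <= t -> is_derive s 1 f (df s)) ->
      (forall s : R, 0 <= s <= t -> `|df s| <= k * speed gamma s) ->
      `|f t - f 0| <= k * (L t - L 0).
    move=> fd fk.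
    have H1 (s : R) : 0 <= s <= t -> is_derive s 1 (k *: L) (k *: speed gamma s).
      by move=> st; have H := Ls s st; exact: is_deriveZ.
    have H2 (s : R) : 0 <= s <= t -> is_derive s 1 (- f) (- df s).
      by move=> st; have H := fd s st; exact: is_deriveN.
    have h3 (s : R) : 0 <= s <= t -> df s <= k *: speed gamma s.
      by move=> /fk; apply: le_trans; exact: ler_norm.
    have h4 (s : R) : 0 <= s <= t -> - df s <= k *: speed gamma s.
      by move=> /fk; apply: le_trans; rewrite -normrN; exact: ler_norm.
    have := mvt_dom t0 fd H1 h3; have := mvt_dom t0 H2 H1 h4.
    rewrite !fctE /GRing.scale /= => a1 a2; rewrite ler_norml mulrBr; apply/andP; split; short_lra.
  split.
    rewrite -g0; apply: norm_le_coord => [|k].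
      by rewrite mulr_ge0 ?invr_ge0 ?(ltW mu0)// subr_ge0; exact: Lmono.
    rewrite rvBE mulrC; apply: (key _ (fun s => c s 0 k) (fun s => derive1 c s 0 k)).
      by move=> s st; have /is_derive_rV := cd s st; exact.
    move=> s st; rewrite ler_pdivlMl// sp//; have [_ sr] := Ht s st.
    apply: le_trans (mu_norm_le _ sr).
    by rewrite ler_wpM2l ?(ltW mu0)//; exact: coord_le_norm.
  rewrite -g0; apply: (key _ (F \o c) (fun s => dF (c s) (derive1 c s))).
    by move=> s st; apply: Fd; [have [] := Ht s st|exact: cd].
  by move=> s st; rewrite sp//; apply: FK; have [] := Ht s st.
have rho_r : rho < r := xr.
have lT (t : R) : 0 <= t <= 1 -> (L t - L 0) / mu <= l / mu.
  move=> /andP[t0 t1]; rewrite ler_wpM2r ?invr_ge0 ?(ltW mu0)// lE lerB//.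
  exact: Lmono.
have l0 : 0 <= l by rewrite lE subr_ge0; exact: Lmono.
have all : forall t : R, 0 <= t <= 1 -> P t.
  apply: (real_induction ler01).
  - rewrite /P g0; split => //; rewrite lerDl mulr_ge0 ?invr_ge0// ltW//.
  - move=> t /andP[t0 t1] Hs.
    have gc : {for t, continuous gamma} by have [] := gCt t; rewrite ?(ltW t0).
    have clP := chart_ball_closed (ltW rho_r).
    apply: clP => B nB; have /nbhs_ballP [d d0 Hd] : nbhs t (gamma @^-1` B) := gc B nB.
    pose s : R := Num.max 0 (t - d / 2).
    have st : 0 <= s < t.
      by rewrite le_max lexx gt_max t0 /= ltrBlDr ltrDl divr_gt0.
    exists (gamma s); split; first exact: Hs.
    apply: Hd; rewrite -ball_normE /= ltr_norml.
    have : t - d / 2 <= s by rewrite le_max lexx orbT.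
    have d2 : 0 < d by [].
    by case/andP: st => s0 s1 s2; apply/andP; split; short_lra.
  - move=> t /andP[t0 t1] Pt.
    have [Dt rt] : P t by apply: Pt; rewrite t0 lexx.
    have [gc H] : {for t, continuous gamma} /\ _ := gCt t (introT andP (conj t0 (ltW t1))).
    have cc : {for t, continuous (coord_curve i gamma)}.
      exact: is_derive_rV_continuous (derivable_is_derive (proj1 (H i Dt))).
    have /continuous_eps /(_ (r - rho)) := cc; rewrite subr_gt0 => /(_ rho_r) [d1 d10 H1].
    have N : \forall s \near t, chart_dom phi (gamma s).
      by apply: gc; apply: open_nbhs_nbhs; split=> //; exact: chart_dom_open.
    have /nbhs_ballP [d2 d20 H2] := N.
    pose d : R := Num.min (d1 / 2) (d2 / 2).
    have d0 : 0 < d by rewrite lt_min !divr_gt0.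
    exists d => // s /andP[ts sd] s1.
    have dd1 : d <= d1 / 2 by rewrite ge_min lexx.
    have dd2 : d <= d2 / 2 by rewrite ge_min lexx orbT.
    have d20' : 0 < d2 by [].
    have good (s' : R) : 0 <= s' <= s -> chart_dom phi (gamma s') /\ `|phi (gamma s') - u0| <= r.
      move=> /andP[s'0 s's]; have [s't|ts'] := leP s' t.
        have [|Ds' rs'] := Pt s'; first by rewrite s'0.
        by split => //; exact: le_trans rs' (ltW rho_r).
      split.
        apply: H2; rewrite -ball_normE /= ltr_norml; apply/andP; split; short_lra.
      have H3 : `|coord_curve i gamma s' - coord_curve i gamma t| <= r - rho.
        by apply: H1; rewrite ltr_norml; apply/andP; split; short_lra.
      rewrite -(subrK (phi (gamma t)) (phi (gamma s'))) -addrA.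
      apply: le_trans (ler_normD _ _) _.
      by apply: le_trans (lerD H3 rt) _; rewrite subrK.
    have [Ds _] := good s (introT andP (conj (le_trans t0 ts) (lexx s))).
    split => //.
    have [|H3 _] := est s _ good; first by rewrite (le_trans t0 ts).
    rewrite -(subrK (phi x) (phi (gamma s))) -addrA addrC.
    apply: le_trans (ler_normD _ _) _; rewrite /rho lerD2l.
    by apply: le_trans H3 (lT s _); rewrite (le_trans t0 ts).
have [Dy _] := all 1 (introT andP (conj ler01 (lexx _))).
have [||H1 H2] := est 1; first by rewrite ler01 lexx.
  by move=> s /all [Ds rs]; split => //; exact: le_trans rs (ltW rho_r).
by rewrite g1 -lE in Dy H1 H2.
Qed.

Lemma calibration (F : 'rV[R]_n -> R) (dF : 'rV[R]_n -> 'rV[R]_n -> R) (K : R)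
    (x y : M) l :
  (forall (c : R -> 'rV[R]_n) t v, `|c t - u0| <= r -> is_derive t 1 c v ->
     is_derive t 1 (F \o c) (dF (c t) v)) ->
  (forall z v, `|z - u0| <= r -> `|dF z v| <= K * Num.sqrt (cinner i z v v)) ->
  chart_dom phi x -> `|phi x - u0| + l / mu < r -> pw x y l ->
  [/\ chart_dom phi y, `|phi y - phi x| <= l / mu & `|F (phi y) - F (phi x)| <= K * l].
Proof.
move=> Fd FK + + H; elim: H => {x y l} [x Dx xr|x y z l l' H H' IH Dx xr].
  by rewrite !subrr !normr0 mul0r mulr0.
have l'0 := pw_ge0 H'.
have xr' : `|phi x - u0| + l / mu < r.
  apply: le_lt_trans xr; rewrite lerD2l ler_wpM2r ?invr_ge0 ?(ltW mu0)//.
  by rewrite lerDl.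
have [Dy H1 H2] := calibration_arc Fd FK Dx xr' H.
have yr : `|phi y - u0| + l' / mu < r.
  apply: le_lt_trans xr; rewrite mulrDl addrA lerD2r.
  rewrite -(subrK (phi x) (phi y)) -addrA addrC.
  by apply: le_trans (ler_normD _ _) _; rewrite lerD2l.
have [Dz H3 H4] := IH Dy yr; split => //.
  by apply: le_trans (ler_distD (phi y) _ _) _; rewrite mulrDl addrC lerD.
by apply: le_trans (ler_distD (F (phi y)) _ _) _; rewrite mulrDr addrC lerD.
Qed.

Lemma rdist_chart_near (x y : M) l :
  chart_dom phi x -> `|phi x - u0| + l / mu < r -> pw x y l ->
  chart_dom phi y /\ `|phi y - phi x| <= l / mu.
Proof.
move=> Dx xr H.
have F0 (c : R -> 'rV[R]_n) t v : `|c t - u0| <= r -> is_derive t 1 c v ->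
    is_derive t 1 ((fun=> 0) \o c) (0 : R).
  by move=> _ _; exact: is_derive_cst.
have K0 (z v : 'rV[R]_n) : `|z - u0| <= r -> `|0 : R| <= 0 * Num.sqrt (cinner i z v v).
  by move=> _; rewrite normr0 mul0r.
by have [] := @calibration (fun=> 0) (fun _ _ => 0) 0 x y l F0 K0 Dx xr H.
Qed.

Lemma segment_extend (a b : 'rV[R]_n) : `|a - u0| < r -> `|b - u0| < r ->
  exists2 e : R, 0 < e & forall s : R, 0 - e < s < 1 + e -> `|a + s *: (b - a) - u0| <= r.
Proof.
move=> ar br; pose w := b - a.
pose m := r - Num.max `|a - u0| `|b - u0|.
have m0 : 0 < m by rewrite subr_gt0 gt_max ar br.
have w0 : 0 < `|w| + 1 by rewrite ltr_wpDl.
pose e := m / (`|w| + 1); have e0 : 0 < e by rewrite divr_gt0.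
exists e => // s /andP[s1 s2].
(* [t] is the closest parameter on the segment proper; the excess [s - t] moves the point by at most
   the margin [m]. *)
pose t : R := Num.max 0 (Num.min s 1).
have t01 : 0 <= t <= 1 by rewrite le_max lexx ge_max ler01 ge_min lexx orbT.
have ts : `|s - t| <= e.
  rewrite /t; case: (leP s 1) => s1'.
    by case: (leP 0 s) => s0; rewrite ?subrr ?normr0 ?(ltW e0)// ler_norml; short_lra.
  by rewrite (max_idPr ler01) ler_norml; short_lra.
have -> : a + s *: (b - a) - u0 = (s - t) *: w + ((1 - t) *: (a - u0) + t *: (b - u0)).
  apply/rowP => k; rewrite /w !(rvDE, rvNE, rvZE); ring.
apply: le_trans (ler_normD _ _) _; rewrite normrZ.
have H1 : `|s - t| * `|w| <= m.
  apply: (@le_trans _ _ (e * (`|w| + 1))); last by rewrite divfK ?gt_eqF.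
  by rewrite ler_pM// lerDl.
apply: le_trans (lerD H1 (ler_normD _ _)) _; rewrite !normrZ.
case/andP: t01 => t0 t1; rewrite (ger0_norm t0) ger0_norm ?subr_ge0//.
have ha : `|a - u0| <= r - m by rewrite /m subKr le_max lexx.
have hb : `|b - u0| <= r - m by rewrite /m subKr le_max lexx orbT.
have : (1 - t) * `|a - u0| <= (1 - t) * (r - m) by rewrite ler_wpM2l ?subr_ge0.
have : t * `|b - u0| <= t * (r - m) by rewrite ler_wpM2l.
rewrite mulrBl mul1r; short_lra.
Qed.

Lemma chart_segment_length (a b : 'rV[R]_n) (F f : R -> R) :
  `|a - u0| < r -> `|b - u0| < r ->
  (forall t : R, 0 <= t <= 1 -> is_derive t 1 F (f t)) ->
  (forall t : R, 0 <= t <= 1 ->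
    Num.sqrt (cinner i (a + t *: (b - a)) (b - a) (b - a)) <= f t) ->
  exists2 l : R, l <= F 1 - F 0 & pw (chart_inv phi a) (chart_inv phi b) l.
Proof.
move=> ar br Fd Ff; have [e e0 cr] := segment_extend ar br.
pose c : R -> 'rV[R]_n := fun s => a + s *: (b - a).
have cd (s : R) : is_derive s 1 c (b - a) := line_derive a (b - a) s.
have H1 t : 0 - e < t < 1 + e -> [/\ chart_codom phi (c t), derivable c t 1 &
     {for t, continuous (derive1 c)}].
  move=> te; split; [exact: (mb_dom mb (cr t te))|by case: (cd t)|].
  rewrite (_ : derive1 c = fun=> b - a); first exact: cvg_cst.
  by apply/funext => s; exact: (derive1_val (cd s)).
have H3 (t : R) : 0 <= t <= 1 -> Num.sqrt (cinner i (c t) (derive1 c t) (derive1 c t)) <= f t.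
  by move=> t01; rewrite (derive1_val (cd t)); exact: Ff.
have [l lF P] := chart_curve_length ltr01 e0 H1 Fd H3.
exists l => //; move: P; rewrite /c scale0r addr0 scale1r addrC subrK //.
Qed.

Lemma linear_derive (k t : R) : is_derive t 1 (fun s : R => s * k) k.
Proof.
apply/is_derive_eps => ep ep0; exists 1 => // h _.
by rewrite /GRing.scale /= mulr1 mulrDl addrK subrr normr0 mulr_ge0// ltW.
Qed.

Lemma rdist_chart_upper (a b : 'rV[R]_n) : `|a - u0| < r -> `|b - u0| < r ->
  exists2 l : R, l <= Num.sqrt C * `|b - a| & pw (chart_inv phi a) (chart_inv phi b) l.
Proof.
move=> ar br; have [e e0 cr] := segment_extend ar br.
have C0 : 0 <= C by apply: le_trans ler01 (mb_C mb).
have Fd (t : R) : 0 <= t <= 1 -> is_derive t 1 (fun s : R => s * (Num.sqrt C * `|b - a|))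
    (Num.sqrt C * `|b - a|).
  by move=> _; exact: linear_derive.
have [|l lF P] := chart_segment_length ar br Fd.
  move=> t /andP[t0 t1].
  have te : 0 - e < t < 1 + e by apply/andP; split; short_lra.
  have H := mb_bound mb (b - a) (b - a) (cr t te).
  have -> : Num.sqrt C * `|b - a| = Num.sqrt (C * `|b - a| ^+ 2).
    by rewrite sqrtrM// sqrtr_sqr normr_id.
  rewrite ler_sqrt ?mulr_ge0 ?exprn_ge0// expr2 mulrA.
  by apply: le_trans H; exact: ler_norm.
by exists l => //; move: lF; rewrite mul1r mul0r subr0.
Qed.

End Calibration.

End Distance.

(** * Minimal paths *)

Lemma ultra_fmap (T U : Type) (f : T -> U) (F : set_system T) :
  UltraFilter F -> UltraFilter (fmap f F).
Proof.
move=> FU; split; first exact: fmap_proper_filter.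
move=> G GF FG; apply/seteqP; split => // A GA.
have [//|FA] := in_ultra_setVsetC (f @^-1` A) FU.
have GnA : G (~` A) by apply: FG.
have G0 : G set0 by rewrite -(setICr A); exact: filterI.
by have := @filter_not_empty _ G GF.
Qed.

Section MetricSpace.
Context {R : realType} {n : nat} (M : riemannianManifold R n).
Hypothesis M_connected : connected [set: M].
Local Notation pw := (@piecewise_C1_arc R n M).
Implicit Types (x y z : M) (i : rm_index M) (l t s e : R) (A : set M).

Local Notation mball i u0 r lam C :=
  (metric_ball (metric i) (chart_codom (atlas i)) u0 r lam C).

Lemma good_chart i x : chart_dom (atlas i) x ->
  exists r lam C, mball i (atlas i x) r lam C.
Proof. by move=> Dx; apply: metric_ball_exists; exact: chart_fun_codom. Qed.

Lemma chart_nbhs i x A : chart_dom (atlas i) x ->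
  (exists2 e : R, 0 < e & forall y, chart_dom (atlas i) y -> `|atlas i y - atlas i x| < e -> A y) ->
  nbhs x A.
Proof.
move=> Dx [e e0 H].
have N1 : \forall y \near x, chart_dom (atlas i) y.
  by apply: open_nbhs_nbhs; split => //; exact: chart_dom_open.
have /cvgrPdist_lt /(_ e e0) N2 := chart_fun_continuous Dx.
near=> y; apply: H; first by near: y.
by rewrite distrC; near: y.
Unshelve. all: by end_near. Qed.

Lemma nbhs_chart i x A : chart_dom (atlas i) x -> nbhs x A ->
  exists2 e : R, 0 < e & forall y, chart_dom (atlas i) y -> `|atlas i y - atlas i x| < e -> A y.
Proof.
move=> Dx nA; have Cx := chart_fun_codom Dx.
have cx := chart_inv_continuous Cx.
have : nbhs (atlas i x) (chart_inv (atlas i) @^-1` A).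
  by apply: cx; rewrite chart_funK.
move=> /nbhs_ballP [e e0 H]; exists e => // y Dy yx.
have : (chart_inv (atlas i) @^-1` A) (atlas i y).
  by apply: H; rewrite -ball_normE /= distrC.
by rewrite /= chart_funK.
Qed.

Lemma pw_near i x : chart_dom (atlas i) x -> exists r K : R, [/\ 0 < r, 0 <= K &
  forall y, chart_dom (atlas i) y -> `|atlas i y - atlas i x| < r ->
  exists2 l : R, l <= K * `|atlas i y - atlas i x| & pw x y l].
Proof.
move=> Dx; have [r [lam [C mb]]] := good_chart Dx.
exists r, (Num.sqrt C); split; [exact: mb_r mb|exact: sqrtr_ge0|].
move=> y Dy yr.
have xr : `|atlas i x - atlas i x| < r by rewrite subrr normr0; exact: mb_r mb.
have [l ll P] := rdist_chart_upper mb xr yr.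
by exists l => //; move: P; rewrite !chart_funK.
Qed.

(** The points reachable from [x] form a set that is open and closed, and the manifold is
    connected. *)
Lemma pw_exists x y : exists l, pw x y l.
Proof.
pose S := [set z | exists l, pw x z l].
suff : S = [set: M] by move=> SE; have : S y by rewrite SE.
apply: M_connected.
- by exists x, 0; exact: piecewise_nil.
- exists S; last by rewrite setTI.
  rewrite openE => z [l xz]; rewrite /interior.
  have Dz := chart_at_dom z; have [r [K [r0 K0 H]]] := pw_near Dz.
  apply: (chart_nbhs Dz); exists r => // w Dw wr.
  by have [l' _ zw] := H w Dw wr; exists (l + l'); exact: pw_cat xz zw.
- exists S; last by rewrite setTI.
  move=> z clz; have Dz := chart_at_dom z; have [r [K [r0 K0 H]]] := pw_near Dz.
  have [w [[l xw] [l' zw]]] : S `&` [set w | exists l, pw z w l] !=set0.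
    apply: clz; apply: (chart_nbhs Dz); exists r => // w Dw wr.
    by have [l' _ zw] := H w Dw wr; exists l'.
  by exists (l + l'); apply: pw_cat xw (pw_rev zw).
Qed.

Lemma rdist_lt x y l : rdist x y < l -> exists2 l' : R, l' < l & pw x y l'.
Proof.
move=> H; have [l0 xy] := pw_exists x y.
by have [l' P ll] := inf_lt (ex_intro _ l0 xy : [set l | pw x y l] !=set0) H; exists l'.
Qed.

Lemma rdist_triangle y x z : rdist x z <= rdist x y + rdist y z.
Proof.
apply/ler_addgt0Pr => e e0.
have e2 : 0 < e / 2 by rewrite divr_gt0.
have [|l ll xy] := @rdist_lt x y (rdist x y + e / 2); first by rewrite ltrDl.
have [|l' ll' yz] := @rdist_lt y z (rdist y z + e / 2); first by rewrite ltrDl.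
apply: le_trans (rdist_le (pw_cat xy yz)) _; lra.
Qed.

Lemma rdist_diff x y z : `|rdist x z - rdist y z| <= rdist x y.
Proof.
have := rdist_triangle y x z; have := rdist_triangle x y z.
rewrite (rdistC y x) ler_norml => *; apply/andP; split; lra.
Qed.

Section Chart.
Variables (i : rm_index M) (u0 : 'rV[R]_n) (r lam C : R).
Hypothesis mb : mball i u0 r lam C.
Local Notation mu := (Num.sqrt lam).
Local Notation phi := (atlas i).

Let mu0 : 0 < mu. Proof. by rewrite sqrtr_gt0; exact: mb_lam mb. Qed.

Lemma exists_longer x y (b : R) : rdist x y < b -> forall e : R, 0 < e ->
  exists l, [/\ pw x y l, l < rdist x y + e & l < b].
Proof.
move=> xb e e0; have [|l ll xy] := @rdist_lt x y (Num.min (rdist x y + e) b).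
  by rewrite lt_min ltrDl e0.
by move: ll; rewrite lt_min => /andP[l1 l2]; exists l.
Qed.

Lemma chart_budget x (d : R) : `|phi x - u0| + d / mu < r ->
  exists2 b : R, d < b & forall l, l < b -> `|phi x - u0| + l / mu < r.
Proof.
move=> H; exists ((r - `|phi x - u0|) * mu).
  by rewrite -ltr_pdivrMr// ltrBrDl.
by move=> l; rewrite -ltr_pdivrMr// ltrBrDl.
Qed.

Lemma rdist_lower x y : chart_dom phi x -> `|phi x - u0| + rdist x y / mu < r ->
  chart_dom phi y /\ mu * `|phi y - phi x| <= rdist x y.
Proof.
move=> Dx /chart_budget [b db Hb].
have [l0 [P0 _ l0b]] := exists_longer db ltr01.
have [Dy _] := rdist_chart_near mb Dx (Hb _ l0b) P0; split => //.
apply/ler_addgt0Pr => e e0; have [l [P le lb]] := exists_longer db e0.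
have [_ H] := rdist_chart_near mb Dx (Hb _ lb) P.
by rewrite mulrC -ler_pdivlMr//; apply: le_trans H _; rewrite ler_wpM2r ?invr_ge0 ?(ltW mu0) ?(ltW le).
Qed.

Lemma rdist_calibration (F : 'rV[R]_n -> R) (dF : 'rV[R]_n -> 'rV[R]_n -> R) (K : R) x y :
  0 <= K ->
  (forall (c : R -> 'rV[R]_n) t v, `|c t - u0| <= r -> is_derive t 1 c v ->
     is_derive t 1 (F \o c) (dF (c t) v)) ->
  (forall z v : 'rV[R]_n, `|z - u0| <= r -> `|dF z v| <= K * Num.sqrt (cinner i z v v)) ->
  chart_dom phi x -> `|phi x - u0| + rdist x y / mu < r ->
  `|F (phi y) - F (phi x)| <= K * rdist x y.
Proof.
move=> K0 Fd FK Dx /chart_budget [b db Hb].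
apply/ler_addgt0Pr => e e0.
have K1 : 0 < K + 1 by rewrite ltr_wpDl.
have [l [P le lb]] := exists_longer db (divr_gt0 e0 K1).
have [_ _ H] := calibration mb Fd FK Dx (Hb _ lb) P.
apply: le_trans H _; apply: (@le_trans _ _ (K * (rdist x y + e / (K + 1)))).
  by rewrite ler_wpM2l// ltW.
rewrite mulrDr lerD2l mulrCA ler_piMr ?(ltW e0)// ler_pdivrMr// mul1r.
by rewrite lerDl.
Qed.

Lemma rdist_upper x y : chart_dom phi x -> chart_dom phi y ->
  `|phi x - u0| < r -> `|phi y - u0| < r ->
  rdist x y <= Num.sqrt C * `|phi y - phi x|.
Proof.
move=> Dx Dy xr yr; have [l ll] := rdist_chart_upper mb xr yr.
by rewrite !chart_funK// => P; apply: le_trans (rdist_le P) ll.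
Qed.

End Chart.

Lemma rdist_eq0 x y : rdist x y = 0 -> x = y.
Proof.
move=> xy; have Dx := chart_at_dom x; have [r [lam [C mb]]] := good_chart Dx.
have [|Dy H] := @rdist_lower _ _ _ _ _ mb x y Dx.
  by rewrite xy mul0r addr0 subrr normr0; exact: mb_r mb.
have mu0 : 0 < Num.sqrt lam by rewrite sqrtr_gt0; exact: mb_lam mb.
move: H; rewrite xy pmulr_rle0// normr_le0 subr_eq0 => /eqP E.
by rewrite -(chart_funK Dx) -(chart_funK Dy) E.
Qed.

(** In a chart the distance is comparable with the coordinate norm, from below by [rdist_lower] and
    from above by [rdist_upper]; hence the given topology is the metric one. *)
Lemma nbhs_rdistP x A : nbhs x A <-> exists2 e : R, 0 < e & forall y, rdist x y < e -> A y.
Proof.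
have Dx := chart_at_dom x; have [r [lam [C mb]]] := good_chart Dx.
have mu0 : 0 < Num.sqrt lam by rewrite sqrtr_gt0; exact: mb_lam mb.
split.
- move=> /(nbhs_chart Dx) [e e0 H].
  exists (Num.sqrt lam * Num.min e r) => [|y].
    by rewrite mulr_gt0// lt_min e0; exact: mb_r mb.
  rewrite mulrC -ltr_pdivrMr// lt_min => /andP[y1 y2].
  have [|Dy yx] := @rdist_lower _ _ _ _ _ mb x y Dx.
    by rewrite subrr normr0 add0r.
  apply: H => //; apply: le_lt_trans y1.
  by rewrite ler_pdivlMr// mulrC.
- move=> [e e0 H]; apply: (chart_nbhs Dx).
  have C0 : 0 < Num.sqrt C + 1 by rewrite ltr_wpDl// sqrtr_ge0.
  exists (Num.min r (e / (Num.sqrt C + 1))) => [|y Dy].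
    by rewrite lt_min (mb_r mb) divr_gt0.
  rewrite lt_min => /andP[y1 y2]; apply: H.
  have := rdist_upper mb Dx Dy _ y1; rewrite subrr normr0 => /(_ (mb_r mb)) /le_lt_trans; apply.
  move: y2; rewrite ltr_pdivlMr// mulrDr mulr1 mulrC; apply: le_lt_trans.
  by rewrite lerDl.
Qed.

Lemma rdist_continuous x : continuous (rdist x).
Proof.
move=> y; apply/cvgrPdist_le => e e0; apply/nbhs_rdistP; exists e => // z yz.
by rewrite (rdistC x y) (rdistC x z); apply: le_trans (rdist_diff _ _ _) (ltW yz).
Qed.

Lemma rdist_select x y l : rdist x y < l -> exists sigma : R -> M,
  [/\ sigma 0 = x, sigma l = y & forall s t, 0 <= s <= l -> 0 <= t <= l ->
     rdist (sigma s) (sigma t) <= `|t - s|].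
Proof.
move=> /rdist_lt [l' ll P]; have [sg [s0 sl H]] := pw_select P ll.
exists sg; split => // s t /andP[s0' s1] /andP[t0 t1].
have [st|/ltW ts] := leP s t.
  have [||m ms Q] := H s t; rewrite ?s0' //.
  by rewrite ger0_norm ?subr_ge0//; exact: le_trans (rdist_le Q) ms.
have [||m ms Q] := H t s; rewrite ?t0 //.
rewrite distrC ger0_norm ?subr_ge0// rdistC; exact: le_trans (rdist_le Q) ms.
Qed.

(** A minimal geodesic parametrized by arc length on [[0, l]], with no smoothness built in; values
    at other times are irrelevant. *)
Definition minimal_path (sigma : R -> M) (l : R) :=
  forall s t, 0 <= s <= l -> 0 <= t <= l -> rdist (sigma s) (sigma t) = `|t - s|.

(** Paths of Lipschitz constant 1 and duration [l + 1 / (N + 1)] have pointwise limits along one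
    fixed ultrafilter of indices, by compactness of [K]. A single ultrafilter serves all times at
    once, in place of an Arzela-Ascoli extraction. The limit is 1-Lipschitz, and the triangle
    inequality between the two ends makes it an isometry. *)
Lemma minimal_path_exists (K : set M) x y : compact K ->
  (forall (sigma : R -> M) l, rdist x y < l -> sigma 0 = x -> sigma l = y ->
    (forall s t, 0 <= s <= l -> 0 <= t <= l -> rdist (sigma s) (sigma t) <= `|t - s|) ->
    forall t : R, 0 <= t <= rdist x y -> K (sigma t)) ->
  exists sigma : R -> M,
    [/\ sigma 0 = x, sigma (rdist x y) = y & minimal_path sigma (rdist x y)].
Proof.
set l := rdist x y => Kc HK.
have l0 : 0 <= l by exact: rdist_ge0.
have /choice [sg Hsg] : forall N : nat, exists sigma : R -> M,
  [/\ sigma 0 = x, sigma (l + N.+1%:R^-1) = y & forall s t,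
    0 <= s <= l + N.+1%:R^-1 -> 0 <= t <= l + N.+1%:R^-1 ->
     rdist (sigma s) (sigma t) <= `|t - s|].
  by move=> N; apply: rdist_select; rewrite ltrDl invr_gt0.
have [F [FU FN]] := @ultraFilterLemma nat \oo _.
have lN (N : nat) t : t <= l -> t <= l + N.+1%:R^-1.
  by move=> tl; apply: le_trans tl _; rewrite lerDl invr_ge0.
have KsgN t N : 0 <= t <= l -> K (sg N t).
  move=> tl; have [a b c] := Hsg N.
  by apply: (HK (sg N) (l + N.+1%:R^-1)) => //; rewrite ltrDl invr_gt0.
have /choice [si Hsi] : forall t, exists z, 0 <= t <= l -> K z /\ (sg^~ t) @ F --> z.
  move=> t; have [tl|] := boolP (0 <= t <= l); last by exists x.
  move: Kc; rewrite compact_ultra => /(_ _ (ultra_fmap (sg^~ t) FU)) [|z [Kz zl]].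
      have S : [set: nat] `<=` (sg^~ t) @^-1` K by move=> N _; exact: KsgN.
    exact: filterS S filterT.
  by exists z.
have conv (t e : R) : 0 <= t <= l -> 0 < e -> \forall N \near F, rdist (si t) (sg N t) < e.
  move=> tl e0; have [_ H] := Hsi t tl.
  have N : nbhs (si t) [set z | rdist (si t) z < e] by apply/nbhs_rdistP; exists e.
  exact: H _ N.
have lip (s t : R) : 0 <= s <= l -> 0 <= t <= l -> rdist (si s) (si t) <= `|t - s|.
  move=> sl tl; apply/ler_addgt0Pr => e e0; have e2 : 0 < e / 2 by rewrite divr_gt0.
  have [N [N1 N2]] := filter_ex (filterI (conv s _ sl e2) (conv t _ tl e2)).
  have [_ _ H] := Hsg N.
  have {}H : rdist (sg N s) (sg N t) <= `|t - s|.
    by case/andP: sl => ? ?; case/andP: tl => ? ?; apply: H; apply/andP; split => //; exact: lN.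
  have := rdist_triangle (sg N s) (si s) (si t).
  have := rdist_triangle (sg N t) (sg N s) (si t); rewrite (rdistC (sg N t) (si t)); lra.
have si0 : si 0 = x.
  apply/esym/rdist_eq0/eqP; rewrite eq_le rdist_ge0 andbT.
  apply/ler_addgt0Pr => e e0; rewrite add0r.
  have [|N N1] := filter_ex (conv 0 e _ e0); first by rewrite lexx.
  by have [E _ _] := Hsg N; rewrite E in N1; rewrite rdistC ltW.
have sil : si l = y.
  apply/rdist_eq0/eqP; rewrite eq_le rdist_ge0 andbT.
  apply/ler_addgt0Pr => e e0; rewrite add0r; have e2 : 0 < e / 2 by rewrite divr_gt0.
  have N2 : F [set N : nat | N.+1%:R^-1 < e / 2].
    by apply: FN; exact: near_infty_natSinv_lt (PosNum e2).
  have [|N [N1 {}N2]] := filter_ex (filterI (conv l _ _ e2) N2); first by rewrite l0 lexx.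
  have [_ E H] := Hsg N.
  have := rdist_triangle (sg N l) (si l) y.
  have : rdist (sg N l) y <= N.+1%:R^-1.
    rewrite -[in X in X <= _]E; apply: le_trans (H _ _ _ _) _.
    + by rewrite l0 lN.
    + by rewrite lexx andbT addr_ge0// invr_ge0.
    + by rewrite addrC addKr ger0_norm// invr_ge0.
  have {}N2 : N.+1%:R^-1 < e / 2 := N2.
  move: N1 N2; set q := N.+1%:R^-1; move: q => q; lra.
exists si; split => //.
have half (s t : R) : 0 <= s <= t -> t <= l -> rdist (si s) (si t) = t - s.
  move=> /andP[s0 st] tl; apply/eqP; rewrite eq_le.
  have s1 : 0 <= s <= l by rewrite s0 (le_trans st).
  have t1 : 0 <= t <= l by rewrite (le_trans s0 st).
  have := lip s t s1 t1; rewrite ger0_norm ?subr_ge0// => ->/=.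
  have := lip 0 s _ s1; rewrite lexx l0 subr0 si0 ger0_norm// => /(_ isT) h1.
  have := lip t l t1; rewrite l0 lexx sil ger0_norm ?subr_ge0// => /(_ isT) h2.
  have := rdist_triangle (si s) x y; have := rdist_triangle (si t) (si s) y; rewrite -/l; lra.
move=> s t sl tl; have [st|/ltW ts] := leP s t.
  case/andP: sl => s0 _; case/andP: tl => _ t1.
  by rewrite half ?s0// ger0_norm ?subr_ge0.
case/andP: sl => _ s1; case/andP: tl => t0 _.
by rewrite rdistC half ?t0// distrC ger0_norm ?subr_ge0.
Qed.

Lemma minimal_path_ball (K : set M) x y : compact K ->
  geodesic_ball x (rdist x y) `<=` K ->
  exists sigma : R -> M,
    [/\ sigma 0 = x, sigma (rdist x y) = y & minimal_path sigma (rdist x y)].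
Proof.
move=> Kc BK; apply: (minimal_path_exists Kc) => sg l xl s0 sl H t /andP[t0 tl].
apply: BK; rewrite /geodesic_ball /= -s0; apply: le_trans (H _ _ _ _) _.
- by rewrite lexx (le_trans (rdist_ge0 x y) (ltW xl)).
- by rewrite t0 (le_trans tl (ltW xl)).
- by rewrite s0 subr0 ger0_norm.
Qed.

End MetricSpace.

(** * Second differences of minimal paths *)

Section Riesz.
Context {R : realType} {n : nat}.

Lemma mx_inner0m (u v : 'rV[R]_n) : mx_inner 0 u v = 0.
Proof. by rewrite /mx_inner mulmx0 mul0mx mxE. Qed.

Lemma mx_inner_parallelogram (G : 'M[R]_n) (u v : 'rV[R]_n) :
  mx_inner G (u + v) (u + v) + mx_inner G (u - v) (u - v) =
  2 * mx_inner G u u + 2 * mx_inner G v v.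
Proof. rewrite !(mx_innerDl, mx_innerDr, mx_innerNl, mx_innerNr); ring. Qed.

Lemma posdef_unitmx (G : 'M[R]_n) (lam : R) : 0 < lam ->
  (forall v, lam * `|v| ^+ 2 <= mx_inner G v v) -> G \in unitmx.
Proof.
move=> lam0 Gp; rewrite -row_free_unit; apply/inj_row_free => v vG.
have := Gp v; rewrite /mx_inner vG mul0mx mxE pmulr_rle0// => H.
by apply/eqP; rewrite -normr_eq0 -[_ == 0](sqrf_eq0 `|v|) eq_le H exprn_ge0.
Qed.

Lemma linear_sum_evec (f : 'rV[R]_n -> R) :
  (forall v w, f (v + w) = f v + f w) -> (forall c v, f (c *: v) = c * f v) ->
  forall w, f w = \sum_k w 0 k * f (evec k).
Proof.
move=> fD fZ w; rewrite {1}(evec_sum w).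
have f0 : f 0 = 0 by rewrite -(scale0r 0) fZ mul0r.
by rewrite (big_morph f fD f0); apply: eq_bigr => k _; rewrite fZ.
Qed.

Lemma riesz (G : 'M[R]_n) (lam : R) (f : 'rV[R]_n -> R) (B : R) : 0 < lam ->
  (forall v, lam * `|v| ^+ 2 <= mx_inner G v v) ->
  (forall v w, f (v + w) = f v + f w) -> (forall c v, f (c *: v) = c * f v) ->
  (forall w, `|f w| <= B * `|w|) -> 0 <= B ->
  exists2 p, (forall w, mx_inner G p w = f w) & `|p| <= B / lam.
Proof.
move=> lam0 Gp fD fZ fB B0; have GU := posdef_unitmx lam0 Gp.
pose p := (\row_k f (evec k)) *m invmx G.
have pE w : mx_inner G p w = f w.
  rewrite /mx_inner /p mulmxKV// mxE [RHS](linear_sum_evec fD fZ).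
  by apply: eq_bigr => k _; rewrite !mxE mulrC.
exists p => //.
have H : lam * `|p| ^+ 2 <= B * `|p|.
  by apply: le_trans (Gp p) _; rewrite pE; apply: le_trans (ler_norm _) (fB p).
have [->|p0] := eqVneq p 0; first by rewrite normr0 divr_ge0// ltW.
have p1 : 0 < `|p| by rewrite normr_gt0.
by rewrite ler_pdivlMr// mulrC -(ler_pM2r p1) -mulrA -expr2.
Qed.

End Riesz.

Lemma sqr_lower_bound (R : realFieldType) (h q s : R) : 0 <= h -> 0 <= q -> 0 <= s ->
  h - q <= s -> h ^+ 2 - 2 * h * q <= s ^+ 2.
Proof.
move=> h0 q0 s0 hs; have [hq|hq] := leP h q.
  apply: (@le_trans _ _ 0); last by rewrite exprn_ge0.
  have : h * h <= h * q by rewrite ler_wpM2l.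
  have : 0 <= h * q by rewrite mulr_ge0.
  rewrite expr2 -mulrA; short_lra.
have : (h - q) ^+ 2 <= s ^+ 2 by rewrite lerXn2r ?nnegrE// subr_ge0 ltW.
have := sqr_ge0 q; rewrite sqrrB; short_lra.
Qed.

Lemma parallelogram_bound (R : realFieldType) (a b y u k e f g : R) : a <= k -> b <= k ->
  k <= e + f -> e - g <= u -> a + b = 2 * y + 2 * u -> y <= f + g.
Proof. short_lra. Qed.

Section SecondDifference.
Context {R : realType} {n : nat} (M : riemannianManifold R n).
Hypothesis M_connected : connected [set: M].
Variables (i : rm_index M).
Variables (u0 : 'rV[R]_n) (r lam C : R).
Hypothesis mb : metric_ball (metric i) (chart_codom (atlas i)) u0 r lam C.
Local Notation g := (metric i).
Local Notation mu := (Num.sqrt lam).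
Local Notation phi := (atlas i).
Implicit Types (m z v w x u : 'rV[R]_n).

Let lam0 : 0 < lam := mb_lam mb.
Let mu0 : 0 < mu. Proof. by rewrite sqrtr_gt0. Qed.
Let C1 : 1 <= C := mb_C mb.
Let C0 : 0 <= C. Proof. exact: le_trans ler01 C1. Qed.

Definition dG m z v w : R := mx_inner (dmetric g m z) v w.

(* The Christoffel symbols of the first kind, as a trilinear form. *)
Definition gam m z v w : R := 2^-1 * (dG m z v w + dG m v z w - dG m w z v).

Lemma dGD m z z' v w : dG m (z + z') v w = dG m z v w + dG m z' v w.
Proof. by rewrite /dG dmetricD mx_innerDm. Qed.

Lemma dGZ m c z v w : dG m (c *: z) v w = c * dG m z v w.
Proof. by rewrite /dG dmetricZ mx_innerZm. Qed.

Lemma gamD m z v w w' : gam m z v (w + w') = gam m z v w + gam m z v w'.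
Proof. by rewrite /gam dGD /dG !mx_innerDr; ring. Qed.

Lemma gamZ m c z v w : gam m z v (c *: w) = c * gam m z v w.
Proof. by rewrite /gam dGZ /dG !mx_innerZr; ring. Qed.

Lemma gamZl m c z w : gam m (c *: z) (c *: z) w = c * (c * gam m z z w).
Proof. by rewrite /gam !dGZ /dG !mx_innerZl !mx_innerZr; ring. Qed.

Lemma dG_sym m z v w : `|m - u0| <= r -> dG m z v w = dG m z w v.
Proof. by move=> mr; rewrite /dG mx_innerC//; exact: (mb_dsym mb). Qed.

Lemma gam_sym m z v w : `|m - u0| <= r -> gam m z v w = gam m v z w.
Proof. by move=> mr; rewrite /gam (dG_sym w z v mr); ring. Qed.

Lemma gam_diag m z v : `|m - u0| <= r -> 2 * gam m z v v = dG m z v v.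
Proof. by move=> mr; rewrite /gam [dG m v z v]dG_sym// mulrA divff// mul1r addrK. Qed.

Lemma gamN m z w : gam m (- z) (- z) w = gam m z z w.
Proof.
rewrite -[- z]scaleN1r /gam !dGZ /dG !mx_innerZl !mx_innerZr; ring.
Qed.

Lemma gam_bound m z v w : `|m - u0| <= r ->
  `|gam m z v w| <= 2 * C * `|z| * `|v| * `|w|.
Proof.
move=> mr; rewrite /gam normrM ger0_norm ?invr_ge0//.
have H1 := mb_dbound mb z v w mr; have H2 := mb_dbound mb v z w mr.
have H3 := mb_dbound mb w z v mr.
have K0 : 0 <= C * `|z| * `|v| * `|w| by rewrite !mulr_ge0.
apply: (@le_trans _ _ (2^-1 * (3 * (C * `|z| * `|v| * `|w|)))); last first.
  rewrite -[leRHS](_ : 2 * (C * `|z| * `|v| * `|w|) = _); last by ring.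
  by set X := C * _ * _ * _ in K0 *; short_lra.
rewrite ler_wpM2l ?invr_ge0//.
apply: le_trans (ler_normB _ _) _.
apply: le_trans (lerD (ler_normD _ _) (lexx _)) _.
apply: le_trans (lerD (lerD H1 H2) H3) _.
by rewrite le_eqVlt; apply/orP; left; apply/eqP; ring.
Qed.

Lemma gam_vector m z v : `|m - u0| <= r -> exists2 p,
  (forall w, mx_inner (g m) p w = gam m z v w) & `|p| <= 2 * C / lam * `|z| * `|v|.
Proof.
move=> mr.
have [||w||p pE pb] := @riesz R n (g m) lam (gam m z v) (2 * C * `|z| * `|v|) lam0 (fun v => mb_pos mb v mr).
- exact: gamD.
- by move=> c w; exact: gamZ.
- exact: gam_bound.
- by rewrite !mulr_ge0.
- exists p => //; apply: le_trans pb _.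
  by rewrite le_eqVlt; apply/orP; left; apply/eqP; ring.
Qed.

Lemma inner_ge0 m w : `|m - u0| <= r -> 0 <= mx_inner (g m) w w.
Proof.
by move=> mr; apply: le_trans (mb_pos mb w mr); rewrite mulr_ge0 ?exprn_ge0// ltW.
Qed.

(** In [dquad_bound], [C] comes from the Taylor remainder of the metric and [4 * C ^+ 2 / lam] from
    the squared norm of the vector representing the Christoffel form; the last division by [lam]
    converts [|v| ^+ 2] into a squared Riemannian norm. *)
Definition distortion : R := (C + 4 * C ^+ 2 / lam) / lam.

Lemma distortion_ge0 : 0 <= distortion.
Proof. by rewrite divr_ge0 ?(ltW lam0)// addr_ge0// divr_ge0 ?(ltW lam0)// mulr_ge0// exprn_ge0. Qed.

(* [z |-> g_m(w, z - m) + gam m (z - m) (z - m) w / 2] has, near [m], gradient of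
   norm at most that of [w] up to a second order factor: its quadratic part kills
   the first derivative of the metric at [m]. *)
Definition quad m w z : R := mx_inner (g m) w (z - m) + 2^-1 * gam m (z - m) (z - m) w.

Definition dquad m w z v : R := mx_inner (g m) w v + gam m (z - m) v w.

(** The bilinear form [gam m _ _ w] as a matrix, so that [is_derive_inner] applies to the quadratic
    part of [quad]. *)
Definition gmat m w : 'M[R]_n := \matrix_(a, b) gam m (evec a) (evec b) w.

Lemma gam_mat m z v w : gam m z v w = mx_inner (gmat m w) z v.
Proof.
rewrite mx_innerE (@linear_sum_evec _ _ (fun z => gam m z v w)); last 2 first.
- by move=> a b; rewrite /gam dGD /dG mx_innerDl mx_innerDl; ring.
- by move=> a b; rewrite /gam dGZ /dG mx_innerZl mx_innerZl; ring.
apply: eq_bigr => a _; rewrite (@linear_sum_evec _ _ (fun v => gam m (evec a) v w)); last 2 first.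
- by move=> x y; rewrite /gam dGD /dG mx_innerDl mx_innerDr; ring.
- by move=> x y; rewrite /gam dGZ /dG mx_innerZl mx_innerZr; ring.
by rewrite mulr_sumr; apply: eq_bigr => b _; rewrite mxE; ring.
Qed.

Lemma quad_derive m w (c : R -> 'rV[R]_n) (t : R) v : `|m - u0| <= r ->
  is_derive t 1 c v -> is_derive t 1 (quad m w \o c) (dquad m w (c t) v).
Proof.
move=> mr cd.
have cmd : is_derive t 1 (fun s => c s - m) v.
  apply/is_derive_eps => e e0; have /is_derive_eps /(_ e e0) [d d0 H] := cd.
  by exists d => // h hd; rewrite opprB addrA subrK; exact: H.
have cst (G : 'M[R]_n) a b : is_derive t (1 : R) (fun=> G a b) ((0 : 'M[R]_n) a b).
  by rewrite mxE; exact: is_derive_cst.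
have wd : is_derive t (1 : R) (fun=> w) (0 : 'rV[R]_n) by exact: is_derive_cst.
have D1 := is_derive_inner (cst (g m)) wd cmd.
have D2 := is_derive_inner (cst (gmat m w)) cmd cmd.
have D3 : is_derive t 1 (fun s => 2^-1 * mx_inner (gmat m w) (c s - m) (c s - m))
   (2^-1 * (gam m (c t - m) v w + gam m (c t - m) v w)).
  have D4 := is_deriveZ 2^-1 D2; apply: is_derive_eq.
  rewrite /GRing.scale /=; congr (_ * _).
  rewrite -!gam_mat (gam_sym v _ _ mr) mx_inner0m add0r //.
rewrite (_ : quad m w \o c = (fun s => mx_inner (g m) w (c s - m)) +
   (fun s => 2^-1 * mx_inner (gmat m w) (c s - m) (c s - m))); last first.
  by apply/funext => s /=; rewrite fctE /quad gam_mat.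
have D5 := is_deriveD D1 D3; apply: is_derive_eq.
rewrite /dquad mx_inner0l mx_inner0m !add0r.
by congr (_ + _); field.
Qed.

(** With [p] representing [gam m (z - m) v], the differential is [g_m(w, v + p)]. The cross term
    [2 g_m(v, p)] equals the derivative of the metric in the direction [z - m], so the squared norm
    of [v + p] at [m] agrees with that of [v] at [z] up to second order. Cauchy-Schwarz at [m]
    concludes. *)
Lemma dquad_bound m w z v : `|m - u0| <= r -> `|z - u0| <= r ->
  `|dquad m w z v| <= (1 + distortion * `|z - m| ^+ 2) *
     Num.sqrt (mx_inner (g m) w w) * Num.sqrt (cinner i z v v).
Proof.
move=> mr zr; have [p pE pb] := gam_vector (z - m) v mr.
set ze := z - m in pE pb *.
have zE : m + ze = z by rewrite /ze addrC subrK.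
have gm := mb_sym mb mr.
have -> : dquad m w z v = mx_inner (g m) w (v + p).
  by rewrite /dquad mx_innerDr [mx_inner (g m) w p]mx_innerC// pE.
set K := 1 + distortion * `|ze| ^+ 2.
have A0 : 0 <= distortion * `|ze| ^+ 2 by rewrite mulr_ge0 ?exprn_ge0// distortion_ge0.
have K1 : 1 <= K by rewrite /K lerDl.
have K0 : 0 <= K by apply: le_trans K1.
have G0 : 0 <= cinner i z v v by exact: inner_ge0.
have W0 : 0 <= mx_inner (g m) w w by exact: inner_ge0.
have key : mx_inner (g m) (v + p) (v + p) <= K * cinner i z v v.
  rewrite mx_innerDl !mx_innerDr [mx_inner (g m) v p]mx_innerC// !pE.
  have T3 := gam_diag ze v mr.
  have := mb_taylor mb (x := m) (h := ze) v v mr; rewrite zE => /(_ zr).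
  rewrite -/(dG m ze v v) -/(cinner i z v v) ler_norml => /andP[T1 _].
  have T4 : gam m ze v p <= 4 * C ^+ 2 / lam * `|ze| ^+ 2 * `|v| ^+ 2.
    apply: le_trans (ler_norm _) _; apply: le_trans (gam_bound _ _ _ mr) _.
    apply: (@le_trans _ _ (2 * C * `|ze| * `|v| * (2 * C / lam * `|ze| * `|v|))).
      by rewrite ler_wpM2l// !mulr_ge0.
    by rewrite le_eqVlt; apply/orP; left; apply/eqP; ring.
  have T5 := mb_pos mb v zr; rewrite -/(cinner i z v v) in T5.
  have T6 : distortion * `|ze| ^+ 2 * (lam * `|v| ^+ 2) <= distortion * `|ze| ^+ 2 * cinner i z v v.
    by rewrite ler_wpM2l.
  have T7 : distortion * `|ze| ^+ 2 * (lam * `|v| ^+ 2) =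
      C * `|ze| ^+ 2 * `|v| * `|v| + 4 * C ^+ 2 / lam * `|ze| ^+ 2 * `|v| ^+ 2.
    by rewrite /distortion; field; rewrite gt_eqF.
  rewrite /K mulrDl mul1r.
  move: T1 T3 T4 T6 T7; set a1 := C * _ * _ * _; set a2 := 4 * _ / _ * _ * _.
  set a3 := distortion * _ * _; set a4 := distortion * _ * _; short_lra.
have CS := mx_inner_cauchy w (v + p) gm (fun w => inner_ge0 w mr).
have H : mx_inner (g m) w (v + p) ^+ 2 <= K ^+ 2 * mx_inner (g m) w w * cinner i z v v.
  apply: le_trans CS _; apply: (@le_trans _ _ (mx_inner (g m) w w * (K * cinner i z v v))).
    by rewrite ler_wpM2l.
  have -> : K ^+ 2 * mx_inner (g m) w w * cinner i z v v =
      mx_inner (g m) w w * (K * (K * cinner i z v v)) by ring.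
  by rewrite ler_wpM2l// ler_wpM2l// ler_peMl.
rewrite -sqrtr_sqr.
have -> : K * Num.sqrt (mx_inner (g m) w w) * Num.sqrt (cinner i z v v) =
    Num.sqrt (K ^+ 2 * mx_inner (g m) w w * cinner i z v v).
  by rewrite sqrtrM ?mulr_ge0 ?exprn_ge0// [X in _ = X * _]sqrtrM ?exprn_ge0// sqrtr_sqr ger0_norm.
by rewrite ler_sqrt// !mulr_ge0// exprn_ge0.
Qed.

Lemma quad_rdist m w (x y : M) (eta : R) : 0 < eta -> `|m - u0| + eta <= r ->
  chart_dom phi x -> `|phi x - m| + rdist x y / mu < eta ->
  `|quad m w (phi y) - quad m w (phi x)| <=
    (1 + distortion * eta ^+ 2) * Num.sqrt (mx_inner (g m) w w) * rdist x y.
Proof.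
move=> eta0 mr Dx xy.
have mr0 : `|m - u0| <= r by short_lra.
have mb' := metric_ball_sub mb eta0 mr.
have sub z : `|z - m| <= eta -> `|z - u0| <= r.
  by move=> zm; apply: le_trans (ler_distD m _ _) _; short_lra.
apply: (rdist_calibration M_connected mb' (dF := dquad m w) _ _ _ Dx xy).
- by rewrite mulr_ge0 ?sqrtr_ge0// addr_ge0// mulr_ge0 ?distortion_ge0// exprn_ge0// ltW.
- by move=> c t v _ cd; exact: quad_derive.
- move=> z v zm; apply: le_trans (dquad_bound _ _ mr0 (sub z zm)) _.
  rewrite ler_wpM2r ?sqrtr_ge0// ler_wpM2r ?sqrtr_ge0// lerD2l.
  rewrite ler_wpM2l ?distortion_ge0// lerXn2r// ?nnegrE// ltW//.
Qed.

(** Along the segment the squared speed is, up to a factor 4, [g_m(u, u)] plus a term odd about the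
    midpoint plus a remainder of order [|u| ^+ 4]. The arithmetic-geometric mean inequality removes
    the square root before integration; the odd term then integrates to 0, and the remainder becomes
    cubic after division by the norm of [u]. *)
Lemma segment_upper m u : `|m - u - u0| < r -> `|m + u - u0| < r -> `|m - u0| <= r -> u != 0 ->
  rdist (chart_inv phi (m - u)) (chart_inv phi (m + u)) <=
    2 * Num.sqrt (mx_inner (g m) u u) + C / mu * `|u| ^+ 3.
Proof.
move=> ur1 ur2 mr u0'.
have un : 0 < `|u| by rewrite normr_gt0.
set N : R := Num.sqrt (mx_inner (g m) u u).
have gu0 := inner_ge0 u mr.
have Nmu : mu * `|u| <= N by exact: (mu_norm_le mb).
have N0 : 0 < N by apply: lt_le_trans Nmu; rewrite mulr_gt0.
have N2 : N ^+ 2 = mx_inner (g m) u u by rewrite sqr_sqrtr.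
pose al := dG m u u u; pose be := C * `|u| ^+ 4.
pose f (t : R) : R := 2 * N + ((2 * t - 1) * al + be) / N.
pose F (t : R) : R := 2 * N * t + ((t ^+ 2 - t) * al + be * t) / N.
have Fd (t : R) : 0 <= t <= 1 -> is_derive t 1 F (f t).
  move=> _; rewrite /F /f; apply: is_derive_eq.
  rewrite /GRing.scale /=; field; rewrite gt_eqF//.
have [|l lF P] := chart_segment_length mb ur1 ur2 Fd.
  move=> t /andP[t0 t1].
  pose s := 2 * t - 1.
  have E : m + u - (m - u) = 2 *: u by rewrite opprB addrC addrA subrK -mulr2n scaler_nat.
  rewrite E.
  have E2 : m - u + t *: (2 *: u) = m + s *: u.
    by rewrite scalerA /s scalerBl scale1r [t * 2]mulrC addrAC addrA.
  rewrite E2 /cinner mx_innerZl mx_innerZr.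
  have sr : `|m + s *: u - u0| <= r.
    have -> : m + s *: u - u0 = (1 - t) *: (m - u - u0) + t *: (m + u - u0).
      by apply/rowP => k; rewrite /s !(rvDE, rvNE, rvZE); ring.
    apply: le_trans (ler_normD _ _) _; rewrite !normrZ (ger0_norm t0) ger0_norm ?subr_ge0//.
    have : (1 - t) * `|m - u - u0| <= (1 - t) * r by rewrite ler_wpM2l ?subr_ge0// ltW.
    have : t * `|m + u - u0| <= t * r by rewrite ler_wpM2l// ltW.
    rewrite mulrBl mul1r; short_lra.
  set G := mx_inner (g (m + s *: u)) u u.
  have G0 : 0 <= G by exact: inner_ge0.
  have Gb : G <= N ^+ 2 + s * al + be.
    have := mb_taylor mb u u mr sr; rewrite -/G -/(dG m _ u u) dGZ -/al -N2.
    rewrite ler_norml => /andP[_ H].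
    have : C * `|s *: u| ^+ 2 * `|u| * `|u| <= be.
      rewrite normrZ exprMn /be.
      have -> : C * (`|s| ^+ 2 * `|u| ^+ 2) * `|u| * `|u| = `|s| ^+ 2 * (C * `|u| ^+ 4) by ring.
      rewrite ler_piMl ?mulr_ge0 ?exprn_ge0// -[leRHS](expr1n _ 2) lerXn2r ?nnegrE//.
      by rewrite ler_norml /s; apply/andP; split; short_lra.
    short_lra.
  have -> : Num.sqrt (2 * (2 * G)) = 2 * Num.sqrt G.
    by rewrite mulrA sqrtrM// -expr2 sqrtr_sqr ger0_norm.
  have AM : Num.sqrt G <= (G + N ^+ 2) / (2 * N).
    rewrite ler_pdivlMr ?mulr_gt0//.
    have := sqr_ge0 (Num.sqrt G - N); rewrite sqrrB sqr_sqrtr//; short_lra.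
  have : 2 * Num.sqrt G <= (G + N ^+ 2) / N.
    have -> : (G + N ^+ 2) / N = 2 * ((G + N ^+ 2) / (2 * N)) by field; rewrite gt_eqF.
    by rewrite ler_wpM2l.
  move=> /le_trans; apply; rewrite ler_pdivrMr// /f mulrDl divfK ?gt_eqF//.
  have -> : 2 * N * N = 2 * N ^+ 2 by ring.
  rewrite -/s; short_lra.
apply: le_trans (rdist_le P) _; apply: le_trans lF _.
have -> : F 1 - F 0 = 2 * N + be / N by rewrite /F; field; rewrite gt_eqF.
rewrite lerD2l ler_pdivrMr// /be.
have -> : C * `|u| ^+ 4 = C / mu * `|u| ^+ 3 * (mu * `|u|) by field; rewrite gt_eqF.
by rewrite ler_wpM2l// mulr_ge0 ?exprn_ge0// divr_ge0 ?C0// ltW.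
Qed.

(** Let [m] be the midpoint of the outer points, [u] half their difference and [ze] the displacement
    of the middle point from [m]; the second difference is [- 2 ze], and [Y] is [- ze] up to
    Christoffel corrections of order [h ^+ 2]. Calibration by [quad] in the directions [Y + u] and
    [Y - u] shows that both have norm at most [h (1 + O(h ^+ 2))], whereas [segment_upper] gives [u]
    a norm of at least [h - O(h ^+ 3)]. The parallelogram law leaves [|Y| ^+ 2 = O(h ^+ 4)]. *)
Lemma second_difference : exists K h0 : R, [/\ 0 <= K, 0 < h0 &
  forall (x y z : M) (h : R), 0 < h -> h <= h0 ->
    chart_dom phi x -> chart_dom phi y -> chart_dom phi z ->
    `|phi x - u0| <= r / 4 -> `|phi y - u0| <= r / 4 -> `|phi z - u0| <= r / 4 ->
    rdist x y = h -> rdist y z = h -> rdist x z = 2 * h ->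
    `|phi x + phi z - 2 *: phi y| <= K * h ^+ 2].
Proof.
have r0 : 0 < r := mb_r mb.
have A0 := distortion_ge0; set A := distortion in A0.
pose C2 := C / mu ^+ 4.
pose C3 := (2 * A + A ^+ 2) * (9 / mu ^+ 2) + C2.
have C20 : 0 <= C2 by rewrite divr_ge0 ?exprn_ge0// ltW.
have C30 : 0 <= C3.
  by rewrite addr_ge0// mulr_ge0 ?divr_ge0 ?exprn_ge0 ?(ltW mu0)// addr_ge0 ?exprn_ge0// mulr_ge0.
pose K := 2 * (2 * C / (lam * mu ^+ 2) + Num.sqrt (C3 / lam)).
(* This makes [eta = 3 * h / mu] at most [r / 4], so that the calibration ball around [m] fits into
   the given one, and at most 1, so that [eta ^+ 4 <= eta ^+ 2]. *)
exists K, (mu / 3 * Num.min 1 (r / 4)); split.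
- rewrite mulr_ge0// addr_ge0 ?sqrtr_ge0// divr_ge0 ?mulr_ge0 ?exprn_ge0 ?(ltW lam0) ?(ltW mu0)//.
- by rewrite mulr_gt0 ?divr_gt0// lt_min ltr01 divr_gt0.
move=> x y z h h0 hh0 Dx Dy Dz xr yr zr xy yz xz.
pose hm := h / mu; have hm0 : 0 < hm by rewrite divr_gt0.
pose eta := 3 * hm; have eta0 : 0 < eta by rewrite mulr_gt0.
have eta_min : eta <= Num.min 1 (r / 4).
  have : h <= mu * (Num.min 1 (r / 4) / 3) by rewrite (le_trans hh0)// mulrAC mulrA.
  by rewrite -ler_pdivrMl// mulrC -/hm ler_pdivlMr// mulrC.
have [eta1 etar] : eta <= 1 /\ eta <= r / 4 by move: eta_min; rewrite le_min => /andP[].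
have hmr : hm <= r / 4 by rewrite /eta in etar; short_lra.
have xyb : `|phi y - phi x| <= hm.
  have [|_] := rdist_lower M_connected mb (x := x) (y := y) Dx; first by rewrite xy -/hm; short_lra.
  by rewrite xy mulrC -ler_pdivlMr.
have yzb : `|phi z - phi y| <= hm.
  have [|_] := rdist_lower M_connected mb (x := y) (y := z) Dy; first by rewrite yz -/hm; short_lra.
  by rewrite yz mulrC -ler_pdivlMr.
set a := phi x in xr xyb *; set b := phi y in yr xyb yzb *; set c := phi z in zr yzb *.
pose m := 2^-1 *: (a + c); pose u := 2^-1 *: (c - a).
have aE : a = m - u by apply/rowP => k; rewrite /m /u !(rvDE, rvNE, rvZE); field.
have cE : c = m + u by apply/rowP => k; rewrite /m /u !(rvDE, rvNE, rvZE); field.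
pose ze := b - m.
have ub : `|u| <= hm.
  rewrite normrZ ger0_norm ?invr_ge0//.
  by have := ler_distD b c a; short_lra.
have zeb : `|ze| <= hm.
  have -> : ze = 2^-1 *: ((b - a) + (b - c)).
    by apply/rowP => k; rewrite /ze /m !(rvDE, rvNE, rvZE); field.
  rewrite normrZ ger0_norm ?invr_ge0//.
  have := ler_normD (b - a) (b - c); rewrite (distrC b c); short_lra.
have mr4 : `|m - u0| <= r / 4.
  have -> : m - u0 = 2^-1 *: ((a - u0) + (c - u0)).
    by apply/rowP => k; rewrite /m !(rvDE, rvNE, rvZE); field.
  rewrite normrZ ger0_norm ?invr_ge0//.
  have := ler_normD (a - u0) (c - u0); short_lra.
have mr : `|m - u0| <= r by short_lra.
have meta : `|m - u0| + eta <= r by short_lra.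
have un0 : u != 0.
  apply/eqP => u0'; have : x = z.
    by rewrite -(chart_funK Dx) -(chart_funK Dz) -/a -/c aE cE u0' subr0 addr0.
  move=> xzE; move: xz; rewrite xzE rdistxx => /esym/eqP.
  by rewrite mulf_eq0 gt_eqF//= gt_eqF.
have [pu puE pub] := gam_vector u u mr.
have [pb pbE pbb] := gam_vector ze ze mr.
pose N v := mx_inner (g m) v v.
pose Y := 2^-1 *: pu - ze - 2^-1 *: pb.
pose K' := 1 + A * eta ^+ 2.
have K'0 : 0 <= K' by rewrite addr_ge0// mulr_ge0 ?exprn_ge0// ltW.
have gsym := mb_sym mb mr.
have quadE w v p : (forall w, mx_inner (g m) p w = gam m v v w) ->
    quad m w (m + v) = mx_inner (g m) w (v + 2^-1 *: p).
  have E : m + v - m = v by rewrite addrC addKr.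
  by move=> pE; rewrite /quad E -pE mx_innerDr mx_innerZr (mx_innerC p w gsym).
have pbE' : b = m + ze by rewrite /ze addrC subrK.
have puE' w : mx_inner (g m) pu w = gam m (- u) (- u) w by rewrite gamN.
have Nroot w : N w <= K' * Num.sqrt (N w) * h -> N w <= K' ^+ 2 * h ^+ 2.
  have Nw0 : 0 <= N w by exact: inner_ge0.
  have [N0|N0] := eqVneq (N w) 0; first by rewrite N0 => _; rewrite mulr_ge0 ?exprn_ge0// ltW.
  have sN : 0 < Num.sqrt (N w) by rewrite sqrtr_gt0 lt_neqAle eq_sym N0.
  rewrite -{1}(sqr_sqrtr Nw0) expr2 mulrAC ler_pM2r// => H.
  rewrite -(sqr_sqrtr Nw0) -exprMn lerXn2r ?nnegrE ?sqrtr_ge0// mulr_ge0// ltW//.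
have bm : `|b - m| + hm < eta by rewrite -/ze /eta; short_lra.
have N1 : N (Y + u) <= K' ^+ 2 * h ^+ 2.
  apply: Nroot; have := @quad_rdist m (Y + u) y z eta eta0 meta Dy.
  rewrite yz -/b -/c -/hm -/A -/K' => /(_ bm) H; apply: le_trans H.
  rewrite cE (quadE _ _ _ puE) pbE' (quadE _ _ _ pbE) -mx_innerBr.
  have -> : u + 2^-1 *: pu - (ze + 2^-1 *: pb) = Y + u.
    by apply/rowP => k; rewrite /Y !(rvDE, rvNE, rvZE); ring.
  exact: ler_norm.
have N2 : N (Y - u) <= K' ^+ 2 * h ^+ 2.
  apply: Nroot; have := @quad_rdist m (Y - u) y x eta eta0 meta Dy.
  rewrite rdistC xy -/b -/a -/hm -/A -/K' => /(_ bm) H; apply: le_trans H.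
  rewrite aE (quadE _ _ _ puE') pbE' (quadE _ _ _ pbE) -mx_innerBr.
  have -> : - u + 2^-1 *: pu - (ze + 2^-1 *: pb) = Y - u.
    by apply/rowP => k; rewrite /Y !(rvDE, rvNE, rvZE); ring.
  exact: ler_norm.
have N3 : h ^+ 2 - C2 * h ^+ 4 <= N u.
  have ar : `|m - u - u0| < r by rewrite -aE; short_lra.
  have cr : `|m + u - u0| < r by rewrite -cE; short_lra.
  have := segment_upper ar cr mr un0; rewrite -aE -cE !chart_funK// xz -/(N u).
  have Nu0 : 0 <= N u by exact: inner_ge0.
  set S : R := Num.sqrt (N u); have S0 : 0 <= S by exact: sqrtr_ge0.
  have SS : S ^+ 2 = N u by rewrite sqr_sqrtr.
  have cub : C / mu * `|u| ^+ 3 <= C2 * h ^+ 3.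
    have -> : C2 * h ^+ 3 = C / mu * hm ^+ 3.
      by rewrite /C2 /hm; field; rewrite gt_eqF.
    rewrite ler_wpM2l ?divr_ge0 ?(ltW mu0)// lerXn2r// ?nnegrE// ltW//.
  move=> H; rewrite -SS.
  pose q := C2 * h ^+ 3 / 2.
  have q0 : 0 <= q by rewrite divr_ge0// mulr_ge0// exprn_ge0// ltW.
  have -> : C2 * h ^+ 4 = 2 * h * q by rewrite /q; field.
  have hS : h - q <= S by rewrite /q; short_lra.
  exact: (sqr_lower_bound (ltW h0) q0 S0 hS).
have par : N (Y + u) + N (Y - u) = 2 * N Y + 2 * N u.
  exact: mx_inner_parallelogram.
have NY : N Y <= C3 * h ^+ 4.
  have H1 : K' ^+ 2 <= 1 + (2 * A + A ^+ 2) * eta ^+ 2.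
    pose e2 := eta ^+ 2; have e20 : 0 <= e2 by rewrite exprn_ge0// ltW.
    have e21 : e2 <= 1 by rewrite exprn_ile1// ltW.
    have -> : K' ^+ 2 = 1 + 2 * A * e2 + A ^+ 2 * (e2 * e2) by rewrite /K' -/e2; ring.
    have : A ^+ 2 * (e2 * e2) <= A ^+ 2 * e2.
      by rewrite ler_wpM2l ?exprn_ge0// ler_piMr.
    by move=> k; rewrite -[eta ^+ 2]/e2 [(_ + _) * e2]mulrDl addrA lerD2l.
  have H2 : (2 * A + A ^+ 2) * eta ^+ 2 = (2 * A + A ^+ 2) * (9 / mu ^+ 2) * h ^+ 2.
    by rewrite /eta /hm; field; rewrite gt_eqF.
  have H3 : K' ^+ 2 * h ^+ 2 <= h ^+ 2 + (2 * A + A ^+ 2) * (9 / mu ^+ 2) * h ^+ 4.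
    apply: le_trans (ler_wpM2r _ H1) _; first by rewrite exprn_ge0// ltW.
    rewrite H2; set q := (2 * A + A ^+ 2) * _.
    by rewrite le_eqVlt; apply/orP; left; apply/eqP; ring.
  by rewrite /C3 mulrDl; exact: (parallelogram_bound N1 N2 H3 N3 par).
have Yb : `|Y| <= Num.sqrt (C3 / lam) * h ^+ 2.
  have -> : `|Y| = Num.sqrt (`|Y| ^+ 2) by rewrite sqrtr_sqr normr_id.
  have -> : h ^+ 2 = Num.sqrt (h ^+ 4).
    by rewrite (exprM h 2 2) sqrtr_sqr ger0_norm// exprn_ge0// ltW.
  rewrite -sqrtrM ?divr_ge0 ?(ltW lam0)// ler_sqrt; last first.
    by rewrite mulr_ge0 ?divr_ge0 ?(ltW lam0) ?exprn_ge0// ltW.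
  rewrite mulrAC ler_pdivlMr// mulrC; apply: le_trans NY.
  exact: (mb_pos mb Y mr).
have -> : a + c - 2 *: b = (-2) *: ze.
  by rewrite cE aE; apply/rowP => k; rewrite /ze !(rvDE, rvNE, rvZE); ring.
have -> : `|(-2) *: ze| = 2 * `|ze| by rewrite normrZ normrN ger0_norm.
rewrite /K -[leRHS]mulrA ler_pM2l//.
have -> : ze = 2^-1 *: pu - 2^-1 *: pb - Y.
  by apply/rowP => k; rewrite /Y !(rvDE, rvNE, rvZE); ring.
apply: le_trans (ler_normB _ _) _; rewrite mulrDl; apply: lerD Yb.
apply: le_trans (ler_normB _ _) _; rewrite !normrZ !ger0_norm ?invr_ge0//.
have bnd (p v : 'rV[R]_n) : `|p| <= 2 * C / lam * `|v| * `|v| -> `|v| <= hm ->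
    2^-1 * `|p| <= C / (lam * mu ^+ 2) * h ^+ 2.
  move=> pv vh; rewrite ler_pdivrMl//; apply: le_trans pv _.
  apply: (@le_trans _ _ (2 * C / lam * hm * hm)).
    have k0 : 0 <= 2 * C / lam by rewrite divr_ge0 ?(ltW lam0)// mulr_ge0.
    have vv : `|v| * `|v| <= hm * hm by rewrite ler_pM.
    by rewrite -[leLHS]mulrA -[leRHS]mulrA ler_wpM2l.
  rewrite /hm le_eqVlt; apply/orP; left; apply/eqP; field.
  by rewrite !gt_eqF.
have := bnd _ _ pub ub; have := bnd _ _ pbb zeb.
have -> : 2 * C / (lam * mu ^+ 2) * h ^+ 2 = 2 * (C / (lam * mu ^+ 2) * h ^+ 2) by ring.
by rewrite [X in _ -> _ -> _ <= X]mulr_natl mulr2n => h2' h1'; exact: lerD.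
Qed.

End SecondDifference.

(** * Velocity of minimal paths *)

Section C11.
Context {R : realType}.

(** A maximum principle: the chord and a parabola with second differences stronger than required by
    [d] are subtracted, so that an interior maximum with positive value would violate the
    hypothesis. The constant [d] is chosen to cost at most [e]. *)
Lemma second_difference_upper (f : R -> R) (x z K : R) : x < z ->
  (forall t, x <= t <= z -> {for t, continuous f}) ->
  (forall t h, 0 < h -> x <= t - h -> t + h <= z ->
     - (K * h ^+ 2) <= f (t + h) + f (t - h) - 2 * f t) ->
  forall y, x <= y <= z ->
    f y - (f x + (y - x) * ((f z - f x) / (z - x))) <= K / 2 * (y - x) * (z - y).
Proof.
move=> xz fc Hf y xyz.
apply/ler_addgt0Pr => e e0.
have L0 : 0 < z - x by rewrite subr_gt0.
pose sl := (f z - f x) / (z - x).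
have slE : sl * (z - x) = f z - f x by rewrite divfK// gt_eqF.
have L2 : 0 < (z - x) ^+ 2 by rewrite exprn_gt0.
pose d := e / (z - x) ^+ 2; have d0 : 0 < d by rewrite divr_gt0.
pose q (t : R) : R := (K / 2 + d) * ((t - x) * (z - t)).
pose g (t : R) : R := f t - (f x + (t - x) * sl) - q t.
have gc t : x <= t <= z -> {for t, continuous g}.
  move=> tz; apply: continuousB; last first.
    apply: (is_derive_continuous (d := (K / 2 + d) * ((z - t) - (t - x)))).
    rewrite /q; apply: is_derive_eq; rewrite /GRing.scale /=; ring.
  apply: continuousB; first exact: fc.
  apply: (is_derive_continuous (d := sl)).
  by apply: is_derive_eq; rewrite /GRing.scale /=; ring.
have [t txz tmax] := EVT_max (ltW xz) (within_continuousP gc).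
have gx : g x = 0 by rewrite /g /q !subrr !mul0r mulr0 addr0 !subrr.
have gz : g z = 0 by rewrite /g /q [(z - x) * sl]mulrC slE subrr; ring.
have gt0 : g t <= 0.
  move: txz; rewrite in_itv /= => /andP[xt tz].
  rewrite leNgt; apply/negP => gpos.
  have xt' : x < t by rewrite lt_neqAle xt andbT; apply/eqP => E; rewrite -E gx ltxx in gpos.
  have tz' : t < z by rewrite lt_neqAle tz andbT; apply/eqP => E; rewrite E gz ltxx in gpos.
  pose h : R := Num.min (t - x) (z - t).
  have h0 : 0 < h by rewrite lt_min !subr_gt0 xt' tz'.
  have hx : h <= t - x by rewrite ge_min lexx.
  have hz : h <= z - t by rewrite ge_min lexx orbT.
  have m1 : g (t + h) <= g t by apply: tmax; rewrite in_itv /=; apply/andP; split; lra.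
  have m2 : g (t - h) <= g t by apply: tmax; rewrite in_itv /=; apply/andP; split; lra.
  have xth : x <= t - h by lra.
  have thz : t + h <= z by lra.
  have H := Hf t h h0 xth thz.
  have Q : q (t + h) + q (t - h) - 2 * q t = - (K * h ^+ 2) - 2 * (d * h ^+ 2).
    by rewrite /q; field.
  have : 0 < d * h ^+ 2 by rewrite mulr_gt0// exprn_gt0.
  move: m1 m2; rewrite /g; move: Q H; lra.
have gy : g y <= 0 by apply: le_trans gt0; apply: tmax; rewrite in_itv.
case/andP: xyz => xy yz.
have : d * ((y - x) * (z - y)) <= e.
  rewrite /d mulrAC ler_pdivrMr// ler_wpM2l ?(ltW e0)// expr2.
  by apply: ler_pM; rewrite ?subr_ge0//; lra.
move: gy; rewrite /g /q mulrDl mulrA; lra.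
Qed.

Section Derivative.
Variables (f : R -> R) (a b K h0 : R).
Hypotheses (K0 : 0 <= K) (h00 : 0 < h0) (ab : a < b).
Hypothesis fc : forall t, a <= t <= b -> {for t, continuous f}.
Hypothesis Hf : forall t h, 0 < h -> h <= h0 -> a <= t - h -> t + h <= b ->
  `|f (t + h) + f (t - h) - 2 * f t| <= K * h ^+ 2.

Lemma interpolation_error x y z : x < z -> z - x <= 2 * h0 -> a <= x -> z <= b ->
  x <= y <= z ->
  `|f y - (f x + (y - x) * ((f z - f x) / (z - x)))| <= K / 2 * (y - x) * (z - y).
Proof.
move=> xz zx2 ax zb xyz.
have fc' t : x <= t <= z -> {for t, continuous f}.
  by move=> /andP[xt tz]; apply: fc; rewrite (le_trans ax xt) (le_trans tz zb).
have fcN t : x <= t <= z -> {for t, continuous (- f)}.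
  by move=> xt; apply: continuousN; exact: fc'.
have Hf' t h : 0 < h -> x <= t - h -> t + h <= z ->
    `|f (t + h) + f (t - h) - 2 * f t| <= K * h ^+ 2.
  by move=> h1 h2 h3; apply: Hf => //; lra.
have U := second_difference_upper xz fc' _ xyz.
have V := @second_difference_upper (- f) x z K xz fcN _ y xyz.
rewrite ler_norml; apply/andP; split.
- have : (- f) y - ((- f) x + (y - x) * (((- f) z - (- f) x) / (z - x))) <= K / 2 * (y - x) * (z - y).
    apply: V => t h h1 h2 h3; have := Hf' t h h1 h2 h3; rewrite !fctE ler_norml => /andP[]; lra.
  rewrite !fctE.
  have -> : (- f z - - f x) / (z - x) = - ((f z - f x) / (z - x)) by rewrite -mulNr; congr (_ / _); ring.
  rewrite mulrN; lra.
- by apply: U => t h h1 h2 h3; have := Hf' t h h1 h2 h3; rewrite ler_norml => /andP[].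
Qed.

(** The interpolation error is applied at whichever of [t], [s], [s'] lies between the other two. *)
Lemma slope_diff t s s' : a <= t <= b -> a <= s <= b -> a <= s' <= b ->
  s != t -> s' != t -> `|s - t| <= h0 -> `|s' - t| <= h0 ->
  `|(f s - f t) / (s - t) - (f s' - f t) / (s' - t)| <= K / 2 * (`|s - t| + `|s' - t|).
Proof.
move=> tab; wlog : s s' / s <= s'.
  move=> W sab s'ab st s't sh s'h; have /orP[ss|ss] := le_total s s'; first exact: W.
  by rewrite distrC [`|s - t| + _]addrC; exact: W.
rewrite le_eqVlt => /predU1P[->|ss].
  by move=> *; rewrite subrr normr0 mulr_ge0 ?addr_ge0// divr_ge0.
move=> /andP[as_ sb] /andP[as' s'b] st s't; case/andP: tab => at_ tb.
move=> /ler_normlP [sh2 sh1] /ler_normlP [sh2' sh1'].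
have K2 : 0 <= K / 2 by rewrite divr_ge0.
set S := (f s - f t) / (s - t); set S' := (f s' - f t) / (s' - t).
have SE : S * (s - t) = f s - f t by rewrite divfK// subr_eq0.
have SE' : S' * (s' - t) = f s' - f t by rewrite divfK// subr_eq0.
have divb (x y p q : R) : 0 < p -> x = p * y -> `|x| <= K / 2 * p * q -> `|y| <= K / 2 * q.
  move=> p0 ->; rewrite normrM (gtr0_norm p0) => H; rewrite -(ler_pM2l p0).
  by apply: le_trans H _; rewrite mulrCA mulrA.
have mono q q' : q <= q' -> K / 2 * q <= K / 2 * q' by move=> ?; rewrite ler_wpM2l.
have ss0 : 0 < s' - s by rewrite subr_gt0.
have [ts|ts|ts] := ltgtP t s; last by rewrite ts eqxx in st.
- have ts0 : 0 < s - t by rewrite subr_gt0.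
  have ts0' : 0 < s' - t by lra.
  rewrite (gtr0_norm ts0) (gtr0_norm ts0').
  have I : `|f s - (f t + (s - t) * S')| <= K / 2 * (s - t) * (s' - s).
    by apply: interpolation_error => //; lra.
  apply: le_trans (divb _ _ _ _ ts0 _ I) (mono _ _ _); last by lra.
  by rewrite mulrBr [(s - t) * S]mulrC SE; ring.
- have [ts'|ts'|ts'] := ltgtP t s'; last by rewrite ts' eqxx in s't.
  + have ts0 : 0 < t - s by rewrite subr_gt0.
    have ts0' : 0 < s' - t by rewrite subr_gt0.
    rewrite distrC (distrC s) (gtr0_norm ts0) (gtr0_norm ts0').
    pose m := (f s' - f s) / (s' - s).
    have mE : m * (s' - s) = f s' - f s by rewrite divfK// gt_eqF.
    have I : `|f t - (f s + (t - s) * m)| <= K / 2 * (t - s) * (s' - t).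
      by apply: interpolation_error => //; lra.
    have I' : `|f t - (f s + (t - s) * m)| <= K / 2 * (s' - t) * (t - s) by rewrite mulrAC.
    have h1 : `|S - m| <= K / 2 * (s' - t).
      apply: divb ts0 _ I; rewrite mulrBr [(t - s) * m]mulrC.
      have -> : (t - s) * S = f t - f s by rewrite -[f t - f s]opprB -SE; ring.
      ring.
    have h2 : `|m - S'| <= K / 2 * (t - s).
      apply: divb ts0' _ I'; rewrite mulrBr [(s' - t) * S']mulrC SE'.
      have -> : (s' - t) * m = m * (s' - s) - (t - s) * m by ring.
      by rewrite mE; ring.
    apply: le_trans (ler_distD m _ _) _; rewrite (distrC S') (distrC m S).
    by apply: le_trans (lerD h2 h1) _; rewrite [leRHS]mulrDr.
  + have ts0 : 0 < t - s by rewrite subr_gt0.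
    have ts0' : 0 < t - s' by rewrite subr_gt0.
    rewrite (distrC s) (distrC s') (gtr0_norm ts0) (gtr0_norm ts0').
    have I : `|f s' - (f s + (s' - s) * ((f t - f s) / (t - s)))| <= K / 2 * (s' - s) * (t - s').
      by apply: interpolation_error => //; lra.
    have SS : (f t - f s) / (t - s) = S by rewrite -[f t - f s]opprB -[t - s]opprB invrN mulrNN.
    rewrite SS in I.
    have I' : `|f s' - (f s + (s' - s) * S)| <= K / 2 * (t - s') * (s' - s) by rewrite mulrAC.
    apply: le_trans (divb _ _ _ _ ts0' _ I') (mono _ _ _); last by lra.
    have -> : f s' = f t + S' * (s' - t) by rewrite SE'; ring.
    have -> : f s = f t + S * (s - t) by rewrite SE; ring.
    ring.
Qed.

(** By [slope_diff] the intervals of radius [K / 2 * |s - t|] around the difference quotients at [t]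
    meet pairwise. The supremum of their left ends belongs to all of them and is the derivative. *)
Lemma C11_derivative t : a <= t <= b -> exists v, forall s, a <= s <= b -> `|s - t| <= h0 ->
  `|f s - f t - (s - t) * v| <= K / 2 * (s - t) ^+ 2.
Proof.
move=> tab.
pose S s := (f s - f t) / (s - t).
pose V s := [/\ a <= s <= b, s != t & `|s - t| <= h0].
pose E := [set S s - K / 2 * `|s - t| | s in V].
have [s0 Vs0] : exists s, V s.
  case/andP: (tab) => at_ tb.
  have [tb'|tb'] := ltP t b.
    exists (Num.min b (t + h0)); split.
    - by apply/andP; split; [rewrite le_min (ltW ab) (le_trans at_)// lerDl ltW|rewrite ge_min lexx].
    - by rewrite gt_eqF// lt_min tb' ltrDl.
    - rewrite ger0_norm ?subr_ge0 ?le_min ?tb ?lerDl ?(ltW h00)//.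
      by rewrite lerBlDl ge_min lexx orbT.
  have tE : t = b by apply/eqP; rewrite eq_le tb.
  exists (Num.max a (t - h0)); split.
  - by apply/andP; split; [rewrite le_max lexx|rewrite ge_max (ltW ab) (le_trans _ tb)// gerBl ltW].
  - by rewrite lt_eqF// gt_max tE ab ltrBlDr ltrDl.
  - rewrite distrC ger0_norm ?subr_ge0 ?ge_max ?at_//; last by rewrite lerBlDr lerDl ltW.
    by rewrite lerBlDl -lerBlDr le_max lexx orbT.
have ub s : V s -> ubound E (S s + K / 2 * `|s - t|).
  move=> [sab st sh] _ [s' [s'ab s't s'h] <-].
  have := slope_diff tab sab s'ab st s't sh s'h; rewrite -/(S s) -/(S s') mulrDr.
  by move=> /ler_normlP []; lra.
have hE : has_sup E by split; [exists (S s0 - K / 2 * `|s0 - t|); exists s0|exists (S s0 + K / 2 * `|s0 - t|); exact: ub].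
exists (sup E) => s sab sh.
have [->|st] := eqVneq s t.
  by rewrite !subrr mul0r subrr normr0 expr0n mulr0.
have Vs : V s by [].
have h1 : sup E <= S s + K / 2 * `|s - t| by apply: ge_sup (ub s Vs); case: hE.
have h2 : S s - K / 2 * `|s - t| <= sup E by apply: ub_le_sup; [case: hE|exists s].
have -> : f s - f t - (s - t) * sup E = (s - t) * (S s - sup E).
  by rewrite mulrBr /S [(s - t) * (_ / _)]mulrC divfK// subr_eq0.
have -> : K / 2 * (s - t) ^+ 2 = `|s - t| * (K / 2 * `|s - t|).
  by rewrite -[(s - t) ^+ 2]real_normK ?num_real//; ring.
by rewrite normrM ler_wpM2l// ler_norml; apply/andP; split; lra.
Qed.

End Derivative.

End C11.

Lemma maxr_lipschitz (R : realType) (a x y : R) :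
  `|Num.max a x - Num.max a y| <= `|x - y|.
Proof.
have h1 := ler_norm (x - y); have h2 := ler_norm (y - x); rewrite distrC in h2.
case: (leP a x) => ax; case: (leP a y) => ay //; rewrite ?subrr ?normr0 ?normr_ge0//;
  rewrite ler_norml; apply/andP; split; lra.
Qed.

Lemma minr_lipschitz (R : realType) (x y a : R) :
  `|Num.min x a - Num.min y a| <= `|x - y|.
Proof.
have h1 := ler_norm (x - y); have h2 := ler_norm (y - x); rewrite distrC in h2.
case: (leP x a) => ax; case: (leP y a) => ay //; rewrite ?subrr ?normr0 ?normr_ge0//;
  rewrite ler_norml; apply/andP; split; lra.
Qed.

(** It bounds length by energy, which is polynomial in the velocity. *)
Lemma sqrt_le_half (R : realType) (y : R) : 0 <= y -> Num.sqrt y <= (1 + y) / 2.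
Proof.
move=> y0; have := sqr_ge0 (Num.sqrt y - 1); rewrite sqrrB sqr_sqrtr// expr1n; lra.
Qed.

(** * First order regularity of minimal paths in a chart *)

Section LocalPaths.
Context {R : realType} {n : nat} (M : riemannianManifold R n).
Hypothesis M_connected : connected [set: M].
Variables (i : rm_index M) (u0 : 'rV[R]_n) (r lam C : R).
Hypothesis mb : metric_ball (metric i) (chart_codom (atlas i)) u0 r lam C.
Local Notation g := (metric i).
Local Notation mu := (Num.sqrt lam).
Local Notation phi := (atlas i).
Implicit Types (gamma : R -> M) (s t h : R).

Let lam0 : 0 < lam. Proof. exact: (mb_lam mb). Qed.
Let mu0 : 0 < mu. Proof. by rewrite sqrtr_gt0. Qed.
Let C0 : 0 <= C. Proof. exact: le_trans ler01 (mb_C mb). Qed.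
Let r0 : 0 < r. Proof. exact: (mb_r mb). Qed.

Definition unit_path gamma (a b : R) :=
  forall s t, a <= s <= b -> a <= t <= b -> rdist (gamma s) (gamma t) = `|t - s|.

Definition path_in_ball gamma (a b : R) :=
  forall t, a <= t <= b -> chart_dom phi (gamma t) /\ `|phi (gamma t) - u0| <= r / 4.

Lemma path_lipschitz gamma a b s t : unit_path gamma a b -> path_in_ball gamma a b ->
  a <= s <= b -> a <= t <= b -> `|t - s| <= mu * r / 4 ->
  `|phi (gamma t) - phi (gamma s)| <= `|t - s| / mu.
Proof.
move=> U B sab tab ts; have [Ds sr] := B s sab.
have E := U s t sab tab.
have [|_] := rdist_lower M_connected mb (x := gamma s) (y := gamma t) Ds.
  rewrite E; apply: (@le_lt_trans _ _ (r / 4 + r / 4)); last by have := r0; lra.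
  by apply: lerD => //; rewrite ler_pdivrMr// mulrAC [r * _]mulrC.
by rewrite E mulrC -ler_pdivlMr.
Qed.

(** [C11_derivative] is applied to each coordinate. The constants depend on the coordinate ball but
    not on the path; the bound [mu * r / 16] keeps the calibrations of [velocity_unit] inside the
    ball. *)
Lemma path_C11 : exists K h0 : R, [/\ 0 <= K, 0 < h0, h0 <= 1, h0 <= mu * r / 16 &
  forall gamma a b, a < b -> unit_path gamma a b -> path_in_ball gamma a b ->
  exists v : R -> 'rV[R]_n, forall s t, a <= s <= b -> a <= t <= b -> `|s - t| <= h0 ->
    `|phi (gamma s) - phi (gamma t) - (s - t) *: v t| <= K * (s - t) ^+ 2].
Proof.
have [K [h1 [K0 h10 SD]]] := second_difference M_connected mb.
pose h0 : R := Num.min h1 (Num.min 1 (mu * r / 16)).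
have mr0 : 0 < mu * r / 16 by rewrite divr_gt0// mulr_gt0.
have h00 : 0 < h0 by rewrite !lt_min h10 ltr01.
have h0h1 : h0 <= h1 by rewrite ge_min lexx.
have h01 : h0 <= 1 by rewrite !ge_min lexx orbT.
have h0r : h0 <= mu * r / 16 by rewrite !ge_min lexx !orbT.
exists (K / 2), h0; split => //; first by rewrite divr_ge0.
move=> gamma a b ab U B.
(* The path is continued by constants, which makes it continuous at the ends as well. *)
pose cl t := Num.max a (Num.min t b).
have clab t : a <= cl t <= b by rewrite le_max lexx ge_max (ltW ab) ge_min lexx orbT.
have clid t : a <= t <= b -> cl t = t.
  by move=> /andP[at_ tb]; rewrite /cl (min_idPl tb) (max_idPr at_).
have cllip s t : `|cl s - cl t| <= `|s - t|.
  by apply: le_trans (maxr_lipschitz _ _ _) (minr_lipschitz _ _ _).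
pose c t := phi (gamma (cl t)).
have cE t : a <= t <= b -> c t = phi (gamma t) by move=> tab; rewrite /c clid.
have cc k t : {for t, continuous (fun t => c t 0 k)}.
  apply/continuous_eps => e e0; exists (Num.min (mu * r / 16) (e * mu)).
    by rewrite lt_min mr0 mulr_gt0.
  move=> s; rewrite lt_min => /andP[s1 s2]; rewrite -rvBE.
  apply: le_trans (coord_le_norm _ _) _.
  apply: le_trans (path_lipschitz U B (clab t) (clab s) _) _.
    by apply: le_trans (cllip _ _) _; apply: le_trans (ltW s1) _; lra.
  by rewrite ler_pdivrMr//; apply: le_trans (cllip _ _) (ltW s2).
have Hf k t h : 0 < h -> h <= h0 -> a <= t - h -> t + h <= b ->
    `|c (t + h) 0 k + c (t - h) 0 k - 2 * c t 0 k| <= K * h ^+ 2.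
  move=> hp hh a1 b1.
  have t1 : a <= t - h <= b by apply/andP; split; lra.
  have t2 : a <= t <= b by apply/andP; split; lra.
  have t3 : a <= t + h <= b by apply/andP; split; lra.
  have [D1 B1] := B _ t1; have [D2 B2] := B _ t2; have [D3 B3] := B _ t3.
  have d1 : rdist (gamma (t - h)) (gamma t) = h.
    by rewrite U// opprB addrC subrK gtr0_norm.
  have d2 : rdist (gamma t) (gamma (t + h)) = h.
    by rewrite U// addrC addKr gtr0_norm.
  have d3 : rdist (gamma (t - h)) (gamma (t + h)) = 2 * h.
    rewrite U// (_ : t + h - (t - h) = 2 * h); last by ring.
    by rewrite gtr0_norm// mulr_gt0.
  have H := SD _ _ _ h hp (le_trans hh h0h1) D1 D2 D3 B1 B2 B3 d1 d2 d3.
  rewrite !cE// [X in X - _]addrC -rvDE -rvZE -rvBE.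
  exact: le_trans (coord_le_norm _ _) H.
have /choice [v Hv] : forall t, exists w : 'rV[R]_n, a <= t <= b -> forall s, a <= s <= b ->
    `|s - t| <= h0 -> `|phi (gamma s) - phi (gamma t) - (s - t) *: w| <= K / 2 * (s - t) ^+ 2.
  move=> t; have [tab|] := boolP (a <= t <= b); last by exists 0.
  have /choice [w Hw] : forall k, exists x, forall s, a <= s <= b -> `|s - t| <= h0 ->
      `|c s 0 k - c t 0 k - (s - t) * x| <= K / 2 * (s - t) ^+ 2.
    move=> k; exact: (C11_derivative K0 h00 ab (fun t _ => cc k t) (Hf k) tab).
  exists (\row_k w k) => _ s sab sh; apply: norm_le_coord => [|k].
    by rewrite mulr_ge0 ?divr_ge0 ?sqr_ge0.
  by rewrite !(rvBE, rvZE) [(\row_k _) _ _]mxE -!cE//; exact: Hw.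
by exists v => s t sab tab; exact: Hv.
Qed.

Section Velocity.
Variables (K h0 : R) (gamma : R -> M) (a b : R) (v : R -> 'rV[R]_n).
Hypotheses (K0 : 0 <= K) (h00 : 0 < h0) (h01 : h0 <= 1) (h0r : h0 <= mu * r / 16).
Hypotheses (ab : a < b) (U : unit_path gamma a b) (B : path_in_ball gamma a b).
Local Notation c := (fun t => phi (gamma t)).
Hypothesis Hv : forall s t, a <= s <= b -> a <= t <= b -> `|s - t| <= h0 ->
    `|c s - c t - (s - t) *: v t| <= K * (s - t) ^+ 2.

Lemma velocity_lipschitz s t : a <= s <= b -> a <= t <= b -> `|s - t| <= h0 ->
  `|v s - v t| <= 2 * K * `|s - t|.
Proof.
move=> sab tab st; have [->|neq] := eqVneq s t; first by rewrite !subrr !normr0 mulr0.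
have d0 : 0 < `|s - t| by rewrite normr_gt0 subr_eq0.
have ts : `|t - s| <= h0 by rewrite distrC.
have H1 := Hv sab tab st; have H2 := Hv tab sab ts.
have E : (s - t) *: (v s - v t) = (c s - c t - (s - t) *: v t) + (c t - c s - (t - s) *: v s).
  by apply/rowP => k; rewrite !(rvDE, rvNE, rvZE); ring.
have : `|(s - t) *: (v s - v t)| <= K * (s - t) ^+ 2 + K * (t - s) ^+ 2.
  by rewrite E; apply: le_trans (ler_normD _ _) (lerD H1 H2).
rewrite normrZ -[(t - s) ^+ 2]sqrrN opprB -[(s - t) ^+ 2]real_normK ?num_real// => H.
rewrite -(ler_pM2l d0); apply: le_trans H _.
by rewrite le_eqVlt; apply/orP; left; apply/eqP; ring.
Qed.

Lemma limit_le (t x y A d1 : R) : a <= t <= b -> 0 < d1 ->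
  (forall s, a <= s <= b -> s != t -> `|s - t| <= d1 -> x <= y + A * `|s - t|) -> x <= y.
Proof.
move=> /andP[at_ tb] d10 H; apply/ler_addgt0Pr => e e0.
have A1 : 0 < `|A| + 1 by rewrite ltr_wpDl.
pose d : R := Num.min d1 (e / (`|A| + 1)).
have d0 : 0 < d by rewrite lt_min d10 divr_gt0.
have [s [sab st sd]] : exists s, [/\ a <= s <= b, s != t & `|s - t| <= d].
  have [tb'|tb'] := ltP t b.
    exists (Num.min b (t + d)); split.
    - by apply/andP; split; [rewrite le_min (ltW ab) (le_trans at_)// lerDl ltW|rewrite ge_min lexx].
    - by rewrite gt_eqF// lt_min tb' ltrDl.
    - have md : Num.min b (t + d) <= t + d by rewrite ge_min lexx orbT.
      rewrite ger0_norm; first by lra.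
      by rewrite subr_ge0 le_min tb lerDl ltW.
  have tE : t = b by apply/eqP; rewrite eq_le tb.
  exists (Num.max a (t - d)); split.
  - by apply/andP; split; [rewrite le_max lexx|rewrite ge_max (ltW ab) (le_trans _ tb)// gerBl ltW].
  - by rewrite lt_eqF// gt_max tE ab ltrBlDr ltrDl.
  - have md : t - d <= Num.max a (t - d) by rewrite le_max lexx orbT.
    rewrite distrC ger0_norm; first by lra.
    by rewrite subr_ge0 ge_max at_ lerBlDr lerDl ltW.
have := H s sab st (le_trans sd _); rewrite ge_min lexx => /(_ isT) /le_trans; apply.
rewrite lerD2l; apply: (@le_trans _ _ (`|A| * d)).
  by apply: le_trans (ler_wpM2r _ (ler_norm A)) _; rewrite // ler_wpM2l.
apply: (@le_trans _ _ (`|A| * (e / (`|A| + 1)))); first by rewrite ler_wpM2l// ge_min lexx orbT.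
by rewrite mulrCA ler_piMr ?(ltW e0)// ler_pdivrMr// mul1r lerDl.
Qed.

(** Calibration by [quad] in the direction [v t] gives [N <= Num.sqrt N]: over a time [d] the path
    advances in this direction by at most [d] times the norm of [v t], to first order. Conversely,
    the coordinate segment between two points of the path is not shorter than their distance [d],
    which gives [1 <= N]. *)
Lemma velocity_unit t : a <= t <= b -> cinner i (c t) (v t) (v t) = 1.
Proof.
move=> tab; have [Dt tr] := B tab.
set N := cinner i (c t) (v t) (v t).
have mr : `|c t - u0| <= r by move: tr r0; lra.
have N0 : 0 <= N by exact: (inner_ge0 mb (v t) mr).
have sN0 : 0 <= Num.sqrt N by exact: sqrtr_ge0.
have sN : Num.sqrt N ^+ 2 = N by rewrite sqr_sqrtr.
have A0 := distortion_ge0 mb; set A := distortion lam C in A0.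
have kb s : a <= s <= b -> `|s - t| <= h0 -> `|c s - c t| <= `|s - t| / mu.
  move=> sab st; apply: path_lipschitz U B tab sab _.
  have : 0 < mu * r by rewrite mulr_gt0.
  by move: h0r; lra.
have N1 : N <= Num.sqrt N.
  apply: (@limit_le t _ _ (9 * A / mu ^+ 2 * Num.sqrt N + C * K * `|v t| + C * `|v t| / mu ^+ 2) h0 tab h00).
  move=> s sab st sh; have [Ds sr] := B sab.
  set d := `|s - t| in sh *; have d0 : 0 < d by rewrite normr_gt0 subr_eq0.
  pose k := c s - c t; have kd : `|k| <= d / mu by exact: kb.
  pose e := k - (s - t) *: v t; have ed : `|e| <= K * d ^+ 2.
    by rewrite /d real_normK ?num_real//; exact: Hv.
  pose eta := 3 * (d / mu).
  have eta0 : 0 < eta by rewrite mulr_gt0 ?divr_gt0.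
  have etar : `|c t - u0| + eta <= r.
    have : d / mu <= r / 16 by rewrite ler_pdivrMr//; move: sh h0r; lra.
    rewrite /eta; move: tr r0; lra.
  have bud : `|c t - c t| + rdist (gamma t) (gamma s) / mu < eta.
    have dm0 : 0 < d / mu by rewrite divr_gt0.
    by rewrite subrr normr0 add0r U// -/d /eta; lra.
  have Q := quad_rdist M_connected mb (v t) eta0 etar Dt bud.
  rewrite U// -/d -/A -/N in Q.
  have Qt : quad i (c t) (v t) (c t) = 0.
    by rewrite /quad subrr mx_inner0r -(scale0r (0 : 'rV_n)) gamZl mul0r mulr0 addr0.
  rewrite Qt subr0 in Q.
  have Qs : quad i (c t) (v t) (c s) = (s - t) * N + mx_inner (g (c t)) (v t) e
       + 2^-1 * gam i (c t) k k (v t).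
    rewrite /quad -/k; congr (_ + _); rewrite /N /cinner -mx_innerZr -mx_innerDr.
    by congr mx_inner; rewrite /e addrC subrK.
  have E1 : `|mx_inner (g (c t)) (v t) e| <= C * K * `|v t| * d ^+ 2.
    apply: le_trans (mb_bound mb _ _ mr) _.
    have -> : C * K * `|v t| * d ^+ 2 = C * `|v t| * (K * d ^+ 2) by ring.
    by rewrite ler_wpM2l// mulr_ge0.
  have E2 : `|2^-1 * gam i (c t) k k (v t)| <= C * `|v t| / mu ^+ 2 * d ^+ 2.
    rewrite normrM ger0_norm ?invr_ge0// ler_pdivrMl//.
    apply: le_trans (gam_bound mb _ _ _ mr) _.
    have -> : 2 * (C * `|v t| / mu ^+ 2 * d ^+ 2) = 2 * C * (d / mu * (d / mu)) * `|v t|.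
      by field; rewrite gt_eqF.
    rewrite ler_wpM2r// -mulrA ler_wpM2l ?mulr_ge0//.
    by rewrite ler_pM.
  have E3 : d * N <= (1 + A * eta ^+ 2) * Num.sqrt N * d + C * K * `|v t| * d ^+ 2
       + C * `|v t| / mu ^+ 2 * d ^+ 2.
    have -> : d * N = `|(s - t) * N| by rewrite normrM (ger0_norm N0).
    have -> : (s - t) * N = quad i (c t) (v t) (c s) - mx_inner (g (c t)) (v t) e
       - 2^-1 * gam i (c t) k k (v t) by rewrite Qs; ring.
    apply: le_trans (ler_normB _ _) _; apply: lerD => //.
    by apply: le_trans (ler_normB _ _) _; apply: lerD.
  rewrite -(ler_pM2l d0); apply: le_trans E3 _.
  have d1 : d <= 1 by exact: le_trans sh h01.
  have -> : (1 + A * eta ^+ 2) * Num.sqrt N * d =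
      d * Num.sqrt N + d ^+ 2 * d * (9 * A / mu ^+ 2 * Num.sqrt N).
    by rewrite /eta; field; rewrite gt_eqF.
  have : d ^+ 2 * d * (9 * A / mu ^+ 2 * Num.sqrt N) <= d ^+ 2 * (9 * A / mu ^+ 2 * Num.sqrt N).
    apply: ler_wpM2r; first by apply: mulr_ge0 => //; apply: divr_ge0; [exact: mulr_ge0|rewrite exprn_ge0// ltW].
    by rewrite ler_piMr ?exprn_ge0// ltW.
  rewrite mulrDr; set a1 := 9 * A / _ * _; set a2 := C * K * _; set a3 := C * _ / _.
  rewrite !mulrDl !mulrDr expr2; move: a1 a2 a3 (Num.sqrt N) => *; lra.
have N2 : 1 <= N.
  (* [B1] collects the error of replacing [k] by [(s - t) v t] and the drift of the metric from
     [c t] to the midpoint [m]; [B2] is the cubic error of [segment_upper]. *)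
  pose B1 := 2 * C * K * `|v t| + C * K ^+ 2 + 4 * C / mu ^+ 3.
  pose B2 := C / mu ^+ 4.
  apply: (@limit_le t _ _ (B1 + 2 * B2) h0 tab h00).
  move=> s sab st sh; have [Ds sr] := B sab.
  set d := `|s - t| in sh *; have d0 : 0 < d by rewrite normr_gt0 subr_eq0.
  have d1 : d <= 1 by exact: le_trans sh h01.
  pose k := c s - c t; have kd : `|k| <= d / mu by exact: kb.
  pose e := k - (s - t) *: v t; have ed : `|e| <= K * d ^+ 2.
    by rewrite /d real_normK ?num_real//; exact: Hv.
  pose u := 2^-1 *: k; pose m := c t + u.
  have ud : `|u| <= d / mu.
    rewrite normrZ ger0_norm ?invr_ge0//; have := normr_ge0 k; move: kd; set x := `|k|; lra.
  have m1 : m - u = c t by rewrite /m addrK.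
  have m2 : m + u = c s.
    by apply/rowP => j; rewrite /m /u /k !(rvDE, rvNE, rvZE); field.
  have ctr : `|m - u - u0| < r by rewrite m1; move: tr r0; lra.
  have csr : `|m + u - u0| < r by rewrite m2; move: sr r0; lra.
  have mr' : `|m - u0| <= r.
    have -> : m - u0 = 2^-1 *: ((c t - u0) + (c s - u0)).
      by apply/rowP => j; rewrite /m /u /k !(rvDE, rvNE, rvZE); field.
    rewrite normrZ ger0_norm ?invr_ge0//.
    have := ler_normD (c t - u0) (c s - u0); move: tr sr r0; lra.
  have un0 : u != 0.
    apply/eqP => u00; have : gamma t = gamma s.
      by rewrite -(chart_funK Dt) -(chart_funK Ds) -m1 -m2 u00 subr0 addr0.
    by move=> E; have := U tab sab; rewrite E rdistxx -/d => /eqP; rewrite lt_eqF.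
  have S := segment_upper mb ctr csr mr' un0.
  rewrite m1 m2 !chart_funK// U// -/d in S.
  have u3 : C / mu * `|u| ^+ 3 <= B2 * d ^+ 3.
    have -> : B2 * d ^+ 3 = C / mu * (d / mu) ^+ 3 by rewrite /B2; field; rewrite gt_eqF.
    rewrite ler_wpM2l ?divr_ge0 ?(ltW mu0)// lerXn2r ?nnegrE// divr_ge0 ?(ltW d0) ?(ltW mu0)//.
  have G1 : mx_inner (g m) u u <= mx_inner (g (c t)) u u + C * (d / mu) ^+ 3.
    have mc : m - c t = u by rewrite /m addrAC subrr add0r.
    have := mb_lip mb u u mr' mr; rewrite mc => /ler_normlP [_].
    have : C * `|u| * `|u| * `|u| <= C * (d / mu) ^+ 3.
      have -> : C * `|u| * `|u| * `|u| = C * `|u| ^+ 3 by ring.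
      by rewrite ler_wpM2l// lerXn2r ?nnegrE// divr_ge0 ?(ltW d0) ?(ltW mu0).
    lra.
  have G2 : 4 * mx_inner (g (c t)) u u = mx_inner (g (c t)) k k.
    by rewrite /u mx_innerZl mx_innerZr; field.
  have G3 : mx_inner (g (c t)) k k <= d ^+ 2 * (N + (2 * C * K * `|v t| + C * K ^+ 2) * d).
    have kE : k = (s - t) *: v t + e by rewrite /e addrC subrK.
    clearbody e; rewrite kE mx_innerDl !mx_innerDr !mx_innerZl !mx_innerZr -/(cinner i _ _ _) -/N.
    rewrite (mx_innerC e (v t) (mb_sym mb mr)).
    have b1 : (s - t) * mx_inner (g (c t)) (v t) e <= d * (C * `|v t| * (K * d ^+ 2)).
      apply: le_trans (ler_norm _) _; rewrite normrM -/d ler_wpM2l ?(ltW d0)//.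
      by apply: le_trans (mb_bound mb _ _ mr) _; rewrite ler_wpM2l// mulr_ge0.
    have b2 : mx_inner (g (c t)) e e <= C * (K * d ^+ 2) * (K * d ^+ 2) .
      apply: le_trans (ler_norm _) _; apply: le_trans (mb_bound mb _ _ mr) _.
      by rewrite !ler_pM ?mulr_ge0.
    have b3 : C * (K * d ^+ 2) * (K * d ^+ 2) <= d ^+ 2 * (C * K ^+ 2 * d).
      have -> : C * (K * d ^+ 2) * (K * d ^+ 2) = d * (d ^+ 2 * (C * K ^+ 2 * d)) by ring.
      by rewrite ler_piMl// !mulr_ge0 ?exprn_ge0// ltW.
    have b4 : (s - t) * ((s - t) * N) = d ^+ 2 * N by rewrite mulrA -expr2 /d real_normK ?num_real.
    have b5 : d ^+ 2 * (N + (2 * C * K * `|v t| + C * K ^+ 2) * d) =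
       d ^+ 2 * N + 2 * (d * (C * `|v t| * (K * d ^+ 2))) + d ^+ 2 * (C * K ^+ 2 * d) by ring.
    rewrite b5 b4; move: b1 b2 b3; lra.
  have G4 : 4 * mx_inner (g m) u u <= d ^+ 2 * (N + B1 * d).
    have -> : d ^+ 2 * (N + B1 * d) = d ^+ 2 * (N + (2 * C * K * `|v t| + C * K ^+ 2) * d)
       + 4 * (C * (d / mu) ^+ 3) by rewrite /B1; field; rewrite gt_eqF.
    by move: G1 G2 G3; lra.
  have B10 : 0 <= B1 by rewrite /B1 !addr_ge0 ?mulr_ge0 ?invr_ge0 ?exprn_ge0 ?(ltW mu0).
  have NB : 0 <= N + B1 * d by rewrite addr_ge0// mulr_ge0// ltW.
  have G5 : 2 * Num.sqrt (mx_inner (g m) u u) <= d * ((1 + (N + B1 * d)) / 2).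
    have -> : 2 * Num.sqrt (mx_inner (g m) u u) = Num.sqrt (4 * mx_inner (g m) u u).
      rewrite sqrtrM//; congr (_ * _).
      have -> : (4 : R) = 2 ^+ 2 by ring.
      by rewrite sqrtr_sqr ger0_norm.
    apply: (@le_trans _ _ (d * Num.sqrt (N + B1 * d))).
      have -> : d * Num.sqrt (N + B1 * d) = Num.sqrt (d ^+ 2 * (N + B1 * d)).
        by rewrite [RHS](sqrtrM _ (sqr_ge0 d)) sqrtr_sqr (ger0_norm (ltW d0)).
      exact: ler_wsqrtr.
    by rewrite ler_wpM2l ?(ltW d0)//; exact: sqrt_le_half.
  have B20 : 0 <= B2 by rewrite /B2 mulr_ge0 ?invr_ge0 ?exprn_ge0 ?(ltW mu0).
  have d3 : B2 * d ^+ 3 <= d * (B2 * d).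
    have -> : B2 * d ^+ 3 = d * (d * (B2 * d)) by ring.
    by rewrite ler_wpM2l ?(ltW d0)// ler_piMl// mulr_ge0// ltW.
  have : d * 1 <= d * ((1 + (N + B1 * d)) / 2 + B2 * d) by rewrite mulr1 mulrDr; lra.
  rewrite ler_pM2l//; lra.
apply/eqP; rewrite eq_le N2 andbT.
have sN1 : 0 < Num.sqrt N by rewrite sqrtr_gt0 (lt_le_trans ltr01).
have : Num.sqrt N <= 1 by rewrite -(ler_pM2l sN1) -expr2 sN mulr1.
by move=> H; apply: le_trans N1 H.
Qed.

End Velocity.
End LocalPaths.

(** * First variation of length *)

(** The vanishing of the integral of [th F + th' P] is phrased with a primitive [N]. For a primitive
    [A] of [F], integration by parts says that [D = P - A] is orthogonal to every [th']. The choice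
    [th' = D - c0], with [c0] the mean of [D] so that [th] vanishes at both ends, forces [D] to be
    constant. *)
Lemma du_bois_reymond (R : realType) (F P : R -> R) (a b e : R) : a < b -> 0 < e ->
  (forall t, a - e < t < b + e -> {for t, continuous F}) ->
  (forall t, a - e < t < b + e -> {for t, continuous P}) ->
  (forall (th dth N : R -> R) (d : R), 0 < d -> d < e -> (forall t, a - d < t < b + d -> is_derive t 1 th (dth t)) ->
     (forall t, a - d < t < b + d -> {for t, continuous dth}) -> th a = 0 -> th b = 0 ->
     (forall t, a - d < t < b + d -> is_derive t 1 N (th t * F t + dth t * P t)) -> N b = N a) ->
  forall t, a < t < b -> is_derive t 1 P (F t).
Proof.
move=> ab e0 cF cP H t /andP[at_ tb].
have [A HA] : exists A, forall t, a - e / 2 < t < b + e / 2 -> is_derive t 1 A (F t).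
  apply: antiderivative; first by lra.
  by move=> s /andP[s1 s2]; apply: cF; apply/andP; split; lra.
have cA s : a - e / 2 < s < b + e / 2 -> {for s, continuous A}.
  by move=> sab; exact: (is_derive_continuous (HA s sab)).
pose D s := P s - A s.
have cD s : a - e / 2 < s < b + e / 2 -> {for s, continuous D}.
  move=> sab; have /andP[s1 s2] := sab; apply: (@cvgB _ _ _ _ _ _ _ _ _ _ (cA s sab)).
  by apply: cP; apply/andP; split; lra.
have [DD HD] : exists DD, forall t, a - e / 4 < t < b + e / 4 -> is_derive t 1 DD (D t).
  apply: antiderivative; first by lra.
  by move=> s /andP[s1 s2]; apply: cD; apply/andP; split; lra.
pose c0 := (DD b - DD a) / (b - a).
have ba : b - a != 0 by rewrite subr_eq0 gt_eqF.
pose dth s := D s - c0.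
pose th s := DD s - DD a - c0 * (s - a).
have cdth s : a - e / 2 < s < b + e / 2 -> {for s, continuous dth}.
  by move=> sab; apply: (@cvgB _ _ _ _ _ _ _ _ _ (cD s sab)); exact: cvg_cst.
have HT s : a - e / 4 < s < b + e / 4 -> is_derive s 1 th (dth s).
  move=> sab; have H1 := HD s sab.
  have H2 : is_derive s (1 : R) (fun s : R => DD a + c0 * (s - a)) (c0 : R).
    have -> : (fun s : R => DD a + c0 * (s - a)) = (fun s => (DD a - c0 * a) + s *: c0).
      by apply/funext => x; rewrite /GRing.scale /=; ring.
    apply/is_derive_eps => ep ep0; exists 1 => // h _.
    have -> : DD a - c0 * a + (h *: 1 + s) *: c0 - (DD a - c0 * a + s *: c0) - h *: c0 = 0.
      by rewrite /GRing.scale /=; ring.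
    by rewrite normr0 mulr_ge0// ltW.
  have -> : th = DD - (fun s => DD a + c0 * (s - a)) by apply/funext => x; rewrite /th !fctE; ring.
  exact: is_deriveB.
have [E HE] : exists E, forall t, a - e / 8 < t < b + e / 8 -> is_derive t 1 E (dth t ^+ 2).
  apply: antiderivative; first by lra.
  move=> s /andP[s1 s2]; have sab : a - e / 2 < s < b + e / 2 by apply/andP; split; lra.
  have -> : (fun t => dth t ^+ 2) = dth * dth by apply/funext => x; rewrite expr2.
  exact: (cvgM (cdth s sab) (cdth s sab)).
have Nd s : a - e / 8 < s < b + e / 8 ->
    is_derive s 1 (fun s => th s * A s + c0 * th s + E s) (th s * F s + dth s * P s).
  move=> /andP[s1 s2].
  have sab : a - e / 2 < s < b + e / 2 by apply/andP; split; lra.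
  have sab4 : a - e / 4 < s < b + e / 4 by apply/andP; split; lra.
  have sab8 : a - e / 8 < s < b + e / 8 by apply/andP; split; lra.
  have H1 := HT s sab4; have H2 := HA s sab; have H3 := HE s sab8.
  have H4 := is_deriveM H1 H2; have H5 := is_deriveZ c0 H1.
  have H6 := is_deriveD (is_deriveD H4 H5) H3.
  apply: is_derive_eq H6 _; rewrite /GRing.scale /= /dth /D; ring.
have tha : th a = 0 by rewrite /th !subrr mulr0 subrr.
have thb : th b = 0 by rewrite /th /c0 divfK// subrr.
have EE : E b = E a.
  have e8 : 0 < e / 8 by lra.
  have e8' : e / 8 < e by lra.
  have := H th dth _ (e / 8) e8 e8' _ _ tha thb Nd; rewrite /= tha thb !mul0r mulr0 !add0r; apply.
  - by move=> s /andP[s1 s2]; apply: HT; apply/andP; split; lra.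
  - by move=> s /andP[s1 s2]; apply: cdth; apply/andP; split; lra.
have Emono s s' : a <= s -> s <= s' -> s' <= b -> E s <= E s'.
  move=> sa ss sb; apply: (@ge0_derive_le _ _ (fun t => dth t ^+ 2)) => //.
    by move=> u /andP[u1 u2]; apply: HE; apply/andP; split; lra.
  by move=> u _; exact: sqr_ge0.
have Ec s : a <= s <= b -> E s = E a.
  move=> /andP[sa sb]; apply/eqP; rewrite eq_le -{1}EE.
  by rewrite !Emono// ltW.
have Dc s : a < s < b -> D s = c0.
  move=> sab; have /andP[s1 s2] := sab.
  have H1 : is_derive s 1 E (dth s ^+ 2) by apply: HE; apply/andP; split; lra.
  have H2 : is_derive s 1 E 0.
    have H2 : is_derive s (1 : R) (fun=> E a : R) (0 : R) by exact: is_derive_cst.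
    apply: near_eq_is_derive H2; near=> u; rewrite Ec//.
    have : a < u < b by near: u; exact: itv_oo_near.
    by move=> /andP[u1 u2]; rewrite !ltW.
  have := @derive_val _ _ _ _ _ _ _ H1; rewrite (@derive_val _ _ _ _ _ _ _ H2).
  by move=> /esym /eqP; rewrite sqrf_eq0 subr_eq0 => /eqP.
have tab : a - e / 2 < t < b + e / 2 by apply/andP; split; lra.
have H1 := HA t tab.
have H2 : is_derive t (1 : R) (fun=> c0 : R) (0 : R) by exact: is_derive_cst.
have H3 := is_deriveD H1 H2; rewrite addr0 in H3.
apply: near_eq_is_derive H3; near=> u; rewrite fctE -(Dc u) /D; first by ring.
by near: u; apply: itv_oo_near; apply/andP.
Unshelve. all: by end_near. Qed.

Lemma scale_derive (R : realType) (n : nat) (f : R -> R) (df t : R) (w : 'rV[R]_n) :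
  is_derive t 1 f df -> is_derive t 1 (fun s => f s *: w) (df *: w).
Proof.
move=> H; apply/is_derive_rV => k.
have -> : (fun s => (f s *: w) 0 k) = w 0 k *: f.
  by apply/funext => s; rewrite rvZE fctE /GRing.scale /= mulrC.
rewrite rvZE mulrC; exact: is_deriveZ.
Qed.

Lemma scale_continuous (R : realType) (n : nat) (f : R -> R) (t : R) (w : 'rV[R]_n) :
  {for t, continuous f} -> {for t, continuous (fun s => f s *: w)}.
Proof. by move=> H; apply: (@cvgZr_tmp _ _ _ _ _ _ _ _ H). Qed.

Lemma itv_bound (R : realType) (f : R -> R) (a b : R) : a <= b ->
  (forall t, a <= t <= b -> {for t, continuous f}) ->
  exists2 T : R, 1 <= T & forall t, a <= t <= b -> `|f t| <= T.
Proof.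
move=> ab cf.
have cw : {within `[a, b], continuous (fun t => `|f t|)}.
  by apply: within_continuousP => t tab; exact: (cvg_norm (cf t tab)).
have [c _ Hc] := EVT_max ab cw.
exists (Num.max 1 `|f c|); first by rewrite le_max lexx.
by move=> t tab; rewrite le_max Hc ?orbT// in_itv.
Qed.

Lemma mx_inner_evec (R : realType) (n : nat) (G : 'M[R]_n) x y :
  mx_inner G (evec x) (evec y) = G x y.
Proof.
rewrite mx_innerE (bigD1 x)//= (bigD1 y)//= !evecE !eqxx mul1r mulr1 !big1 ?addr0// => z zn.
  by rewrite big1// => w _; rewrite evecE (negPf zn) !mul0r.
by rewrite evecE (negPf zn) mulr0.
Qed.

Lemma mx_inner_evecr (R : realType) (n : nat) (G : 'M[R]_n) (u : 'rV[R]_n) k :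
  mx_inner G u (evec k) = (u *m G) 0 k.
Proof.
rewrite /mx_inner mxE (bigD1 k)//= big1 ?addr0 => [|j jk]; rewrite !mxE.
  by rewrite !eqxx mulr1.
by rewrite (negPf jk) mulr0.
Qed.

(** A factor that vanishes at [t] makes the product differentiable although the other factor is
    merely continuous; in [velocity_derive] the other factor is the velocity, not yet known to be
    differentiable. *)
Lemma derive_vanishing (R : realType) (f h : R -> R) (t df : R) : is_derive t 1 f df ->
  f t = 0 -> {for t, continuous h} -> is_derive t 1 (fun s => f s * h s) (df * h t).
Proof.
move=> /is_derive_eps fd f0 /continuous_eps hc; apply/is_derive_eps => e e0.
pose q : R := Num.min 1 (e / (2 * (`|h t| + 1))).
have H1 : 0 < `|h t| + 1 by rewrite ltr_wpDl.
have q0 : 0 < q by rewrite lt_min ltr01 divr_gt0// mulr_gt0.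
have q1 : q <= 1 by rewrite ge_min lexx.
have qe : q * (`|h t| + 1) <= e / 2.
  by rewrite -ler_pdivlMr// /q ge_min; apply/orP; right; rewrite -mulrA -invfM.
have D1 : 0 < `|df| + 1 by rewrite ltr_wpDl.
pose p : R := Num.min 1 (e / (2 * (`|df| + 1))).
have p0 : 0 < p by rewrite lt_min ltr01 divr_gt0// mulr_gt0.
have p1 : p <= 1 by rewrite ge_min lexx.
have pe : p * (`|df| + 1) <= e / 2.
  by rewrite -ler_pdivlMr// /p ge_min; apply/orP; right; rewrite -mulrA -invfM.
have [d1 d10 H] := fd q q0; have [d2 d20 H'] := hc p p0.
exists (Num.min d1 d2) => [|k]; first by rewrite lt_min d10.
rewrite lt_min => /andP[k1 k2]; have := H k k1; have := H' (k *: 1 + t).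
rewrite addrK /GRing.scale /= mulr1 f0 mul0r !subr0 => /(_ k2) H2 H3.
have -> : f (k + t) * h (k + t) - k * (df * h t) =
  (f (k + t) - k * df) * h (k + t) + k * (df * (h (k + t) - h t)) by ring.
apply: le_trans (ler_normD _ _) _.
have hb : `|h (k + t)| <= `|h t| + 1.
  have -> : h (k + t) = h t + (h (k + t) - h t) by rewrite subrKC.
  by apply: le_trans (ler_normD _ _) _; rewrite lerD2l (le_trans H2).
have -> : e * `|k| = e / 2 * `|k| + e / 2 * `|k| by field.
rewrite !normrM; apply: lerD.
  apply: (@le_trans _ _ (q * `|k| * (`|h t| + 1))); first by rewrite ler_pM.
  by rewrite mulrAC ler_wpM2r.
rewrite mulrC ler_wpM2r//; apply: le_trans pe; rewrite [X in _ <= X]mulrC.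
by rewrite ler_pM// lerDl.
Qed.

Lemma is_derive_bigsum (R : realType) (m : nat) (F : 'I_m -> R -> R) (dF : 'I_m -> R) (t : R) :
  (forall k, is_derive t 1 (F k) (dF k)) -> is_derive t 1 (fun s => \sum_k F k s) (\sum_k dF k).
Proof.
move=> H; have -> : (fun s => \sum_k F k s) = \sum_k F k.
  by apply/funext => s; rewrite fct_sumE.
by apply: is_derive_sum => k; exact: (H k).
Qed.

Section FirstVariation.
Context {R : realType} {n : nat} (M : riemannianManifold R n).
Variables (i : rm_index M) (u0 : 'rV[R]_n) (r lam C : R).
Hypothesis mb : metric_ball (metric i) (chart_codom (atlas i)) u0 r lam C.
Local Notation g := (metric i).
Local Notation mu := (Num.sqrt lam).
Local Notation phi := (atlas i).
Variables (gamma : R -> M) (a b : R) (v : R -> 'rV[R]_n).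
Local Notation c := (fun t => phi (gamma t)).
Hypothesis U : unit_path gamma a b.
Hypothesis B : path_in_ball i u0 r gamma a b.
Hypothesis vd : forall t, a < t < b -> is_derive t 1 c (v t).
Hypothesis vc : forall t, a < t < b -> {for t, continuous v}.
Hypothesis vn : forall t, a < t < b -> cinner i (c t) (v t) (v t) = 1.

Let lam0 : 0 < lam. Proof. exact: (mb_lam mb). Qed.
Let mu0 : 0 < mu. Proof. by rewrite sqrtr_gt0. Qed.
Let C0 : 0 <= C. Proof. exact: le_trans ler01 (mb_C mb). Qed.
Let r0 : 0 < r. Proof. exact: (mb_r mb). Qed.

Let oc t : a < t < b -> a <= t <= b.
Proof. by move=> /andP[h1 h2]; rewrite !ltW. Qed.

Let cr t : a < t < b -> `|c t - u0| <= r.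
Proof. by move=> /oc tab; have [_ H] := B tab; move: r0 H; lra. Qed.

Lemma unit_velocity_bound t : a < t < b -> `|v t| <= mu^-1.
Proof.
move=> tab; have := mu_norm_le mb (v t) (cr tab); rewrite vn// sqrtr1 => H.
by rewrite -(ler_pM2l mu0) mulfV// gt_eqF.
Qed.

(* The length of the variation [c + eps th e_k] is at most the integral of
   [(1 + |c'|^2) / 2], whose derivative in [eps] is [(N b - N a) / 2]. *)
Lemma first_variation k (a1 b1 d : R) (th dth N : R -> R) :
  a1 < b1 -> 0 < d -> a < a1 - d -> b1 + d < b ->
  (forall t, a1 - d < t < b1 + d -> is_derive t 1 th (dth t)) ->
  (forall t, a1 - d < t < b1 + d -> {for t, continuous dth}) -> th a1 = 0 -> th b1 = 0 ->
  (forall t, a1 - d < t < b1 + d -> is_derive t 1 N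
     (th t * dG i (c t) (evec k) (v t) (v t) +
      dth t * (2 * mx_inner (g (c t)) (v t) (evec k)))) ->
  N b1 = N a1.
Proof.
move=> ab1 d0 ad bd thd dthc tha thb Nd.
pose e : R := d / 2.
have sub t : a1 - d < t < b1 + d -> a < t < b.
  by move=> /andP[h1 h2]; apply/andP; split; lra.
have sube t : a1 - e <= t <= b1 + e -> a1 - d < t < b1 + d.
  by rewrite /e => /andP[h1 h2]; apply/andP; split; lra.
have ae : a1 - e <= b1 + e by rewrite /e; lra.
have [T1 T11 HT1] : exists2 T : R, 1 <= T & forall t, a1 - e <= t <= b1 + e -> `|th t| <= T.
  apply: itv_bound => // t /sube tt; have H := thd t tt; exact: (is_derive_continuous H).
have [T2 T21 HT2] : exists2 T : R, 1 <= T & forall t, a1 - e <= t <= b1 + e -> `|dth t| <= T.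
  by apply: itv_bound => // t /sube tt; exact: dthc.
pose T := T1 + T2.
have T0 : 0 < T by rewrite /T; lra.
have T1T t : a1 - e <= t <= b1 + e -> `|th t| <= T by move=> /HT1; rewrite /T; lra.
have T2T t : a1 - e <= t <= b1 + e -> `|dth t| <= T by move=> /HT2; rewrite /T; lra.
pose V := mu^-1.
have V0 : 0 < V by rewrite invr_gt0.
(* After division by [ep ^+ 2] the four terms bound [g(kk, kk)], [2 dg(h)(v, kk)], [dg(h)(kk, kk)]
   and the Taylor remainder of the metric; the terms of first order in [ep] go into [N]. *)
pose B0 := C * T ^+ 2 + 2 * C * T ^+ 2 * V + C * T ^+ 3 + C * T ^+ 2 * (V + T) ^+ 2.
have T0' := ltW T0; have V0' := ltW V0; have VT := addr_ge0 V0' T0'.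
have B00 : 0 <= B0 by rewrite /B0; do !apply: addr_ge0; rewrite ?mulr_ge0 ?exprn_ge0.
have key (ep : R) : `|ep| <= 1 -> `|ep| * T <= r / 2 ->
    0 <= ep * (N b1 - N a1) + B0 * ep ^+ 2 * (b1 - a1).
  move=> ep1 epT.
  pose h t := (ep * th t) *: evec k : 'rV[R]_n.
  pose kk t := (ep * dth t) *: evec k : 'rV[R]_n.
  pose cv t := c t + h t.
  have hb t : a1 - e <= t <= b1 + e -> `|h t| <= `|ep| * T.
    move=> tt; rewrite normrZ; apply: le_trans (ler_piMr _ (norm_evec _)) _ => //.
    by rewrite normrM ler_wpM2l// T1T.
  have kb t : a1 - e <= t <= b1 + e -> `|kk t| <= `|ep| * T.
    move=> tt; rewrite normrZ; apply: le_trans (ler_piMr _ (norm_evec _)) _ => //.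
    by rewrite normrM ler_wpM2l// T2T.
  have cvr t : a1 - e <= t <= b1 + e -> `|cv t - u0| <= r.
    move=> tt; have [_ H] := B (oc (sub _ (sube _ tt))).
    rewrite /cv addrAC; apply: le_trans (ler_normD _ _) _.
    have := hb t tt; move: r0 H epT; lra.
  have cvd t : a1 - e < t < b1 + e -> is_derive t 1 cv (v t + kk t).
    move=> tt; have tt' : a1 - d < t < b1 + d.
      by apply: sube; move/andP: tt => [h1 h2]; rewrite !ltW.
    have H1 := vd (sub _ tt').
    have H2 : is_derive t 1 (fun t => ep * th t) (ep * dth t).
      by have H := thd t tt'; exact: (is_deriveZ ep H).
    exact: (is_deriveD H1 (scale_derive _ H2)).
  have cvdc t : a1 - e < t < b1 + e -> {for t, continuous cv^`()}.
    move=> tt; have tt' : a1 - d < t < b1 + d.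
      by apply: sube; move/andP: tt => [h1 h2]; rewrite !ltW.
    apply: (near_eq_continuous (f := fun s => v s + kk s)).
      near=> s; apply/esym/derive1_val/cvd; near: s; exact: itv_oo_near.
    apply: (@cvgD _ _ _ _ _ _ _ _ _ (vc (sub _ tt'))).
    have H3 : {for t, continuous (fun s => ep * dth s)}.
      by have H := dthc t tt'; apply: continuousM => //; exact: cst_continuous.
    exact: (scale_continuous (w := evec k) H3).
  have ce t : a1 <= t <= b1 -> a1 - e < t < b1 + e.
    by rewrite /e => /andP[h1 h2]; apply/andP; split; lra.
  have ce' t : a1 <= t <= b1 -> a1 - e <= t <= b1 + e.
    by move=> /ce /andP[h1 h2]; rewrite !ltW.
  pose F t := t + (ep * N t + B0 * ep ^+ 2 * t) / 2.
  pose N' t := th t * dG i (c t) (evec k) (v t) (v t) +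
      dth t * (2 * mx_inner (g (c t)) (v t) (evec k)).
  pose f t := 1 + (ep * N' t + B0 * ep ^+ 2) / 2.
  have Fd t : a1 <= t <= b1 -> is_derive t 1 F (f t).
    move=> /ce' /sube tt; have H1 := Nd t tt.
    have H2 := is_deriveZ (ep / 2) H1.
    have H3 : is_derive t (1 : R) (fun t : R => 0 + t *: (1 + B0 * ep ^+ 2 / 2)) (1 + B0 * ep ^+ 2 / 2).
      apply/is_derive_eps => q q0; exists 1 => // x _.
      have -> : 0 + (x *: 1 + t) *: (1 + B0 * ep ^+ 2 / 2) - (0 + t *: (1 + B0 * ep ^+ 2 / 2)) - x *: (1 + B0 * ep ^+ 2 / 2) = 0.
        by rewrite /GRing.scale /=; ring.
      by rewrite normr0 mulr_ge0// ltW.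
    have -> : F = (fun t : R => 0 + t *: (1 + B0 * ep ^+ 2 / 2)) + (ep / 2) *: N.
      by apply/funext => s; rewrite /F !fctE /GRing.scale /=; ring.
    apply: is_derive_eq (is_deriveD H3 H2) _.
    by rewrite /f /N' /GRing.scale /=; ring.
  have Hf t : a1 <= t <= b1 -> Num.sqrt (cinner i (cv t) (derive1 cv t) (derive1 cv t)) <= f t.
    move=> tt; have tt1 := ce t tt; have tt2 := ce' t tt; have tt3 := sub _ (sube _ tt2).
    have H0 := cvd t tt1; rewrite (derive1_val H0).
    have sq0 := inner_ge0 mb (v t + kk t) (cvr t tt2).
    apply: le_trans (sqrt_le_half sq0) _; rewrite /f -/(cinner _ _ _ _).
    have H1 := mb_taylor mb (v t + kk t) (v t + kk t) (cr tt3) (cvr t tt2).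
    rewrite -/(cv t) in H1; move: H1 => /ler_normlP[_].
    set D1 := mx_inner (dmetric _ _ _) _ _.
    have D1E : D1 = ep * th t * dG i (c t) (evec k) (v t) (v t) +
         2 * mx_inner (dmetric g (c t) (h t)) (v t) (kk t) +
         mx_inner (dmetric g (c t) (h t)) (kk t) (kk t).
      rewrite /D1 mx_innerDl !mx_innerDr (mx_innerC (kk t) (v t) (mb_dsym mb _ (cr tt3))).
      by rewrite {1}/h dmetricZ mx_innerZm /dG; ring.
    have G1E : mx_inner (g (c t)) (v t + kk t) (v t + kk t) =
         1 + ep * dth t * (2 * mx_inner (g (c t)) (v t) (evec k)) + mx_inner (g (c t)) (kk t) (kk t).
      rewrite mx_innerDl !mx_innerDr (mx_innerC (kk t) (v t) (mb_sym mb (cr tt3))).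
      by rewrite -/(cinner i (c t) (v t) (v t)) vn// {1 2}/kk !mx_innerZr; ring.
    rewrite D1E G1E => H1.
    have vb := unit_velocity_bound tt3; rewrite -/V in vb.
    have hb' := hb t tt2; have kb' := kb t tt2.
    set E := `|ep| * T in hb' kb' epT *; have E0 : 0 <= E by rewrite mulr_ge0// ltW.
    have ET : E <= T by rewrite ler_piMl// ltW.
    have b1' : mx_inner (g (c t)) (kk t) (kk t) <= C * E * E.
      apply: le_trans (ler_norm _) _; apply: le_trans (mb_bound mb _ _ (cr tt3)) _.
      by rewrite !ler_pM ?mulr_ge0.
    have b2' : mx_inner (dmetric g (c t) (h t)) (v t) (kk t) <= C * E * V * E.
      apply: le_trans (ler_norm _) _; apply: le_trans (mb_dbound mb _ _ _ (cr tt3)) _.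
      by rewrite !ler_pM ?mulr_ge0.
    have b3' : mx_inner (dmetric g (c t) (h t)) (kk t) (kk t) <= C * E * T * E.
      apply: le_trans (ler_norm _) _; apply: le_trans (mb_dbound mb _ _ _ (cr tt3)) _.
      by rewrite !ler_pM ?mulr_ge0//; apply: le_trans kb' ET.
    have b4' : C * `|h t| ^+ 2 * `|v t + kk t| * `|v t + kk t| <= C * E ^+ 2 * (V + T) * (V + T).
      have vk : `|v t + kk t| <= V + T.
        by apply: le_trans (ler_normD _ _) (lerD vb (le_trans kb' ET)).
      by rewrite !ler_pM ?mulr_ge0 ?exprn_ge0// lerXn2r ?nnegrE.
    have E2 : E ^+ 2 = ep ^+ 2 * T ^+ 2 by rewrite /E exprMn real_normK ?num_real.
    have B0E : B0 * ep ^+ 2 = C * E * E + 2 * (C * E * V * E) + C * E * T * E +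
         C * E ^+ 2 * (V + T) * (V + T).
      have -> : C * E * E + 2 * (C * E * V * E) + C * E * T * E +
         C * E ^+ 2 * (V + T) * (V + T) = E ^+ 2 * (C + 2 * C * V + C * T + C * (V + T) ^+ 2) by ring.
      by rewrite E2 /B0; ring.
    rewrite B0E /N' -/(cinner i _ _ _); rewrite /cinner.
    move: H1 b1' b2' b3' b4'; lra.
  have cvC t : a1 - e < t < b1 + e ->
      [/\ chart_codom phi (cv t), derivable cv t 1 & {for t, continuous cv^`()}].
    move=> tt; split; last exact: cvdc.
      by apply: (mb_dom mb); apply: cvr; move/andP: tt => [h1 h2]; rewrite !ltW.
    by have H := cvd t tt; exact: ex_derive.
  have e0 : 0 < e by rewrite /e; lra.
  have [l lF pwl] := chart_curve_length ab1 e0 cvC Fd Hf.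
  have a1o : a < a1 < b by apply: sub; apply: sube; apply: ce'; rewrite lexx ltW.
  have b1o : a < b1 < b by apply: sub; apply: sube; apply: ce'; rewrite lexx ltW.
  have cva : chart_inv phi (cv a1) = gamma a1.
    rewrite /cv /h tha mulr0 scale0r addr0 chart_funK//; exact: (B (oc a1o)).1.
  have cvb : chart_inv phi (cv b1) = gamma b1.
    rewrite /cv /h thb mulr0 scale0r addr0 chart_funK//; exact: (B (oc b1o)).1.
  rewrite cva cvb in pwl; have := rdist_le pwl.
  rewrite (U (oc a1o) (oc b1o)) gtr0_norm ?subr_gt0//.
  move=> /le_trans /(_ lF); rewrite /F; lra.
(* A small [ep] of either sign gives [s * Dl <= O(s ^+ 2)], which is impossible for [Dl > 0] and
   small [s]. *)
apply/eqP; rewrite -subr_eq0 -normr_le0 leNgt; apply/negP => D0.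
set Dl := `|N b1 - N a1| in D0.
pose L := B0 * (b1 - a1) + 1.
have L0 : 0 < L by rewrite ltr_wpDl// mulr_ge0// subr_ge0 ltW.
pose s : R := Num.min 1 (Num.min (r / 2 / T) (Dl / 2 / L)).
have s0 : 0 < s by rewrite !lt_min ltr01 !divr_gt0.
have s1 : s <= 1 by rewrite ge_min lexx.
have s2 : s * T <= r / 2 by rewrite -ler_pdivlMr// !ge_min lexx orbT.
have s3 : s * L <= Dl / 2 by rewrite -ler_pdivlMr// !ge_min lexx !orbT.
have : s * Dl <= B0 * s ^+ 2 * (b1 - a1).
  have k1 : 0 <= s * (N b1 - N a1) + B0 * s ^+ 2 * (b1 - a1).
    by apply: key; rewrite (ger0_norm (ltW s0)).
  have k2 : 0 <= - s * (N b1 - N a1) + B0 * (- s) ^+ 2 * (b1 - a1).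
    by apply: key; rewrite normrN (ger0_norm (ltW s0)).
  rewrite sqrrN mulNr addrC subr_ge0 in k2; rewrite /Dl; have [h|h] := ger0P (N b1 - N a1) => //.
  by rewrite mulrN -subr_ge0 opprK addrC.
have -> : B0 * s ^+ 2 * (b1 - a1) = s * (s * L - s) by rewrite /L; ring.
rewrite ler_pM2l//; move: s3 s0 D0; lra.
Unshelve. all: by end_near. Qed.

(** The Euler-Lagrange equation of the energy in the direction [evec k]: on a small interval around
    [t], [first_variation] is the weak equation to which [du_bois_reymond] applies. *)
Lemma momentum_derive k t : a < t < b ->
  is_derive t 1 (fun t => 2 * mx_inner (g (c t)) (v t) (evec k)) (dG i (c t) (evec k) (v t) (v t)).
Proof.
move=> /andP[at_ tb].
pose d : R := Num.min (t - a) (b - t) / 4.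
have d0 : 0 < d by rewrite divr_gt0// lt_min !subr_gt0 at_.
have da : 4 * d <= t - a by rewrite mulrC divfK// ge_min lexx.
have db : 4 * d <= b - t by rewrite mulrC divfK// ge_min lexx orbT.
have sub s : t - d - d < s < t + d + d -> a < s < b.
  by move=> /andP[h1 h2]; apply/andP; split; lra.
have cvec s : {for s, continuous (fun _ : R => @evec R n k)} by exact: cst_continuous.
have entries s x y : a < s < b -> {for s, continuous (fun s => g (c s) x y)}.
  move=> sab; have H := mb_derive mb x y (cr sab) (vd sab); exact: (is_derive_continuous H).
have dentries s x y : a < s < b -> {for s, continuous (fun s => dmetric g (c s) (evec k) x y)}.
  move=> sab; apply/continuous_eps => e e0.
  have cs : {for s, continuous c} by have H := vd sab; exact: (is_derive_rV_continuous H).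
  have C1 : 0 < C by exact: lt_le_trans ltr01 (mb_C mb).
  have [d1 d10 Hd] := (continuous_eps _ _).1 cs (e / C) (divr_gt0 e0 C1).
  have /andP[sa sb] := sab; exists (Num.min d1 (Num.min (s - a) (b - s))).
    by rewrite !lt_min d10 !subr_gt0 sa.
  move=> s'; rewrite !lt_min => /and3P[h1 h2 h3].
  have sab' : a < s' < b.
    by move: h2 h3; rewrite !ltr_norml => /andP[? ?] /andP[? ?]; apply/andP; split; lra.
  have := mb_dlip mb (evec k) (evec x) (evec y) (cr sab') (cr sab).
  rewrite [X in `|X - _|]mx_inner_evec [X in `|_ - X|]mx_inner_evec => /le_trans; apply.
  have H := Hd s' h1.
  have -> : e = C * (e / C) * 1 * 1 * 1 by field; rewrite gt_eqF.
  by rewrite !ler_pM ?mulr_ge0 ?norm_evec.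
have tdd : t - d < t + d by lra.
have tt : t - d < t < t + d by apply/andP; split; lra.
pose F s := dG i (c s) (evec k) (v s) (v s).
pose P s := 2 * mx_inner (g (c s)) (v s) (evec k).
have cF s : t - d - d < s < t + d + d -> {for s, continuous F}.
  by move=> /sub sab; exact: (continuous_inner (fun x y => dentries s x y sab) (vc sab) (vc sab)).
have cP s : t - d - d < s < t + d + d -> {for s, continuous P}.
  move=> /sub sab; apply: continuousM; first exact: cst_continuous.
  exact: (continuous_inner (fun x y => entries s x y sab) (vc sab) (cvec s)).
apply: (du_bois_reymond (F := F) (P := P) tdd d0 cF cP _ tt).
move=> th dth N d1 d10 d1d thd dthc tha thb Nd.
by apply: (first_variation tdd d10 _ _ thd dthc tha thb Nd); lra.
Qed.
(** The right-hand side of the geodesic equation: minus the Christoffel form [gam i x w w] with its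
    index raised by the inverse metric. *)
Definition acceleration (x w : 'rV[R]_n) : 'rV[R]_n :=
  - ((\row_k gam i x w w (evec k)) *m invmx (g x)).

Lemma acceleration_inner x w u : `|x - u0| <= r ->
  mx_inner (g x) (acceleration x w) u = - gam i x w w u.
Proof.
move=> xr; have GU := posdef_unitmx lam0 (fun v => mb_pos mb v xr).
rewrite /acceleration mx_innerNl; congr (- _); rewrite /mx_inner mulmxKV// mxE.
rewrite [RHS](linear_sum_evec (f := gam i x w w)).
- by apply: eq_bigr => k _; rewrite !mxE mulrC.
- by move=> ? ?; rewrite gamD.
- by move=> ? ?; rewrite gamZ.
Qed.

Lemma velocity_derive t : a < t < b -> is_derive t 1 v (acceleration (c t) (v t)).
Proof.
move=> tab; have tr := cr tab.
have GU := posdef_unitmx lam0 (fun v => mb_pos mb v tr).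
pose Psi k s := (v s *m g (c t)) 0 k.
have PsiD k : is_derive t 1 (Psi k) (- gam i (c t) (v t) (v t) (evec k)).
  have H1 := momentum_derive k tab.
  have H2 : is_derive t 1 (fun s => \sum_x (g (c s) x k - g (c t) x k) * v s 0 x)
      (\sum_x dmetric g (c t) (v t) x k * v t 0 x).
    apply: is_derive_bigsum => x; apply: derive_vanishing.
    - have H := mb_derive mb x k tr (vd tab).
      have H' : is_derive t (1 : R) (fun=> g (c t) x k : R) (0 : R) by exact: is_derive_cst.
      by apply: is_derive_eq (is_deriveB H H') _; rewrite subr0.
    - by rewrite subrr.
    - exact: ((continuous_rV _ _).2 (vc tab) x).
  have -> : Psi k = 2^-1 *: (fun t => 2 * mx_inner (g (c t)) (v t) (evec k)) -
       (fun s => \sum_x (g (c s) x k - g (c t) x k) * v s 0 x).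
    apply/funext => s; rewrite !fctE /GRing.scale /= mulrA mulVf// mul1r mx_inner_evecr /Psi !mxE.
    by rewrite -sumrB; apply: eq_bigr => x _; ring.
  apply: is_derive_eq (is_deriveB (is_deriveZ 2^-1 H1) H2) _.
  have E : \sum_x dmetric g (c t) (v t) x k * v t 0 x = dG i (c t) (v t) (v t) (evec k).
    by rewrite /dG mx_inner_evecr mxE; apply: eq_bigr => x _; rewrite mulrC.
  by rewrite E /gam /GRing.scale /=; field.
apply/is_derive_rV => j.
have -> : (fun s => v s 0 j) = (fun s => \sum_k invmx (g (c t)) k j * Psi k s).
  apply/funext => s; rewrite -{1}(mulmxK GU (v s)) mxE.
  by apply: eq_bigr => k _; rewrite /Psi mulrC.
have -> : acceleration (c t) (v t) 0 j =
    \sum_k invmx (g (c t)) k j * - gam i (c t) (v t) (v t) (evec k).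
  rewrite /acceleration !mxE -sumrN; apply: eq_bigr => k _.
  by rewrite mxE; ring.
apply: is_derive_bigsum => k; have H := PsiD k; exact: (is_deriveZ _ H).
Qed.

End FirstVariation.

(** * Locally isometric curves are geodesics *)

Section LocalIsometry.
Context {R : realType} {n : nat} (M : riemannianManifold R n).
Hypothesis M_connected : connected [set: M].
Implicit Types (gamma : R -> M) (i : rm_index M) (s t d : R).

(** The metric notion of a unit speed geodesic near [t]. Unlike minimality it is local, so it
    survives extension and gluing. *)
Definition isometric_near gamma t d :=
  forall s s', `|s - t| < d -> `|s' - t| < d -> rdist (gamma s) (gamma s') = `|s' - s|.

Lemma isometric_near_sub gamma t d t' d' : isometric_near gamma t d -> `|t' - t| + d' <= d ->
  isometric_near gamma t' d'.
Proof.
have tr s : `|t' - t| + d' <= d -> `|s - t'| < d' -> `|s - t| < d.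
  move=> td st; apply: le_lt_trans (ler_distD t' _ _) _; short_lra.
by move=> H td s s' /(tr _ td) h1 /(tr _ td) h2; exact: H.
Qed.

Lemma isometric_near_continuous gamma t d : 0 < d -> isometric_near gamma t d ->
  {for t, continuous gamma}.
Proof.
move=> d0 H A /(nbhs_rdistP M_connected) [e e0 HA].
apply/nbhs_ballP; exists (Num.min d e); first by rewrite /= lt_min d0.
move=> s /=; rewrite /ball /= lt_min => /andP[h1 h2]; apply: HA.
by rewrite H ?subrr ?normr0// distrC.
Qed.

Definition geodesic_velocity i gamma (v : R -> 'rV[R]_n) t :=
  [/\ chart_dom (atlas i) (gamma t), is_derive t 1 (fun s => atlas i (gamma s)) (v t),
    is_derive t 1 v (acceleration i (atlas i (gamma t)) (v t)) &
    cinner i (atlas i (gamma t)) (v t) (v t) = 1].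

Lemma isometric_near_velocity i gamma t d : 0 < d -> isometric_near gamma t d ->
  chart_dom (atlas i) (gamma t) ->
  exists v (d' : R), 0 < d' /\ forall s, `|s - t| < d' -> geodesic_velocity i gamma v s.
Proof.
move=> d0 H Dt.
have [r [lam [C mb]]] := good_chart Dt.
have r0 := mb_r mb.
have gc := isometric_near_continuous d0 H.
have [K [h0 [K0 h00 h01 h0r HC]]] := path_C11 M_connected mb.
have [e e0 He] : exists2 e : R, 0 < e & forall s, `|s - t| < e ->
    chart_dom (atlas i) (gamma s) /\ `|atlas i (gamma s) - atlas i (gamma t)| <= r / 4.
  have N1 : \forall s \near t, chart_dom (atlas i) (gamma s).
    by apply: gc; apply: open_nbhs_nbhs; split=> //; exact: chart_dom_open.
  have cc : {for t, continuous (fun s => atlas i (gamma s))}.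
    by apply: continuous_comp => //; exact: chart_fun_continuous.
  have r4 : 0 < r / 4 by rewrite divr_gt0.
  have [d1 d10 H1] := (continuous_eps _ _).1 cc _ r4.
  have /nbhs_ballP [d2 /= d20 H2] := N1.
  exists (Num.min d1 d2); first by rewrite lt_min d10.
  move=> s; rewrite lt_min => /andP[s1 s2]; split; last exact: H1.
  by apply: H2; rewrite /ball /= distrC.
pose d' : R := Num.min (Num.min d e) h0 / 4.
have m0 : 0 < Num.min (Num.min d e) h0 by rewrite !lt_min d0 e0.
have d'0 : 0 < d' by rewrite divr_gt0.
have d'd : 4 * d' <= d by rewrite mulrC divfK// !ge_min lexx.
have d'e : 4 * d' <= e by rewrite mulrC divfK// !ge_min lexx orbT.
have d'h : 4 * d' <= h0 by rewrite mulrC divfK// ge_min lexx orbT.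
clearbody d'.
pose a := t - 2 * d'; pose b := t + 2 * d'.
have near_t s : a <= s <= b -> `|s - t| <= 2 * d'.
  by rewrite /a /b => /andP[? ?]; rewrite ler_norml; apply/andP; split; short_lra.
have ab : a < b by rewrite /a /b; short_lra.
have U : unit_path gamma a b.
  by move=> s s' /near_t h1 /near_t h2; apply: H; [move: h1|move: h2]; short_lra.
have B : path_in_ball i (atlas i (gamma t)) r gamma a b.
  by move=> s /near_t h1; apply: He; short_lra.
have [v Hv0] := HC gamma a b ab U B.
have Hv s s' : a <= s <= b -> a <= s' <= b ->
   `|atlas i (gamma s) - atlas i (gamma s') - (s - s') *: v s'| <= K * (s - s') ^+ 2.
  move=> h1 h2; apply: Hv0 => //.
  apply: le_trans (ler_distD t _ _) _; rewrite [`|t - s'|]distrC.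
  by move: (near_t _ h1) (near_t _ h2); short_lra.
have HvL s s' : a <= s <= b -> a <= s' <= b -> `|s - s'| <= h0 ->
    `|atlas i (gamma s) - atlas i (gamma s') - (s - s') *: v s'| <= K * (s - s') ^+ 2.
  by move=> h1 h2 _; exact: Hv.
have oc s : a < s < b -> a <= s <= b by move=> /andP[? ?]; rewrite !ltW.
have nbh s : a < s < b -> exists2 q : R, 0 < q & forall h, `|h| < q -> a <= s + h <= b.
  move=> /andP[sa sb]; exists (Num.min (s - a) (b - s)).
    by rewrite lt_min !subr_gt0 sa.
  move=> h; rewrite lt_min !ltr_norml => /andP[/andP[? ?] /andP[? ?]].
  by apply/andP; split; short_lra.
have vd s : a < s < b -> is_derive s 1 (fun s => atlas i (gamma s)) (v s).
  move=> sab; apply/is_derive_eps => p p0.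
  have [q q0 Hq] := nbh s sab.
  have K1 : 0 < K + 1 by short_lra.
  exists (Num.min q (p / (K + 1))); first by rewrite lt_min q0 divr_gt0.
  move=> h; rewrite lt_min => /andP[h1 h2].
  have -> : h *: 1 + s = s + h by rewrite /GRing.scale /= mulr1 addrC.
  have := Hv _ _ (Hq h h1) (oc s sab); have -> : s + h - s = h by rewrite addrAC subrr add0r.
  move=> /le_trans; apply; rewrite -[h ^+ 2]real_normK ?num_real// expr2 mulrA ler_wpM2r//.
  move: h2; rewrite ltr_pdivlMr// => h2; have := normr_ge0 h; short_lra.
have vc s : a < s < b -> {for s, continuous v}.
  move=> sab; apply/continuous_eps => p p0.
  have [q q0 Hq] := nbh s sab.
  have K1 : 0 < 2 * K + 1 by short_lra.
  exists (Num.min h0 (Num.min q (p / (2 * K + 1)))); first by rewrite !lt_min h00 q0 divr_gt0.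
  move=> s'; rewrite !lt_min => /and3P[h1 h2 h3].
  have s'ab : a <= s' <= b by have := Hq _ h2; rewrite subrKC.
  apply: le_trans (velocity_lipschitz HvL s'ab (oc s sab) (ltW h1)) _.
  move: h3; rewrite ltr_pdivlMr// => h3; have := normr_ge0 (s' - s); short_lra.
have vn s : a < s < b -> cinner i (atlas i (gamma s)) (v s) (v s) = 1.
  by move=> sab; apply: (velocity_unit M_connected mb K0 h00 h01 h0r ab U B HvL (oc s sab)).
exists v, d'; split=> // s st.
have sab : a < s < b.
  by move: st; rewrite ltr_norml /a /b => /andP[? ?]; apply/andP; split; short_lra.
have [Ds _] := B s (oc s sab); split => //; [exact: vd|exact: (velocity_derive mb U B)|exact: vn].
Qed.

(** Identifies the term of the geodesic equation written with symbols of the second kind; exchanging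
    summation indices symmetrizes the first two derivatives of the metric. *)
Lemma christoffel_acceleration i (x w : 'rV[R]_n) k : chart_codom (atlas i) x ->
  \sum_(a < n) \sum_(b < n) christoffel i x k a b * w 0 a * w 0 b =
  - acceleration i x w 0 k.
Proof.
move=> Dx; rewrite /acceleration !mxE opprK.
have entry (e : 'rV[R]_n) a b : 'D_e (fun y => metric i y a b) x = ('D_e (metric i) x) a b.
  by rewrite derive_mx ?mxE//; have [H _] := metric_smooth i 1 e; exact: H.
have symI l : invmx (metric i x) k l = invmx (metric i x) l k.
  by rewrite -{2}(metric_symmetric Dx) -trmx_inv mxE.
have dGE (u y : 'rV[R]_n) l : dG i x u y (evec l) =
    \sum_a \sum_b u 0 a * y 0 b * ('D_(evec a) (metric i) x) b l.
  rewrite /dG /dmetric mx_inner_summ; apply: eq_bigr => a _.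
  rewrite mx_innerZm mx_inner_evecr mxE mulr_sumr; apply: eq_bigr => b _; ring.
have dGE' l : dG i x (evec l) w w =
    \sum_a \sum_b w 0 a * w 0 b * ('D_(evec l) (metric i) x) a b.
  rewrite /dG /dmetric mx_inner_summ (bigD1 l)//= big1 ?addr0 => [|j jl].
    rewrite mx_innerZm evecE eqxx mul1r mx_innerE.
    by apply: eq_bigr => a _; apply: eq_bigr => b _; ring.
  by rewrite mx_innerZm evecE (negPf jl) mul0r.
have gamE l : gam i x w w (evec l) = \sum_a \sum_b w 0 a * w 0 b *
   (2^-1 * (('D_(evec a) (metric i) x) b l + ('D_(evec b) (metric i) x) a l -
            ('D_(evec l) (metric i) x) a b)).
  rewrite /gam {2}dGE exchange_big/= dGE dGE' -big_split -sumrB mulr_sumr /=.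
  apply: eq_bigr => a _; rewrite -big_split -sumrB mulr_sumr /=.
  by apply: eq_bigr => b _; ring.
transitivity (\sum_a \sum_b \sum_l w 0 a * w 0 b *
   (2^-1 * (('D_(evec a) (metric i) x) b l + ('D_(evec b) (metric i) x) a l -
            ('D_(evec l) (metric i) x) a b)) * invmx (metric i x) l k).
  apply: eq_bigr => a _; apply: eq_bigr => b _.
  rewrite /christoffel mulr_sumr !mulr_suml; apply: eq_bigr => l _.
  by rewrite !entry symI; ring.
under eq_bigr do rewrite exchange_big/=.
rewrite exchange_big/=; apply: eq_bigr => l _.
rewrite mxE gamE mulr_suml; apply: eq_bigr => a _.
by rewrite mulr_suml.
Qed.

Lemma isometric_near_geodesic gamma t d : 0 < d -> isometric_near gamma t d ->
  geodesic_on [set t] gamma /\ speed gamma t = 1.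
Proof.
move=> d0 H; have gc := isometric_near_continuous d0 H.
split=> [s -> |].
  split=> // i Di; have [v [e [e0 Hv]]] := isometric_near_velocity d0 H Di.
  have [_ H1 H2 _] := Hv t (ltac:(by rewrite subrr normr0)).
  have near_v : {near t, v =1 (coord_curve i gamma)^`()}.
    apply/nbhs_ballP; exists e => // s' /=; rewrite /ball /= distrC => h.
    by have [_ h1 _ _] := Hv s' h; rewrite (derive1_val h1).
  have H3 : is_derive t 1 (coord_curve i gamma)^`() (acceleration i (atlas i (gamma t)) (v t)).
    exact: near_eq_is_derive near_v H2.
  have E1 : derive1 (coord_curve i gamma) t = v t := derive1_val H1.
  split; [exact: ex_derive|exact: ex_derive|move=> k].
  rewrite (derive1_val H3) E1 christoffel_acceleration ?subrr//.
  exact: chart_fun_codom.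
have [v [e [e0 Hv]]] := isometric_near_velocity d0 H (chart_at_dom (gamma t)).
have [Di H1 _ H3] := Hv t (ltac:(by rewrite subrr normr0)).
by rewrite (speed_chart gc Di H1) H3 sqrtr1.
Qed.

End LocalIsometry.

(** * The geodesic equation *)

(** The supremum of [f] is at most half of itself. This takes the place of Gronwall's inequality in
    the uniqueness proofs for differential equations. *)
Lemma halving (R : realType) (T : Type) (P : T -> Prop) (f : T -> R) (B : R) :
  (forall t, P t -> 0 <= f t <= B) ->
  (forall S : R, 0 <= S -> (forall t, P t -> f t <= S) -> forall t, P t -> f t <= S / 2) ->
  forall t, P t -> f t = 0.
Proof.
move=> fB H t Pt.
pose A := [set f s | s in P].
have A0 : A (f t) by exists t.
have hs : has_sup A.
  by split; [exists (f t)|exists B => _ [s Ps <-]; case/andP: (fB s Ps)].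
have S0 : 0 <= sup A.
  by have /andP[f0 _] := fB t Pt; apply: le_trans f0 _; apply: (sup_upper_bound hs).
have HS s : P s -> f s <= sup A by move=> Ps; apply: (sup_upper_bound hs); exists s.
have S1 : sup A <= sup A / 2.
  by apply: ge_sup; [exists (f t)|move=> _ [s Ps <-]; exact: H].
have /andP[f0 _] := fB t Pt; have := HS t Pt.
by move=> h; apply/eqP; rewrite eq_le f0 andbT; lra.
Qed.

Lemma geometric_limit (R : realType) (u : nat -> R) (C : R) : 0 <= C ->
  (forall k, `|u k.+1 - u k| <= C / 2 ^+ k) ->
  exists l, forall k, `|u k - l| <= 2 * C / 2 ^+ k.
Proof.
move=> C0 H.
have step k : C / 2 ^+ k = 2 * C / 2 ^+ k - 2 * C / 2 ^+ k.+1.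
  by rewrite exprS; field; rewrite expf_neq0.
pose a k := u k - 2 * C / 2 ^+ k; pose b k := u k + 2 * C / 2 ^+ k.
have aS k : a k <= a k.+1.
  by have := H k; rewrite ler_norml step /a => /andP[h1 h2]; lra.
have bS k : b k.+1 <= b k.
  by have := H k; rewrite ler_norml step /b => /andP[h1 h2]; lra.
have am k j : (k <= j)%N -> a k <= a j.
  move=> /subnK <-; elim: (j - k)%N => [|m IH]; first by rewrite add0n.
  by apply: le_trans IH _; rewrite addSn.
have bm k j : (k <= j)%N -> b j <= b k.
  move=> /subnK <-; elim: (j - k)%N => [|m IH]; first by rewrite add0n.
  by apply: le_trans _ IH; rewrite addSn.
have ab' k : a k <= b k.
  have : 0 <= 2 * C / 2 ^+ k by rewrite divr_ge0 ?exprn_ge0 ?mulr_ge0.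
  by rewrite /a /b; lra.
have ab k j : a k <= b j.
  have [kj|/ltnW jk] := leqP k j.
    by apply: le_trans (am _ _ kj) (ab' j).
  by apply: le_trans (ab' k) (bm _ _ jk).
pose A := [set a k | k in [set: nat]].
have hs : has_sup A by split; [exists (a 0%N), 0%N|exists (b 0%N) => _ [k _ <-]].
exists (sup A) => k.
have h1 : a k <= sup A by apply: (sup_upper_bound hs); exists k.
have h2 : sup A <= b k by apply: ge_sup; [exists (a 0%N), 0%N|move=> _ [j _ <-]].
by move: h1 h2; rewrite /a /b ler_norml => h1 h2; apply/andP; split; lra.
Qed.

Lemma mvt_bound_rV (R : realType) (n : nat) (f df : R -> 'rV[R]_n) (a b K : R) : 0 <= K ->
  (forall x, Num.min a b <= x <= Num.max a b -> is_derive x 1 f (df x)) ->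
  (forall x, Num.min a b <= x <= Num.max a b -> `|df x| <= K) ->
  `|f b - f a| <= K * `|b - a|.
Proof.
move=> K0 fd dK; apply: norm_le_coord => [|k]; first by rewrite mulr_ge0.
rewrite rvBE; apply: (@mvt_bound _ (fun x => f x 0 k) (fun x => df x 0 k)) => x xab.
  exact: ((is_derive_rV _ _ _).1 (fd x xab) k).
exact: le_trans (coord_le_norm _ _) (dK x xab).
Qed.

Lemma between_dist (R : realDomainType) (s t x : R) :
  Num.min s t <= x <= Num.max s t -> `|x - s| <= `|t - s|.
Proof.
rewrite ge_min le_max; have [h|h] := ger0P (x - s); have [h'|h'] := ger0P (t - s);
move=> /andP[/orP[h1|h1] /orP[h2|h2]]; lra.
Qed.

(** * Existence for bounded Lipschitz vector fields *)

Section Picard.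
Context {R : realType} {m : nat}.
Variables (F : 'rV[R]_m -> 'rV[R]_m) (L B T : R).
Hypotheses (L0 : 0 <= L) (B0 : 0 <= B) (T0 : 0 < T) (LT : L * T <= 2^-1).
Hypothesis FL : forall x y, `|F x - F y| <= L * `|x - y|.
Hypothesis FB : forall x, `|F x| <= B.

Let clamp (t : R) := Num.max (- T) (Num.min t T).

Let clampT t : `|clamp t| <= T.
Proof.
rewrite ler_norml /clamp le_max lexx ge_max ge_min lexx orbT andbT /=.
by move: T0; lra.
Qed.

Let clamp_id t : `|t| <= T -> clamp t = t.
Proof. by rewrite ler_norml => /andP[h1 h2]; rewrite /clamp (min_idPl h2) (max_idPr h1). Qed.

Let clampL s t : `|clamp s - clamp t| <= `|s - t|.
Proof. exact: le_trans (maxr_lipschitz _ _ _) (minr_lipschitz _ _ _). Qed.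

Let picard_step z0 (z : R -> 'rV[R]_m) : (forall t, {for t, continuous z}) ->
  exists w : R -> 'rV[R]_m, w 0 = z0 /\ forall t : R, `|t| <= T -> is_derive t 1 w (F (z t)).
Proof.
move=> zc.
have Fc t k : {for t, continuous (fun s => F (z s) 0 k)}.
  apply/continuous_eps => e e0; have L1 : 0 < L + 1 by move: L0; lra.
  have [d d0 H] := (continuous_eps _ _).1 (zc t) _ (divr_gt0 e0 L1).
  exists d => // s st; rewrite -rvBE; apply: le_trans (coord_le_norm _ _) _.
  apply: le_trans (FL _ _) _; have := H s st; rewrite ler_pdivlMr//.
  by have := normr_ge0 (z s - z t); lra.
have /choice [Lk HL] : forall k, exists g, forall t, - (T + 1) < t < T + 1 ->
    is_derive t 1 g (F (z t) 0 k).
  by move=> k; apply: antiderivative => [|t _]; [move: T0; lra|exact: Fc].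
exists (fun t => \row_k (z0 0 k + (Lk k t - Lk k 0))); split.
  by apply/rowP => k; rewrite mxE subrr addr0.
move=> t tT; apply/is_derive_rV => k.
have -> : (fun s => (\row_k (z0 0 k + (Lk k s - Lk k 0))) 0 k) =
    (fun=> z0 0 k - Lk k 0) + Lk k.
  by apply/funext => s; rewrite !fctE mxE; ring.
have H1 : is_derive t (1 : R) (fun=> z0 0 k - Lk k 0 : R) (0 : R) by exact: is_derive_cst.
have H2 : is_derive t 1 (Lk k) (F (z t) 0 k).
  by apply: HL; move: tT; rewrite ler_norml => /andP[h1 h2]; apply/andP; split; lra.
by apply: is_derive_eq (is_deriveD H1 H2) _; rewrite add0r.
Qed.

Let seg (t s : R) : `|t| <= T -> `|s| <= T -> forall x, Num.min t s <= x <= Num.max t s ->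
  `|x| <= T.
Proof.
rewrite !ler_norml => /andP[t1 t2] /andP[s1 s2] x; rewrite ge_min le_max.
by rewrite ler_norml => /andP[/orP[h1|h1] /orP[h2|h2]]; apply/andP; split; lra.
Qed.

(** The iterates converge geometrically because [L * T <= 2^-1]. They satisfy a first order
    expansion with quadratic remainder and common constants up to their geometric errors; this
    passes to the pointwise limit and shows that it is differentiable. *)
Lemma picard z0 : exists z : R -> 'rV[R]_m, z 0 = z0 /\
  forall t : R, `|t| < T -> is_derive t 1 z (F (z t)).
Proof.
have /choice [Phi HPhi] : forall z : R -> 'rV[R]_m, exists w : R -> 'rV[R]_m,
    (forall t, {for t, continuous z}) ->
    w 0 = z0 /\ forall t : R, `|t| <= T -> is_derive t 1 w (F (z t)).
  move=> z; have [H|H] := pselect (forall t, {for t, continuous z}); last by exists z.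
  by have [w Hw] := picard_step z0 H; exists w.
(* [clamp] freezes the iterate outside [[- T, T]]: the integration step asks for continuity at all
   times, while an iterate is controlled on this interval. *)
pose fix w k := if k is k'.+1 then Phi (w k' \o clamp) else fun=> z0.
have wc k t : {for t, continuous (w k \o clamp)}.
  elim: k t => [|k IH] t; first exact: cst_continuous.
  apply/continuous_eps => e e0; have B1 : 0 < B + 1 by move: B0; lra.
  exists (e / (B + 1)) => [|s]; first by rewrite divr_gt0.
  rewrite ltr_pdivlMr// => st; apply: (@le_trans _ _ (B * `|clamp s - clamp t|)).
    apply: (@mvt_bound_rV _ _ (w k.+1) (fun t => F (w k (clamp t)))) => // x xt.
    exact: (HPhi _ IH).2 (seg (clampT _) (clampT _) xt).
  have := ler_wpM2l B0 (clampL s t); have := normr_ge0 (s - t); move: st; lra.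
have w0 k : w k 0 = z0 by case: k => //= k; exact: (HPhi _ (wc k)).1.
have wd k (t : R) : `|t| <= T -> is_derive t 1 (w k.+1) (F (w k t)).
  by move=> tT; have := (HPhi _ (wc k)).2 t tT; rewrite /= clamp_id.
have z00 : `|0 : R| <= T by rewrite normr0 ltW.
have diff k (t : R) : `|t| <= T -> `|w k.+1 t - w k t| <= B * T / 2 ^+ k.
  elim: k t => [|k IH] t tT.
    have E : w 1%N t - w 0%N t = w 1%N t - w 1%N 0 by rewrite w0.
    rewrite expr0 divr1 E.
    apply: (@le_trans _ _ (B * `|t - 0|)).
      apply: (@mvt_bound_rV _ _ (w 1%N) (fun t => F (w 0%N t))) => // x xt.
      by apply: wd; exact: seg z00 tT x xt.
    by rewrite subr0 ler_wpM2l.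
  have E : w k.+2 t - w k.+1 t = (w k.+2 t - w k.+1 t) - (w k.+2 0 - w k.+1 0).
    by rewrite !w0 subrr subr0.
  rewrite E; apply: (@le_trans _ _ (L * (B * T / 2 ^+ k) * `|t - 0|)).
    apply: (@mvt_bound_rV _ _ (fun t => w k.+2 t - w k.+1 t) (fun t => F (w k.+1 t) - F (w k t))).
    - by rewrite !mulr_ge0 ?invr_ge0 ?exprn_ge0// ltW.
    - move=> x xt; have xT := seg z00 tT xt.
      by have H1 := wd k.+1 x xT; have H2 := wd k x xT; exact: (is_deriveB H1 H2).
    - move=> x xt; have xT := seg z00 tT xt.
      by apply: le_trans (FL _ _) _; rewrite ler_wpM2l// IH.
  rewrite subr0 mulrAC exprS invfM; apply: (@le_trans _ _ (2^-1 * (B * T / 2 ^+ k))).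
    rewrite ler_wpM2r ?mulr_ge0 ?invr_ge0 ?exprn_ge0 ?(ltW T0)//.
    by apply: le_trans _ LT; rewrite ler_wpM2l.
  by rewrite le_eqVlt; apply/orP; left; apply/eqP; ring.
have BT0 : 0 <= B * T by rewrite mulr_ge0// ltW.
have /choice [z Hz] : forall t, exists l : 'rV[R]_m, `|t| <= T ->
    forall k, `|w k t - l| <= 2 * (B * T) / 2 ^+ k.
  move=> t; have [tT|tT] := boolP (`|t| <= T); last by exists 0.
  have /choice [l Hl] : forall j, exists l, forall k, `|w k t 0 j - l| <= 2 * (B * T) / 2 ^+ k.
    move=> j; apply: geometric_limit => // k; rewrite -rvBE.
    exact: le_trans (coord_le_norm _ _) (diff k t tT).
  exists (\row_j l j) => _ k; apply: norm_le_coord => [|j].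
    by rewrite divr_ge0 ?exprn_ge0// mulr_ge0.
  by rewrite rvBE [(\row_j _) _ _]mxE.
have small (a A : R) : 0 <= A -> (forall k, a <= A / 2 ^+ k) -> a <= 0.
  move=> A0 Ha; rewrite leNgt; apply/negP => a0.
  have := Ha (Num.bound (A / a)); rewrite leNgt => /negP; apply.
  rewrite ltr_pdivrMr ?exprn_gt0// mulrC -ltr_pdivrMr//.
  apply: lt_le_trans (archi_boundP _) _; first by rewrite divr_ge0// ltW.
  by rewrite -natrX ler_nat ltnW// ltn_expl.
have wlip k (s t : R) : `|s| <= T -> `|t| <= T -> `|w k t - w k s| <= B * `|t - s|.
  move=> sT tT; case: k => [|k]; first by rewrite subrr normr0 mulr_ge0.
  apply: (@mvt_bound_rV _ _ (w k.+1) (fun t => F (w k t))) => // x xt.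
  by apply: wd; exact: seg sT tT x xt.
have zest (s t : R) : `|s| <= T -> `|t| <= T -> `|z t - z s - (t - s) *: F (z s)| <= L * B * `|t - s| ^+ 2.
  move=> sT tT; rewrite -subr_le0; apply: (small _ ((2 + `|t - s| * L) * (2 * (B * T)))).
    by apply: mulr_ge0; [rewrite addr_ge0// mulr_ge0|rewrite mulr_ge0].
  move=> k; pose ep := 2 * (B * T) / 2 ^+ k.
  have ep0 : 0 <= ep by rewrite divr_ge0 ?exprn_ge0// mulr_ge0.
  have epS : 2 * (B * T) / 2 ^+ k.+1 <= ep.
    have -> : 2 * (B * T) / 2 ^+ k.+1 = ep / 2 by rewrite /ep exprS; field; rewrite expf_neq0.
    lra.
  have D1 : `|w k.+1 t - w k.+1 s - (t - s) *: F (w k s)| <= L * B * `|t - s| ^+ 2.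
    have E : w k.+1 t - w k.+1 s - (t - s) *: F (w k s) =
        (w k.+1 t - (t - s) *: F (w k s)) - (w k.+1 s - (s - s) *: F (w k s)).
      by apply/rowP => j; rewrite !(rvDE, rvNE, rvZE); ring.
    rewrite E expr2 mulrA.
    apply: (@mvt_bound_rV _ _ (fun t => w k.+1 t - (t - s) *: F (w k s))
       (fun t => F (w k t) - F (w k s))); first by rewrite !mulr_ge0.
    - move=> x xt; have H1 := wd k x (seg sT tT xt).
      have H2 : is_derive x (1 : R) (fun x : R => (x - s) *: F (w k s)) (F (w k s)).
        have -> : (fun x : R => (x - s) *: F (w k s)) = (fun x : R => - s *: F (w k s) + x *: F (w k s)).
          by apply/funext => y; rewrite -scalerDl addrC.
        exact: line_derive.
      exact: (is_deriveB H1 H2).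
    - move=> x xt; apply: le_trans (FL _ _) _; rewrite -mulrA ler_wpM2l//.
      apply: le_trans (wlip _ _ _ sT (seg sT tT xt)) _; rewrite ler_wpM2l//.
      exact: between_dist.
  have h1 := Hz t tT k.+1; have h2 := Hz s sT k.+1; have h3 := Hz s sT k.
  have E : z t - z s - (t - s) *: F (z s) = (w k.+1 t - w k.+1 s - (t - s) *: F (w k s))
     - (w k.+1 t - z t) + (w k.+1 s - z s) + (t - s) *: (F (w k s) - F (z s)).
    by apply/rowP => j; rewrite !(rvDE, rvNE, rvZE); ring.
  rewrite E lerBlDr; apply: le_trans (ler_normD _ _) _.
  have b1 := ler_normD (w k.+1 t - w k.+1 s - (t - s) *: F (w k s) - (w k.+1 t - z t)) (w k.+1 s - z s).
  have b2 := ler_normB (w k.+1 t - w k.+1 s - (t - s) *: F (w k s)) (w k.+1 t - z t).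
  have b3 : `|(t - s) *: (F (w k s) - F (z s))| <= `|t - s| * L * ep.
    rewrite normrZ -mulrA ler_wpM2l//; apply: le_trans (FL _ _) _.
    by rewrite ler_wpM2l.
  have -> : (2 + `|t - s| * L) * (2 * (B * T)) / 2 ^+ k = 2 * ep + `|t - s| * L * ep.
    by rewrite /ep; ring.
  move: b1 b2 b3 D1 h1 h2 epS; lra.
exists z; split.
  apply/eqP; rewrite -subr_eq0 -normr_le0.
  apply: (small _ (2 * (B * T))); first by rewrite mulr_ge0.
  by move=> k; rewrite distrC -{1}(w0 k); exact: Hz.
move=> t tT; apply/is_derive_eps => e e0.
have LB1 : 0 < L * B + 1 by rewrite ltr_wpDl// mulr_ge0.
exists (Num.min (T - `|t|) (e / (L * B + 1))).
  by rewrite lt_min subr_gt0 tT divr_gt0.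
move=> h; rewrite lt_min ltr_pdivlMr// => /andP[h1 h2].
have -> : h *: 1 + t = t + h by rewrite /GRing.scale /= mulr1 addrC.
have thT : `|t + h| <= T by apply: le_trans (ler_normD _ _) _; lra.
have := zest t (t + h) (ltW tT) thT.
have -> : t + h - t = h by rewrite addrAC subrr add0r.
move=> /le_trans; apply; rewrite expr2 mulrA ler_wpM2r//.
by have := normr_ge0 h; lra.
Qed.

End Picard.

Lemma half_combination_bound (R : realFieldType) (a b c d e : R) :
  `|a - b| <= e -> `|c - d| <= e -> 0 <= e ->
  2^-1 * (a + a - c) - 2^-1 * (b + b - d) <= 2 * e.
Proof. by rewrite !ler_norml => /andP[? ?] /andP[? ?]; short_lra. Qed.

Lemma gam_polarization (R : realType) (n : nat) (M : riemannianManifold R n)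
    (i : rm_index M) (z u d q : 'rV[R]_n) :
  gam i z (u + d) (u + d) q - gam i z u u q = gam i z d (u + d) q + gam i z u d q.
Proof. by rewrite /gam !dGD /dG !(mx_innerDl, mx_innerDr); ring. Qed.

(** * Estimates and uniqueness for the geodesic equation *)

Section GeodesicFlow.
Context {R : realType} {n : nat} (M : riemannianManifold R n).
Hypothesis M_connected : connected [set: M].
Variables (i : rm_index M) (u0 : 'rV[R]_n) (r lam C : R).
Hypothesis mb : metric_ball (metric i) (chart_codom (atlas i)) u0 r lam C.
Local Notation g := (metric i).
Local Notation mu := (Num.sqrt lam).
Local Notation phi := (atlas i).
Local Notation acc := (acceleration i).
Implicit Types (x y : R -> 'rV[R]_n) (v w : R -> 'rV[R]_n) (s t h : R).

Let lam0 : 0 < lam. Proof. exact: (mb_lam mb). Qed.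
Let mu0 : 0 < mu. Proof. by rewrite sqrtr_gt0. Qed.
Let C1 : 1 <= C. Proof. exact: (mb_C mb). Qed.
Let C0 : 0 <= C. Proof. exact: le_trans ler01 C1. Qed.
Let r0 : 0 < r. Proof. exact: (mb_r mb). Qed.

Lemma accelerationZ (z u : 'rV[R]_n) k : acc z (k *: u) = k ^+ 2 *: acc z u.
Proof.
have E : \row_j gam i z (k *: u) (k *: u) (evec j) = k ^+ 2 *: \row_j gam i z u u (evec j).
  by apply/rowP => j; rewrite rvZE !mxE gamZl expr2 mulrA.
by rewrite /acceleration E -scalemxAl scalerN.
Qed.

Lemma acceleration_bound (z u : 'rV[R]_n) : `|z - u0| <= r ->
  `|acc z u| <= 2 * C / lam * `|u| ^+ 2.
Proof.
move=> zr; set q := acc z u.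
have [q0|q0] := eqVneq q 0; first by rewrite q0 normr0 mulr_ge0 ?exprn_ge0 ?divr_ge0 ?mulr_ge0 ?(ltW lam0).
have q1 : 0 < `|q| by rewrite normr_gt0.
have H := mb_pos mb q zr; rewrite {2}/q (acceleration_inner mb)// in H.
have H2 := gam_bound mb u u q zr.
rewrite -(ler_pM2l lam0) -(ler_pM2r q1).
have -> : lam * (2 * C / lam * `|u| ^+ 2) * `|q| = 2 * C * `|u| * `|u| * `|q|.
  by field; rewrite gt_eqF.
rewrite -mulrA -expr2; apply: le_trans H _; apply: le_trans (ler_norm _) _.
by rewrite normrN.
Qed.

(** A Lipschitz constant of [acceleration] for velocities bounded by [V]; the terms account in turn
    for the variation of the derivative of the metric, of the metric itself and of the velocity. *)
Definition acc_const (V : R) : R :=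
  (2 * C * V ^+ 2 + 2 * C ^+ 2 * V ^+ 2 / lam + 4 * C * V) / lam.

Lemma acc_const_ge0 V : 0 <= V -> 0 <= acc_const V.
Proof.
move=> V0; rewrite /acc_const; apply: divr_ge0; last exact: ltW.
by do !apply: addr_ge0; rewrite ?mulr_ge0 ?exprn_ge0// invr_ge0 ltW.
Qed.

(** The difference [q] of the accelerations is tested against itself in the metric at [z]. All
    resulting terms are linear in [|q|], which cancels against one factor of [lam * |q| ^+ 2]. *)
Lemma acceleration_lipschitz V (z z' u u' : 'rV[R]_n) : `|z - u0| <= r -> `|z' - u0| <= r ->
  `|u| <= V -> `|u'| <= V ->
  `|acc z u - acc z' u'| <= acc_const V * (`|z - z'| + `|u - u'|).
Proof.
move=> zr z'r uV u'V; set q := acc z u - acc z' u'.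
have V0 : 0 <= V by exact: le_trans uV.
have [q0|q0] := eqVneq q 0.
  by rewrite q0 normr0 mulr_ge0 ?acc_const_ge0 ?addr_ge0.
have q1 : 0 < `|q| by rewrite normr_gt0.
have H := mb_pos mb q zr.
have E : mx_inner (g z) q q = (gam i z' u u q - gam i z u u q) +
   (gam i z' u' u' q - gam i z' u u q) + (mx_inner (g z') (acc z' u') q - mx_inner (g z) (acc z' u') q).
  have := mx_innerBl (g z) (acc z u) (acc z' u') q; rewrite -/q => ->.
  rewrite (acceleration_inner mb u q zr) (acceleration_inner mb u' q z'r).
  move: (gam i z u u q) (gam i z' u u q) (gam i z' u' u' q) (mx_inner (g z) (acc z' u') q).
  by move=> a b c d; ring.
have b1 : gam i z' u u q - gam i z u u q <= 2 * C * V ^+ 2 * `|z - z'| * `|q|.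
  have h1 : `|dG i z' u u q - dG i z u u q| <= C * `|z' - z| * `|u| * `|u| * `|q|.
    exact: (mb_dlip mb u u q z'r zr).
  have h2 : `|dG i z' q u u - dG i z q u u| <= C * `|z' - z| * `|q| * `|u| * `|u|.
    exact: (mb_dlip mb q u u z'r zr).
  have k1 : C * `|z' - z| * `|u| * `|u| * `|q| <= C * V ^+ 2 * `|z - z'| * `|q|.
    rewrite distrC.
    have -> : C * V ^+ 2 * `|z - z'| * `|q| = C * `|z - z'| * V * V * `|q| by ring.
    by rewrite !ler_pM ?mulr_ge0.
  have k2 : C * `|z' - z| * `|q| * `|u| * `|u| <= C * V ^+ 2 * `|z - z'| * `|q|.
    by apply: le_trans k1; rewrite le_eqVlt; apply/orP; left; apply/eqP; ring.
  have {}h1 := le_trans h1 k1; have {}h2 := le_trans h2 k2.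
  have -> : 2 * C * V ^+ 2 * `|z - z'| * `|q| = 2 * (C * V ^+ 2 * `|z - z'| * `|q|) by ring.
  have : 0 <= C * V ^+ 2 * `|z - z'| * `|q| by rewrite !mulr_ge0 ?exprn_ge0.
  exact: half_combination_bound h1 h2.
have b2 : gam i z' u' u' q - gam i z' u u q <= 4 * C * V * `|u - u'| * `|q|.
  have -> : gam i z' u' u' q - gam i z' u u q = gam i z' (u' - u) u' q + gam i z' u (u' - u) q.
    by have := gam_polarization i z' u (u' - u) q; rewrite subrKC.
  have h1 := gam_bound mb (u' - u) u' q z'r; have h2 := gam_bound mb u (u' - u) q z'r.
  have k1 : 2 * C * `|u' - u| * `|u'| * `|q| <= 2 * C * V * `|u - u'| * `|q|.
    rewrite distrC [2 * C * V * _]mulrAC.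
    by rewrite !ler_pM ?mulr_ge0.
  have k2 : 2 * C * `|u| * `|u' - u| * `|q| <= 2 * C * V * `|u - u'| * `|q|.
    by rewrite distrC !ler_pM ?mulr_ge0.
  have {}h1 := le_trans (le_trans (ler_norm _) h1) k1.
  have {}h2 := le_trans (le_trans (ler_norm _) h2) k2.
  have -> : 4 * C * V * `|u - u'| * `|q| = 2 * C * V * `|u - u'| * `|q| + 2 * C * V * `|u - u'| * `|q|.
    by ring.
  exact: lerD.
have b3 : mx_inner (g z') (acc z' u') q - mx_inner (g z) (acc z' u') q <=
    2 * C ^+ 2 * V ^+ 2 / lam * `|z - z'| * `|q|.
  apply: le_trans (ler_norm _) _; apply: le_trans (mb_lip mb _ _ z'r zr) _.
  have -> : 2 * C ^+ 2 * V ^+ 2 / lam * `|z - z'| * `|q| =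
     C * `|z - z'| * (2 * C / lam * V ^+ 2) * `|q| by ring.
  rewrite [`|z' - z|]distrC ler_wpM2r// ler_wpM2l ?mulr_ge0//.
  apply: le_trans (acceleration_bound _ z'r) _.
  by rewrite ler_wpM2l ?divr_ge0 ?mulr_ge0 ?(ltW lam0)// lerXn2r ?nnegrE.
rewrite -(ler_pM2l lam0) -(ler_pM2r q1) -mulrA -expr2; apply: le_trans H _; rewrite E {E}.
have -> : lam * (acc_const V * (`|z - z'| + `|u - u'|)) * `|q| =
   2 * C * V ^+ 2 * `|z - z'| * `|q| + 2 * C ^+ 2 * V ^+ 2 / lam * `|z - z'| * `|q|
   + 4 * C * V * `|u - u'| * `|q|
   + (2 * C * V ^+ 2 + 2 * C ^+ 2 * V ^+ 2 / lam) * `|u - u'| * `|q|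
   + 4 * C * V * `|z - z'| * `|q|.
  by rewrite /acc_const; field; rewrite gt_eqF.
have p1 : 0 <= (2 * C * V ^+ 2 + 2 * C ^+ 2 * V ^+ 2 / lam) * `|u - u'| * `|q|.
  rewrite !mulr_ge0//; apply: addr_ge0; rewrite ?mulr_ge0 ?exprn_ge0//.
  by rewrite invr_ge0 ltW.
have p2 : 0 <= 4 * C * V * `|z - z'| * `|q| by rewrite !mulr_ge0.
by apply: le_trans (lerD (lerD b1 b2) b3) _; clear b1 b2 b3; short_lra.
Qed.

Definition geodesic_ode x v t := is_derive t 1 x (v t) /\ is_derive t 1 v (acc (x t) (v t)).

Lemma geodesic_ode_unique V x v y w (a b t0 : R) : 0 <= V -> a < t0 < b ->
  b - a <= 4^-1 -> acc_const V * (b - a) <= 4^-1 ->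
  (forall t, a < t < b -> [/\ geodesic_ode x v t, `|x t - u0| <= r & `|v t| <= V]) ->
  (forall t, a < t < b -> [/\ geodesic_ode y w t, `|y t - u0| <= r & `|w t| <= V]) ->
  x t0 = y t0 -> v t0 = w t0 -> forall t, a < t < b -> x t = y t /\ v t = w t.
Proof.
move=> V0 t0ab h1 h2 Hx Hy e1 e2.
have A0 := acc_const_ge0 V0; set A := acc_const V in A0 h2.
have btw t s : a < t < b -> a < s < b -> forall q, Num.min t s <= q <= Num.max t s -> a < q < b.
  move=> /andP[? ?] /andP[? ?] q; rewrite ge_min le_max.
  by move=> /andP[/orP[?|?] /orP[?|?]]; apply/andP; split; short_lra.
have Z : forall t, a < t < b -> `|x t - y t| + `|v t - w t| = 0.
  apply: (@halving _ _ _ _ (r + r + (V + V))).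
    move=> t tab; rewrite addr_ge0//=.
    have [_ xr vV] := Hx t tab; have [_ yr wV] := Hy t tab.
    have k1 := ler_distD u0 (x t) (y t); rewrite [`|u0 - _|]distrC in k1.
    by have k2 := ler_normB (v t) (w t); short_lra.
  move=> S S0 HS t tab.
  have tt : `|t - t0| <= b - a.
    by move: tab t0ab => /andP[? ?] /andP[? ?]; rewrite ler_norml; apply/andP; split; short_lra.
  have k1 : `|x t - y t| <= S * `|t - t0|.
    have -> : x t - y t = (x t - y t) - (x t0 - y t0) by rewrite e1 subrr subr0.
    apply: (@mvt_bound_rV _ _ (fun t => x t - y t) (fun t => v t - w t)) => //.
      move=> q /(btw _ _ t0ab tab) qab; have [[d1 _] _ _] := Hx q qab.
      by have [[d2 _] _ _] := Hy q qab; exact: (is_deriveB d1 d2).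
    move=> q /(btw _ _ t0ab tab) qab; have := HS q qab.
    by have := normr_ge0 (x q - y q); short_lra.
  have k2 : `|v t - w t| <= A * S * `|t - t0|.
    have -> : v t - w t = (v t - w t) - (v t0 - w t0) by rewrite e2 subrr subr0.
    apply: (@mvt_bound_rV _ _ (fun t => v t - w t) (fun t => acc (x t) (v t) - acc (y t) (w t))).
    - by rewrite mulr_ge0.
    - move=> q /(btw _ _ t0ab tab) qab; have [[_ d1] _ _] := Hx q qab.
      by have [[_ d2] _ _] := Hy q qab; exact: (is_deriveB d1 d2).
    move=> q /(btw _ _ t0ab tab) qab; have [_ xr vV] := Hx q qab; have [_ yr wV] := Hy q qab.
    by apply: le_trans (acceleration_lipschitz xr yr vV wV) _; rewrite ler_wpM2l// HS.
  have k3 : S * `|t - t0| <= S * 4^-1 by rewrite ler_wpM2l// (le_trans tt).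
  have k4 : A * S * `|t - t0| <= S * 4^-1.
    rewrite [A * S]mulrC -mulrA ler_wpM2l//; apply: le_trans h2; rewrite ler_wpM2l//.
  move: k1 k2 k3 k4; short_lra.
move=> t tab; have := Z t tab => /eqP; rewrite paddr_eq0// !normr_eq0 !subr_eq0.
by move=> /andP[/eqP -> /eqP ->].
Qed.

(** At the ends of a minimal path a Lipschitz bound is known, but no derivative; the bound supplies
    the continuity that the mean value theorem requires there. *)
Lemma mvt_lipschitz (f df : R -> R) (a b K : R) : a < b ->
  (forall s t, a <= s <= b -> a <= t <= b -> `|f t - f s| <= K * `|t - s|) ->
  (forall t, a < t < b -> is_derive t 1 f (df t)) ->
  exists2 c, a < c < b & f b - f a = df c * (b - a).
Proof.
move=> ab fL fd.
pose cl t := Num.max a (Num.min t b).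
have clab t : a <= cl t <= b by rewrite le_max lexx ge_max (ltW ab) ge_min lexx orbT.
have clid t : a <= t <= b -> cl t = t.
  by move=> /andP[at_ tb]; rewrite /cl (min_idPl tb) (max_idPr at_).
have cllip s t : `|cl s - cl t| <= `|s - t|.
  by apply: le_trans (maxr_lipschitz _ _ _) (minr_lipschitz _ _ _).
have oc t : a < t < b -> a <= t <= b by move=> /andP[? ?]; rewrite !ltW.
have d t : t \in `]a, b[%R -> is_derive t 1 (f \o cl) (df t).
  rewrite in_itv /= => tab; have H := fd t tab; apply: near_eq_is_derive H.
  near=> s; rewrite /= clid//; apply: oc; near: s; exact: itv_oo_near.
have cw : {within `[a, b], continuous (f \o cl)}.
  apply: within_continuousP => t _; apply/continuous_eps => e e0.
  have K1 : 0 < `|K| + 1 by rewrite ltr_wpDl.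
  exists (e / (`|K| + 1)) => [|s]; first by rewrite divr_gt0.
  rewrite ltr_pdivlMr// => st; apply: le_trans (fL _ _ (clab _) (clab _)) _.
  apply: (@le_trans _ _ (`|K| * `|s - t|)).
    by apply: le_trans (ler_wpM2r _ (ler_norm K)) _ => //; rewrite ler_wpM2l.
  by have := normr_ge0 (s - t); short_lra.
have [c] := MVT ab d cw; rewrite in_itv /= => cab E; exists c => //.
by move: E; rewrite /= !clid// ?lexx ?ltW.
Unshelve. all: by end_near. Qed.

(** Each coordinate of [x - y] vanishes at both ends, so the same coordinate of [v - w] vanishes at
    some interior time, which depends on the coordinate. On a short interval the equation then
    halves every bound on [v - w]. *)
Lemma geodesic_ode_bvp V K x v y w (a b : R) : 0 <= V -> 0 <= K -> a < b ->
  b - a <= 4^-1 -> acc_const V * (b - a) <= 4^-1 ->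
  (forall t, a < t < b -> [/\ geodesic_ode x v t, `|x t - u0| <= r & `|v t| <= V]) ->
  (forall t, a < t < b -> [/\ geodesic_ode y w t, `|y t - u0| <= r & `|w t| <= V]) ->
  (forall s t, a <= s <= b -> a <= t <= b -> `|x t - x s| <= K * `|t - s|) ->
  (forall s t, a <= s <= b -> a <= t <= b -> `|y t - y s| <= K * `|t - s|) ->
  x a = y a -> x b = y b -> forall t, a < t < b -> x t = y t /\ v t = w t.
Proof.
move=> V0 K0 ab h1 h2 Hx Hy Kx Ky e1 e2.
have A0 := acc_const_ge0 V0; set A := acc_const V in A0 h2.
have btw t s : a < t < b -> a < s < b -> forall q, Num.min t s <= q <= Num.max t s -> a < q < b.
  move=> /andP[? ?] /andP[? ?] q; rewrite ge_min le_max.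
  by move=> /andP[/orP[?|?] /orP[?|?]]; apply/andP; split; short_lra.
pose z k t := x t 0 k - y t 0 k.
have zL k s t : a <= s <= b -> a <= t <= b -> `|z k t - z k s| <= (K + K) * `|t - s|.
  move=> sab tab; have k1 := Kx s t sab tab; have k2 := Ky s t sab tab.
  have -> : z k t - z k s = ((x t - x s) - (y t - y s)) 0 k by rewrite !rvBE /z; ring.
  apply: le_trans (coord_le_norm _ _) _; apply: le_trans (ler_normB _ _) _; short_lra.
have zd k t : a < t < b -> is_derive t 1 (z k) ((v t - w t) 0 k).
  move=> tab; have [[d1 _] _ _] := Hx t tab; have [[d2 _] _ _] := Hy t tab.
  have d3 := (is_derive_rV _ _ _).1 d1 k; have d4 := (is_derive_rV _ _ _).1 d2 k.
  by rewrite rvBE; exact: (is_deriveB d3 d4).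
have sub t : a < t -> t < b -> forall s, a <= s <= t -> a <= s <= b.
  by move=> ? ? s /andP[? ?]; apply/andP; split; short_lra.
have aab : a <= a <= b by rewrite lexx ltW.
have bab : a <= b <= b by rewrite lexx ltW.
have za k : z k a = 0 by rewrite /z e1 subrr.
have zb k : z k b = 0 by rewrite /z e2 subrr.
have Z : forall t, a < t < b -> `|v t - w t| = 0.
  apply: (@halving _ _ _ _ (V + V)).
    move=> t tab; rewrite normr_ge0/=; have [_ _ vV] := Hx t tab; have [_ _ wV] := Hy t tab.
    by have := ler_normB (v t) (w t); short_lra.
  move=> S S0 HS.
  have xS t : a < t < b -> `|x t - y t| <= S.
    move=> /andP[at_ tb]; apply: norm_le_coord => // k.
    have [||c /andP[ac ct]] := @mvt_lipschitz (z k) (fun t => (v t - w t) 0 k) a t (K + K) at_.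
    - by move=> s s' /(sub _ at_ tb) h /(sub _ at_ tb) h'; exact: zL.
    - by move=> s /andP[? ?]; apply: zd; apply/andP; split; short_lra.
    rewrite za subr0 [(x t - y t) 0 k]rvBE -/(z k t) => ->; rewrite normrM.
    have cab : a < c < b by apply/andP; split; short_lra.
    have k1 := le_trans (coord_le_norm _ k) (HS c cab).
    have k2 : `|t - a| <= 1 by rewrite ger0_norm; short_lra.
    by rewrite -[S]mulr1 ler_pM.
  move=> t tab; apply: norm_le_coord => [|k]; first by rewrite divr_ge0.
  have [c cab] := @mvt_lipschitz (z k) (fun t => (v t - w t) 0 k) a b (K + K) ab (zL k) (zd k).
  rewrite za zb subrr => /esym/eqP; rewrite mulf_eq0 (subr_eq0 b a) (gt_eqF ab) orbF => /eqP c0.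
  rewrite -[_ 0 k]subr0 -c0 -rvBE; apply: le_trans (coord_le_norm _ _) _.
  apply: (@le_trans _ _ (A * (S + S) * `|t - c|)).
    apply: (@mvt_bound_rV _ _ (fun t => v t - w t) (fun t => acc (x t) (v t) - acc (y t) (w t))).
    - by rewrite mulr_ge0// addr_ge0.
    - move=> q /(btw _ _ cab tab) qab; have [[_ d1] _ _] := Hx q qab.
      by have [[_ d2] _ _] := Hy q qab; exact: (is_deriveB d1 d2).
    move=> q /(btw _ _ cab tab) qab; have [_ xr vV] := Hx q qab; have [_ yr wV] := Hy q qab.
    apply: le_trans (acceleration_lipschitz xr yr vV wV) _; rewrite ler_wpM2l//.
    by apply: lerD; [exact: xS|exact: HS].
  have tc : `|t - c| <= b - a.
    by move: tab cab => /andP[? ?] /andP[? ?]; rewrite ler_norml; apply/andP; split; short_lra.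
  have : A * (S + S) * `|t - c| <= (S + S) * 4^-1.
    by rewrite [A * _]mulrC -mulrA ler_wpM2l ?addr_ge0//; apply: le_trans h2; rewrite ler_wpM2l.
  short_lra.
move=> t tab; have /eqP := Z t tab; rewrite normr_eq0 subr_eq0 => /eqP vw; split=> //.
apply/rowP => k; apply/eqP; rewrite -subr_eq0; have /andP[at_ tb] := tab.
have [||c /andP[ac ct]] := @mvt_lipschitz (z k) (fun t => (v t - w t) 0 k) a t (K + K) at_.
- by move=> s s' /(sub _ at_ tb) h /(sub _ at_ tb) h'; exact: zL.
- by move=> s /andP[? ?]; apply: zd; apply/andP; split; short_lra.
rewrite za subr0 -/(z k t) => ->.
have cab : a < c < b by apply/andP; split; short_lra.
by have /eqP := Z c cab; rewrite normr_eq0 => /eqP ->; rewrite mxE mul0r.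
Qed.

(** Conservation of energy: by [gam_diag] the derivative of the metric along the curve cancels
    against twice the Christoffel form. *)
Lemma geodesic_ode_speed x v (a b : R) :
  (forall t, a < t < b -> geodesic_ode x v t /\ `|x t - u0| <= r) ->
  forall s t, a < s < b -> a < t < b ->
  cinner i (x s) (v s) (v s) = cinner i (x t) (v t) (v t).
Proof.
move=> H s t sab tab.
pose f t := cinner i (x t) (v t) (v t).
have fd q : a < q < b -> is_derive q 1 f 0.
  move=> qab; have [[d1 d2] xr] := H q qab.
  have e a b := mb_derive mb a b xr d1.
  apply: is_derive_eq (is_derive_inner e d2 d2) _.
  rewrite (mx_innerC (v q) _ (mb_sym mb xr)) (acceleration_inner mb)//.
  by have := gam_diag mb (v q) (v q) xr; rewrite /dG => <-; ring.
apply/eqP; rewrite -subr_eq0 -normr_le0 -(mul0r `|s - t|).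
apply: (@mvt_bound _ f (fun=> 0)) => q; last by rewrite normr0.
move: sab tab => /andP[? ?] /andP[? ?]; rewrite ge_min le_max.
by move=> /andP[/orP[?|?] /orP[?|?]]; apply: fd; apply/andP; split; short_lra.
Qed.

End GeodesicFlow.

Lemma itv_cc_convex (R : realDomainType) (s t q q' : R) : s <= q <= t -> s <= q' <= t ->
  forall p, Num.min q q' <= p <= Num.max q q' -> s <= p <= t.
Proof.
move=> /andP[sq qt] /andP[sq' q't] p /andP[qp pq].
by apply/andP; split; [apply: le_trans qp; rewrite le_min sq|apply: le_trans pq _; rewrite ge_max qt].
Qed.

(** * Short solutions are minimal *)

Section SolutionIsometric.
Context {R : realType} {n : nat} (M : riemannianManifold R n).
Hypothesis M_connected : connected [set: M].
Variables (i : rm_index M) (u0 : 'rV[R]_n) (r lam C : R).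
Hypothesis mb : metric_ball (metric i) (chart_codom (atlas i)) u0 r lam C.
Local Notation g := (metric i).
Local Notation mu := (Num.sqrt lam).
Local Notation phi := (atlas i).
Local Notation acc := (acceleration i).
Implicit Types (x y : R -> 'rV[R]_n) (v w : R -> 'rV[R]_n) (s t h : R).

Let lam0 : 0 < lam. Proof. exact: (mb_lam mb). Qed.
Let mu0 : 0 < mu. Proof. by rewrite sqrtr_gt0. Qed.
Let C1 : 1 <= C. Proof. exact: (mb_C mb). Qed.
Let C0 : 0 <= C. Proof. exact: le_trans ler01 C1. Qed.
Let r0 : 0 < r. Proof. exact: (mb_r mb). Qed.

Lemma isometric_near_ode (gamma : R -> M) (t d : R) : 0 < d -> isometric_near gamma t d ->
  chart_dom phi (gamma t) -> geodesic_velocity i gamma (derive1 (coord_curve i gamma)) t.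
Proof.
move=> d0 H Dt; have [v [e [e0 Hv]]] := isometric_near_velocity M_connected d0 H Dt.
have t0 : `|t - t| < e by rewrite subrr normr0.
have [_ H1 H2 H3] := Hv t t0.
have near_v : {near t, v =1 (coord_curve i gamma)^`()}.
  apply/nbhs_ballP; exists e => // s' /=; rewrite /ball /= distrC => h.
  by have [_ h1 _ _] := Hv s' h; rewrite (derive1_val h1).
have E1 : derive1 (coord_curve i gamma) t = v t := derive1_val H1.
split; rewrite ?E1//; exact: near_eq_is_derive near_v H2.
Qed.

Lemma unit_norm_le (z u : 'rV[R]_n) : `|z - u0| <= r -> cinner i z u u = 1 -> `|u| <= mu^-1.
Proof.
move=> zr u1; have := mu_norm_le mb u zr; rewrite u1 sqrtr1 => H.
by rewrite -(ler_pM2l mu0) mulfV// gt_eqF.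
Qed.

Lemma minimal_path_interior (sigma : R -> M) (l t : R) : minimal_path sigma l -> 0 < t < l ->
  isometric_near sigma t (Num.min t (l - t)).
Proof.
move=> H /andP[t0 tl] s s'; rewrite !lt_min !ltr_norml.
move=> /andP[/andP[? ?] /andP[? ?]] /andP[/andP[? ?] /andP[? ?]].
by apply: H; apply/andP; split; short_lra.
Qed.

Lemma minimal_path_lipschitz (sigma : R -> M) (l K : R) : minimal_path sigma l ->
  (forall t : R, 0 <= t <= l -> chart_dom phi (sigma t) /\ `|phi (sigma t) - u0| <= K) ->
  K + l / mu < r -> forall s t, 0 <= s <= l -> 0 <= t <= l ->
  `|phi (sigma t) - phi (sigma s)| <= mu^-1 * `|t - s|.
Proof.
move=> H D Kr s t sl tl; have [Ds sK] := D s sl.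
have E := H s t sl tl.
have ts : `|t - s| <= l.
  by move: sl tl => /andP[? ?] /andP[? ?]; rewrite ler_norml; apply/andP; split; short_lra.
have [|_] := rdist_lower M_connected mb (x := sigma s) (y := sigma t) Ds.
  rewrite E; apply: le_lt_trans Kr; apply: lerD => //.
  by rewrite ler_wpM2r// invr_ge0 ltW.
by rewrite E -ler_pdivlMl.
Qed.

(** A minimal path between the two points, reparametrized affinely to the time interval of the
    solution, solves the same boundary value problem and so coincides with it. Its speed is
    [k = l / (t - s)], that of the solution is 1, hence [k = 1]. *)
Lemma solution_isometric : exists2 h1 : R, 0 < h1 & forall x v (a b : R), a < b -> b - a <= h1 ->
  (forall t, a < t < b -> [/\ geodesic_ode i x v t, `|x t - u0| <= r / 8 &
     cinner i (x t) (v t) (v t) = 1]) ->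
  forall s t, a < s < b -> a < t < b ->
    rdist (chart_inv phi (x s)) (chart_inv phi (x t)) = `|t - s|.
Proof.
(* Bounds both velocities: that of the solution by [1 / mu], that of the reparametrized path by
   [k / mu] with [k <= Num.sqrt C / mu]. *)
pose V : R := Num.sqrt C / mu ^+ 2 + mu^-1.
have sC0 : 0 <= Num.sqrt C by exact: sqrtr_ge0.
have V1 : 0 <= Num.sqrt C / mu ^+ 2 by rewrite divr_ge0 ?exprn_ge0 ?(ltW mu0).
have mV : 0 < mu^-1 by rewrite invr_gt0.
have V0 : 0 <= V by rewrite /V; short_lra.
have A0 := acc_const_ge0 mb V0; set A := acc_const _ _ _ in A0.
(* The first two entries are the conditions of [geodesic_ode_bvp]; the third keeps the minimal path
   within [r / 16] of its start in coordinates. *)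
pose h1 : R := Num.min 4^-1 (Num.min (4^-1 / (A + 1)) (r / 16 / (Num.sqrt C / mu ^+ 2 + 1))).
have A1 : 0 < A + 1 by short_lra.
have V2 : 0 < Num.sqrt C / mu ^+ 2 + 1 by short_lra.
have q4 : 0 < 4^-1 :> R by rewrite invr_gt0.
have h10 : 0 < h1 by rewrite /h1 !lt_min q4 (divr_gt0 q4 A1) (divr_gt0 (divr_gt0 r0 _) V2).
have h1a : h1 <= 4^-1 by rewrite ge_min lexx.
have h1b : A * h1 <= 4^-1.
  apply: (@le_trans _ _ (h1 * (A + 1))); first by rewrite mulrDr mulr1 mulrC lerDl ltW.
  by rewrite -ler_pdivlMr// !ge_min lexx orbT.
have h1c : Num.sqrt C / mu ^+ 2 * h1 <= r / 16.
  apply: (@le_trans _ _ (h1 * (Num.sqrt C / mu ^+ 2 + 1))).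
    by rewrite mulrDr mulr1 mulrC lerDl ltW.
  by rewrite -ler_pdivlMr// !ge_min lexx !orbT.
clearbody h1; exists h1 => // x v a b ab bah H.
suff W s t : a < s < b -> a < t < b -> s < t ->
    rdist (chart_inv phi (x s)) (chart_inv phi (x t)) = t - s.
  move=> s t sab tab; have [st|ts|->] := ltgtP s t.
  - by rewrite W// gtr0_norm// subr_gt0.
  - by rewrite rdistC W// distrC gtr0_norm// subr_gt0.
  - by rewrite rdistxx subrr normr0.
move=> sab tab st.
have xr q : a < q < b -> `|x q - u0| <= r by move=> /H[_ k _]; move: r0 k; short_lra.
have codx q : a < q < b -> chart_codom phi (x q) by move=> /xr; exact: (mb_dom mb).
have vb q : a < q < b -> `|v q| <= mu^-1.
  by move=> qab; have [_ _ k] := H q qab; exact: unit_norm_le (xr q qab) k.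
have sub q : s <= q <= t -> a < q < b.
  by move: sab tab => /andP[? ?] /andP[? ?] /andP[? ?]; apply/andP; split; short_lra.
have btw q q' : s <= q <= t -> s <= q' <= t -> forall p, Num.min q q' <= p <= Num.max q q' ->
    s <= p <= t by exact: itv_cc_convex.
have xL q q' : s <= q <= t -> s <= q' <= t -> `|x q' - x q| <= mu^-1 * `|q' - q|.
  move=> qs qs'; apply: (@mvt_bound_rV _ _ x v); first exact: ltW.
    by move=> p /(btw _ _ qs qs') /sub pab; have [[d _] _ _] := H p pab.
  by move=> p /(btw _ _ qs qs') /sub pab; exact: vb.
pose p := chart_inv phi (x s); pose q := chart_inv phi (x t).
have Dp : chart_dom phi p by apply: chart_inv_dom; exact: codx.
have Dq : chart_dom phi q by apply: chart_inv_dom; exact: codx.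
have pE : phi p = x s by rewrite chart_invK//; exact: codx.
have qE : phi q = x t by rewrite chart_invK//; exact: codx.
have ss : s <= s <= t by rewrite lexx ltW.
have tt : s <= t <= t by rewrite lexx ltW.
have ts0 : 0 < t - s by rewrite subr_gt0.
have tsh : t - s <= h1.
  by move: sab tab => /andP[? ?] /andP[? ?]; short_lra.
rewrite -/p -/q; set l := rdist p q.
have l0 : 0 <= l by exact: rdist_ge0.
have [_ sr _] := H s sab; have [_ tr _] := H t tab.
have lC : l <= Num.sqrt C / mu * (t - s).
  have := rdist_upper mb Dp Dq; rewrite pE qE => k.
  apply: le_trans (k _ _) _; [move: r0 sr; short_lra|move: r0 tr; short_lra|].
  rewrite -mulrA ler_wpM2l//; apply: le_trans (xL _ _ ss tt) _.
  by rewrite gtr0_norm.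
have lr : l / mu <= r / 16.
  apply: le_trans h1c; rewrite ler_pdivrMr//; apply: le_trans lC _.
  have -> : Num.sqrt C / mu ^+ 2 * h1 * mu = Num.sqrt C / mu * h1 by field; rewrite gt_eqF.
  by rewrite ler_wpM2l// divr_ge0// ltW.
have stay (z : M) : rdist p z <= l -> chart_dom phi z /\ `|phi z - u0| <= r / 4.
  move=> pz; have zr : rdist p z / mu <= r / 16.
    by apply: le_trans lr; rewrite ler_wpM2r// ltW.
  have [|Dz k] := rdist_lower M_connected mb (x := p) (y := z) Dp.
    by rewrite pE; move: r0 sr zr; short_lra.
  split=> //; rewrite -ler_pdivlMl// mulrC pE in k.
  have := ler_distD (x s) (phi z) u0; move: r0 sr zr k; short_lra.
have [sigma [s0 sl smin]] : exists sigma : R -> M,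
    [/\ sigma 0 = p, sigma l = q & minimal_path sigma l].
  apply: (@minimal_path_exists _ _ _ M_connected
    [set z : M | chart_dom phi z /\ `|phi z - u0| <= r / 4]).
    by apply: (chart_ball_compact mb); move: r0; short_lra.
  move=> sg l' ll' sg0 sgl Hsg q' /andP[q0 ql]; apply: stay; rewrite -sg0.
  apply: le_trans (Hsg 0 q' _ _) _; [by rewrite lexx; short_lra|by rewrite q0; short_lra|].
  by rewrite subr0 ger0_norm.
have sD (q' : R) : 0 <= q' <= l -> chart_dom phi (sigma q') /\ `|phi (sigma q') - u0| <= r / 4.
  move=> q'l; apply: stay; rewrite -s0 (smin _ _ _ q'l) ?lexx//.
  by move: q'l => /andP[? ?]; rewrite subr0 ger0_norm.
have r4 : r / 4 + l / mu < r by move: r0 lr; short_lra.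
have sL := minimal_path_lipschitz smin sD r4.
pose k := l / (t - s).
have k0 : 0 <= k by rewrite divr_ge0// ltW.
have kC : k <= Num.sqrt C / mu by rewrite ler_pdivrMr.
have kE : k * (t - s) = l by rewrite divfK// gt_eqF.
pose cs := coord_curve i sigma; pose vs := derive1 cs.
pose y q := cs (- (s * k) + q * k); pose w q := k *: vs (- (s * k) + q * k).
have aff q' : s <= q' <= t -> 0 <= - (s * k) + q' * k <= l.
  move=> /andP[q1 q2]; have -> : - (s * k) + q' * k = k * (q' - s) by ring.
  by rewrite mulr_ge0 ?subr_ge0// -kE ler_wpM2l// lerD2r.
have yL q1 q2 : s <= q1 <= t -> s <= q2 <= t -> `|y q2 - y q1| <= mu^-1 * k * `|q2 - q1|.
  move=> h2 h3; apply: le_trans (sL _ _ (aff _ h2) (aff _ h3)) _.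
  have -> : - (s * k) + q2 * k - (- (s * k) + q1 * k) = k * (q2 - q1) by ring.
  by rewrite normrM (ger0_norm k0) mulrA.
have ys : y s = x s by rewrite /y addNr /cs /coord_curve /= s0.
have yt : y t = x t.
  rewrite /y (_ : - (s * k) + t * k = l); last by rewrite -kE; ring.
  by rewrite /cs /coord_curve /= sl.
have oc q' : s < q' < t -> s <= q' <= t by move=> /andP[? ?]; rewrite !ltW.
have Hy q' : s < q' < t -> [/\ geodesic_ode i y w q', `|y q' - u0| <= r, `|w q'| <= V &
    cinner i (y q') (w q') (w q') = k ^+ 2].
  move=> q'st; have q'c := oc _ q'st; have [_ yr] := sD _ (aff _ q'c).
  have {}yr : `|y q' - u0| <= r by move: r0 yr; rewrite /y /cs /coord_curve /=; short_lra.
  (* If [l = 0], the path has no interior times; the comparison curve is then a constant solution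
     with [k = 0]. *)
  move: l0; rewrite le_eqVlt => /orP[/eqP l0|l0].
    have kz : k = 0 by rewrite /k -l0 mul0r.
    have wE : w = fun=> 0 by apply/funext => q2; rewrite /w kz scale0r.
    have yE : y = fun=> y q' by apply/funext => q2; rewrite /y kz !mulr0.
    split => //; last 2 first.
    - by rewrite wE normr0.
    - by rewrite wE /cinner mx_inner0l kz expr0n.
    split.
      by rewrite yE wE; exact: is_derive_cst.
    rewrite [acc _ _](_ : _ = 0); first by rewrite wE; exact: is_derive_cst.
    by have := @accelerationZ _ _ M i (y q') 0 0; rewrite expr0n !scale0r wE.
  have k1 : 0 < k by rewrite divr_gt0.
  have qo : 0 < - (s * k) + q' * k < l.
    have -> : - (s * k) + q' * k = k * (q' - s) by ring.
    move: q'st => /andP[h2 h3].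
    by rewrite mulr_gt0 ?subr_gt0// -kE ltr_pM2l// ltrD2r.
  have d0 : 0 < Num.min (- (s * k) + q' * k) (l - (- (s * k) + q' * k)).
    by move/andP: qo => [? ?]; rewrite lt_min subr_gt0; apply/andP.
  have iso := minimal_path_interior smin qo.
  have [Ds e1 e2 e3] := isometric_near_ode d0 iso (sD _ (aff _ q'c)).1.
  have vsb := unit_norm_le yr e3.
  split => //.
  - split; first exact: affine_derive e1.
    rewrite /w accelerationZ.
    have := affine_derive e2 => /(is_deriveZ k).
    by rewrite scalerA -expr2.
  - rewrite /w normrZ (ger0_norm k0); apply: (@le_trans _ _ (Num.sqrt C / mu * mu^-1)).
      by rewrite ler_pM.
    rewrite /V; have -> : Num.sqrt C / mu * mu^-1 = Num.sqrt C / mu ^+ 2 by field; rewrite gt_eqF.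
    by rewrite lerDl ltW.
  - by rewrite /cinner /w mx_innerZl mx_innerZr -/(cinner _ _ _ _) e3 mulr1 expr2.
have Hx q' : s < q' < t -> [/\ geodesic_ode i x v q', `|x q' - u0| <= r & `|v q'| <= V].
  move=> /oc /sub q'ab; have [e1 _ e2] := H _ q'ab; split=> //; first exact: xr.
  by apply: le_trans (vb _ q'ab) _; rewrite /V lerDr.
have Hy' q' : s < q' < t -> [/\ geodesic_ode i y w q', `|y q' - u0| <= r & `|w q'| <= V].
  by move=> /Hy [].
pose K := mu^-1 + mu^-1 * k.
have mk : 0 <= mu^-1 * k by rewrite mulr_ge0// ltW.
have K0 : 0 <= K by rewrite /K addr_ge0// ltW.
have E := geodesic_ode_bvp mb V0 K0 st (le_trans tsh h1a) _ Hx Hy' _ _ (esym ys) (esym yt).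
have mid : s < (s + t) / 2 < t by rewrite !(midf_lt st).
have [||| xm vm] := E _ _ _ _ mid.
- by apply: le_trans h1b; rewrite ler_wpM2l.
- move=> q1 q2 h2 h3; apply: le_trans (xL _ _ h2 h3) _; rewrite ler_wpM2r//.
  by rewrite /K lerDl.
- move=> q1 q2 h2 h3; apply: le_trans (yL _ _ h2 h3) _; rewrite ler_wpM2r//.
  by rewrite /K lerDr ltW.
have [_ _ _ k2] := Hy _ mid; have [_ _ k3] := H _ (sub _ (oc _ mid)).
move: k2; rewrite -xm -vm k3 => /esym /eqP; rewrite sqrf_eq1 => /orP[/eqP k1|/eqP k1].
  by rewrite -kE k1 mul1r.
by move: k0; rewrite k1 oppr_ge0 ler10.
Qed.

End SolutionIsometric.

(** * Extension of minimal paths *)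

Lemma itv_oo_convex (R : realDomainType) (s t q q' : R) : s < q < t -> s < q' < t ->
  forall p, Num.min q q' <= p <= Num.max q q' -> s < p < t.
Proof.
move=> /andP[sq qt] /andP[sq' q't] p /andP[qp pq].
by apply/andP; split; [apply: lt_le_trans qp; rewrite lt_min sq|apply: le_lt_trans pq _; rewrite gt_max qt].
Qed.

Section Clamp.
Context {R : realType} {n : nat}.
Implicit Types (u z : 'rV[R]_n) (d : R).

(** The coordinatewise retraction onto the closed sup norm ball. It makes the geodesic vector field
    bounded and globally Lipschitz without changing it on the ball. *)
Definition clamp u d z : 'rV[R]_n := \row_k Num.max (u 0 k - d) (Num.min (z 0 k) (u 0 k + d)).

Lemma clamp_near u d z : 0 <= d -> `|clamp u d z - u| <= d.
Proof.
move=> d0; apply: norm_le_coord => // k; rewrite rvBE mxE ler_norml.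
apply/andP; split; first by rewrite lerBrDl le_max lexx.
by rewrite lerBlDl ge_max ge_min lexx orbT andbT; short_lra.
Qed.

Lemma clamp_id u d z : `|z - u| <= d -> clamp u d z = z.
Proof.
move=> zu; apply/rowP => k; rewrite mxE.
have := le_trans (coord_le_norm (z - u) k) zu; rewrite rvBE ler_norml => /andP[h1 h2].
by rewrite (min_idPl _) ?(max_idPr _)//; short_lra.
Qed.

Lemma clamp_lipschitz u d z z' : `|clamp u d z - clamp u d z'| <= `|z - z'|.
Proof.
apply: norm_le_coord => // k; rewrite rvBE !mxE.
apply: le_trans (maxr_lipschitz _ _ _) _; apply: le_trans (minr_lipschitz _ _ _) _.
by rewrite -rvBE; exact: coord_le_norm.
Qed.

End Clamp.

Section Blocks.
Context {R : realType} {n : nat}.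
Implicit Types (a b : 'rV[R]_n) (z : 'rV[R]_(n + n)).

Lemma norm_lsubmx z : `|lsubmx z| <= `|z|.
Proof. by apply: norm_le_coord => // k; rewrite mxE coord_le_norm. Qed.

Lemma norm_rsubmx z : `|rsubmx z| <= `|z|.
Proof. by apply: norm_le_coord => // k; rewrite mxE coord_le_norm. Qed.

Lemma norm_row_mx a b : `|row_mx a b| <= `|a| + `|b|.
Proof.
apply: norm_le_coord => [|k]; first by rewrite addr_ge0.
rewrite mxE; case: (fintype.split k) => j; apply: le_trans (coord_le_norm _ j) _.
  by rewrite lerDl.
by rewrite lerDr.
Qed.

Lemma derive_lsubmx (z : R -> 'rV[R]_(n + n)) (t : R) dz : is_derive t 1 z dz ->
  is_derive t 1 (fun s => lsubmx (z s)) (lsubmx dz).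
Proof.
move=> /is_derive_rV H; apply/is_derive_rV => k; rewrite mxE.
have -> : (fun s => lsubmx (z s) 0 k) = (fun s => z s 0 (lshift n k)).
  by apply/funext => s; rewrite mxE.
exact: H.
Qed.

Lemma derive_rsubmx (z : R -> 'rV[R]_(n + n)) (t : R) dz : is_derive t 1 z dz ->
  is_derive t 1 (fun s => rsubmx (z s)) (rsubmx dz).
Proof.
move=> /is_derive_rV H; apply/is_derive_rV => k; rewrite mxE.
have -> : (fun s => rsubmx (z s) 0 k) = (fun s => z s 0 (rshift n k)).
  by apply/funext => s; rewrite mxE.
exact: H.
Qed.

End Blocks.

Section Extension.
Context {R : realType} {n : nat} (M : riemannianManifold R n).
Hypothesis M_connected : connected [set: M].
Implicit Types (i : rm_index M) (r lam C s t h l : R).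

(** [picard] is applied to the first order system clamped in position and velocity, and [T] is so
    short that the solution stays where clamping has no effect. That [T] is uniform in the initial
    data is essential in [minimal_path_extend_right]. *)
Lemma geodesic_ode_exists i u0 r lam C :
  metric_ball (metric i) (chart_codom (atlas i)) u0 r lam C ->
  exists2 T : R, 0 < T & forall x0 v0 : 'rV[R]_n, `|x0 - u0| <= r / 16 ->
    `|v0| <= (Num.sqrt lam)^-1 ->
    exists x v : R -> 'rV[R]_n, [/\ x 0 = x0, v 0 = v0 &
      forall t : R, `|t| < T -> geodesic_ode (M := M) i x v t /\ `|x t - u0| <= r / 8].
Proof.
move=> mb; have r0 := mb_r mb; have lam0 := mb_lam mb; have C1 := mb_C mb.
have C0 : 0 <= C by exact: le_trans ler01 C1.
set mu : R := Num.sqrt lam; have mu0 : 0 < mu by rewrite sqrtr_gt0.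
(* One more than the initial velocity bound, since the velocity changes by at most [B * T <= 1]. *)
pose V := mu^-1 + 1.
have mi0 : 0 < mu^-1 by rewrite invr_gt0.
have V0 : 0 <= V by rewrite /V; short_lra.
have A0 := acc_const_ge0 mb V0; set A := acc_const _ _ _ in A0.
pose Q := 2 * C / lam * V ^+ 2.
have Q0 : 0 <= Q by rewrite /Q !mulr_ge0 ?exprn_ge0// invr_ge0 ltW.
pose L := 1 + 2 * A; pose B := V + Q.
have L0 : 0 < L by rewrite /L; short_lra.
have B0 : 0 <= B by rewrite /B; short_lra.
pose F (z : 'rV[R]_(n + n)) : 'rV[R]_(n + n) :=
  row_mx (clamp 0 V (rsubmx z)) (acceleration i (clamp u0 r (lsubmx z)) (clamp 0 V (rsubmx z))).
have cV u : `|clamp 0 V u : 'rV[R]_n| <= V by have := clamp_near 0 u V0; rewrite subr0.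
have cr u : `|clamp u0 r u - u0| <= r by apply: clamp_near; exact: ltW.
have FL z z' : `|F z - F z'| <= L * `|z - z'|.
  rewrite /F opp_row_mx add_row_mx; apply: le_trans (norm_row_mx _ _) _.
  have k1 : `|clamp 0 V (rsubmx z) - clamp 0 V (rsubmx z')| <= `|z - z'|.
    apply: le_trans (clamp_lipschitz _ _ _ _) _; rewrite -linearB; exact: norm_rsubmx.
  have k2 : `|clamp u0 r (lsubmx z) - clamp u0 r (lsubmx z')| <= `|z - z'|.
    apply: le_trans (clamp_lipschitz _ _ _ _) _; rewrite -linearB; exact: norm_lsubmx.
  have k3 := acceleration_lipschitz mb (cr (lsubmx z)) (cr (lsubmx z')) (cV (rsubmx z)) (cV (rsubmx z')).
  have k4 := le_trans k3 (ler_wpM2l A0 (lerD k2 k1)).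
  have -> : L * `|z - z'| = `|z - z'| + A * (`|z - z'| + `|z - z'|) by rewrite /L; ring.
  exact: lerD.
have FB z : `|F z| <= B.
  apply: le_trans (norm_row_mx _ _) _; apply: lerD => //.
  apply: le_trans (acceleration_bound mb _ (cr _)) _.
  rewrite /Q ler_wpM2l ?mulr_ge0 ?invr_ge0 ?(ltW lam0)//.
  by rewrite lerXn2r ?nnegrE.
have B1 : 0 < B + 1 by short_lra.
pose T : R := Num.min (2^-1 / L) (Num.min (1 / (B + 1)) (r / 16 / (B + 1))).
have T0 : 0 < T.
  have h2 : 0 < 2^-1 :> R by rewrite invr_gt0.
  by rewrite /T !lt_min (divr_gt0 h2 L0) (divr_gt0 ltr01 B1) (divr_gt0 (divr_gt0 r0 _) B1).
have LT : L * T <= 2^-1 by rewrite mulrC -ler_pdivlMr// ge_min lexx.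
have BT1 : B * T <= 1.
  apply: (@le_trans _ _ (T * (B + 1))); first by rewrite mulrDr mulr1 mulrC lerDl ltW.
  by rewrite -ler_pdivlMr// !ge_min lexx orbT.
have BTr : B * T <= r / 16.
  apply: (@le_trans _ _ (T * (B + 1))); first by rewrite mulrDr mulr1 mulrC lerDl ltW.
  by rewrite -ler_pdivlMr// !ge_min lexx !orbT.
clearbody T; exists T => // x0 v0 x0r v0V.
have [z [z0 zd]] := picard (ltW L0) B0 T0 LT FL FB (row_mx x0 v0).
have zB t : `|t| < T -> `|z t - z 0| <= B * T.
  move=> tT; apply: (@le_trans _ _ (B * `|t - 0|)).
    have tT' : - T < t < T by rewrite -ltr_norml.
    have oT : - T < 0 < T by rewrite oppr_lt0 T0.
    apply: (@mvt_bound_rV _ _ z (fun t => F (z t))) => // q /(itv_oo_convex oT tT').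
    by rewrite -ltr_norml => /zd.
  by rewrite subr0 ler_wpM2l// ltW.
exists (fun t => lsubmx (z t)), (fun t => rsubmx (z t)); split.
- by rewrite z0 row_mxKl.
- by rewrite z0 row_mxKr.
move=> t tT; have zt := zB t tT.
have x8 : `|lsubmx (z t) - u0| <= r / 8.
  apply: le_trans (ler_distD x0 _ _) _.
  have : `|lsubmx (z t) - x0| <= B * T.
    apply: le_trans zt; rewrite -(row_mxKl x0 v0) -z0 -linearB; exact: norm_lsubmx.
  move: x0r BTr; short_lra.
have vV : `|rsubmx (z t) - 0| <= V.
  rewrite subr0; have -> : rsubmx (z t) = rsubmx (z t - z 0) + v0.
    by rewrite linearB /= z0 row_mxKr subrK.
  apply: le_trans (ler_normD _ _) _; rewrite /V addrC; apply: lerD => //.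
  by apply: le_trans (norm_rsubmx _) _; exact: le_trans zt BT1.
have xr : `|lsubmx (z t) - u0| <= r by move: r0 x8; short_lra.
split=> //; have H := zd t tT; split.
  by have := derive_lsubmx H; rewrite /F row_mxKl clamp_id.
by have := derive_rsubmx H; rewrite /F row_mxKr !clamp_id.
Qed.

Lemma isometric_near_eq (gamma gamma' : R -> M) (t d d' : R) : 0 < d -> 0 < d' ->
  isometric_near gamma t d -> (forall s, `|s - t| < d' -> gamma' s = gamma s) ->
  exists2 e : R, 0 < e & isometric_near gamma' t e.
Proof.
move=> d0 d'0 H E; exists (Num.min d d'); first by rewrite lt_min d0.
by move=> s s'; rewrite !lt_min => /andP[h1 h2] /andP[h3 h4]; rewrite !E//; exact: H.
Qed.

Lemma minimal_path_extend_right (sigma : R -> M) l : 0 < l -> minimal_path sigma l ->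
  exists sg (e : R), [/\ 0 < e, forall t, t <= l -> sg t = sigma t &
    forall t : R, 0 < t < l + e -> exists2 d : R, 0 < d & isometric_near sg t d].
Proof.
move=> l0 smin; pose i := chart_at (sigma l).
have Dl : chart_dom (atlas i) (sigma l) by exact: chart_at_dom.
have [r [lam [C mb]]] := good_chart Dl.
have r0 := mb_r mb; have lam0 := mb_lam mb.
set mu : R := Num.sqrt lam; have mu0 : 0 < mu by rewrite sqrtr_gt0.
have mi0 : 0 < mu^-1 by rewrite invr_gt0.
set u0 := atlas i (sigma l) in mb.
have [h1 h10 Hiso] := solution_isometric M_connected mb.
have [T T0 Hode] := geodesic_ode_exists mb.
have A0 := acc_const_ge0 mb (ltW mi0); set A := acc_const _ _ _ in A0.
pose q : R := Num.min T (h1 / 2).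
have q0 : 0 < q by rewrite lt_min T0 divr_gt0.
have qT : q <= T by rewrite ge_min lexx.
have qh : q <= h1 / 2 by rewrite ge_min lexx orbT.
clearbody q.
pose d : R := Num.min (Num.min l q) (Num.min (mu * r / 32) (Num.min 4^-1 (4^-1 / (A + 1)))).
have A1 : 0 < A + 1 by short_lra.
have q4 : 0 < 4^-1 :> R by rewrite invr_gt0.
have mr0 : 0 < mu * r by rewrite mulr_gt0.
have d0 : 0 < d.
  by rewrite /d !lt_min l0 q0 q4 (divr_gt0 q4 A1) (divr_gt0 mr0).
have dl : d <= l by rewrite !ge_min lexx.
have dq : d <= q by rewrite !ge_min lexx orbT.
have dr : d <= mu * r / 32 by rewrite !ge_min lexx !orbT.
have d4 : d <= 4^-1 by rewrite !ge_min lexx !orbT.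
have dA : A * d <= 4^-1.
  apply: (@le_trans _ _ (d * (A + 1))); first by rewrite mulrDr mulr1 mulrC lerDl ltW.
  by rewrite -ler_pdivlMr// !ge_min lexx !orbT.
clearbody d.
pose t0 := l - d / 2; pose a := l - d.
have near_l t : a <= t <= l -> chart_dom (atlas i) (sigma t) /\
    `|atlas i (sigma t) - u0| <= mu^-1 * (l - t).
  rewrite /a => /andP[ta tl]; have tl0 : 0 <= t <= l by apply/andP; split; short_lra.
  have E : rdist (sigma l) (sigma t) = l - t.
    by rewrite smin ?lexx ?(ltW l0)// distrC ger0_norm// subr_ge0.
  have [|Dt k] := rdist_lower M_connected mb (x := sigma l) (y := sigma t) Dl.
    rewrite -/u0 -/mu subrr normr0 add0r E ltr_pdivrMr//; move: mr0 dr; short_lra.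
  by split=> //; rewrite ler_pdivlMl// -E.
have near_r t : a <= t <= l -> `|atlas i (sigma t) - u0| <= r / 16.
  move=> tal; have [_ k] := near_l t tal; apply: le_trans k _.
  by rewrite ler_pdivrMl//; move: tal mr0 dr; rewrite /a => /andP[? ?]; short_lra.
pose c := coord_curve i sigma; pose v := derive1 c.
have Hc t : a < t < l -> [/\ geodesic_ode i c v t, `|c t - u0| <= r, `|v t| <= mu^-1 &
    cinner i (c t) (v t) (v t) = 1].
  move=> /andP[at_ tl]; have tal : a <= t <= l by rewrite !ltW.
  have tl0 : 0 < t < l by move: at_; rewrite /a => ?; apply/andP; split; short_lra.
  have m0 : 0 < Num.min t (l - t) by move/andP: tl0 => [? ?]; rewrite lt_min subr_gt0; apply/andP.
  have [_ e1 e2 e3] := isometric_near_ode M_connected m0 (minimal_path_interior smin tl0) (near_l t tal).1.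
  have cr : `|c t - u0| <= r by have := near_r t tal; rewrite -/(c t); move: r0; short_lra.
  by split=> //; exact: (unit_norm_le mb cr e3).
have t0al : a < t0 < l by rewrite /a /t0; apply/andP; split; short_lra.
have t0al' : a <= t0 <= l by move/andP: t0al => [? ?]; rewrite !ltW.
have [ode0 cr0 v0 u1] := Hc t0 t0al.
have [x [w [x0 w0 xw]]] := Hode (c t0) (v t0) (near_r _ t0al') v0.
pose X t := x (- t0 + t * 1); pose W t := w (- t0 + t * 1).
have argE t : - t0 + t * 1 = t - t0 by rewrite mulr1 addrC.
have Xt0 : X t0 = c t0 by rewrite /X argE subrr.
have Wt0 : W t0 = v t0 by rewrite /W argE subrr.
have HX t : t0 - q < t < t0 + q -> geodesic_ode i X W t /\ `|X t - u0| <= r / 8.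
  move=> /andP[k1 k2]; have tT : `|- t0 + t * 1| < T.
    by rewrite argE ltr_norml; apply/andP; split; short_lra.
  have [[e1 e2] xr] := xw _ tT; split=> //; split.
    by have := affine_derive e1; rewrite scale1r.
  by have := affine_derive e2; rewrite scale1r.
have HXr t : t0 - q < t < t0 + q -> geodesic_ode i X W t /\ `|X t - u0| <= r.
  by move=> /HX[? k]; split=> //; move: r0 k; short_lra.
have t0q : t0 - q < t0 < t0 + q by apply/andP; split; short_lra.
have X1 t : t0 - q < t < t0 + q -> cinner i (X t) (W t) (W t) = 1.
  by move=> tq; rewrite (geodesic_ode_speed mb HXr tq t0q) Xt0 Wt0.
have XW t : t0 - q < t < t0 + q -> [/\ geodesic_ode i X W t, `|X t - u0| <= r & `|W t| <= mu^-1].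
  move=> tq; have [e1 e2] := HXr t tq; split=> //.
  exact: (unit_norm_le mb e2 (X1 t tq)).
have al : l - a <= 4^-1 by rewrite /a; short_lra.
have alA : A * (l - a) <= 4^-1 by rewrite /a opprB addrC subrK.
have aq t : a < t < l -> t0 - q < t < t0 + q.
  by rewrite /a /t0 => /andP[? ?]; apply/andP; split; short_lra.
have Heq t : a < t < l -> X t = c t.
  move=> tal; have [||-> //] := @geodesic_ode_unique _ _ _ _ _ _ _ _ mb mu^-1 X W c v a l t0 (ltW mi0) t0al al alA _ _ Xt0 Wt0 t tal.
  - by move=> s /aq; exact: XW.
  - by move=> s /Hc [].
have lq : t0 - q < l < t0 + q by rewrite /t0; apply/andP; split; short_lra.
have XL s t : t0 - q < s < t0 + q -> t0 - q < t < t0 + q -> `|X t - X s| <= mu^-1 * `|t - s|.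
  move=> sq tq; apply: (@mvt_bound_rV _ _ X W); first exact: ltW.
    by move=> p /(itv_oo_convex sq tq) pq; have [[]] := XW p pq.
  by move=> p /(itv_oo_convex sq tq) pq; have [] := XW p pq.
have Xl : X l = c l.
  apply/eqP; rewrite -subr_eq0 -normr_le0.
  have tl' : t0 < l by case/andP: t0al.
  have tll : t0 <= l <= l by rewrite lexx andbT ltW.
  apply: (@limit_le _ t0 l tl' l _ _ (2 * mu^-1) d tll d0) => s /andP[s1 s2] sl _; rewrite add0r.
  have sal : a < s < l by case/andP: t0al => [at0 _]; rewrite (lt_le_trans at0 s1) lt_neqAle sl s2.
  have sal' : a <= s <= l by case/andP: sal => [? ?]; rewrite !ltW.
  have k1 := XL _ _ (aq s sal) lq; rewrite [`|l - s|]distrC in k1.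
  have k2 : `|c s - c l| <= mu^-1 * (l - s) := (near_l s sal').2.
  have k3 : l - s = `|s - l| by rewrite distrC ger0_norm// subr_ge0.
  rewrite k3 -(Heq s sal) in k2.
  apply: le_trans (ler_distD (X s) _ _) _; rewrite [2 * _]mulr_natl mulr2n mulrDl.
  exact: lerD.
pose sg t := if t <= l then sigma t else chart_inv (atlas i) (X t).
have sgX t : t0 < t < t0 + q -> sg t = chart_inv (atlas i) (X t).
  move=> /andP[t1 t2]; rewrite /sg; case: ifP => // tl.
  have tal : a <= t <= l by case/andP: t0al => [? ?]; rewrite tl andbT; short_lra.
  have -> : X t = c t.
    move: tl; rewrite le_eqVlt => /orP[/eqP ->//|tl]; apply: Heq.
    by case/andP: t0al => [? ?]; rewrite tl andbT; short_lra.
  by rewrite /c /coord_curve /= chart_funK//; case: (near_l t tal).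
exists sg, (t0 + q - l); split; first by rewrite subr_gt0; case/andP: lq.
  by move=> t tl; rewrite /sg tl.
move=> t /andP[tp]; rewrite subrKC => tq.
have [tl|lt] := ltP t l.
  have tl0 : 0 < t < l by rewrite tp.
  have m0 : 0 < Num.min t (l - t) by rewrite lt_min subr_gt0 tp.
  have lt0 : 0 < l - t by rewrite subr_gt0.
  apply: (isometric_near_eq m0 lt0 (minimal_path_interior smin tl0)).
  by move=> s; rewrite ltr_norml => /andP[_ k]; rewrite /sg ifT//; short_lra.
have t0t : t0 < t by apply: lt_le_trans lt; case/andP: t0al.
exists (Num.min (t - t0) (t0 + q - t)); first by rewrite lt_min !subr_gt0 t0t.
have in_q s : `|s - t| < Num.min (t - t0) (t0 + q - t) -> t0 < s < t0 + q.
  by rewrite lt_min !ltr_norml => /andP[/andP[? ?] /andP[? ?]]; apply/andP; split; short_lra.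
have wide s : t0 < s < t0 + q -> t0 - q < s < t0 + q.
  by move=> /andP[? ?]; apply/andP; split; short_lra.
move=> s s' /in_q sq /in_q s'q; rewrite !sgX//.
apply: (Hiso X W (t0 - q) (t0 + q)); [short_lra|short_lra| |exact: wide|exact: wide].
by move=> p pq; have [e1 e2] := HX p pq; split=> //; exact: X1.
Qed.

End Extension.

(** * Two-sided extension and unique continuation *)

Section UniqueContinuation.
Context {R : realType} {n : nat} (M : riemannianManifold R n).
Hypothesis M_connected : connected [set: M].
Implicit Types (sigma tau : R -> M) (l s t : R) (i : rm_index M).

Lemma minimal_path_rev sigma l : minimal_path sigma l -> minimal_path (fun t => sigma (l - t)) l.
Proof.
move=> H s t /andP[s0 sl] /andP[t0 tl]; rewrite H; first by rewrite distrC; congr `|_|; ring.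
  by apply/andP; split; short_lra.
by apply/andP; split; short_lra.
Qed.

Lemma isometric_near_rev (gamma : R -> M) l t d : isometric_near gamma (l - t) d ->
  isometric_near (fun s => gamma (l - s)) t d.
Proof.
have E s : `|l - s - (l - t)| = `|s - t| by rewrite distrC; congr `|_|; ring.
move=> H s s' sd s'd; rewrite H ?E//.
by rewrite distrC; congr `|_|; ring.
Qed.

(** The extension to the left is the one to the right of the reversed path; the two are glued at
    [l / 2], where both equal [sigma]. *)
Lemma minimal_path_extend sigma l : 0 < l -> minimal_path sigma l ->
  exists sg (e : R), [/\ 0 < e, forall t : R, 0 <= t <= l -> sg t = sigma t &
    forall t : R, - e < t < l + e -> exists2 d : R, 0 < d & isometric_near sg t d].
Proof.
move=> l0 smin.
have [g1 [e1 [e10 g1E g1i]]] := minimal_path_extend_right M_connected l0 smin.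
have [g2 [e2 [e20 g2E g2i]]] := minimal_path_extend_right M_connected l0 (minimal_path_rev smin).
pose sg t := if t <= l / 2 then g2 (l - t) else g1 t.
have l2 : 0 < l / 2 by rewrite divr_gt0.
have sgE (t : R) : 0 <= t <= l -> sg t = sigma t.
  move=> /andP[t0 tl]; rewrite /sg; case: ifP => _; last exact: g1E.
  by rewrite g2E ?subKr//; short_lra.
pose e : R := Num.min e1 e2.
have e0 : 0 < e by rewrite lt_min e10.
have ee1 : e <= e1 by rewrite ge_min lexx.
have ee2 : e <= e2 by rewrite ge_min lexx orbT.
clearbody e; exists sg, e; split=> // t /andP[te tl].
have [tm|mt|tm] := ltgtP t (l / 2).
- have [|d d0 di] := g2i (l - t); first by apply/andP; split; short_lra.
  have k0 : 0 < l / 2 - t by rewrite subr_gt0.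
  apply: (isometric_near_eq d0 k0 (isometric_near_rev di)) => s.
  by rewrite ltr_norml => /andP[_ k]; rewrite /sg ifT//; short_lra.
- have [|d d0 di] := g1i t; first by apply/andP; split; short_lra.
  have k0 : 0 < t - l / 2 by rewrite subr_gt0.
  apply: (isometric_near_eq d0 k0 di) => s.
  by rewrite ltr_norml => /andP[k _]; rewrite /sg ifF//; apply/negbTE; rewrite -ltNge; short_lra.
have tl0 : 0 < t < l by apply/andP; split; short_lra.
have m0 : 0 < Num.min t (l - t) by rewrite lt_min; apply/andP; split; short_lra.
apply: (isometric_near_eq m0 l2 (minimal_path_interior smin tl0)) => s.
by rewrite tm ltr_norml => /andP[k1 k2]; apply: sgE; apply/andP; split; short_lra.
Qed.

Lemma minimal_path_segment sigma l : 0 < l -> minimal_path sigma l ->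
  exists2 sg, geodesic_segment (sigma 0) (sigma l) l sg & forall t : R, 0 <= t <= l -> sg t = sigma t.
Proof.
move=> l0 smin; have [sg [e [e0 sgE Hi]]] := minimal_path_extend l0 smin.
exists sg => //; split; [exact: ltW|by rewrite sgE// lexx ltW|by rewrite sgE// lexx ltW|].
exists e => //; split=> t; rewrite /= in_itv /= => /Hi [d d0 di];
  have [G S] := isometric_near_geodesic M_connected d0 di; [exact: G|exact: S].
Qed.

Lemma left_derive_eq (c c' : R -> 'rV[R]_n) t (v v' : 'rV[R]_n) d : 0 < d ->
  (forall s, t - d < s <= t -> c s = c' s) ->
  is_derive t 1 c v -> is_derive t 1 c' v' -> v = v'.
Proof.
move=> d0 E /is_derive_eps H /is_derive_eps H'.
apply/eqP; rewrite -subr_eq0 -normr_le0; apply/ler_addgt0Pr => e e0; rewrite add0r.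
have e2 : 0 < e / 2 by rewrite divr_gt0.
have [d1 d10 H1] := H _ e2; have [d2 d20 H2] := H' _ e2.
pose h : R := Num.min d (Num.min d1 d2) / 2.
have m0 : 0 < Num.min d (Num.min d1 d2) by rewrite !lt_min d0 d10.
have h0 : 0 < h by rewrite divr_gt0.
have hd : 2 * h <= d by rewrite mulrC divfK// ge_min lexx.
have hd1 : 2 * h <= d1 by rewrite mulrC divfK// !ge_min lexx orbT.
have hd2 : 2 * h <= d2 by rewrite mulrC divfK// !ge_min lexx !orbT.
clearbody h.
have nh : `|- h| = h by rewrite normrN gtr0_norm.
have {}H1 := H1 (- h); have {}H2 := H2 (- h); rewrite nh in H1 H2.
have t1 : (- h) *: 1 + t = t - h by rewrite /GRing.scale /= mulr1 addrC.
rewrite t1 !E in H1; [|by apply/andP; split; short_lra|by apply/andP; split; short_lra].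
rewrite t1 in H2.
have {}H1 := H1 (ltac:(short_lra)); have {}H2 := H2 (ltac:(short_lra)).
have E1 : h *: (v - v') = (c' (t - h) - c' t - (- h) *: v) - (c' (t - h) - c' t - (- h) *: v').
  by apply/rowP => k; rewrite !(rvDE, rvNE, rvZE); ring.
have : `|h *: (v - v')| <= e * h.
  by rewrite E1; apply: le_trans (ler_normB _ _) _; move: H1 H2; short_lra.
by rewrite normrZ gtr0_norm// mulrC ler_pM2r.
Qed.

Lemma isometric_near_dom (gamma : R -> M) (t d : R) i (r : R) : 0 < d -> isometric_near gamma t d ->
  chart_dom (atlas i) (gamma t) -> 0 < r ->
  exists2 e : R, 0 < e & forall s, `|s - t| < e -> chart_dom (atlas i) (gamma s) /\
    `|atlas i (gamma s) - atlas i (gamma t)| <= r.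
Proof.
move=> d0 H Dt r0; have gc := isometric_near_continuous M_connected d0 H.
have N1 : \forall s \near t, chart_dom (atlas i) (gamma s).
  by apply: gc; apply: open_nbhs_nbhs; split=> //; exact: chart_dom_open.
have cc : {for t, continuous (fun s => atlas i (gamma s))}.
  by apply: continuous_comp => //; exact: chart_fun_continuous.
have [d1 d10 H1] := (continuous_eps _ _).1 cc _ r0.
have /nbhs_ballP [d2 /= d20 H2] := N1.
exists (Num.min d1 d2); first by rewrite lt_min d10.
move=> s; rewrite lt_min => /andP[s1 s2]; split; last exact: H1.
by apply: H2; rewrite /ball /= distrC.
Qed.

Lemma isometric_near_unique (gamma gamma' : R -> M) (t d d' : R) i : 0 < d -> 0 < d' ->
  isometric_near gamma t d -> isometric_near gamma' t d' ->
  chart_dom (atlas i) (gamma t) -> gamma t = gamma' t ->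
  derive1 (coord_curve i gamma) t = derive1 (coord_curve i gamma') t ->
  exists2 e : R, 0 < e & forall s, `|s - t| < e -> gamma s = gamma' s.
Proof.
move=> d0 d'0 Hg Hg' Dt E E'.
have [r [lam [C mb]]] := good_chart Dt.
have r0 := mb_r mb; have lam0 := mb_lam mb.
have mi0 : 0 < (Num.sqrt lam)^-1 by rewrite invr_gt0 sqrtr_gt0.
have A0 := acc_const_ge0 mb (ltW mi0); set A := acc_const _ _ _ in A0.
have A1 : 0 < A + 1 by short_lra.
have [e1 e10 D1] := isometric_near_dom d0 Hg Dt r0.
have Dt' := Dt; rewrite E in Dt'.
have [e2 e20 D2] := isometric_near_dom d'0 Hg' Dt' r0.
have q8 : 0 < 8^-1 :> R by rewrite invr_gt0.
pose e : R := Num.min (Num.min e1 e2) (Num.min (Num.min d d') (Num.min 8^-1 (8^-1 / (A + 1)))).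
have e0 : 0 < e by rewrite /e !lt_min e10 e20 d0 d'0 q8 (divr_gt0 q8 A1).
have ee1 : e <= e1 by rewrite !ge_min lexx.
have ee2 : e <= e2 by rewrite !ge_min lexx orbT.
have ed : e <= d by rewrite !ge_min lexx !orbT.
have ed' : e <= d' by rewrite !ge_min lexx !orbT.
have e8 : e <= 8^-1 by rewrite !ge_min lexx !orbT.
have eA : A * e <= 8^-1.
  apply: (@le_trans _ _ (e * (A + 1))); first by rewrite mulrDr mulr1 mulrC lerDl ltW.
  by rewrite -ler_pdivlMr// !ge_min lexx !orbT.
clearbody e.
have inI s : t - e < s < t + e -> `|s - t| < e by rewrite ltr_distl.
have ode (g : R -> M) q p : 0 < q -> e <= q -> isometric_near g t q ->
    (forall s, `|s - t| < p -> chart_dom (atlas i) (g s) /\ `|atlas i (g s) - atlas i (gamma t)| <= r) ->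
    e <= p -> forall s, t - e < s < t + e ->
    [/\ geodesic_ode (M := M) i (coord_curve i g) (derive1 (coord_curve i g)) s,
      `|coord_curve i g s - atlas i (gamma t)| <= r &
      `|derive1 (coord_curve i g) s| <= (Num.sqrt lam)^-1].
  move=> q0 eq gi D ep s /inI se.
  have k0 : 0 < q - `|s - t| by rewrite subr_gt0 (lt_le_trans se).
  have gis : isometric_near g s (q - `|s - t|).
    by apply: (isometric_near_sub gi); rewrite subrKC.
  have [Ds sr] := D s (lt_le_trans se ep).
  have [_ k1 k2 k3] := isometric_near_ode M_connected k0 gis Ds.
  by split=> //; exact: (unit_norm_le mb sr k3).
have D2' s : `|s - t| < e2 -> chart_dom (atlas i) (gamma' s) /\
    `|atlas i (gamma' s) - atlas i (gamma t)| <= r by rewrite E; exact: D2.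
have tI : t - e < t < t + e by apply/andP; split; short_lra.
have w1 : t + e - (t - e) <= 4^-1 by short_lra.
have w2 : A * (t + e - (t - e)) <= 4^-1.
  by rewrite (_ : t + e - (t - e) = e + e) ?mulrDr; [short_lra|ring].
have cE : coord_curve i gamma t = coord_curve i gamma' t by rewrite /coord_curve /= E.
have U := geodesic_ode_unique mb (ltW mi0) tI w1 w2 (ode _ _ _ d0 ed Hg D1 ee1)
  (ode _ _ _ d'0 ed' Hg' D2' ee2) cE E'.
exists e => // s se; have sI : t - e < s < t + e by rewrite -ltr_distl.
have [+ _] := U s sI; rewrite /coord_curve /= => k.
have [Ds _] := D1 s (lt_le_trans se ee1); have [Ds' _] := D2' s (lt_le_trans se ee2).
by rewrite -(chart_funK Ds) k chart_funK.
Qed.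

(** Agreement before a time [s] determines both the point and the velocity at [s], the latter as a
    left derivative, so that [isometric_near_unique] applies at [s] and carries the agreement
    further. *)
Lemma local_geodesic_unique (gamma gamma' : R -> M) (t0 b : R) i :
  (forall t, t0 <= t < b -> exists2 d : R, 0 < d & isometric_near gamma t d) ->
  (forall t, t0 <= t < b -> exists2 d : R, 0 < d & isometric_near gamma' t d) ->
  chart_dom (atlas i) (gamma t0) -> gamma t0 = gamma' t0 ->
  derive1 (coord_curve i gamma) t0 = derive1 (coord_curve i gamma') t0 ->
  forall t, t0 <= t < b -> gamma t = gamma' t.
Proof.
move=> Hg Hg' Dt E E' t /andP[t0t tb].
pose P s := exists2 e : R, 0 < e & forall u, `|u - s| < e -> gamma u = gamma' u.
suff: P t by move=> [e e0]; apply; rewrite subrr normr0.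
have t0b : t0 <= t0 < b by rewrite lexx (le_lt_trans t0t).
apply: (@real_induction _ P t0 t t0t); last by rewrite t0t lexx.
- have [d d0 di] := Hg t0 t0b; have [d' d'0 di'] := Hg' t0 t0b.
  exact: (isometric_near_unique d0 d'0 di di' Dt E E').
- move=> s /andP[t0s st] IH.
  have sb : t0 <= s < b by rewrite ltW// (le_lt_trans st).
  have [d d0 di] := Hg s sb; have [d' d'0 di'] := Hg' s sb.
  have agree u : t0 <= u < s -> gamma u = gamma' u.
    by move=> /IH [e e0]; apply; rewrite subrr normr0.
  have Es : gamma s = gamma' s.
    apply: (rdist_eq0 M_connected); apply/eqP; rewrite eq_le rdist_ge0 andbT.
    apply/ler_addgt0Pr => e e0; rewrite add0r.
    pose h : R := Num.min (Num.min d d') (Num.min (s - t0) e) / 2.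
    have m0 : 0 < Num.min (Num.min d d') (Num.min (s - t0) e).
      by rewrite !lt_min d0 d'0 subr_gt0 t0s.
    have h0 : 0 < h by rewrite divr_gt0.
    have hd : 2 * h <= d by rewrite mulrC divfK// !ge_min lexx.
    have hd' : 2 * h <= d' by rewrite mulrC divfK// !ge_min lexx orbT.
    have hs : 2 * h <= s - t0 by rewrite mulrC divfK// !ge_min lexx !orbT.
    have he : 2 * h <= e by rewrite mulrC divfK// !ge_min lexx !orbT.
    clearbody h.
    have ss (q : R) : 0 < q -> `|s - s| < q by rewrite subrr normr0.
    have hh : `|s - h - s| = h by rewrite addrAC subrr add0r normrN gtr0_norm.
    have k1 : rdist (gamma s) (gamma (s - h)) = h by rewrite di ?ss ?hh//; short_lra.
    have k2 : rdist (gamma' s) (gamma' (s - h)) = h by rewrite di' ?ss ?hh//; short_lra.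
    have := rdist_triangle M_connected (gamma (s - h)) (gamma s) (gamma' s).
    rewrite k1 (agree (s - h)); last by apply/andP; split; short_lra.
    by rewrite [X in _ + X]rdistC k2; short_lra.
  have Ds : chart_dom (atlas (chart_at (gamma s))) (gamma s) by exact: chart_at_dom.
  have Ds' := Ds; rewrite {2}Es in Ds'.
  have [_ v1 _ _] := isometric_near_ode M_connected d0 di Ds.
  have [_ v2 _ _] := isometric_near_ode M_connected d'0 di' Ds'.
  apply: (isometric_near_unique d0 d'0 di di' Ds Es).
  have k0 : 0 < s - t0 by rewrite subr_gt0.
  apply: (left_derive_eq k0 _ v1 v2) => u /andP[u1]; rewrite le_eqVlt => /orP[/eqP ->|us].
    by rewrite Es.
  by rewrite (agree u)// us andbT; short_lra.
- move=> s /andP[t0s _] /(_ s) [|e e0 He]; first by rewrite t0s lexx.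
  have e2 : 0 < e / 2 by rewrite divr_gt0.
  exists (e / 2) => // u /andP[su ue] _; exists (e / 2) => // w wu; apply: He.
  by move: wu; rewrite !ltr_norml => /andP[? ?]; apply/andP; split; short_lra.
Qed.

(** Geodesics do not branch. The continuation starts at [a / 2], where both paths have a velocity
    and agree on the left; the end [l], out of reach of the local statement, follows by
    continuity. *)
Lemma minimal_path_unique sigma tau l a : 0 < a -> minimal_path sigma l -> minimal_path tau l ->
  (forall t : R, 0 <= t <= a -> sigma t = tau t) -> forall t : R, 0 <= t <= l -> sigma t = tau t.
Proof.
move=> a0 smin tmin E t /andP[t0 tl].
have [ta|at_] := leP t a; first by apply: E; rewrite t0.
have loc (s : R -> M) : minimal_path s l -> forall u, a / 2 <= u < l ->
    exists2 d : R, 0 < d & isometric_near s u d.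
  move=> m u /andP[u1 u2]; have ul : 0 < u < l by rewrite u2 andbT; short_lra.
  exists (Num.min u (l - u)); first by rewrite lt_min subr_gt0.
  exact: minimal_path_interior.
have D : chart_dom (atlas (chart_at (sigma (a / 2)))) (sigma (a / 2)) by exact: chart_at_dom.
have Ea : sigma (a / 2) = tau (a / 2) by apply: E; apply/andP; split; short_lra.
have a2l : a / 2 <= a / 2 < l by rewrite lexx; short_lra.
have Ed : derive1 (coord_curve (chart_at (sigma (a / 2))) sigma) (a / 2) =
          derive1 (coord_curve (chart_at (sigma (a / 2))) tau) (a / 2).
  have [d d0 di] := loc _ smin _ a2l; have [d' d'0 di'] := loc _ tmin _ a2l.
  have D' := D; rewrite {2}Ea in D'.
  have [_ v1 _ _] := isometric_near_ode M_connected d0 di D.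
  have [_ v2 _ _] := isometric_near_ode M_connected d'0 di' D'.
  have a20 : 0 < a / 2 by rewrite divr_gt0.
  apply: (left_derive_eq a20 _ v1 v2) => u /andP[u1 u2].
  by rewrite /coord_curve /= (E u)//; apply/andP; split; short_lra.
have U := local_geodesic_unique (loc _ smin) (loc _ tmin) D Ea Ed.
have {}U u : a / 2 <= u < l -> sigma u = tau u by exact: U.
move: tl; rewrite le_eqVlt => /orP[/eqP tl|tl]; last by apply: U; rewrite tl andbT; short_lra.
apply: (rdist_eq0 M_connected); apply/eqP; rewrite eq_le rdist_ge0 andbT.
apply/ler_addgt0Pr => e e0; rewrite add0r.
pose h : R := Num.min (l - a) e / 2.
have m0 : 0 < Num.min (l - a) e by rewrite lt_min e0 subr_gt0 -tl at_.
have h0 : 0 < h by rewrite divr_gt0.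
have hl : 2 * h <= l - a by rewrite mulrC divfK// ge_min lexx.
have he : 2 * h <= e by rewrite mulrC divfK// ge_min lexx orbT.
clearbody h.
have hl0 : 0 <= l - h <= l by apply/andP; split; short_lra.
have ll0 : 0 <= l <= l by rewrite lexx andbT; short_lra.
have lh : `|l - h - l| = h by rewrite addrAC subrr add0r normrN gtr0_norm.
have := rdist_triangle M_connected (sigma (l - h)) (sigma l) (tau l).
rewrite smin// lh (U (l - h)); last by apply/andP; split; short_lra.
by rewrite [X in _ + X]rdistC tmin// lh tl; short_lra.
Qed.

End UniqueContinuation.

(** * The boundary hypersurface *)

(** If the path avoided the boundary, being in [A] would be an open condition on the time as well as
    a closed one, and would persist up to [b]. *)
Lemma boundary_crossing (R : realType) (T : topologicalType) (A : set T) (f : R -> T) (a b : R) :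
  closed A -> a <= b -> (forall t, a <= t <= b -> {for t, continuous f}) ->
  A (f a) -> ~ A (f b) -> exists2 t, a <= t <= b & boundary A (f t).
Proof.
move=> cA ab fc Aa Ab; apply: contra_notP Ab => H.
have nb t : a <= t <= b -> A (f t) -> \forall s \near t, A (f s).
  move=> tab At; apply: (fc t tab); apply: contrapT => H'; apply: H.
  exists t => //; split=> //; exact: subset_closure.
apply: (@real_induction _ (fun t => A (f t)) a b ab Aa); last by rewrite ab lexx.
  move=> t /andP[at_ tb] IH; apply: cA => B B0.
  have tab : a <= t <= b by rewrite (ltW at_).
  have /nbhs_ballP [e /= e0 He] : \forall s \near t, B (f s) by exact: (fc t tab).
  pose s : R := Num.max a (t - e / 2).
  have sa : a <= s by rewrite le_max lexx.
  have st : s < t by rewrite gt_max at_ gtrBl divr_gt0.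
  have es : t - e / 2 <= s by rewrite le_max lexx orbT.
  exists (f s); split; first by apply: IH; rewrite sa.
  by apply: He; rewrite /ball /= gtr0_norm ?subr_gt0//; short_lra.
move=> t /andP[at_ tb] IH.
have tab : a <= t <= b by rewrite at_ ltW.
have At : A (f t) by apply: IH; rewrite at_ lexx.
have /nbhs_ballP [e /= e0 He] := nb t tab At.
exists (e / 2) => [|s /andP[ts se] _]; first by rewrite divr_gt0.
by apply: He; rewrite /ball /= distrC ger0_norm ?subr_ge0//; short_lra.
Qed.

Lemma nbhs_norm_lt (R : realType) (V : normedModType R) (x : V) (d : R) : 0 < d ->
  nbhs x [set y | `|y - x| < d].
Proof.
by move=> d0; apply/nbhs_ballP; exists d => // y; rewrite -ball_normE /ball_ /= distrC.
Qed.

Section InnerNormal.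
Context {R : realType} {n : nat} (M : riemannianManifold R n).
Hypothesis M_connected : connected [set: M].
Variables (U : set M) (Uc : closed U).

(* The half balls of a chart flattening the boundary do not meet the boundary,
   so that each of them is inside or outside U; they are not both inside. *)
Lemma boundary_side (psi : chart R n M) (c : 'I_n) (x : M) : chart_dom psi x -> boundary U x ->
  boundary U `&` chart_dom psi = chart_dom psi `&` [set y | psi y 0 c = 0] ->
  exists (sg d : R), [/\ sg != 0, 0 < d & forall z, chart_dom psi z -> `|psi z - psi x| < d ->
    U z -> sg * psi z 0 c <= 0].
Proof.
move=> Dx bx E.
have [d d0 Hd] := open_eps (@chart_codom_open _ _ _ psi) (chart_fun_codom Dx).
have xc : psi x 0 c = 0.
  by have [_ ->] : (chart_dom psi `&` [set y | psi y 0 c = 0]) x by rewrite -E.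
have bU z : boundary U z -> U z by move=> [k _]; exact: Uc.
have side (sg : R) (a b : M) : chart_dom psi a -> chart_dom psi b -> `|psi a - psi x| < d ->
    `|psi b - psi x| < d -> 0 < sg * psi a 0 c -> 0 < sg * psi b 0 c -> U a -> U b.
  move=> Da Db ad bd ac bc Ua; apply: contrapT => Ub.
  pose w := psi b - psi a; pose l (t : R) := psi a + t *: w.
  have lE t : l t = (1 - t) *: psi a + t *: psi b.
    by apply/rowP => k; rewrite !(rvDE, rvNE, rvZE); ring.
  have ld (t : R) : 0 <= t <= 1 -> `|l t - psi x| <= d.
    move=> /andP[t0 t1]; have -> : l t - psi x = (1 - t) *: (psi a - psi x) + t *: (psi b - psi x).
      by apply/rowP => k; rewrite !(rvDE, rvNE, rvZE); ring.
    apply: le_trans (ler_normD _ _) _; rewrite !normrZ ger0_norm ?subr_ge0// (ger0_norm t0).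
    have -> : d = (1 - t) * d + t * d by ring.
    by apply: lerD; rewrite ler_wpM2l ?subr_ge0// ltW.
  have lc t : {for t, continuous l}.
    have H := line_derive (psi a) w t; exact: (is_derive_rV_continuous H).
  have fc (t : R) : 0 <= t <= 1 -> {for t, continuous (chart_inv psi \o l)}.
    move=> t01; apply: continuous_comp; first exact: lc.
    by apply: chart_inv_continuous; apply: Hd; exact: ld.
  have fa : U ((chart_inv psi \o l) 0) by rewrite /= /l scale0r addr0 chart_funK.
  have fb : ~ U ((chart_inv psi \o l) 1) by rewrite /= /l scale1r /w subrKC chart_funK.
  have [t t01 [bt nt]] := boundary_crossing Uc ler01 fc fa fb.
  have codt : chart_codom psi (l t) by apply: Hd; exact: ld.
  have [_ /=] : (chart_dom psi `&` [set y | psi y 0 c = 0]) (chart_inv psi (l t)).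
    by rewrite -E; split; [split|exact: chart_inv_dom].
  rewrite chart_invK// => lt0; have : sg * l t 0 c = 0 by rewrite lt0 mulr0.
  rewrite lE !(rvDE, rvZE); move/andP: t01 => [t0 t1] k.
  have : (1 - t) * (sg * psi a 0 c) + t * (sg * psi b 0 c) = 0 by rewrite -[RHS]k; ring.
  have k1 : 0 <= (1 - t) * (sg * psi a 0 c) by rewrite mulr_ge0 ?subr_ge0// ltW.
  have k2 : 0 <= t * (sg * psi b 0 c) by rewrite mulr_ge0// ltW.
  have [t0'|t0'] := ltP 0 t; last first.
    have tz : t = 0 by apply/eqP; rewrite eq_le t0' t0.
    by rewrite tz; short_lra.
  have k3 : 0 < t * (sg * psi b 0 c) by rewrite mulr_gt0.
  short_lra.
have one (sg : R) : sg != 0 -> ~ (forall z, chart_dom psi z -> `|psi z - psi x| < d ->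
    U z -> sg * psi z 0 c <= 0) -> exists a, [/\ chart_dom psi a, `|psi a - psi x| < d, U a & 0 < sg * psi a 0 c].
  move=> s0 H; apply: contrapT => H'; apply: H => z Dz zd Uz; rewrite leNgt; apply/negP => k.
  by apply: H'; exists z.
apply: contrapT => H.
have [|H1|a [Da ad Ua ac]] := one 1; first exact: oner_neq0.
  by apply: H; exists 1, d; split=> //; exact: oner_neq0.
have [|H1|b [Db bd Ub bc]] := one (-1); first by rewrite oppr_eq0 oner_neq0.
  by apply: H; exists (-1), d; split=> //; rewrite oppr_eq0 oner_neq0.
case: bx => _; apply; apply: (@filterS _ _ _ [set z | chart_dom psi z /\ `|psi z - psi x| < d]).
  move=> z [Dz zd]; have [zc|zc|zc] := ltgtP (psi z 0 c) 0.
  - by apply: (side (-1) b z) => //; rewrite mulN1r oppr_gt0.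
  - by apply: (side 1 a z) => //; rewrite mul1r.
  - by apply: bU; have [] : (boundary U `&` chart_dom psi) z by rewrite E.
apply: filterI; first by apply: open_nbhs_nbhs; split=> //; exact: chart_dom_open.
exact: (chart_fun_continuous Dx (nbhs_norm_lt _ d0)).
Qed.

(** Strict convexity of the unit ball: the sum of two different maximizers has norm below 2 and
    would exceed the maximum after normalization. Maximality is assumed against vectors of norm
    below 1, as [small_segment] provides it; scaling extends it to the closed ball. *)
Lemma unit_maximizer_unique (i : rm_index M) (z : 'rV[R]_n) (f : 'rV[R]_n -> R) v v' :
  (metric i z)^T = metric i z -> (forall w, w != 0 -> 0 < cinner i z w w) ->
  (forall w w', f (w + w') = f w + f w') -> (forall k w, f (k *: w) = k * f w) ->
  (exists w, 0 < f w) -> cinner i z v v = 1 -> cinner i z v' v' = 1 ->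
  (forall w, cinner i z w w < 1 -> f w <= f v) ->
  (forall w, cinner i z w w < 1 -> f w <= f v') -> v = v'.
Proof.
move=> sym pos fD fZ [w0 fw0] v1 v'1 Hv Hv'.
have bound u : (forall w, cinner i z w w < 1 -> f w <= f u) -> forall w, cinner i z w w <= 1 -> f w <= f u.
  move=> H w w1; apply/ler_addgt0Pr => e e0; have W1 : 0 < `|f w| + 1 by rewrite ltr_wpDl.
  pose k : R := Num.min (e / (`|f w| + 1)) 2^-1.
  have k0 : 0 < k by rewrite lt_min divr_gt0//= invr_gt0.
  have ke : k * (`|f w| + 1) <= e by rewrite -ler_pdivlMr// ge_min lexx.
  have k2 : k <= 2^-1 by rewrite ge_min lexx orbT.
  clearbody k.
  have := H ((1 - k) *: w); rewrite fZ /cinner mx_innerZl mx_innerZr -/(cinner i z w w).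
  have kw : (1 - k) * ((1 - k) * cinner i z w w) < 1.
    apply: (@le_lt_trans _ _ ((1 - k) * ((1 - k) * 1))).
      by rewrite !ler_wpM2l// subr_ge0; short_lra.
    have kk : 0 < k * (2 - k) by apply: mulr_gt0 => //; short_lra.
    short_lra.
  by move=> /(_ kw); have := ler_wpM2l (ltW k0) (ler_norm (f w)); short_lra.
have f0 : f v = f v' by apply/eqP; rewrite eq_le (bound v' Hv') ?v1// (bound v Hv) ?v'1.
have fv0 : 0 < f v.
  have w00 : w0 != 0 by apply/eqP => E; move: fw0; rewrite E -(scale0r w0) fZ mul0r ltxx.
  have N0 := pos w0 w00; set N := cinner i z w0 w0 in N0.
  have S0 : 0 < Num.sqrt N by rewrite sqrtr_gt0.
  apply: (@lt_le_trans _ _ (f ((Num.sqrt N)^-1 *: w0))); first by rewrite fZ mulr_gt0// invr_gt0.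
  apply: (bound v Hv); rewrite /cinner mx_innerZl mx_innerZr -/(cinner i z w0 w0) -/N.
  by rewrite mulrA -invfM -expr2 sqr_sqrtr ?(ltW N0)// mulVf// gt_eqF.
apply/eqP; rewrite -subr_eq0; apply/negPn/negP => d0.
have P := mx_inner_parallelogram (metric i z) v v'.
have dpos := pos _ d0; rewrite /cinner in dpos v1 v'1; rewrite v1 v'1 in P.
set a := mx_inner _ (v + v') (v + v') in P.
have a4 : a < 4 by short_lra.
have fa : f (v + v') = 2 * f v by rewrite fD -f0; ring.
have [a0|a0] := leP a 0.
  have : f (1 *: (v + v')) <= f v by apply: Hv; rewrite scale1r /cinner -/a; short_lra.
  by rewrite fZ fa; short_lra.
pose k := (Num.sqrt a)^-1.
have sa : 0 < Num.sqrt a by rewrite sqrtr_gt0.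
have sa2 : Num.sqrt a < 2.
  have -> : 2 = Num.sqrt 4 :> R.
    have -> : (4 : R) = 2 ^+ 2 by ring.
    by rewrite sqrtr_sqr ger0_norm.
  by rewrite ltr_sqrt.
have : f (k *: (v + v')) <= f v.
  apply: (bound v Hv); rewrite /cinner mx_innerZl mx_innerZr -/a /k.
  by rewrite mulrA -invfM -expr2 sqr_sqrtr ?(ltW a0)// mulVf// gt_eqF.
rewrite fZ fa /k mulrC ler_pdivrMr// mulrC ler_pM2l// => k2.
by move: sa2; rewrite ltNge k2.
Qed.

(** The strict inequality at [c 0] leaves room for the variation of the metric: at nearby points [w]
    still has norm at most 1, and the segment from [c t] to [c t + t w] has length at most [t]. *)
Lemma small_segment (i : rm_index M) (c : R -> 'rV[R]_n) (v w : 'rV[R]_n) :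
  chart_codom (atlas i) (c 0) -> is_derive (0 : R) 1 c v -> cinner i (c 0) w w < 1 ->
  exists2 e : R, 0 < e & forall t : R, 0 < t < e -> chart_codom (atlas i) (c t + t *: w) /\
    rdist (chart_inv (atlas i) (c t)) (chart_inv (atlas i) (c t + t *: w)) <= t.
Proof.
move=> cod cd w1.
have [r [lam [C mb]]] : exists r lam C, metric_ball (metric i) (chart_codom (atlas i)) (c 0) r lam C.
  have := good_chart (chart_inv_dom cod); rewrite chart_invK//.
have r0 := mb_r mb; have C1 := mb_C mb.
have C0 : 0 <= C by exact: le_trans ler01 C1.
pose q : R := Num.min r ((1 - cinner i (c 0) w w) / (C * (`|w| ^+ 2 + 1))).
have w21 : 0 < `|w| ^+ 2 + 1 by rewrite ltr_wpDl ?exprn_ge0.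
have D0 : 0 < C * (`|w| ^+ 2 + 1) by rewrite mulr_gt0// (lt_le_trans ltr01).
have q0 : 0 < q by rewrite lt_min r0 divr_gt0// subr_gt0.
have qr : q <= r by rewrite ge_min lexx.
have qw : C * q * `|w| ^+ 2 <= 1 - cinner i (c 0) w w.
  apply: (@le_trans _ _ (q * (C * (`|w| ^+ 2 + 1)))); last by rewrite -ler_pdivlMr// ge_min lexx orbT.
  have -> : q * (C * (`|w| ^+ 2 + 1)) = C * q * `|w| ^+ 2 + C * q by ring.
  by rewrite lerDl mulr_ge0// ltW.
clearbody q.
have q2 : 0 < q / 2 by rewrite divr_gt0.
have [d d0 Hd] := (continuous_eps _ _).1 (is_derive_rV_continuous cd) _ q2.
have W1 : 0 < `|w| + 1 by rewrite ltr_wpDl.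
pose e : R := Num.min d (q / 4 / (`|w| + 1)).
exists e => [|t /andP[t0]]; first by rewrite lt_min d0 !divr_gt0.
rewrite lt_min => /andP[td te].
have tw : t * `|w| <= q / 4.
  apply: (@le_trans _ _ (t * (`|w| + 1))); first by rewrite ler_wpM2l ?lerDl// ltW.
  by rewrite -ler_pdivlMr// ltW.
have ct : `|c t - c 0| <= q / 2 by apply: Hd; rewrite subr0 gtr0_norm.
have near (s : R) : 0 <= s <= 1 -> `|c t + s *: (c t + t *: w - c t) - c 0| <= q * (3 / 4).
  move=> /andP[s0 s1]; have -> : c t + s *: (c t + t *: w - c t) - c 0 = (c t - c 0) + (s * t) *: w.
    by apply/rowP => k; rewrite !(rvDE, rvNE, rvZE); ring.
  apply: le_trans (ler_normD _ _) _; rewrite normrZ normrM (ger0_norm s0) (gtr0_norm t0) -mulrA.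
  have : s * (t * `|w|) <= q / 4.
    by apply: le_trans tw; rewrite ler_piMl// mulr_ge0// ltW.
  by move: ct; short_lra.
have a0 : `|c t - c 0| < r by short_lra.
have b0 : `|c t + t *: w - c 0| < r.
  have := near 1; rewrite scale1r subrKC => k; apply: le_lt_trans (k _) _; last by short_lra.
  by rewrite ler01 lexx.
split; first by apply: (mb_dom mb); exact: ltW.
have Fd (s : R) : 0 <= s <= 1 -> is_derive s 1 (fun s : R => s * t) t by move=> _; exact: linear_derive.
have [|l lF P] := chart_segment_length mb a0 b0 Fd.
  move=> s s01; have k := near s s01; set z := c t + s *: _ in k *.
  have zr : `|z - c 0| <= r by short_lra.
  have cr : `|c 0 - c 0| <= r by rewrite subrr normr0 ltW.
  have -> : c t + t *: w - c t = t *: w by rewrite addrAC subrr add0r.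
  rewrite /cinner mx_innerZl mx_innerZr.
  have k1 : mx_inner (metric i z) w w <= 1.
    have /ler_normlP[_] := mb_lip mb w w zr cr.
    have : C * `|z - c 0| * `|w| * `|w| <= C * q * `|w| ^+ 2.
      by rewrite expr2 mulrA !ler_wpM2r// ler_wpM2l//; short_lra.
    by move: qw; rewrite /cinner; short_lra.
  rewrite -[leRHS](gtr0_norm t0) -sqrtr_sqr; apply: ler_wsqrtr.
  by rewrite mulrA -expr2 ler_piMr// exprn_ge0// ltW.
by apply: le_trans (rdist_le P) _; apply: le_trans lF _; rewrite mul1r mul0r subr0.
Qed.

(** For [w] of norm below 1 the point with coordinates [c t - t w], where [c] is the coordinate
    curve of [g], lies in the ball of radius [t] around [g t], hence in [U]. There the function
    defining the boundary, with the sign [sg], is non-positive, and it vanishes at [x]; so its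
    derivative in the direction [v - w] is non-positive. Thus [v], and likewise [v'], maximizes a
    non-zero linear form over the unit ball. *)
Lemma inner_normal_unique (i : rm_index M) (x : M) (g g' : R -> M) (v v' : 'rV[R]_n) :
  C1_hypersurface (boundary U) -> boundary U x -> chart_dom (atlas i) x ->
  g 0 = x -> g' 0 = x -> is_derive (0 : R) 1 (coord_curve i g) v -> is_derive (0 : R) 1 (coord_curve i g') v' ->
  cinner i (atlas i x) v v = 1 -> cinner i (atlas i x) v' v' = 1 ->
  (exists2 e : R, 0 < e & forall t : R, 0 <= t < e -> chart_dom (atlas i) (g t) /\ geodesic_ball (g t) t `<=` U) ->
  (exists2 e : R, 0 < e & forall t : R, 0 <= t < e -> chart_dom (atlas i) (g' t) /\ geodesic_ball (g' t) t `<=` U) ->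
  v = v'.
Proof.
move=> hyp bx Dx g0 g'0 gd g'd v1 v'1 gU g'U.
have [psi [k [Px CC E]]] := hyp x bx; have [C1 C2] := CC i.
have [sg [d [sg0 d0 side]]] := boundary_side Px bx E.
set u := atlas i x in v1 v'1.
pose Psi (z : 'rV[R]_n) : R := transition (atlas i) psi z 0 k.
have oD := @transition_dom_open R n M (atlas i) psi.
have PC : Ck 1 (transition_dom (atlas i) psi) Psi by exact: Ck_entry.
have Du : transition_dom (atlas i) psi u by exact: transition_dom_chart.
pose dP (w : 'rV[R]_n) : R := \sum_j w 0 j * 'D_(evec j) Psi u.
have dPD w w' : dP (w + w') = dP w + dP w'.
  by rewrite /dP -big_split; apply: eq_bigr => j _; rewrite rvDE mulrDl.
have dPZ (q : R) w : dP (q *: w) = q * dP w.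
  by rewrite /dP mulr_sumr; apply: eq_bigr => j _; rewrite rvZE mulrA.
have xk : psi x 0 k = 0.
  by have [_ ->] : (chart_dom psi `&` [set y | psi y 0 k = 0]) x by rewrite -E.
(* Moving along the coordinate [k] of [psi] changes the defining function at unit rate, so that its
   differential is not zero. *)
have [w1 dw1] : exists w, dP w = 1.
  pose l (t : R) := psi x + t *: @evec R n k.
  have ld : is_derive (0 : R) 1 l (evec k) := line_derive _ _ _.
  have oD' := @transition_dom_open R n M psi (atlas i).
  have l0 : l 0 = psi x by rewrite /l scale0r addr0.
  have Dl : transition_dom psi (atlas i) (l 0) by rewrite l0; exact: transition_dom_chart.
  have H1 := C1_chain_rV oD' C2 Dl ld.
  set w := 'D_ _ _ _ in H1; exists w.
  have u0 : (transition psi (atlas i) \o l) 0 = u by rewrite /= l0 /transition /= chart_funK.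
  have H2 : is_derive (0 : R) 1 (fun s => Psi ((transition psi (atlas i) \o l) s)) (dP w).
    by have := C1_chain oD PC _ H1; rewrite u0; apply.
  have H3 : is_derive (0 : R) 1 (fun s : R => s * 1) (1 : R) := linear_derive _ _.
  have H4 : is_derive (0 : R) 1 (fun s => Psi ((transition psi (atlas i) \o l) s)) 1.
    apply: near_eq_is_derive H3.
    have lc : {for (0 : R), continuous l} := is_derive_rV_continuous ld.
    have : \forall s \near (0 : R), transition_dom psi (atlas i) (l s).
      by apply: lc; apply: open_nbhs_nbhs.
    apply: filterS => s [ls Ls]; rewrite /Psi /transition /= chart_funK// chart_invK//.
    by rewrite /l rvDE rvZE evecE eqxx xk add0r.
  by rewrite -(derive1_val H2) (derive1_val H4).
have key (h : R -> M) (w0 : 'rV[R]_n) : h 0 = x -> is_derive (0 : R) 1 (coord_curve i h) w0 ->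
    (exists2 e : R, 0 < e & forall t : R, 0 <= t < e -> chart_dom (atlas i) (h t) /\ geodesic_ball (h t) t `<=` U) ->
    forall w, cinner i u w w < 1 -> - sg * dP w <= - sg * dP w0.
  move=> h0 hd [e e0 He] w w1'.
  have c0 : coord_curve i h 0 = u by rewrite /coord_curve /= h0.
  have [||e' e'0 He'] := @small_segment i (coord_curve i h) w0 (- w) _ hd.
  - by rewrite c0; exact: chart_fun_codom.
  - by rewrite c0 /cinner mx_innerNl mx_innerNr opprK.
  pose z (t : R) := coord_curve i h t + t *: - w.
  have zd : is_derive (0 : R) 1 z (w0 - w).
    have H := line_derive 0 (- w) 0.
    have -> : z = coord_curve i h + (fun t : R => 0 + t *: - w).
      by apply/funext => t; rewrite !fctE add0r.
    exact: is_deriveD.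
  have z0 : z 0 = u by rewrite /z scale0r addr0.
  have Pd : is_derive (0 : R) 1 (fun t => Psi (z t)) (dP (w0 - w)).
    by have := C1_chain oD PC _ zd; rewrite z0; apply.
  have zc : {for (0 : R), continuous z} := is_derive_rV_continuous zd.
  have zn : \forall t \near (0 : R), transition_dom (atlas i) psi (z t) /\
      `|transition (atlas i) psi (z t) - psi x| < d.
    suff N : nbhs (z 0) [set y | transition_dom (atlas i) psi y /\
      `|transition (atlas i) psi y - psi x| < d] by exact: (zc _ N).
    rewrite z0; apply: filterI; first exact: open_nbhs_nbhs.
    have tc : {for u, continuous (transition (atlas i) psi)}.
      apply: continuous_comp; first by apply: chart_inv_continuous; exact: chart_fun_codom.
      by rewrite /u chart_funK//; exact: chart_fun_continuous.
    have uE : transition (atlas i) psi u = psi x by rewrite /transition /= /u chart_funK.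
    by rewrite -uE; exact: (tc _ (nbhs_norm_lt _ d0)).
  have /nbhs_ballP [e2 /= e20 He2] := zn.
  pose q : R := Num.min (Num.min e e') e2.
  have q0 : 0 < q by rewrite !lt_min e0 e'0.
  have neg (t : R) : 0 < t < q -> sg * Psi (z t) <= 0.
    rewrite !lt_min => /andP[t0 /andP[/andP[te te'] te2]].
    have [|tD td] := He2 t; first by rewrite /ball /= sub0r normrN gtr0_norm.
    have [|Dh hU] := He t; first by rewrite (ltW t0).
    have [|cz zr] := He' t; first by rewrite t0.
    apply: side; [exact: tD.2|exact: td|].
    by apply: hU; move: zr; rewrite /coord_curve /= chart_funK.
  suff : sg * dP (w0 - w) <= 0.
    have -> : dP (w0 - w) = dP w0 - dP w by rewrite dPD -scaleN1r dPZ mulN1r.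
    by rewrite mulrBr; short_lra.
  apply/ler_addgt0Pr => p p0; rewrite add0r.
  have S0 : 0 < `|sg| by rewrite normr_gt0.
  have [r r0 Hr] := (is_derive_eps _ _ _ _).1 Pd _ (divr_gt0 p0 S0).
  pose t : R := Num.min q r / 2.
  have m0 : 0 < Num.min q r by rewrite lt_min q0.
  have t0 : 0 < t by rewrite divr_gt0.
  have tq : 2 * t <= q by rewrite mulrC divfK// ge_min lexx.
  have tr : 2 * t <= r by rewrite mulrC divfK// ge_min lexx orbT.
  clearbody t; have := Hr t; rewrite gtr0_norm// => /(_ (ltac:(short_lra))).
  have -> : t *: 1 + 0 = t by rewrite /GRing.scale /= mulr1 addr0.
  have -> : Psi (z 0) = 0 by rewrite z0 /Psi /transition /= /u chart_funK.
  rewrite subr0 => k1; have k2 := neg t (ltac:(by apply/andP; split; short_lra)).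
  have k3 : `|sg * Psi (z t) - t * (sg * dP (w0 - w))| <= p * t.
    have -> : sg * Psi (z t) - t * (sg * dP (w0 - w)) = sg * (Psi (z t) - t *: dP (w0 - w)).
      by rewrite /GRing.scale /=; ring.
    rewrite normrM; apply: le_trans (ler_wpM2l (ltW S0) k1) _.
    by rewrite mulrA [`|sg| * _]mulrC divfK// gt_eqF.
  rewrite -(ler_pM2l t0); move: k3; rewrite ler_norml => /andP[k3 _]; short_lra.
have codu : chart_codom (atlas i) u by exact: chart_fun_codom.
apply: (@unit_maximizer_unique i u (fun w => - sg * dP w)) => //.
- exact: metric_symmetric.
- by move=> w w0; exact: metric_posdef.
- by move=> w w'; rewrite dPD mulrDr.
- by move=> q w; rewrite dPZ mulrCA.
- by exists (- sg *: w1); rewrite dPZ dw1 mulr1 mulrNN -expr2 lt_neqAle sqr_ge0 eq_sym sqrf_eq0 sg0.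
- exact: key g0 gd gU.
- exact: key g'0 g'd g'U.
Qed.

End InnerNormal.

(** * Maximal balls *)

Section Joining.
Context {R : realType} {n : nat} (M : riemannianManifold R n).
Hypothesis M_connected : connected [set: M].
Implicit Types (x y z : M).

(** Existence of a minimal path is carried as a property of the pair of points, because the compact
    set that provides it varies: [U], a ball, or a coordinate ball. *)
Definition joinable x y := exists sigma : R -> M,
  [/\ sigma 0 = x, sigma (rdist x y) = y & minimal_path sigma (rdist x y)].

Lemma joinable_sym x y : joinable x y -> joinable y x.
Proof.
move=> [sigma [s0 sl smin]]; exists (fun t => sigma (rdist x y - t)).
rewrite [rdist y x]rdistC subr0 subrr; split=> //; exact: minimal_path_rev.
Qed.

Lemma minimal_path_of_le (sigma : R -> M) (l : R) :
  (forall s t, 0 <= s -> s <= t -> t <= l -> rdist (sigma s) (sigma t) = t - s) ->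
  minimal_path sigma l.
Proof.
move=> H s t /andP[s0 sl] /andP[t0 tl]; have [st|/ltW ts] := leP s t.
  by rewrite H// ger0_norm// subr_ge0.
by rewrite rdistC H// distrC ger0_norm// subr_ge0.
Qed.

Lemma minimal_path_cat (sigma tau : R -> M) (a b : R) : 0 <= a -> 0 <= b ->
  minimal_path sigma a -> minimal_path tau b -> sigma a = tau 0 ->
  rdist (sigma 0) (tau b) = a + b ->
  minimal_path (fun t => if t <= a then sigma t else tau (t - a)) (a + b).
Proof.
move=> a0 b0 smin tmin E D; apply: minimal_path_of_le => s t s0 st tl.
have [ta|at_] := leP t a.
  rewrite (le_trans st ta) smin ?ger0_norm ?subr_ge0//; first by rewrite s0 (le_trans st).
  by rewrite (le_trans s0 st).
have [sa|as_] := leP s a; last first.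
  rewrite tmin; first by rewrite opprB addrA subrK ger0_norm// subr_ge0.
    by apply/andP; split; lra.
  by apply/andP; split; lra.
have I0 : (0 : R) <= 0 <= a by rewrite lexx.
have Ia : 0 <= a <= a by rewrite a0 lexx.
have Is : 0 <= s <= a by rewrite s0.
have J0 : (0 : R) <= 0 <= b by rewrite lexx.
have Jb : 0 <= b <= b by rewrite b0 lexx.
have Jt : 0 <= t - a <= b by apply/andP; split; lra.
apply/eqP; rewrite eq_le; apply/andP; split.
  apply: le_trans (rdist_triangle M_connected (sigma a) _ _) _.
  by rewrite smin// E tmin// subr0 !ger0_norm; lra.
have := rdist_triangle M_connected (sigma s) (sigma 0) (tau b).
have := rdist_triangle M_connected (tau (t - a)) (sigma s) (tau b).
by rewrite D smin// tmin// subr0 !ger0_norm; lra.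
Qed.

(** Both concatenations through [y] are minimal because their lengths add up to the distances, and
    they share an initial piece of positive length. *)
Lemma branch_unique x y z z' : 0 < rdist x y -> joinable x y -> joinable y z -> joinable y z' ->
  rdist y z = rdist y z' -> rdist x z = rdist x y + rdist y z ->
  rdist x z' = rdist x y + rdist y z -> z = z'.
Proof.
move=> a0 [sg [sg0 sga smin]] [t1 [t10 t1b t1min]] [t2 [t20 t2b t2min]] E D D'.
rewrite -E in t2b t2min; set a := rdist x y in a0 sga smin D D'.
set b := rdist y z in E D D' t1b t1min t2b t2min.
have b0 : 0 <= b by exact: rdist_ge0.
have m1 : minimal_path (fun t => if t <= a then sg t else t1 (t - a)) (a + b).
  by apply: minimal_path_cat => //; [exact: ltW|rewrite sga t10|rewrite sg0 t1b].
have m2 : minimal_path (fun t => if t <= a then sg t else t2 (t - a)) (a + b).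
  by apply: minimal_path_cat => //; [exact: ltW|rewrite sga t20|rewrite sg0 t2b].
have ag (t : R) : 0 <= t <= a -> (if t <= a then sg t else t1 (t - a)) = (if t <= a then sg t else t2 (t - a)).
  by move=> /andP[_ ->].
have /= := minimal_path_unique M_connected a0 m1 m2 ag (t := a + b).
rewrite lexx addr_ge0 ?(ltW a0)// => /(_ isT).
have [ab|ab] := leP (a + b) a.
  have bz : b = 0 by apply/eqP; rewrite eq_le b0 andbT; lra.
  by move=> _; rewrite -t1b -t2b bz t10 t20.
by rewrite addrAC subrr add0r t1b t2b.
Qed.

Lemma joinable_ball (K : set M) x y : compact K -> geodesic_ball x (rdist x y) `<=` K ->
  joinable x y.
Proof. by move=> Kc sub; apply: minimal_path_ball Kc sub. Qed.

End Joining.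

(** A point of [K] off the interior of a given neighbourhood of [y0] has [rel0 > 0], hence
    [rel i > 0] at nearby points for late [i]. Compactness makes this uniform, so that [f i] ends up
    in the neighbourhood. The inequality [rel <= 0] encodes a closed graph. *)
Lemma cvg_of_closed_relation (R : realType) (I : Type) (F : set_system I) (M : topologicalType)
    (f : I -> M) (K : set M) (y0 : M) (rel : I -> M -> R) (rel0 : M -> R) : Filter F ->
  compact K -> (\forall i \near F, K (f i)) -> (forall y, K y -> rel0 y <= 0 -> y = y0) ->
  (\forall i \near F, rel i (f i) <= 0) ->
  (forall y, K y -> (fun q : M * I => rel q.2 q.1) @ (filter_prod (nbhs y) F) --> rel0 y) ->
  f @ F --> y0.
Proof.
move=> FF Kc fK K0 fr rc A nA.
have /compact_near_coveringP Kn : compact (K `&` ~` A^°).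
  by apply: compact_closedI => //; apply: open_closedC; exact: open_interior.
have H : \forall i \near F, K `&` ~` A^° `<=` (fun y => f i <> y).
  apply: Kn => y [Ky nAy].
  have ry : 0 < rel0 y.
    rewrite ltNge; apply/negP => /(K0 y Ky) E; apply: nAy; rewrite E; exact: nA.
  have N1 : \forall q \near filter_prod (nbhs y) F, 0 < rel q.2 q.1.
    exact: (rc y Ky _ (lt_nbhsr ry)).
  have N2 : \forall q \near filter_prod (nbhs y) F, rel q.2 (f q.2) <= 0.
    by exists (setT, [set i | rel i (f i) <= 0]) => //=; [split=> //; exact: filterT|move=> [q1 q2] [_]].
  by apply: filterS2 N1 N2 => -[y' i] /= h1 h2 E; move: h2; rewrite E leNgt h1.
apply: filterS2 fK H => i Ki Hi; apply: interior_subset; apply: contrapT => nAi.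
exact: (Hi (f i)).
Qed.

Lemma sublevel_closed (R : realType) (T : topologicalType) (f : T -> R) :
  continuous f -> closed [set x | f x <= 0].
Proof. by move=> fc; apply: preimage_closed (@closed_le R 0) => x _; exact: fc. Qed.

(** * Depth and existence of maximal balls *)

Section Depth.
Context {R : realType} {n : nat} (M : riemannianManifold R n).
Hypothesis M_connected : connected [set: M].
Variables (U : set M) (U_compact : compact U) (U_proper : U `<` [set: M]).
Implicit Types (x y z : M) (r : R).

Let Uc : closed U.
Proof. by apply: compact_closed => //; exact: rm_hausdorff. Qed.

Let outside : exists w, ~ U w.
Proof.
case: U_proper => _ ns; apply: contrapT => H; apply: ns => w _.
by apply: contrapT => Uw; apply: H; exists w.
Qed.

Definition depth x : R := inf [set rdist x w | w in ~` U].

Let depth_has_inf x : has_inf [set rdist x w | w in ~` U].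
Proof.
split; first by have [w Uw] := outside; exists (rdist x w), w.
by exists 0 => _ [w _ <-]; exact: rdist_ge0.
Qed.

Lemma depth_le x w : ~ U w -> depth x <= rdist x w.
Proof. by move=> Uw; apply: (inf_lbound (depth_has_inf x).2); exists w. Qed.

Lemma depth_ge x r : (forall w, ~ U w -> r <= rdist x w) -> r <= depth x.
Proof.
move=> H; apply: lb_le_inf; first exact: (depth_has_inf x).1.
by move=> _ [w Uw <-]; exact: H.
Qed.

Lemma depth_ge0 x : 0 <= depth x.
Proof. by apply: depth_ge => w _; exact: rdist_ge0. Qed.

Lemma depth_lipschitz x y : depth x <= rdist x y + depth y.
Proof.
rewrite -lerBlDl; apply: depth_ge => w Uw; rewrite lerBlDl.
by apply: le_trans (depth_le x Uw) (rdist_triangle M_connected _ _ _).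
Qed.

Lemma depth_continuous : continuous depth.
Proof.
move=> x; apply/cvgrPdist_lt => e e0; apply/(nbhs_rdistP M_connected); exists e => // y xy.
apply: le_lt_trans xy; have h1 := depth_lipschitz x y; have h2 := depth_lipschitz y x.
by rewrite rdistC in h2; rewrite ler_norml; apply/andP; split; lra.
Qed.

Lemma ball_depth x r : geodesic_ball x r `<=` U -> r <= depth x.
Proof.
by move=> B; apply: depth_ge => w Uw; rewrite leNgt; apply/negP => /ltW /B.
Qed.

Lemma boundary_outside s e : boundary U s -> 0 < e -> exists2 w, ~ U w & rdist s w < e.
Proof.
move=> [_ ns] e0; apply: contrapT => H; apply: ns; apply/(nbhs_rdistP M_connected).
by exists e => // w sw; apply: contrapT => Uw; apply: H; exists w.
Qed.

Lemma depth_le_boundary x s : boundary U s -> depth x <= rdist x s.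
Proof.
move=> bs; apply/ler_addgt0Pr => e e0; have [w Uw sw] := boundary_outside bs e0.
apply: le_trans (depth_le x Uw) _; apply: le_trans (rdist_triangle M_connected s _ _) _.
by rewrite lerD2l ltW.
Qed.

Lemma boundary_closed : closed (boundary U).
Proof.
rewrite /boundary setDE; apply: closedI; first exact: closed_closure.
by apply: open_closedC; exact: open_interior.
Qed.

Lemma boundary_sub : boundary U `<=` U.
Proof. by move=> s [k _]; exact: Uc. Qed.

(* The clamped path is continuous at all times, as [boundary_crossing] requires. *)
Lemma lipschitz_crossing (sigma : R -> M) (l : R) (A : set M) : closed A -> 0 <= l ->
  (forall s t, 0 <= s <= l -> 0 <= t <= l -> rdist (sigma s) (sigma t) <= `|t - s|) ->
  A (sigma 0) -> ~ A (sigma l) -> exists2 t : R, 0 <= t <= l & boundary A (sigma t).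
Proof.
move=> cA l0 sL A0 Al; pose cl t := Num.max 0 (Num.min t l).
have clab (t : R) : 0 <= cl t <= l by rewrite le_max lexx ge_max l0 ge_min lexx orbT.
have clid (t : R) : 0 <= t <= l -> cl t = t.
  by move=> /andP[at_ tb]; rewrite /cl (min_idPl tb) (max_idPr at_).
have I0 : (0 : R) <= 0 <= l by rewrite lexx.
have Il : 0 <= l <= l by rewrite lexx andbT.
have fc (t : R) : 0 <= t <= l -> {for t, continuous (sigma \o cl)}.
  move=> _ B /(nbhs_rdistP M_connected) [e e0 He].
  apply/nbhs_ballP; exists e => // s; rewrite /ball /= => ts; apply: He.
  apply: le_lt_trans (sL _ _ (clab _) (clab _)) _; rewrite distrC in ts.
  by apply: le_lt_trans ts; apply: le_trans (maxr_lipschitz _ _ _) (minr_lipschitz _ _ _).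
have f0 : A ((sigma \o cl) 0) by rewrite /= clid.
have fl : ~ A ((sigma \o cl) l) by rewrite /= clid.
have [t tl bt] := boundary_crossing cA l0 fc f0 fl.
by exists t => //; rewrite /= clid in bt.
Qed.

Lemma depth_attained x : U x -> exists2 s, boundary U s & rdist x s = depth x.
Proof.
move=> Ux.
have cross l w : ~ U w -> rdist x w < l -> exists2 s, boundary U s & rdist x s <= l.
  move=> Uw xl; have [sigma [s0 sl sL]] := rdist_select M_connected xl.
  have l0 : 0 <= l by apply: le_trans (rdist_ge0 x w) (ltW xl).
  have [||t tl bt] := lipschitz_crossing Uc l0 sL; rewrite ?s0 ?sl//.
  exists (sigma t) => //; rewrite -s0; apply: le_trans (sL _ _ _ tl) _; first by rewrite lexx.
  by move/andP: tl => [t0 tl]; rewrite subr0 ger0_norm.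
have bc : compact (boundary U).
  by apply: subclosed_compact U_compact _; [exact: boundary_closed|exact: boundary_sub].
have b0 : boundary U !=set0.
  have [w Uw] := outside; have [|s bs _] := cross (rdist x w + 1) w Uw; first by rewrite ltrDl.
  by exists s.
have [s] := compact_EVT_min b0 bc (continuous_subspaceT (rdist_continuous M_connected (x := x))).
rewrite inE => bs smin; exists s => //; apply/eqP; rewrite eq_le depth_le_boundary// andbT.
apply/ler_addgt0Pr => e e0.
have [_ [w Uw <-] we] := inf_adherent e0 (depth_has_inf x).
have [s' bs' xs'] := cross _ w Uw we.
by apply: le_trans (smin s' _) xs'; rewrite inE.
Qed.

(** The closed ball is meant, so a point at distance exactly the depth matters: if it were outside
    [U], so would be its neighbours, and one of them on a nearly minimal path is strictly closer to
    [x]. *)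
Lemma depth_ball x : U x -> geodesic_ball x (depth x) `<=` U.
Proof.
move=> Ux z xz; rewrite /geodesic_ball /= in xz; apply: contrapT => Uz.
have /(nbhs_rdistP M_connected) [e e0 He] : nbhs z (~` U).
  by apply: open_nbhs_nbhs; split=> //; exact: closed_openC.
have xz0 : 0 < rdist x z.
  rewrite lt_neqAle rdist_ge0 andbT; apply/eqP => /esym E.
  by apply: Uz; rewrite -(rdist_eq0 M_connected E).
(* The path exceeds the distance by a quarter of the minimum and is stopped half of it before its
   end, thus within [e] of [z] and at distance less than [rdist x z] from [x]. *)
pose l := rdist x z + Num.min e (rdist x z) / 4.
have m0 : 0 < Num.min e (rdist x z) by rewrite lt_min e0.
have me : Num.min e (rdist x z) <= e by rewrite ge_min lexx.
have mx : Num.min e (rdist x z) <= rdist x z by rewrite ge_min lexx orbT.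
have xl : rdist x z < l by rewrite /l; lra.
have [sigma [s0 sl sL]] := rdist_select M_connected xl.
pose t := l - Num.min e (rdist x z) / 2.
have tl : 0 <= t <= l by rewrite /t /l; apply/andP; split; lra.
have l0 : 0 <= l by rewrite /l; lra.
have ll : 0 <= l <= l by rewrite l0 lexx.
have I0 : (0 : R) <= 0 <= l by rewrite lexx.
have Ut : ~ U (sigma t).
  apply: He; rewrite -sl; apply: le_lt_trans (sL _ _ ll tl) _.
  by rewrite distrC ger0_norm /t; lra.
have := depth_le x Ut; rewrite -s0; have := sL _ _ I0 tl; rewrite subr0 ger0_norm; last by case/andP: tl.
by rewrite s0; rewrite /t /l; lra.
Qed.

Lemma maximal_depth x r : maximal_ball U x r -> U x /\ r = depth x.
Proof.
move=> [r0 B H]; have Ux : U x by apply: B; rewrite /geodesic_ball /= rdistxx.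
split=> //; apply/eqP; rewrite eq_le ball_depth//= leNgt; apply/negP => rd.
have [s bs xs] := depth_attained Ux.
apply: H; exists x, (depth x); split; [exact: depth_ge0|exact: depth_ball| |].
  by rewrite rdistxx add0r ltW.
split; first by move=> z /= xz; apply: le_trans xz (ltW rd).
by move=> /(_ s); rewrite /geodesic_ball /= xs lexx => /(_ isT); rewrite leNgt rd.
Qed.

Lemma central_maximal x : central_set U x -> maximal_ball U x (depth x).
Proof. by move=> [r H]; have [_ <-] := maximal_depth H. Qed.

Lemma central_radiusE x : central_set U x -> central_radius U x = depth x.
Proof.
move=> Cx; rewrite /central_radius; case: xgetP => [r _ H|H]; first by have [_ ->] := maximal_depth H.
by have := H (depth x) (central_maximal Cx).
Qed.

Lemma central_exists x : U x -> exists y, [/\ central_set U y, U y & rdist x y + depth x <= depth y].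
Proof.
move=> Ux; pose A := U `&` [set y | rdist x y + depth x <= depth y].
have Ac : compact A.
  apply: subclosed_compact U_compact _; last by move=> y [].
  apply: closedI => //.
  have -> : [set y | rdist x y + depth x <= depth y] =
      [set y | rdist x y - depth y + depth x <= 0].
    by apply/seteqP; split=> y /=; lra.
  apply: sublevel_closed => y; apply: cvgD; last exact: cvg_cst.
  by apply: cvgB; [exact: rdist_continuous|exact: depth_continuous].
have A0 : A !=set0 by exists x; split=> //=; rewrite rdistxx add0r.
have [y] := compact_EVT_max A0 Ac (continuous_subspaceT depth_continuous).
rewrite inE => -[Uy xy] ymax; exists y; split=> //.
exists (depth y); split; [exact: depth_ge0|exact: depth_ball|].
move=> [z [r [r0 B D [S NS]]]].
have rz := ball_depth B.
have Uz : U z by apply: B; rewrite /geodesic_ball /= rdistxx.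
(* The centre of a larger ball is again a competitor, so its depth is at most that of [y]; the
   condition on the radii then puts it at distance 0 from [y]. *)
have /ymax zy : z \in A.
  rewrite inE; split=> //=; apply: le_trans rz; apply: le_trans D.
  have := rdist_triangle M_connected y x z; move: xy => /=; lra.
have yz0 : rdist y z = 0 by apply/eqP; rewrite eq_le rdist_ge0 andbT; lra.
apply: NS => w /=; rewrite -(rdist_eq0 M_connected yz0) => /le_trans; apply.
by apply: le_trans rz zy.
Qed.

End Depth.

(** * Uniqueness of the maximal ball around a given ball *)

Section CentralUnique.
Context {R : realType} {n : nat} (M : riemannianManifold R n).
Hypothesis M_connected : connected [set: M].
Variables (U : set M) (U_compact : compact U) (U_proper : U `<` [set: M]).
Hypothesis U_hypersurface : C1_hypersurface (boundary U).
Implicit Types (x y z s w q : M).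

Let Uc : closed U.
Proof. by apply: compact_closed => //; exact: rm_hausdorff. Qed.

Lemma joinable_in_ball y z : U y -> rdist y z <= depth U y -> joinable y z.
Proof.
move=> Uy yz; apply: (joinable_ball M_connected U_compact) => q; rewrite /geodesic_ball /= => yq.
by apply: (depth_ball M_connected U_compact U_proper Uy); exact: le_trans yq yz.
Qed.

(** The minimal path is parametrized from the boundary point [s] and extended beyond it, so that it
    has a velocity at [s]. The balls of radius [t] around [sg t] touch the boundary at [s] from
    inside, as [inner_normal_unique] requires. *)
Lemma foot_geodesic y s : boundary U s -> U y -> rdist y s = depth U y -> 0 < depth U y ->
  exists (sg : R -> M) (e : R), [/\ 0 < e, sg 0 = s, sg (depth U y) = y &
    [/\ minimal_path sg (depth U y),
      forall t : R, - e < t < depth U y + e -> exists2 d : R, 0 < d & isometric_near sg t d &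
      forall t : R, 0 <= t <= depth U y -> geodesic_ball (sg t) t `<=` U]].
Proof.
move=> bs Uy ys l0; set l := depth U y in ys l0 *.
have /joinable_sym [sigma [s0 sl smin]] : joinable y s by apply: joinable_in_ball => //; rewrite ys.
rewrite rdistC ys in sl smin.
have [sg [e [e0 sgE Hi]]] := minimal_path_extend M_connected l0 smin.
have I0 : (0 : R) <= 0 <= l by rewrite lexx ltW.
have Il : 0 <= l <= l by rewrite lexx ltW.
exists sg, e; split => //; [by rewrite sgE|by rewrite sgE|split => //].
  by move=> t t' tl t'l; rewrite !sgE// smin.
move=> t tl z; rewrite /geodesic_ball /= sgE// => tz.
apply: (depth_ball M_connected U_compact U_proper Uy); rewrite /geodesic_ball /=.
apply: le_trans (rdist_triangle M_connected (sigma t) _ _) _.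
rewrite -{1}sl smin//; move/andP: tl => [t0 tl].
by rewrite distrC ger0_norm ?subr_ge0// -/l; lra.
Qed.

Lemma foot_rdist y y' s : boundary U s -> U y -> U y' -> rdist y s = depth U y ->
  rdist y' s = depth U y' -> 0 < depth U y -> depth U y <= depth U y' ->
  rdist y y' = depth U y' - depth U y.
Proof.
move=> bs Uy Uy' ys y's l0 ll.
have [g [e [e0 g0 gl [gmin gi gU]]]] := foot_geodesic bs Uy ys l0.
have [g' [e' [e'0 g'0 g'l [g'min g'i g'U]]]] := foot_geodesic bs Uy' y's (lt_le_trans l0 ll).
set l := depth U y in ys l0 ll gl gmin gi gU *.
set l' := depth U y' in y's ll g'l g'min g'i g'U *.
pose i := chart_at s; have Ds : chart_dom (atlas i) s by exact: chart_at_dom.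
have loc (h : R -> M) (d m : R) : 0 < d -> l <= m -> h 0 = s ->
    (forall t : R, - d < t < m + d -> exists2 d' : R, 0 < d' & isometric_near h t d') ->
    (forall t : R, 0 <= t <= m -> geodesic_ball (h t) t `<=` U) ->
    geodesic_velocity i h (derive1 (coord_curve i h)) 0 /\
    exists2 d' : R, 0 < d' & forall t : R, 0 <= t < d' -> chart_dom (atlas i) (h t) /\ geodesic_ball (h t) t `<=` U.
  move=> d0 lm h0 hi hU; have [|d' d'0 di] := hi 0; first by apply/andP; split; lra.
  have Dh : chart_dom (atlas i) (h 0) by rewrite h0.
  split; first exact: (isometric_near_ode M_connected d'0 di Dh).
  have [p p0 Hp] := isometric_near_dom M_connected d'0 di Dh ltr01.
  exists (Num.min p l); first by rewrite lt_min p0.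
  move=> t; rewrite lt_min => /andP[t0 /andP[tp tl]]; split.
    by case: (Hp t); rewrite // subr0 ger0_norm.
  by apply: hU; rewrite t0 (le_trans (ltW tl)).
have [[_ v1 _ n1] U1] := loc g e l e0 (lexx l) g0 gi gU.
have [[_ v2 _ n2] U2] := loc g' e' l' e'0 ll g'0 g'i g'U.
rewrite g0 in n1; rewrite g'0 in n2.
have E := inner_normal_unique Uc U_hypersurface bs Ds g0 g'0 v1 v2 n1 n2 U1 U2.
pose b : R := Num.min (l + e) (l' + e').
have bl : b <= l + e by rewrite ge_min lexx.
have bl' : b <= l' + e' by rewrite ge_min lexx orbT.
have lb : l < b by rewrite lt_min ltrDl e0 (le_lt_trans ll)// ltrDl.
have H1 (t : R) : 0 <= t < b -> exists2 d : R, 0 < d & isometric_near g t d.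
  move=> /andP[t0 tb]; apply: gi; rewrite (lt_le_trans tb bl) andbT.
  by rewrite (lt_le_trans _ t0)// oppr_lt0.
have H2 (t : R) : 0 <= t < b -> exists2 d : R, 0 < d & isometric_near g' t d.
  move=> /andP[t0 tb]; apply: g'i; rewrite (lt_le_trans tb bl') andbT.
  by rewrite (lt_le_trans _ t0)// oppr_lt0.
have Dg : chart_dom (atlas i) (g 0) by rewrite g0.
have gg : g 0 = g' 0 by rewrite g0.
have := local_geodesic_unique M_connected H1 H2 Dg gg E (t := l); rewrite (ltW l0) lb => /(_ isT).
rewrite gl => ->; rewrite -{1}g'l g'min ?ger0_norm ?subr_ge0//.
  by rewrite (ltW l0).
by rewrite lexx andbT (le_trans (ltW l0)).
Qed.

(* If B_x(r) = B_y(d(y, x) + r) with x <> y then geodesics from y do not branch at x, so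
   the sphere bounding this ball is the single point s; every minimal path leaving the ball
   passes through s, and geodesics do not branch at s, so d(s, .) is injective on the ball.
   This is impossible near the point of the ball farthest from s, which is interior. *)
Section Duplicate.
Variables (x y s : M) (r : R).
Hypotheses (bs : boundary U s) (Uy : U y) (ys : rdist y s = depth U y) (r0 : 0 <= r).
Hypotheses (yx0 : 0 < rdist y x) (yx : rdist y x + r = depth U y).
Hypothesis sub : geodesic_ball y (depth U y) `<=` geodesic_ball x r.

Let B := geodesic_ball y (depth U y).

Let BU : B `<=` U. Proof. exact: (depth_ball M_connected U_compact U_proper Uy). Qed.

Let sphere z : rdist y z = depth U y -> z = s.
Proof.
have xr p : rdist y p = depth U y -> rdist x p = r.
  move=> yp; have xp : rdist x p <= r by apply: sub; rewrite /geodesic_ball /= yp.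
  have := rdist_triangle M_connected x y p; rewrite yp -yx => h.
  by apply/eqP; rewrite eq_le xp /=; lra.
have jx p : rdist y p = depth U y -> joinable x p.
  move=> /xr xp; apply: (joinable_ball M_connected U_compact) => q; rewrite /geodesic_ball /= xp => xq.
  apply: BU; rewrite /B /geodesic_ball /= -yx.
  by apply: le_trans (rdist_triangle M_connected x _ _) _; rewrite lerD2l.
move=> yz; have jyx : joinable y x by apply: joinable_in_ball => //; rewrite -yx lerDl.
by apply: (branch_unique M_connected yx0 jyx (jx _ yz) (jx _ ys)); rewrite ?(xr _ yz) ?(xr _ ys) ?yx.
Qed.

Let B_closed : closed B.
Proof.
have -> : B = [set z | rdist y z - depth U y <= 0].
  by apply/seteqP; split=> z; rewrite /B /geodesic_ball /= subr_le0.
apply: sublevel_closed => z; apply: cvgB; [exact: rdist_continuous|exact: cvg_cst].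
Qed.

Let B_boundary z : boundary B z -> z = s.
Proof.
move=> [cz nz]; have Bz : B z by exact: B_closed.
apply: sphere; apply/eqP; rewrite eq_le Bz /= leNgt; apply/negP => yz; apply: nz.
apply/(nbhs_rdistP M_connected); exists (depth U y - rdist y z); first by rewrite subr_gt0.
move=> q zq; rewrite /B /geodesic_ball /=; apply: le_trans (rdist_triangle M_connected z _ _) _.
by rewrite -lerBrDl ltW.
Qed.

Let exit (sigma : R -> M) (l : R) : 0 <= l ->
  (forall t t', 0 <= t <= l -> 0 <= t' <= l -> rdist (sigma t) (sigma t') <= `|t' - t|) ->
  B (sigma 0) -> ~ B (sigma l) -> exists2 t : R, 0 <= t <= l & sigma t = s.
Proof.
move=> l0 sL B0 Bl; have [t tl bt] := lipschitz_crossing M_connected B_closed l0 sL B0 Bl.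
by exists t => //; exact: B_boundary.
Qed.

Let through q w : B q -> ~ B w -> rdist w q = rdist w s + rdist s q.
Proof.
move=> Bq Bw; apply/eqP; rewrite eq_le rdist_triangle//=.
apply/ler_addgt0Pr => e e0.
have qe : rdist q w < rdist q w + e by rewrite ltrDl.
have [sigma [s0 sl sL]] := rdist_select M_connected qe.
set l := rdist q w + e in sl sL.
have l0 : 0 <= l by rewrite addr_ge0 ?rdist_ge0 ?ltW.
have [t tl st] : exists2 t : R, 0 <= t <= l & sigma t = s by apply: exit => //; rewrite ?s0 ?sl.
have I0 : (0 : R) <= 0 <= l by rewrite lexx.
have Il : 0 <= l <= l by rewrite l0 lexx.
have := sL _ _ I0 tl; have := sL _ _ tl Il; rewrite s0 sl st subr0.
move/andP: tl => [t0 tl]; rewrite !ger0_norm ?subr_ge0// [rdist w s]rdistC [rdist s q]rdistC [rdist w q]rdistC.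
by rewrite /l; lra.
Qed.

Let join_s q : B q -> joinable q s.
Proof.
move=> Bq; have Bc : compact B by exact: subclosed_compact U_compact BU.
(* A 1-Lipschitz path from [q] that has left [B] has met [s] on its way, and not before the time
   [rdist q s]; up to that time it therefore stays in the compact set [B]. *)
apply: (minimal_path_exists M_connected Bc) => sigma l ql s0 sl sL t /andP[t0 tq].
apply: contrapT => Bt.
have sL' p p' : 0 <= p <= t -> 0 <= p' <= t -> rdist (sigma p) (sigma p') <= `|p' - p|.
  by move=> /andP[? ?] /andP[? ?]; apply: sL; apply/andP; split; lra.
have [t1 /andP[t10 t1t] st1] : exists2 t1 : R, 0 <= t1 <= t & sigma t1 = s by apply: exit => //; rewrite s0.
have := sL 0 t1; rewrite s0 st1 subr0 ger0_norm// lexx t10 => /(_ _ _) k.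
have {}k : rdist q s <= t1 by apply: k; [lra|lra].
have tt1 : t = t1 by apply/eqP; rewrite eq_le t1t andbT; lra.
by apply: Bt; rewrite tt1 st1 /B /geodesic_ball /= ys.
Qed.

Let Bs : B s. Proof. by rewrite /B /geodesic_ball /= ys. Qed.

Let inj q q' : B q -> B q' -> rdist s q = rdist s q' -> q = q'.
Proof.
move=> Bq Bq' E.
have [rr [lam [C mb]]] := good_chart (chart_at_dom s); set i := chart_at s in mb.
have Ds : chart_dom (atlas i) s by exact: chart_at_dom.
have m0 : 0 < Num.sqrt lam by rewrite sqrtr_gt0 (mb_lam mb).
have e0 : 0 < Num.sqrt lam * rr by rewrite mulr_gt0// (mb_r mb).
(* The outside point [w] is chosen within a coordinate ball around [s], whose compactness joins it
   to [s]; the paths from [w] through [s] into [B] are the ones that must not branch. *)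
have [w Uw sw] := boundary_outside M_connected bs e0.
have jsw : joinable s w.
  apply: (joinable_ball M_connected (chart_ball_compact mb (lexx rr))) => z.
  rewrite /geodesic_ball /= => sz; have szr : rdist s z / Num.sqrt lam < rr.
    by rewrite ltr_pdivrMr// mulrC; exact: le_lt_trans sz sw.
  have [|Dz k] := rdist_lower M_connected mb (x := s) (y := z) Ds.
    by rewrite subrr normr0 add0r.
  split=> //; rewrite -ler_pdivlMl// mulrC in k; exact: le_trans k (ltW szr).
have Bw : ~ B w by move=> /BU.
have ws0 : 0 < rdist w s.
  rewrite lt_neqAle rdist_ge0 andbT; apply/eqP => /esym ws.
  by apply: Uw; rewrite (rdist_eq0 M_connected ws); exact: BU.
apply: (branch_unique M_connected ws0 (joinable_sym jsw) (joinable_sym (join_s Bq)) (joinable_sym (join_s Bq')) E).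
  exact: through.
by rewrite (through Bq' Bw) E.
Qed.

Lemma no_duplicate_ball : False.
Proof.
have Bc : compact B by exact: subclosed_compact U_compact BU.
have R0 : 0 < depth U y by rewrite -yx ltr_wpDr.
have By : B y by rewrite /B /geodesic_ball /= rdistxx ltW.
have B0 : B !=set0 by exists y.
have [qm] := compact_EVT_max B0 Bc (continuous_subspaceT (rdist_continuous M_connected (x := s))).
rewrite inE => Bqm qmax.
have sq0 : 0 < rdist s qm.
  by apply: lt_le_trans (qmax y _); rewrite ?inE// rdistC ys.
have yq : rdist y qm < depth U y.
  rewrite lt_neqAle Bqm andbT; apply/eqP => /sphere E.
  by move: sq0; rewrite E rdistxx ltxx.
have [sigma [s0 sl smin]] := join_s Bqm.
pose i := chart_at qm; have Dq : chart_dom (atlas i) qm by exact: chart_at_dom.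
have N : nbhs qm [set z | chart_dom (atlas i) z /\ rdist y z < depth U y].
  apply: filterI; first by apply: open_nbhs_nbhs; split=> //; exact: chart_dom_open.
  apply/(nbhs_rdistP M_connected); exists (depth U y - rdist y qm); first by rewrite subr_gt0.
  move=> q zq /=; apply: le_lt_trans (rdist_triangle M_connected qm _ _) _.
  by rewrite -ltrBrDl.
have [e e0 He] := (nbhs_rdistP M_connected _ _).1 N.
have l0 : 0 < rdist qm s by rewrite rdistC.
(* The point [sigma t1] serves to provide a second point in the chart, hence a non-zero direction
   [v]. *)
pose t1 : R := Num.min (rdist qm s) e / 2.
have m0 : 0 < Num.min (rdist qm s) e by rewrite lt_min l0.
have t10 : 0 < t1 by rewrite divr_gt0.
have t1l : 2 * t1 <= rdist qm s by rewrite mulrC divfK// ge_min lexx.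
have t1e : 2 * t1 <= e by rewrite mulrC divfK// ge_min lexx orbT.
clearbody t1.
have dq1 : rdist qm (sigma t1) = t1.
  rewrite -{1}s0 smin ?subr0 ?gtr0_norm//; first by rewrite lexx ltW.
  by apply/andP; split; lra.
have [|D1 _] := He (sigma t1); first by rewrite dq1; lra.
pose v := atlas i (sigma t1) - atlas i qm.
have v0 : v != 0.
  rewrite subr_eq0; apply/eqP => E; move: t10; rewrite -dq1 -(chart_funK D1) E chart_funK//.
  by rewrite rdistxx ltxx.
have Cq : chart_codom (atlas i) (atlas i qm) by exact: chart_fun_codom.
have N' : nbhs (atlas i qm) [set u | chart_codom (atlas i) u /\ rdist y (chart_inv (atlas i) u) < depth U y].
  apply: filterI; first by apply: open_nbhs_nbhs; split=> //; exact: chart_codom_open.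
  have N2 : nbhs (chart_inv (atlas i) (atlas i qm)) [set z | rdist y z < depth U y].
    by rewrite chart_funK//; apply: filterS N => z [].
  exact: (chart_inv_continuous Cq N2).
have key (u : 'rV[R]_n) : u != 0 -> exists2 ep : R, 0 < ep & forall t : R, `|t| <= ep ->
    chart_codom (atlas i) (atlas i qm + t *: u) /\
    rdist y (chart_inv (atlas i) (atlas i qm + t *: u)) < depth U y.
  move=> u0; have un : 0 < `|u| by rewrite normr_gt0.
  have /nbhs_ballP [d /= d0 Hd] := N'.
  exists (d / 2 / `|u|) => [|t]; first by rewrite !divr_gt0.
  rewrite ler_pdivlMr// => td; apply: Hd; rewrite -ball_normE /ball_ /= opprD addNKr normrN normrZ.
  by apply: le_lt_trans td _; lra.
have [ep ep0 Hep] := key v v0.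
pose m (u : 'rV[R]_n) (t : R) := chart_inv (atlas i) (atlas i qm + t *: u).
pose h u t := rdist s (m u t).
(* On the coordinate line through [qm], [h u] is largest at 0. If its value at [- ep] is at least
   that at [ep], the intermediate value theorem finds a time in [[0, ep]] with the same value as
   [- ep], against injectivity. The opposite case is that of the direction [- u]. *)
have half (u : 'rV[R]_n) : u != 0 -> (forall t : R, `|t| <= ep -> chart_codom (atlas i) (atlas i qm + t *: u) /\
    rdist y (chart_inv (atlas i) (atlas i qm + t *: u)) < depth U y) -> h u ep <= h u (- ep) -> False.
  move=> u0 Hu hle.
  have hc (t : R) : 0 <= t <= ep -> {for t, continuous (h u)}.
    move=> /andP[t0 te]; apply: continuous_comp; last exact: rdist_continuous.
    apply: continuous_comp.
      have L := line_derive (atlas i qm) u t; exact: (is_derive_rV_continuous L).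
    by apply: chart_inv_continuous; apply: (Hu t _).1; rewrite ger0_norm.
  have h0 : h u 0 = rdist s qm by rewrite /h /m scale0r addr0 chart_funK.
  have eN : `|- ep| <= ep by rewrite normrN gtr0_norm.
  have hm : h u (- ep) <= h u 0.
    by rewrite h0; apply: qmax; rewrite inE /B /geodesic_ball /= ltW//; exact: (Hu _ eN).2.
  have [|t] := @IVT R (h u) 0 ep (h u (- ep)) (ltW ep0) (within_continuousP hc).
    by rewrite ge_min hle orbT le_max hm.
  rewrite in_itv /= => /andP[t0 te] ht.
  have tN : `|t| <= ep by rewrite ger0_norm.
  have [C1 y1] := Hu t tN; have [C2 y2] := Hu _ eN.
  have E : m u t = m u (- ep) by apply: inj => //; rewrite /B /geodesic_ball /= ltW.
  have : atlas i qm + t *: u = atlas i qm + (- ep) *: u.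
    by rewrite -(chart_invK C1) -/(m u t) E chart_invK.
  move=> /addrI /eqP; rewrite -subr_eq0 -scalerBl scaler_eq0 (negPf u0) orbF opprK.
  by rewrite paddr_eq0 ?(ltW ep0)// => /andP[_ /eqP e00]; move: ep0; rewrite e00 ltxx.
have [hle|/ltW hle] := leP (h v ep) (h v (- ep)); first exact: (half v v0 Hep hle).
apply: (half (- v)); [by rewrite oppr_eq0| |].
  by move=> t te; rewrite scalerN -scaleNr; apply: Hep; rewrite normrN.
by rewrite /h /m !scalerN -!scaleNr opprK.
Qed.

End Duplicate.

Lemma central_unique x y y' : U x -> central_set U y -> central_set U y' ->
  rdist x y + depth U x <= depth U y -> rdist x y' + depth U x <= depth U y' -> y = y'.
Proof.
move=> Ux; have [s bs xs] := depth_attained M_connected U_compact U_proper Ux.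
have foot z : rdist x z + depth U x <= depth U z -> rdist z s = depth U z.
  move=> xz; apply/eqP; rewrite eq_le (depth_le_boundary M_connected U_proper)// andbT.
  apply: le_trans (rdist_triangle M_connected x _ _) _; by rewrite xs rdistC.
suff W z z' : central_set U z -> central_set U z' -> rdist x z + depth U x <= depth U z ->
    rdist x z' + depth U x <= depth U z' -> depth U z <= depth U z' -> z = z'.
  move=> Cy Cy' xy xy'; have [k|/ltW k] := leP (depth U y) (depth U y'); first exact: W.
  by apply/esym; exact: W.
move=> Cz Cz' xz xz' zz'.
have zm := central_maximal M_connected U_compact U_proper Cz.
have [Uz _] := maximal_depth M_connected U_compact U_proper zm.
have [Uz' _] := maximal_depth M_connected U_compact U_proper (central_maximal M_connected U_compact U_proper Cz').
have zs := foot z xz; have z's := foot z' xz'.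
have D : rdist z z' = depth U z' - depth U z.
  (* Depth 0 leaves no path to follow, but then [z] is the boundary point [s] itself. *)
  have := depth_ge0 U_proper z; rewrite le_eqVlt => /orP[/eqP z0|z0]; last exact: (foot_rdist bs).
  have zE : z = s by apply: (rdist_eq0 M_connected); rewrite zs.
  by rewrite {1}zE rdistC z's -z0 subr0.
apply: contrapT => nz.
have zz0 : 0 < rdist z' z.
  rewrite lt_neqAle rdist_ge0 andbT; apply/eqP => /esym E.
  by apply: nz; rewrite (rdist_eq0 M_connected E).
have z0 := depth_ge0 U_proper z.
apply: (no_duplicate_ball (x := z) bs Uz' z's z0 zz0); first by rewrite rdistC D subrK.
apply: contrapT => ns; case: zm => _ _; apply; exists z', (depth U z'); split.
- exact: depth_ge0.
- exact: depth_ball.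
- by rewrite D subrK.
split=> // q; rewrite /geodesic_ball /= => zq.
apply: le_trans (rdist_triangle M_connected z _ _) _; rewrite [rdist z' z]rdistC D.
by move: zq; lra.
Qed.

End CentralUnique.

(** * Contraction onto the point p *)

Section Contraction.
Context {R : realType} {n : nat} (M : riemannianManifold R n).
Hypothesis M_connected : connected [set: M].
Variables (U : set M) (U_compact : compact U) (U_proper : U `<` [set: M]).
Hypothesis U_hypersurface : C1_hypersurface (boundary U).
Hypothesis CU_compact : compact (central_set U).
Variables (p : M) (p_standard : standard_point U p).
Implicit Types (x y z : M) (t : R).

Local Notation depth := (depth U).

Lemma rdist_cvg (I : Type) (F : set_system I) (f g : I -> M) (x y : M) : Filter F ->
  f @ F --> x -> g @ F --> y -> (fun i => rdist (f i) (g i)) @ F --> rdist x y.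
Proof.
move=> FF fx gy; apply/cvgrPdist_lt => e e0.
have nb (z : M) : nbhs z [set w | rdist z w < e / 2].
  by apply/(nbhs_rdistP M_connected); exists (e / 2) => //; rewrite divr_gt0.
have N1 : \forall i \near F, rdist x (f i) < e / 2 := fx _ (nb x).
have N2 : \forall i \near F, rdist y (g i) < e / 2 := gy _ (nb y).
apply: filterS2 N1 N2 => i xi yi.
have h1 := rdist_triangle M_connected (f i) x y.
have h2 := rdist_triangle M_connected (g i) (f i) y; rewrite [rdist (g i) y]rdistC in h2.
have h3 := rdist_triangle M_connected x (f i) (g i); rewrite [rdist (f i) x]rdistC in h3.
have h4 := rdist_triangle M_connected y x (g i).
by rewrite ltr_norml; apply/andP; split; lra.
Qed.

Lemma depth_cvg (I : Type) (F : set_system I) (f : I -> M) (x : M) : Filter F ->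
  f @ F --> x -> (fun i => depth (f i)) @ F --> depth x.
Proof. by move=> FF fx; exact: cvg_comp fx (depth_continuous M_connected U_proper (x := x)). Qed.

(** [c] is arbitrary off [U], so continuity is stated for filters along which the points lie in [U].
    It is an instance of [cvg_of_closed_relation] with the central set as the compact set. *)
Lemma center_function : exists c : M -> M, [/\
  forall x, U x -> [/\ central_set U (c x), U (c x) & rdist x (c x) + depth x <= depth (c x)],
  forall x, central_set U x -> c x = x &
  forall (I : Type) (F : set_system I) (f : I -> M) (x : M), Filter F -> f @ F --> x -> U x ->
    (\forall i \near F, U (f i)) -> (fun i => c (f i)) @ F --> c x].
Proof.
have /choice [c Hc] : forall x, exists y, U x ->
    [/\ central_set U y, U y & rdist x y + depth x <= depth y].
  move=> x; have [Ux|nU] := pselect (U x); last by exists x.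
  by have [y Hy] := central_exists M_connected U_compact U_proper Ux; exists y.
have uniq := central_unique M_connected U_compact U_proper U_hypersurface.
have CU x : central_set U x -> U x.
  by move=> /(central_maximal M_connected U_compact U_proper) /(maximal_depth M_connected U_compact U_proper) [].
exists c; split=> //.
  move=> x Cx; have [Cc _ cx] := Hc x (CU x Cx).
  by apply: (uniq x) => //; [exact: CU|rewrite rdistxx add0r].
move=> I F f x FF fx Ux fU.
apply: (@cvg_of_closed_relation R I F M _ (central_set U) _
  (fun i y => rdist (f i) y + depth (f i) - depth y)
  (fun y => rdist x y + depth x - depth y)) => //.
- by apply: filterS fU => i /Hc [].
- move=> y Cy; rewrite subr_le0 => xy; have [Cc _ cx] := Hc x Ux; exact: (uniq x).
- by apply: filterS fU => i /Hc [_ _]; rewrite subr_le0.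
move=> y _; have f2 : (fun q : M * I => f q.2) @ filter_prod (nbhs y) F --> x.
  exact: cvg_comp cvg_snd fx.
have id1 : (fun q : M * I => q.1) @ filter_prod (nbhs y) F --> y by exact: cvg_fst.
apply: cvgB; last exact: depth_cvg.
by apply: cvgD; [exact: rdist_cvg|exact: depth_cvg].
Qed.

(** The points whose largest ball in [U] contains [p]: the contraction runs through them, and the
    central ones among them form the relative central set. *)
Definition sees x := U x /\ rdist p x <= depth x.

(** [z] divides a minimal path from [p] to [x] in the ratio [t]. Phrased by distances, the relation
    is closed in [t], [x] and [z] jointly, which gives continuity in [divides_cvg]. *)
Definition divides t x z :=
  [/\ U z, rdist p z = t * rdist p x & rdist z x = (1 - t) * rdist p x].

Lemma divides_sees t x z : sees x -> divides t x z -> sees z.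
Proof.
move=> [Ux xp] [Uz pz zx]; split=> //.
have := depth_lipschitz M_connected U_proper x z; rewrite rdistC zx pz; move: xp.
by move: (rdist p x) => l; lra.
Qed.

Lemma divides_exists t x : 0 <= t <= 1 -> sees x -> exists z, divides t x z.
Proof.
move=> /andP[t0 t1] [Ux xp]; set l := rdist p x in xp.
have l0 : 0 <= l by exact: rdist_ge0.
have /joinable_sym [sigma [s0 sl smin]] : joinable x p.
  by apply: (joinable_in_ball M_connected U_compact U_proper) => //; rewrite rdistC.
rewrite -/l in sl smin.
have tl : 0 <= t * l <= l by rewrite mulr_ge0//= ler_piMl.
have I0 : (0 : R) <= 0 <= l by rewrite lexx.
have Il : 0 <= l <= l by rewrite l0 lexx.
have zx : rdist (sigma (t * l)) x = (1 - t) * l.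
  rewrite -{1}sl smin// mulrBl mul1r ger0_norm// subr_ge0; by case/andP: tl.
exists (sigma (t * l)); split=> //.
  apply: (depth_ball M_connected U_compact U_proper Ux); rewrite /geodesic_ball /= rdistC zx.
  by apply: le_trans xp; rewrite ler_piMl// gerBl.
by rewrite -{1}s0 smin// subr0 ger0_norm// mulr_ge0.
Qed.

(** Two different such points would be passed at the same time [t * l] by two minimal paths from [p]
    to [x]. These are distinct geodesic segments of the same length [l], and the ball of radius [l]
    around [x] lies in [U], against the standardness of [p]. *)
Lemma divides_unique t x z z' : 0 <= t <= 1 -> sees x -> divides t x z -> divides t x z' -> z = z'.
Proof.
move=> /andP[t0 t1] xs dz dz'; have [Ux xp] := xs; set l := rdist p x in xp.
have := rdist_ge0 p x; rewrite -/l le_eqVlt => /orP[/eqP l0|l0].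
  have E w : divides t x w -> p = w.
    by move=> [_ pw _]; apply: (rdist_eq0 M_connected); rewrite pw -/l -l0 mulr0.
  by rewrite -(E z dz) -(E z' dz').
have path w : divides t x w -> exists P : R -> M, [/\ P 0 = p, P l = x, P (t * l) = w & minimal_path P l].
  move=> dw; have [Uw pw wx] := dw; have [_ wp] := divides_sees xs dw.
  have /joinable_sym [s1 [s10 s1l s1min]] : joinable w p.
    by apply: (joinable_in_ball M_connected U_compact U_proper) => //; rewrite rdistC.
  have /joinable_sym [s2 [s20 s2l s2min]] : joinable x w.
    apply: (joinable_in_ball M_connected U_compact U_proper) => //; rewrite rdistC wx.
    by apply: le_trans xp; rewrite -/l ler_piMl ?(ltW l0)// gerBl.
  rewrite pw -/l in s1l s1min; rewrite wx -/l in s2l s2min.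
  have tl0 : 0 <= t * l by rewrite mulr_ge0// ltW.
  have tl1 : 0 <= (1 - t) * l by rewrite mulr_ge0 ?subr_ge0// ltW.
  have E : t * l + (1 - t) * l = l by ring.
  have := minimal_path_cat M_connected tl0 tl1 s1min s2min; rewrite s1l s20 s10 s2l E => /(_ erefl erefl).
  move=> m; eexists; split; last exact: m.
  - by rewrite /= tl0.
  - rewrite /=; case: ifP => [lt|_]; last by rewrite (_ : l - t * l = (1 - t) * l) ?s2l//; ring.
    have tl : t * l = l by apply/eqP; rewrite eq_le lt andbT ler_piMl// ltW.
    have wx0 : rdist w x = 0 by rewrite wx -/l mulrBl mul1r tl subrr.
    by rewrite -{1}tl s1l (rdist_eq0 M_connected wx0).
  - by rewrite /= lexx.
have [P [P0 Pl Pz Pmin]] := path z dz; have [P' [P'0 P'l P'z P'min]] := path z' dz'.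
have [g gseg gE] := minimal_path_segment M_connected l0 Pmin.
have [g' g'seg g'E] := minimal_path_segment M_connected l0 P'min.
rewrite P0 Pl in gseg; rewrite P'0 P'l in g'seg.
rewrite -Pz -P'z; apply: contrapT => ne.
have tl : 0 <= t * l <= l by rewrite mulr_ge0 ?(ltW l0)//= ler_piMl// ltW.
case: p_standard => _ /(_ x l l g g' Ux gseg g'seg); apply.
  by right; exists (t * l); rewrite ?gE ?g'E //= in_itv.
rewrite maxxx => w; rewrite /geodesic_ball /= => xw.
by apply: (depth_ball M_connected U_compact U_proper Ux); exact: le_trans xw xp.
Qed.

Lemma divides_cvg (I : Type) (F : set_system I) (t : I -> R) (x z : I -> M) t0 x0 z0 : Filter F ->
  0 <= t0 <= 1 -> sees x0 -> divides t0 x0 z0 -> t @ F --> t0 -> x @ F --> x0 ->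
  (\forall i \near F, divides (t i) (x i) (z i)) -> z @ F --> z0.
Proof.
move=> FF t01 x0s dz0 tF xF dz.
apply: (@cvg_of_closed_relation R I F M _ U _
  (fun i y => `|rdist p y - t i * rdist p (x i)| + `|rdist y (x i) - (1 - t i) * rdist p (x i)|)
  (fun y => `|rdist p y - t0 * rdist p x0| + `|rdist y x0 - (1 - t0) * rdist p x0|)) => //.
- by apply: filterS dz => i [].
- move=> y Uy h; apply: (divides_unique t01 x0s _ dz0); move: h.
  have a1 := normr_ge0 (rdist p y - t0 * rdist p x0).
  have a2 := normr_ge0 (rdist y x0 - (1 - t0) * rdist p x0).
  move=> h; split=> //; apply/eqP; rewrite -subr_eq0 -normr_le0; lra.
- by apply: filterS dz => i [_ -> ->]; rewrite !subrr normr0 addr0.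
move=> y _.
have t2 : (fun q : M * I => t q.2) @ filter_prod (nbhs y) F --> t0 by exact: cvg_comp cvg_snd tF.
have x2 : (fun q : M * I => x q.2) @ filter_prod (nbhs y) F --> x0 by exact: cvg_comp cvg_snd xF.
have y2 : (fun q : M * I => q.1) @ filter_prod (nbhs y) F --> y by exact: cvg_fst.
have p2 : (fun=> p : M) @ filter_prod (nbhs y) F --> p by exact: cvg_cst.
have px : (fun q : M * I => rdist p (x q.2)) @ filter_prod (nbhs y) F --> rdist p x0.
  exact: (rdist_cvg _ p2 x2).
apply: cvgD; apply: cvg_norm; apply: cvgB.
- exact: rdist_cvg.
- apply: cvgM; [exact: t2|exact: px].
- exact: rdist_cvg.
by apply: cvgM px; apply: cvgB t2; exact: cvg_cst.
Qed.

Lemma sees_center c x : (forall x, U x -> [/\ central_set U (c x), U (c x) &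
    rdist x (c x) + depth x <= depth (c x)]) -> sees x -> relative_central_set U p (c x).
Proof.
move=> Hc [Ux xp]; have [Cc _ cx] := Hc x Ux; split=> //.
rewrite /geodesic_ball /= (central_radiusE M_connected U_compact U_proper Cc).
apply: le_trans cx; apply: le_trans (rdist_triangle M_connected x _ _) _.
by rewrite rdistC lerD2l rdistC.
Qed.

Lemma relative_central_sees x : relative_central_set U p x -> sees x.
Proof.
move=> [Cx]; rewrite /geodesic_ball /= (central_radiusE M_connected U_compact U_proper Cx) rdistC => xp.
by split=> //; case: (maximal_depth M_connected U_compact U_proper (central_maximal M_connected U_compact U_proper Cx)).
Qed.

End Contraction.

Theorem lemma4p10 (R : realType) (n : nat) (M : riemannianManifold R n)
    (M_complete : metrically_complete M) (M_connected : connected [set: M])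
    (U : set M) (U_proper : U `<` [set: M])
    (U_compact : compact U) (U_connected : connected U)
    (S_hypersurface : C1_hypersurface (boundary U))
    (CU_compact : compact (central_set U))
    (p : M) (p_standard : standard_point U p) :
  [/\ compact (relative_central_set U p),
      relative_central_set U p !=set0 &
      homotopy_equivalent R (set_type (relative_central_set U p))
        (set_type [set p])].
Proof.
case: (center_function M_connected U_compact U_proper S_hypersurface CU_compact) => c [Hc cid ccvg].
have Up : U p by case: p_standard.
have ps : sees U p p by split=> //; rewrite rdistxx depth_ge0.
have sC := sees_center M_connected U_compact U_proper Hc.
have Cs := relative_central_sees M_connected U_compact U_proper (p := p).
set C := relative_central_set U p.
split.
- have -> : C = central_set U `&` [set x | rdist p x - depth U x <= 0].
    apply/seteqP; split=> [x Cx|x [Cx px]].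
      by split; [case: Cx|rewrite /= subr_le0; case: (Cs _ Cx)].
    split=> //; rewrite /geodesic_ball /= (central_radiusE M_connected U_compact U_proper Cx).
    by rewrite rdistC -subr_le0.
  apply: compact_closedI => //; apply: sublevel_closed => x; apply: cvgB.
    exact: rdist_continuous.
  exact: depth_continuous.
- by exists (c p); exact: sC.
have /choice [h Hh] : forall q : R * set_type C, exists z, 0 <= q.1 <= 1 ->
    divides U p q.1 (set_val q.2) z.
  move=> [t x] /=; have [t01|] := boolP (0 <= t <= 1); last by exists p.
  have [z Hz] := divides_exists M_connected U_compact U_proper t01 (Cs _ (set_mem (valP x))).
  by exists z.
(* At time 0 the value is [c p]; at time 1 it is the point itself, as [c] fixes central points.
   Outside [[0, 1]] the projection keeps the values in [C]. *)
pose Hv q := if 0 <= q.1 <= 1 then c (h q) else set_val q.2.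
have xs (x : set_type C) : sees U p (set_val x) by exact: Cs _ (set_mem (valP x)).
have HvC q : C (Hv q).
  rewrite /Hv; case: ifP => [t01|_]; last exact: set_mem (valP q.2).
  by apply: sC; exact: (divides_sees M_connected U_proper (xs q.2) (Hh q t01)).
pose H q : set_type C := exist _ (Hv q) (mem_set (HvC q)).
pose pt : set_type [set p] := exist _ p (mem_set (erefl : [set p] p)).
pose c0 : set_type C := exist _ (c p) (mem_set (sC _ _ ps)).
exists (fun=> pt), (fun=> c0); split; [exact: cst_continuous|exact: cst_continuous| |].
  exists H; split.
  - apply: continuous_comp_initial; apply/subspace_continuousP => -[t x] [/= t01 _].
    have {}t01 : 0 <= t <= 1 by move: t01; rewrite in_itv.
    pose F := within (`[0, 1]%classic `*` [set: set_type C]) (nbhs (t, x)).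
    have FI : \forall q \near F, 0 <= q.1 <= 1.
      by apply: filterS (withinT _ _) => q [/= + _]; rewrite in_itv.
    have Fq : (fun q : R * set_type C => q) @ F --> (t, x) by exact: cvg_within.
    have dz : \forall q \near F, divides U p q.1 (set_val q.2) (h q).
      by apply: filterS FI => q; exact: Hh.
    have F1 : (fun q : R * set_type C => q.1) @ F --> t by exact: (cvg_comp _ _ Fq cvg_fst).
    have F2 : (fun q : R * set_type C => set_val q.2) @ F --> set_val x.
      apply: (cvg_comp _ _ (G := nbhs x)); first exact: (cvg_comp _ _ Fq cvg_snd).
      exact: initial_continuous.
    have hF : h @ F --> h (t, x).
      exact: (divides_cvg M_connected U_compact U_proper p_standard _ t01 (xs x) (Hh (t, x) t01) F1 F2 dz).
    have hU : \forall q \near F, U (h q) by apply: filterS dz => q [].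
    have [Uh _ _] := Hh (t, x) t01; have FF : Filter F by exact: within_filter.
    have K := ccvg _ F h _ FF hF Uh hU.
    suff : Hv @ F --> Hv (t, x) by [].
    have -> : Hv (t, x) = c (h (t, x)) by rewrite /Hv /= t01.
    move=> A nA; have KA : \forall q \near F, A (c (h q)) := K A nA.
    suff : \forall q \near F, A (Hv q) by [].
    by apply: filterS2 FI KA => q q01; rewrite /Hv q01.
  - move=> x; apply: val_inj; rewrite /= /Hv /= lexx ler01 /=.
    have [|_ pz _] := Hh (0, x); first by rewrite /= lexx ler01.
    by rewrite -(rdist_eq0 M_connected (_ : rdist p (h (0, x)) = 0)) // pz mul0r.
  - move=> x; apply: val_inj; rewrite /= /Hv /= lexx ler01 /=.
    have [|_ _ zx] := Hh (1, x); first by rewrite /= lexx ler01.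
    rewrite (rdist_eq0 M_connected (_ : rdist (h (1, x)) (set_val x) = 0)); last by rewrite zx subrr mul0r.
    by apply: cid; case: (set_mem (valP x)).
have ptE (x : set_type [set p]) : x = pt by apply: val_inj; exact: set_mem (valP x).
exists snd; split.
- by apply: continuous_subspaceT => q; exact: cvg_snd.
- by move=> x; rewrite [LHS]ptE [RHS]ptE.
- by move=> x; rewrite [LHS]ptE [RHS]ptE.
Qed.
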